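(* Let $\mathcal{H}(T,A,\mu)$ be a Cauchy--de Branges space with $T$ power separated. The following are equivalent: 1. For every $m\in\mathbb{N}$, $\mathcal{H}(T,A,\mu)$ contains a nearly invariant subspace of codimension $m$, and every nontrivial (nonzero) nearly invariant subspace has finite codimension. 2. The set $\mathcal{P}$ of all polynomials is contained in $L^2(\mu)$ and is dense in $L^2(\mu)$. 3. $\mathcal{H}(T,A,\mu)$ has the strong localization property.
   Context: Let $T=\{t_n\}_{n\ge1}\subset\mathbb{C}$ be a set of distinct points with $|t_n|\to\infty$, and let $\mu_n>0$ satisfy $\sum_n\frac{\mu_n}{|t_n|^2+1}<\infty$; $\mu=\sum_n\mu_n\delta_{t_n}$, so $L^2(\mu)$ consists of sequences $(d_n)$ with $\sum_n|d_n|^2\mu_n<\infty$. Let $A$ be an entire function with simple zeros exactly at $T$ and no other zeros. The Cauchy--de Branges space is $\mathcal{H}(T,A,\mu)=\{F(z)=A(z)\sum_n\frac{c_n\mu_n^{1/2}}{z-t_n}:(c_n)\in\ell^2\}$ with norm $\|F\|=\|(c_n)\|_{\ell^2}$. A closed subspace $\mathcal{H}_0$ is nearly invariant if $f\in\mathcal{H}_0$, $f(w)=0$ imply $f(z)/(z-w)\in\mathcal{H}_0$. $T$ is power separated if there exist $C>0$, $N>-1$ with $\operatorname{dist}(t_n,T\setminus\{t_n\})\ge C(|t_n|+1)^{-N}$ for all $n$. The space has the strong localization property if there exist pairwise disjoint disks $D(t_n,r_n)$, $r_n\to0$, such that for every nonzero $f$ in the space the set $\mathcal{Z}(f)\setminus\bigcup_nD(t_n,r_n)$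 is finite and, for all but finitely many $n$, the disk $D(t_n,r_n)$ contains exactly one zero of $f$ (counting multiplicities). *)

(* Defs.v *)
From Stdlib Require Import Reals List.
From Coquelicot Require Import Coquelicot.
Open Scope R_scope.

Definition entire (f : C -> C) : Prop :=
  forall z : C, @ex_derive C_AbsRing C_NormedModule f z.

Definition simple_zero (f : C -> C) (w : C) : Prop :=
  f w = 0%C /\ exists l : C, @is_derive C_AbsRing C_NormedModule f w l /\ l <> 0%C.

Definition cseries (a : nat -> C) (l : C) : Prop :=
  @is_series C_AbsRing C_NormedModule a l.

(* t : nat -> C enumerates T, mu : nat -> R the weights *)
Definition admissible_data (t : nat -> C) (mu : nat -> R) : Prop :=
  (forall n m, t n = t m -> n = m) /\
  (forall M : R, exists N, forall n, (N <= n)%nat -> M <= Cmod (t n)) /\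
  (forall n, 0 < mu n) /\
  ex_series (fun n => mu n / (Cmod (t n) ^ 2 + 1)).

Definition generating_function (t : nat -> C) (A : C -> C) : Prop :=
  entire A /\
  (forall z, A z = 0%C <-> exists n, z = t n) /\
  (forall n, simple_zero A (t n)).

Definition l2 (c : nat -> C) : Prop := ex_series (fun n => Cmod (c n) ^ 2).

(* F(z) = A(z) * sum_n c_n mu_n^{1/2} / (z - t_n), the value at the t_n being
   given by continuity (F is entire). *)
Definition represents (t : nat -> C) (A : C -> C) (mu : nat -> R)
    (c : nat -> C) (F : C -> C) : Prop :=
  l2 c /\ entire F /\
  forall z, (forall n, z <> t n) ->
    cseries (fun n => (c n * RtoC (sqrt (mu n)) / (z - t n))%C) (F z / A z)%C.

Definition inH (t : nat -> C) (A : C -> C) (mu : nat -> R) (F : C -> C) : Prop :=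
  exists c, represents t A mu c F.

(* S is a closed (linear) subspace of H(T,A,mu); the norm of F is the l^2 norm
   of its coefficient sequence *)
Definition closed_subspace (t : nat -> C) (A : C -> C) (mu : nat -> R)
    (S : (C -> C) -> Prop) : Prop :=
  (forall F, S F -> inH t A mu F) /\
  S (fun _ => 0%C) /\
  (forall F G, S F -> S G -> S (fun z => F z + G z)%C) /\
  (forall (a : C) F, S F -> S (fun z => a * F z)%C) /\
  (forall (ck : nat -> nat -> C) (Fk : nat -> C -> C) (c : nat -> C) (F : C -> C),
     (forall k, represents t A mu (ck k) (Fk k)) ->
     (forall k, S (Fk k)) ->
     represents t A mu c F ->
     is_lim_seq (fun k => Series (fun n => Cmod (ck k n - c n)%C ^ 2)) 0 ->
     S F).

Definition nearly_invariant (t : nat -> C) (A : C -> C) (mu : nat -> R)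
    (S : (C -> C) -> Prop) : Prop :=
  closed_subspace t A mu S /\
  forall F w, S F -> F w = 0%C ->
    exists G, S G /\ forall z, z <> w -> G z = (F z / (z - w))%C.

Definition lincomb (m : nat) (a : nat -> C) (v : nat -> C -> C) (z : C) : C :=
  fold_right (fun i acc => (a i * v i z + acc)%C) 0%C (seq 0 m).

Definition codim (t : nat -> C) (A : C -> C) (mu : nat -> R)
    (S : (C -> C) -> Prop) (m : nat) : Prop :=
  exists v : nat -> C -> C,
    (forall i, (i < m)%nat -> inH t A mu (v i)) /\
    (forall F, inH t A mu F ->
       exists a : nat -> C, S (fun z => (F z - lincomb m a v z)%C)) /\
    (forall a : nat -> C, S (lincomb m a v) -> forall i, (i < m)%nat -> a i = 0%C).

Definition power_separated (t : nat -> C) : Prop :=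
  exists (Cc N : R), 0 < Cc /\ -1 < N /\
    forall n m, n <> m ->
      Cc * Rpower (Cmod (t n) + 1) (- N) <= Cmod (t n - t m).

Definition peval (p : list C) (z : C) : C :=
  fold_right (fun a acc => (a + z * acc)%C) 0%C p.

Definition inL2 (t : nat -> C) (mu : nat -> R) (d : nat -> C) : Prop :=
  ex_series (fun n => Cmod (d n) ^ 2 * mu n).

Definition polys_in_and_dense (t : nat -> C) (mu : nat -> R) : Prop :=
  (forall p, inL2 t mu (fun n => peval p (t n))) /\
  (forall d, inL2 t mu d -> forall eps, 0 < eps ->
     exists p, Series (fun n => Cmod (d n - peval p (t n))%C ^ 2 * mu n) < eps).

Definition in_disk (a : C) (r : R) (z : C) : Prop := Cmod (z - a) < r.

Definition strong_localization (t : nat -> C) (A : C -> C) (mu : nat -> R) : Prop :=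
  exists r : nat -> R,
    (forall n, 0 < r n) /\
    is_lim_seq r 0 /\
    (forall n m z, n <> m -> in_disk (t n) (r n) z -> in_disk (t m) (r m) z -> False) /\
    forall F, inH t A mu F -> (exists z, F z <> 0%C) ->
      (exists L : list C, forall z, F z = 0%C ->
          (forall n, ~ in_disk (t n) (r n) z) -> In z L) /\
      (exists N, forall n, (N <= n)%nat ->
          exists w, in_disk (t n) (r n) w /\ simple_zero F w /\
            forall z, in_disk (t n) (r n) z -> F z = 0%C -> z = w).

(* Main.v *)
(* An element [F] of the space is determined by its residues [a_n = F(t_n) / A'(t_n)], with
   [sum |a_n|^2 / mu_n < oo], and [F] pairs with a polynomial [g] through the moment [sum a_n g(t_n)].
   So the polynomials are dense exactly if all moments exist and no nonzero [F] has all moments [0].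

   Codimension: dividing an element by its zeros, a nearly invariant [S] of finite codimension is found
   to contain [A / prod_{i <= k} (z - x_i)] for some points [x_i] of [T], with [k] minimal. The weighted
   sum of the squares of the Newton polynomials of degree less than [k] at the [x_i] converges, since
   otherwise averaging would put a shorter quotient into [S], and by Newton interpolation of [1 / (z - t_n)]
   the corresponding [k] moments vanish only on [S], whose codimension is then at most [k]. Conversely the
   vanishing of the moments of degree less than [m] is nearly invariant of codimension [m], while
   the vanishing of all moments is nearly invariant of infinite codimension.

   Density gives localization: if [m] is the first nonzero moment of [F], of order [K], then
   [z^{K+1} F / A] is close to [m] off tiny disks about [T], and in each of these disks the zero of [F] is a
   fixed point of a contraction. When the zeros [s_i] of an element of [S] are that close to the [t_i],
   multiplying by [(z - t_i) / (z - s_i)] for almost all [i] leaves an element of [S] with finitely many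
   residues.

   Localization gives density: if localized zeros [s_j] of [f] could be exchanged for points outside the
   disks with control of the residues, doing so along a sparse sequence of [j] would give an element
   without zeros in infinitely many disks. For [f = A / (z - t_0)] and the zeros [t_j] this forces
   [mu_j] to decay faster than any power of [|t_j|]. For [f] with all moments [0] it forces the zeros
   [s_j] to be close to the [t_j], and then moving them to the [t_j] gives an element with all moments [0]
   and finitely many residues, which is absurd. *)
Require Import Defs.
From Stdlib Require Import Reals List Lra Lia Wf_nat Classical ClassicalEpsilon FunctionalExtensionality.
From Coquelicot Require Import Coquelicot.
Import ListNotations.
Open Scope R_scope.

(** * Complex differentiability *)

(** One fact about division carries the algebra: if [F] vanishes at [w], the residues of
    [F / (z - w)] sum to [0]. With [t - x = (t - w) + (w - x)] it gives all moments of the quotient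
    from those of [F], hence the near invariance of subspaces cut out by moments. Newton polynomials
    enter because the moments of [A / prod (z - x_i)] are divided differences.

    The hard direction is from localization to density. Taking away a zero of [f] may enlarge the
    residues beyond it by a power of their weight, so it cannot be repeated at will. A prior
    division by finitely many zeros buys polynomial decay that absorbs this loss, and an exchange
    far out then hardly changes the element. Lower bounds on the modulus survive in the limit, so a
    zero of the limit in a treated disk is a zero of [f], hence the one taken away; it would have to
    be double, against simplicity.

    Power separation gives both the lower bounds on distances and a convergent series
    [sum (1 + |t_n|)^(-L)], against which corrections are measured residue by residue. Of function
    theory only division by zeros, finiteness of zeros in a disk and a weak maximum principle are
    required. *)

Definition ccont (f : C -> C) (z : C) : Prop :=
  forall eps, 0 < eps -> exists d, 0 < d /\
    forall y, Cmod (y - z)%C < d -> Cmod (f y - f z)%C < eps.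

(** Written without a quotient, so that [y = z] needs no exception; [is_derive_cderiv] identifies it
    with the derivative in the statement of the theorem. *)
Definition cderiv (f : C -> C) (z l : C) : Prop :=
  forall eps, 0 < eps -> exists d, 0 < d /\
    forall y, Cmod (y - z)%C < d ->
      Cmod (f y - f z - (y - z) * l)%C <= eps * Cmod (y - z)%C.

Definition hol (f : C -> C) (z : C) : Prop := exists l, cderiv f z l.

Lemma Cmod_sub_sym (x y : C) : Cmod (x - y)%C = Cmod (y - x)%C.
Proof. rewrite <- Cmod_opp. f_equal. ring. Qed.

Lemma Cmod_sub_le (x y : C) : Cmod (x - y)%C <= Cmod x + Cmod y.
Proof. unfold Cminus. rewrite <- (Cmod_opp y). apply Cmod_triangle. Qed.

Lemma Cmod_rev_triangle (x y : C) : Cmod x - Cmod y <= Cmod (x - y)%C.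
Proof.
  assert (H := Cmod_triangle (x - y)%C y).
  replace (x - y + y)%C with x in H by ring. lra.
Qed.

Lemma Cminus_eq0 (x y : C) : (x - y)%C = 0%C -> x = y.
Proof. intros H. replace x with (x - y + y)%C by ring. rewrite H. ring. Qed.

Lemma Cminus_neq0 (x y : C) : x <> y -> (x - y)%C <> 0%C.
Proof. intros H E. apply H, Cminus_eq0, E. Qed.

Lemma Cmod_sub_pos (x y : C) : x <> y -> 0 < Cmod (x - y)%C.
Proof. intros H. apply Cmod_gt_0, Cminus_neq0, H. Qed.

Lemma Cmult_integral (x y : C) : (x * y)%C = 0%C -> x = 0%C \/ y = 0%C.
Proof.
  intros H. destruct (classic (x = 0%C)) as [E|E]; [now left|right].
  apply Cmod_eq_0. assert (H1 : Cmod (x * y)%C = 0) by (rewrite H; apply Cmod_0).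
  rewrite Cmod_mult in H1. apply Cmod_gt_0 in E.
  apply Rmult_integral in H1. destruct H1; lra.
Qed.

Lemma Cmod_small_eq0 (x : C) : (forall eps, 0 < eps -> Cmod x <= eps) -> x = 0%C.
Proof.
  intros H. apply Cmod_eq_0. destruct (Rle_lt_or_eq_dec _ _ (Cmod_ge_0 x)) as [L|L]; [|auto].
  assert (H1 := H (Cmod x / 2) ltac:(lra)). lra.
Qed.

Lemma is_derive_cderiv (f : C -> C) (z l : C) :
  @is_derive C_AbsRing C_NormedModule f z l <-> cderiv f z l.
Proof.
  split.
  - intros [_ H] eps He.
    specialize (H z (fun P HP => HP) (mkposreal eps He)).
    destruct H as [d Hd]. exists d. split; [apply cond_pos|].
    intros y Hy. exact (Hd y Hy).
  - intros H. split; [apply is_linear_scal_l|].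
    intros x Hx. assert (E := @is_filter_lim_locally_unique C_AbsRing (AbsRing_NormedModule C_AbsRing) z x Hx). subst x.
    intros eps. destruct (H eps (cond_pos eps)) as [d [Hd H1]].
    exists (mkposreal d Hd). intros y Hy. exact (H1 y Hy).
Qed.

Lemma ex_derive_hol (f : C -> C) (z : C) :
  @ex_derive C_AbsRing C_NormedModule f z <-> hol f z.
Proof. split; intros [l H]; exists l; now apply is_derive_cderiv. Qed.

Lemma entire_hol (f : C -> C) : entire f <-> forall z, hol f z.
Proof. split; intros H z; apply ex_derive_hol, H. Qed.

Lemma ccont_const (a z : C) : ccont (fun _ => a) z.
Proof.
  intros e He. exists 1. split; [lra|]. intros y _.
  replace (a - a)%C with (RtoC 0) by ring. now rewrite Cmod_0.
Qed.

Lemma ccont_id (z : C) : ccont (fun w => w) z.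
Proof. intros e He. exists e. split; auto. Qed.

Lemma ccont_plus (f g : C -> C) (z : C) :
  ccont f z -> ccont g z -> ccont (fun w => f w + g w)%C z.
Proof.
  intros Hf Hg e He.
  destruct (Hf (e / 2)) as [d1 [D1 H1]]; [lra|].
  destruct (Hg (e / 2)) as [d2 [D2 H2]]; [lra|].
  exists (Rmin d1 d2). split; [now apply Rmin_pos|]. intros y Hy.
  assert (K1 := H1 y (Rlt_le_trans _ _ _ Hy (Rmin_l _ _))).
  assert (K2 := H2 y (Rlt_le_trans _ _ _ Hy (Rmin_r _ _))).
  replace (f y + g y - (f z + g z))%C with ((f y - f z) + (g y - g z))%C by ring.
  eapply Rle_lt_trans; [apply Cmod_triangle|]. lra.
Qed.

Lemma ccont_mult (f g : C -> C) (z : C) :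
  ccont f z -> ccont g z -> ccont (fun w => f w * g w)%C z.
Proof.
  intros Hf Hg e He.
  set (M := Cmod (f z) + Cmod (g z) + 1).
  assert (HM : 1 <= M) by (unfold M; generalize (Cmod_ge_0 (f z)) (Cmod_ge_0 (g z)); lra).
  set (e' := Rmin 1 (e / (2 * M))).
  assert (He' : 0 < e').
  { apply Rmin_pos; [lra|]. apply Rdiv_lt_0_compat; lra. }
  destruct (Hf e' He') as [d1 [D1 H1]]. destruct (Hg e' He') as [d2 [D2 H2]].
  exists (Rmin d1 d2). split; [now apply Rmin_pos|]. intros y Hy.
  assert (K1 := H1 y (Rlt_le_trans _ _ _ Hy (Rmin_l _ _))).
  assert (K2 := H2 y (Rlt_le_trans _ _ _ Hy (Rmin_r _ _))).
  replace (f y * g y - f z * g z)%C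
    with ((f y - f z) * (g y - g z) + (f y - f z) * g z + f z * (g y - g z))%C by ring.
  assert (T1 := Cmod_triangle ((f y - f z) * (g y - g z) + (f y - f z) * g z)
     (f z * (g y - g z))).
  assert (T2 := Cmod_triangle ((f y - f z) * (g y - g z)) ((f y - f z) * g z)).
  rewrite Cmod_mult in T1. rewrite (Cmod_mult (f y - f z)%C (g z)), Cmod_mult in T2.
  assert (E1 : e' <= 1) by apply Rmin_l.
  assert (E2 : e' <= e / (2 * M)) by apply Rmin_r.
  assert (E3 : e' * M <= e / 2).
  { replace (e / 2) with (e / (2 * M) * M) by (field; lra). apply Rmult_le_compat_r; lra. }
  generalize (Cmod_ge_0 (f y - f z)) (Cmod_ge_0 (g y - g z)) (Cmod_ge_0 (f z)) (Cmod_ge_0 (g z)).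
  intros. assert (e' * M = e' * Cmod (f z) + e' * Cmod (g z) + e') by (unfold M; ring).
  assert (Cmod (f y - f z) * Cmod (g y - g z) <= e' * 1) by (apply Rmult_le_compat; lra).
  assert (Cmod (f y - f z) * Cmod (g z) <= e' * Cmod (g z)) by (apply Rmult_le_compat_r; lra).
  assert (Cmod (f z) * Cmod (g y - g z) <= Cmod (f z) * e') by (apply Rmult_le_compat_l; lra).
  clearbody e' M. eapply Rle_lt_trans; [apply T1|]. lra.
Qed.

Lemma ccont_opp (f : C -> C) (z : C) : ccont f z -> ccont (fun w => - f w)%C z.
Proof.
  intros Hf e He. destruct (Hf e He) as [d [D H]]. exists d. split; [auto|].
  intros y Hy. replace (- f y - - f z)%C with (- (f y - f z))%C by ring.
  rewrite Cmod_opp. auto.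
Qed.

Lemma ccont_minus (f g : C -> C) (z : C) :
  ccont f z -> ccont g z -> ccont (fun w => f w - g w)%C z.
Proof. intros. apply ccont_plus; [auto|now apply ccont_opp]. Qed.

Lemma ccont_nonzero (f : C -> C) (z : C) :
  ccont f z -> f z <> 0%C ->
  exists d, 0 < d /\ forall y, Cmod (y - z)%C < d -> Cmod (f z) / 2 <= Cmod (f y).
Proof.
  intros Hf Hz. apply Cmod_gt_0 in Hz. destruct (Hf (Cmod (f z) / 2)) as [d [D H]]; [lra|].
  exists d. split; [auto|]. intros y Hy. specialize (H y Hy).
  rewrite Cmod_sub_sym in H. generalize (Cmod_rev_triangle (f z) (f y)). lra.
Qed.

Lemma ccont_inv (f : C -> C) (z : C) :
  ccont f z -> f z <> 0%C -> ccont (fun w => / f w)%C z.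
Proof.
  intros Hf Hz e He. destruct (ccont_nonzero f z Hf Hz) as [d1 [D1 H1]].
  assert (P := proj1 (Cmod_gt_0 _) Hz). set (m := Cmod (f z)) in *.
  destruct (Hf (e * m * m / 2)) as [d2 [D2 H2]].
  { assert (0 < e * m * m) by (apply Rmult_lt_0_compat; [apply Rmult_lt_0_compat|]; auto). lra. }
  exists (Rmin d1 d2). split; [now apply Rmin_pos|]. intros y Hy.
  assert (K1 := H1 y (Rlt_le_trans _ _ _ Hy (Rmin_l _ _))).
  assert (K2 := H2 y (Rlt_le_trans _ _ _ Hy (Rmin_r _ _))).
  assert (Hy0 : f y <> 0%C) by (apply Cmod_gt_0; lra).
  replace (/ f y - / f z)%C with ((f z - f y) / (f y * f z))%C by (field; auto).
  rewrite Cmod_div, Cmod_mult. 2:{ intros E. apply Cmult_integral in E. tauto. }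
  fold m. rewrite Cmod_sub_sym. apply Rmult_lt_reg_r with (Cmod (f y) * m).
  { apply Rmult_lt_0_compat; lra. }
  unfold Rdiv. rewrite Rmult_assoc, Rinv_l, Rmult_1_r.
  2:{ assert (0 < Cmod (f y) * m) by (apply Rmult_lt_0_compat; lra). lra. }
  assert (m / 2 * m * e <= Cmod (f y) * m * e).
  { apply Rmult_le_compat_r; [lra|]. apply Rmult_le_compat_r; lra. }
  lra.
Qed.

Lemma ccont_div (f g : C -> C) (z : C) :
  ccont f z -> ccont g z -> g z <> 0%C -> ccont (fun w => f w / g w)%C z.
Proof. intros. apply ccont_mult; [auto|now apply ccont_inv]. Qed.

Lemma ccont_ext_loc (f g : C -> C) (z : C) (r : R) :
  0 < r -> (forall y, Cmod (y - z)%C < r -> f y = g y) -> ccont f z -> ccont g z.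
Proof.
  intros Hr E Hf e He. destruct (Hf e He) as [d [D H]].
  exists (Rmin r d). split; [now apply Rmin_pos|]. intros y Hy.
  rewrite <- !E. apply H. eapply Rlt_le_trans; [apply Hy|apply Rmin_r].
  replace (z - z)%C with (RtoC 0) by ring. now rewrite Cmod_0.
  eapply Rlt_le_trans; [apply Hy|apply Rmin_l].
Qed.

(** Removable points: an identity obtained by cancelling a factor holds off one point, and
    continuity carries it over to that point. *)
Lemma ccont_eq_at (f g : C -> C) (z : C) (r : R) :
  0 < r -> ccont f z -> ccont g z ->
  (forall y, y <> z -> Cmod (y - z)%C < r -> f y = g y) -> f z = g z.
Proof.
  intros Hr Hf Hg E. apply Cminus_eq0, Cmod_small_eq0. intros e He.
  destruct (Hf (e / 2)) as [d1 [D1 H1]]; [lra|].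
  destruct (Hg (e / 2)) as [d2 [D2 H2]]; [lra|].
  set (d := Rmin r (Rmin d1 d2)).
  assert (Hd : 0 < d) by (repeat apply Rmin_pos; auto).
  set (y := (z + RtoC (d / 2))%C).
  assert (Hyz : Cmod (y - z)%C = d / 2).
  { unfold y. replace (z + RtoC (d / 2) - z)%C with (RtoC (d / 2)) by ring.
    rewrite Cmod_R. apply Rabs_pos_eq. lra. }
  assert (d <= r) by apply Rmin_l.
  assert (d <= Rmin d1 d2) by apply Rmin_r.
  assert (Rmin d1 d2 <= d1) by apply Rmin_l.
  assert (Rmin d1 d2 <= d2) by apply Rmin_r.
  assert (K1 := H1 y ltac:(lra)). assert (K2 := H2 y ltac:(lra)).
  rewrite (E y) in K1.
  2:{ intros EE. rewrite EE in Hyz. replace (z - z)%C with (RtoC 0) in Hyz by ring.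
      rewrite Cmod_0 in Hyz. lra. }
  2: lra.
  replace (f z - g z)%C with ((g y - g z) - (g y - f z))%C by ring.
  eapply Rle_trans; [apply Cmod_sub_le|]. lra.
Qed.

(** Caratheodory's criterion. With a continuous slope [phi], the sum and product rules become
    algebraic identities between slopes and need no estimates. *)
Lemma cderiv_carath (f : C -> C) (z l : C) :
  cderiv f z l <->
  exists phi, ccont phi z /\ phi z = l /\ forall y, (f y - f z = (y - z) * phi y)%C.
Proof.
  split.
  - intros H.
    exists (fun y => if excluded_middle_informative (y = z) then l else ((f y - f z) / (y - z))%C).
    split; [|split].
    + intros e He. destruct (H (e / 2)) as [d [D H1]]; [lra|].
      exists d. split; [auto|]. intros y Hy.
      destruct (excluded_middle_informative (z = z)) as [_|K]; [|now elim K].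
      destruct (excluded_middle_informative (y = z)) as [E|E].
      { replace (l - l)%C with (RtoC 0) by ring. now rewrite Cmod_0. }
      specialize (H1 y Hy). assert (P := Cmod_sub_pos _ _ E).
      assert (Hn := Cminus_neq0 _ _ E).
      replace ((f y - f z) / (y - z) - l)%C
        with ((f y - f z - (y - z) * l) / (y - z))%C by (field; auto).
      rewrite Cmod_div by auto.
      apply Rle_lt_trans with (e / 2); [|lra].
      apply Rmult_le_reg_r with (Cmod (y - z)); [auto|].
      unfold Rdiv at 1. rewrite Rmult_assoc, Rinv_l by lra. lra.
    + destruct (excluded_middle_informative (z = z)) as [_|K]; [auto|now elim K].
    + intros y. destruct (excluded_middle_informative (y = z)) as [E|E].
      * subst. ring.
      * assert (Hn := Cminus_neq0 _ _ E). field. auto.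
  - intros [phi [Hc [Hl He]]] e Pe. destruct (Hc e Pe) as [d [D H1]].
    exists d. split; [auto|]. intros y Hy. rewrite He, <- Hl.
    replace ((y - z) * phi y - (y - z) * phi z)%C with ((phi y - phi z) * (y - z))%C by ring.
    rewrite Cmod_mult. apply Rmult_le_compat_r; [apply Cmod_ge_0|]. left. auto.
Qed.

Lemma cderiv_cont (f : C -> C) (z l : C) : cderiv f z l -> ccont f z.
Proof.
  intros H. apply cderiv_carath in H. destruct H as [phi [H1 [H2 H3]]].
  apply ccont_ext_loc with (fun y => f z + (y - z) * phi y)%C 1; [lra| |].
  - intros y _. rewrite <- H3. ring.
  - apply ccont_plus; [apply ccont_const|]. apply ccont_mult; [|auto].
    apply ccont_minus; [apply ccont_id|apply ccont_const].
Qed.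

Lemma hol_cont (f : C -> C) (z : C) : hol f z -> ccont f z.
Proof. intros [l H]. now apply cderiv_cont with l. Qed.

Lemma cderiv_unique (f : C -> C) (z l l' : C) : cderiv f z l -> cderiv f z l' -> l = l'.
Proof.
  intros H H'. apply cderiv_carath in H, H'.
  destruct H as [p [H1 [<- H3]]]. destruct H' as [q [K1 [<- K3]]].
  apply (ccont_eq_at p q z 1); [lra|auto|auto|]. intros y Hy _.
  specialize (H3 y). specialize (K3 y). rewrite H3 in K3.
  apply Cminus_eq0. assert (E : ((y - z) * (p y - q y))%C = 0%C).
  { replace ((y - z) * (p y - q y))%C with ((y - z) * p y - (y - z) * q y)%C by ring.
    rewrite K3. ring. }
  apply Cmult_integral in E. destruct E as [E|E]; [|auto].
  apply Cminus_eq0 in E. contradiction.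
Qed.

Lemma hol_const (a z : C) : hol (fun _ => a) z.
Proof.
  exists 0%C. apply cderiv_carath. exists (fun _ => 0%C).
  split; [apply ccont_const|split;[auto|]]. intros. ring.
Qed.

Lemma hol_id (z : C) : hol (fun w => w) z.
Proof.
  exists 1%C. apply cderiv_carath. exists (fun _ => 1%C).
  split; [apply ccont_const|split;[auto|]]. intros. ring.
Qed.

Lemma cderiv_plus (f g : C -> C) (z l m : C) :
  cderiv f z l -> cderiv g z m -> cderiv (fun w => f w + g w)%C z (l + m)%C.
Proof.
  rewrite !cderiv_carath. intros [p [H1 [H2 H3]]] [q [K1 [K2 K3]]].
  exists (fun y => p y + q y)%C. split; [now apply ccont_plus|].
  split; [now rewrite H2, K2|]. intros y.
  replace (f y + g y - (f z + g z))%C with ((f y - f z) + (g y - g z))%C by ring.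
  rewrite H3, K3. ring.
Qed.

Lemma cderiv_mult (f g : C -> C) (z l m : C) :
  cderiv f z l -> cderiv g z m -> cderiv (fun w => f w * g w)%C z (l * g z + f z * m)%C.
Proof.
  intros Hf Hg. assert (Cg := cderiv_cont _ _ _ Hg). revert Hf Hg.
  rewrite !cderiv_carath. intros [p [H1 [H2 H3]]] [q [K1 [K2 K3]]].
  exists (fun y => p y * g y + f z * q y)%C. split; [|split].
  - apply ccont_plus; apply ccont_mult; auto. apply ccont_const.
  - now rewrite H2, K2.
  - intros y.
    replace (f y * g y - f z * g z)%C with ((f y - f z) * g y + f z * (g y - g z))%C by ring.
    rewrite H3, K3. ring.
Qed.

Lemma cderiv_inv (f : C -> C) (z l : C) :
  cderiv f z l -> f z <> 0%C -> hol (fun w => / f w)%C z.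
Proof.
  intros Hf Hz. assert (Cf := cderiv_cont _ _ _ Hf).
  destruct (ccont_nonzero f z Cf Hz) as [d [D Hd]].
  apply cderiv_carath in Hf. destruct Hf as [p [H1 [H2 H3]]].
  exists (- p z / (f z * f z))%C.
  intros e He.
  assert (Hc : ccont (fun y => - p y / (f y * f z))%C z).
  { apply ccont_div; [now apply ccont_opp|apply ccont_mult; [auto|apply ccont_const]|].
    intros E. apply Cmult_integral in E. tauto. }
  destruct (Hc e He) as [d2 [D2 Hd2]].
  exists (Rmin d d2). split; [now apply Rmin_pos|]. intros y Hy.
  assert (K1 := Hd y (Rlt_le_trans _ _ _ Hy (Rmin_l _ _))).
  assert (K2 := Hd2 y (Rlt_le_trans _ _ _ Hy (Rmin_r _ _))).
  assert (Pz := proj1 (Cmod_gt_0 _) Hz).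
  assert (Hy0 : f y <> 0%C) by (apply Cmod_gt_0; lra).
  replace (/ f y - / f z - (y - z) * (- p z / (f z * f z)))%C
    with ((- p y / (f y * f z) - - p z / (f z * f z)) * (y - z))%C.
  - rewrite Cmod_mult. apply Rmult_le_compat_r; [apply Cmod_ge_0|]. now left.
  - replace (/ f y - / f z)%C with (- (f y - f z) / (f y * f z))%C by (field; auto).
    rewrite H3. field. auto.
Qed.

Lemma hol_plus (f g : C -> C) (z : C) : hol f z -> hol g z -> hol (fun w => f w + g w)%C z.
Proof. intros [l H] [m K]. eexists. now apply cderiv_plus; eauto. Qed.

Lemma hol_mult (f g : C -> C) (z : C) : hol f z -> hol g z -> hol (fun w => f w * g w)%C z.
Proof. intros [l H] [m K]. eexists. now apply cderiv_mult; eauto. Qed.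

Lemma hol_ext_loc (f g : C -> C) (z : C) (r : R) :
  0 < r -> (forall y, Cmod (y - z)%C < r -> f y = g y) -> hol f z -> hol g z.
Proof.
  intros Hr E [l Hf]. exists l. intros e He. destruct (Hf e He) as [d [D H]].
  exists (Rmin r d). split; [now apply Rmin_pos|]. intros y Hy.
  rewrite <- !E. apply H. eapply Rlt_le_trans; [apply Hy|apply Rmin_r].
  replace (z - z)%C with (RtoC 0) by ring. now rewrite Cmod_0.
  eapply Rlt_le_trans; [apply Hy|apply Rmin_l].
Qed.

Lemma hol_opp (f : C -> C) (z : C) : hol f z -> hol (fun w => - f w)%C z.
Proof.
  intros H. apply hol_ext_loc with (fun w => -(1) * f w)%C 1; [lra| |].
  - intros. ring.
  - apply hol_mult; [apply hol_const|auto].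
Qed.

Lemma hol_minus (f g : C -> C) (z : C) : hol f z -> hol g z -> hol (fun w => f w - g w)%C z.
Proof. intros. apply hol_plus; [auto|now apply hol_opp]. Qed.

Lemma hol_inv (f : C -> C) (z : C) : hol f z -> f z <> 0%C -> hol (fun w => / f w)%C z.
Proof. intros [l H] Hz. now apply cderiv_inv with l. Qed.

Lemma hol_div (f g : C -> C) (z : C) :
  hol f z -> hol g z -> g z <> 0%C -> hol (fun w => f w / g w)%C z.
Proof. intros. apply hol_mult; [auto|now apply hol_inv]. Qed.

(** * Cauchy's theorem and the zeros of entire functions *)

Definition rcont (g : R -> C) (x : R) : Prop :=
  continuous (fun t => fst (g t)) x /\ continuous (fun t => snd (g t)) x.

Definition rcont_on (g : R -> C) (a b : R) : Prop := forall x, a <= x <= b -> rcont g x.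

Definition CInt (g : R -> C) (a b : R) : C :=
  (RInt (fun t => fst (g t)) a b, RInt (fun t => snd (g t)) a b).

Definition hor (c : R) (x : R) : C := (x, c).
Definition ver (c : R) (y : R) : C := (c, y).

Lemma rcont_on_ex (g : R -> C) (a b : R) : a <= b -> rcont_on g a b ->
  ex_RInt (fun t => fst (g t)) a b /\ ex_RInt (fun t => snd (g t)) a b.
Proof.
  intros Hab H.
  split.
  - apply (@ex_RInt_continuous R_CompleteNormedModule (fun t => fst (g t))). intros z Hz.
    rewrite Rmin_left, Rmax_right in Hz by auto. apply (H z Hz).
  - apply (@ex_RInt_continuous R_CompleteNormedModule (fun t => snd (g t))). intros z Hz.
    rewrite Rmin_left, Rmax_right in Hz by auto. apply (H z Hz).
Qed.

Lemma CInt_ext (f g : R -> C) (a b : R) : a <= b ->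
  (forall x, a <= x <= b -> f x = g x) -> CInt f a b = CInt g a b.
Proof.
  intros Hab H. unfold CInt.
  f_equal; apply RInt_ext; intros x Hx; rewrite Rmin_left, Rmax_right in Hx by auto;
    rewrite H; auto; lra.
Qed.

Lemma CInt_plus (f g : R -> C) (a b : R) : a <= b -> rcont_on f a b -> rcont_on g a b ->
  CInt (fun x => f x + g x)%C a b = (CInt f a b + CInt g a b)%C.
Proof.
  intros Hab Hf Hg. destruct (rcont_on_ex f a b Hab Hf), (rcont_on_ex g a b Hab Hg).
  unfold CInt, Cplus; simpl. f_equal; apply (@RInt_plus R_CompleteNormedModule); auto.
Qed.

Lemma CInt_scal (k : C) (f : R -> C) (a b : R) : a <= b -> rcont_on f a b ->
  CInt (fun x => k * f x)%C a b = (k * CInt f a b)%C.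
Proof.
  intros Hab Hf. destruct (rcont_on_ex f a b Hab Hf) as [H1 H2].
  unfold CInt, Cmult; simpl. f_equal.
  - rewrite <- !(RInt_scal (V := R_CompleteNormedModule)) by auto.
    rewrite <- (@RInt_minus R_CompleteNormedModule) by (apply @ex_RInt_scal; auto).
    reflexivity.
  - rewrite <- !(RInt_scal (V := R_CompleteNormedModule)) by auto.
    rewrite <- (@RInt_plus R_CompleteNormedModule) by (apply @ex_RInt_scal; auto).
    reflexivity.
Qed.

Lemma rcont_const (k : C) (x : R) : rcont (fun _ => k) x.
Proof. split; apply continuous_const. Qed.

Lemma rcont_mult (f g : R -> C) (x : R) : rcont f x -> rcont g x ->
  rcont (fun x => f x * g x)%C x.
Proof.
  intros [H1 H2] [K1 K2]. split; simpl.
  - apply (continuous_minus (V := R_NormedModule) (fun t => fst (f t) * fst (g t))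
      (fun t => snd (f t) * snd (g t)));
    apply (continuous_mult (K := R_AbsRing)); auto.
  - apply (continuous_plus (V := R_NormedModule) (fun t => fst (f t) * snd (g t))
      (fun t => snd (f t) * fst (g t)));
    apply (continuous_mult (K := R_AbsRing)); auto.
Qed.

Lemma rcont_scal (k : C) (f : R -> C) (x : R) : rcont f x -> rcont (fun x => k * f x)%C x.
Proof. intros. apply rcont_mult; [apply rcont_const|auto]. Qed.

Lemma CInt_minus (f g : R -> C) (a b : R) : a <= b -> rcont_on f a b -> rcont_on g a b ->
  CInt (fun x => f x - g x)%C a b = (CInt f a b - CInt g a b)%C.
Proof.
  intros Hab Hf Hg.
  rewrite (CInt_ext _ (fun x => f x + (-(1)) * g x)%C); auto.
  2: intros; ring.
  rewrite CInt_plus; auto. rewrite CInt_scal; auto. ring.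
  intros x Hx. apply rcont_scal, Hg, Hx.
Qed.

Lemma CInt_const (k : C) (a b : R) : CInt (fun _ => k) a b = (RtoC (b - a) * k)%C.
Proof.
  unfold CInt. rewrite !RInt_const. unfold scal, Cmult, RtoC; simpl. unfold mult; simpl.
  f_equal; ring.
Qed.

Lemma CInt_Chasles (f : R -> C) (a m b : R) : a <= m <= b -> rcont_on f a b ->
  CInt f a b = (CInt f a m + CInt f m b)%C.
Proof.
  intros Hm H.
  destruct (rcont_on_ex f a m) as [H1 H2]; [lra|intros x Hx; apply H; lra|].
  destruct (rcont_on_ex f m b) as [K1 K2]; [lra|intros x Hx; apply H; lra|].
  unfold CInt, Cplus; simpl. symmetry.
  f_equal; apply (@RInt_Chasles R_CompleteNormedModule); auto.
Qed.

Lemma Cmod_le_sum (z : C) : Cmod z <= Rabs (fst z) + Rabs (snd z).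
Proof.
  replace z with (RtoC (fst z) + Ci * RtoC (snd z))%C at 1.
  - eapply Rle_trans; [apply Cmod_triangle|]. rewrite Cmod_mult, Cmod_Ci, !Cmod_R. lra.
  - destruct z. unfold Cplus, Cmult, RtoC, Ci; simpl. f_equal; ring.
Qed.

(** Real and imaginary parts are estimated separately, hence the factor [2]; it only enlarges later
    constants. *)
Lemma CInt_bound (f : R -> C) (a b M : R) : a <= b -> rcont_on f a b ->
  (forall x, a <= x <= b -> Cmod (f x) <= M) ->
  Cmod (CInt f a b) <= 2 * (M * (b - a)).
Proof.
  intros Hab Hc HM. destruct (rcont_on_ex f a b Hab Hc) as [H1 H2].
  assert (K1 : Rabs (RInt (fun t => fst (f t)) a b) <= (b - a) * M).
  { apply abs_RInt_le_const; [exact Hab|exact H1|]. intros t Ht.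
    eapply Rle_trans; [|apply (HM t); lra].
    eapply Rle_trans; [|apply Rmax_Cmod]. apply Rmax_l. }
  assert (K2 : Rabs (RInt (fun t => snd (f t)) a b) <= (b - a) * M).
  { apply abs_RInt_le_const; [exact Hab|exact H2|]. intros t Ht.
    eapply Rle_trans; [|apply (HM t); lra].
    eapply Rle_trans; [|apply Rmax_Cmod]. apply Rmax_r. }
  eapply Rle_trans; [apply Cmod_le_sum|]. unfold CInt; simpl. lra.
Qed.

Lemma rcont_comp (f : C -> C) (g : R -> C) (t : R) :
  (forall s, Cmod (g s - g t)%C <= Rabs (s - t)) -> ccont f (g t) ->
  rcont (fun s => f (g s)) t.
Proof.
  intros Hg Hf.
  assert (H : forall p : C -> R, (forall z w, Rabs (p z - p w) <= Cmod (z - w)%C) ->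
     continuous (fun s => p (f (g s))) t).
  { intros p Hp. apply continuity_pt_filterlim. intros e He.
    destruct (Hf e He) as [d [D H]]. exists d. split; [auto|].
    intros s [_ Hs]. unfold dist in *; simpl in *. unfold R_dist in *.
    eapply Rle_lt_trans; [apply Hp|]. apply H. eapply Rle_lt_trans; [apply Hg|auto]. }
  split; apply H; intros z w.
  - eapply Rle_trans; [|apply Rmax_Cmod]. apply (Rmax_l (Rabs (fst z - fst w))).
  - eapply Rle_trans; [|apply Rmax_Cmod]. apply (Rmax_r _ (Rabs (snd z - snd w))).
Qed.

Lemma hor_lip (c s t : R) : Cmod (hor c s - hor c t)%C <= Rabs (s - t).
Proof.
  unfold hor. replace ((s, c) - (t, c))%C with (RtoC (s - t)).
  rewrite Cmod_R. lra. unfold RtoC, Cminus, Cplus, Copp; simpl. f_equal; ring.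
Qed.

Lemma ver_lip (c s t : R) : Cmod (ver c s - ver c t)%C <= Rabs (s - t).
Proof.
  unfold ver. replace ((c, s) - (c, t))%C with (Ci * RtoC (s - t))%C.
  rewrite Cmod_mult, Cmod_Ci, Cmod_R. lra.
  unfold RtoC, Cminus, Cplus, Copp, Ci, Cmult; simpl. f_equal; ring.
Qed.

(** The counterclockwise integral of [f dz] around the rectangle; [dz = i dy] on the vertical
    sides. *)
Definition BInt (f : C -> C) (a b c d : R) : C :=
  (CInt (fun x => f (hor c x)) a b - CInt (fun x => f (hor d x)) a b
   + Ci * CInt (fun y => f (ver b y)) c d - Ci * CInt (fun y => f (ver a y)) c d)%C.

Definition inrect (a b c d : R) (z : C) : Prop := a <= fst z <= b /\ c <= snd z <= d.

Definition ccont_on (f : C -> C) (a b c d : R) : Prop :=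
  forall z, inrect a b c d z -> ccont f z.

Lemma rcont_hor (f : C -> C) (a b c d y : R) : c <= y <= d -> ccont_on f a b c d ->
  rcont_on (fun x => f (hor y x)) a b.
Proof. intros Hy H x Hx. apply rcont_comp; [intros; apply hor_lip|]. apply H. split; auto. Qed.

Lemma rcont_ver (f : C -> C) (a b c d x : R) : a <= x <= b -> ccont_on f a b c d ->
  rcont_on (fun y => f (ver x y)) c d.
Proof. intros Hy H y Hx. apply rcont_comp; [intros; apply ver_lip|]. apply H. split; auto. Qed.

(** Continuity is asked on the four sides only, because the Cauchy kernels integrated below have a
    pole inside. *)
Definition bcont (f : C -> C) (a b c d : R) : Prop :=
  (rcont_on (fun x => f (hor c x)) a b /\ rcont_on (fun x => f (hor d x)) a b) /\
  (rcont_on (fun x => f (ver a x)) c d /\ rcont_on (fun x => f (ver b x)) c d).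

Definition onbd (a b c d : R) (z : C) : Prop :=
  inrect a b c d z /\ (fst z = a \/ fst z = b \/ snd z = c \/ snd z = d).

Lemma bcont_bd (f : C -> C) (a b c d : R) : a <= b -> c <= d ->
  (forall z, onbd a b c d z -> ccont f z) -> bcont f a b c d.
Proof.
  intros Hab Hcd H. split; split;
  intros x Hx; apply rcont_comp; try (intros; apply hor_lip); try (intros; apply ver_lip);
    apply H; (split; [split; simpl; lra|simpl; tauto]).
Qed.

Lemma bcont_on (f : C -> C) (a b c d : R) : a <= b -> c <= d ->
  ccont_on f a b c d -> bcont f a b c d.
Proof. intros Hab Hcd H. apply bcont_bd; auto. intros z [Hz _]. auto. Qed.

Lemma BInt_ext (f g : C -> C) (a b c d : R) : a <= b -> c <= d ->
  (forall z, onbd a b c d z -> f z = g z) -> BInt f a b c d = BInt g a b c d.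
Proof.
  intros Hab Hcd H. unfold BInt.
  rewrite (CInt_ext (fun x => f (hor c x)) (fun x => g (hor c x))),
   (CInt_ext (fun x => f (hor d x)) (fun x => g (hor d x))),
   (CInt_ext (fun x => f (ver a x)) (fun x => g (ver a x))),
   (CInt_ext (fun x => f (ver b x)) (fun x => g (ver b x))); auto;
   intros x Hx; apply H; (split; [split; simpl; lra|simpl; tauto]).
Qed.

Lemma BInt_plus (f g : C -> C) (a b c d : R) : a <= b -> c <= d ->
  bcont f a b c d -> bcont g a b c d ->
  BInt (fun z => f z + g z)%C a b c d = (BInt f a b c d + BInt g a b c d)%C.
Proof.
  intros Hab Hcd [[F1 F2] [F3 F4]] [[G1 G2] [G3 G4]]. unfold BInt.
  rewrite (CInt_plus (fun x => f (hor c x)) _ _ _ Hab F1 G1),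
   (CInt_plus (fun x => f (hor d x)) _ _ _ Hab F2 G2),
   (CInt_plus (fun x => f (ver a x)) _ _ _ Hcd F3 G3),
   (CInt_plus (fun x => f (ver b x)) _ _ _ Hcd F4 G4).
  ring.
Qed.

Lemma BInt_scal (k : C) (f : C -> C) (a b c d : R) : a <= b -> c <= d ->
  bcont f a b c d -> BInt (fun z => k * f z)%C a b c d = (k * BInt f a b c d)%C.
Proof.
  intros Hab Hcd [[F1 F2] [F3 F4]]. unfold BInt.
  rewrite (CInt_scal k (fun x => f (hor c x)) _ _ Hab F1),
   (CInt_scal k (fun x => f (hor d x)) _ _ Hab F2),
   (CInt_scal k (fun x => f (ver a x)) _ _ Hcd F3),
   (CInt_scal k (fun x => f (ver b x)) _ _ Hcd F4).
  ring.
Qed.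

Lemma BInt_bound_bd (f : C -> C) (a b c d M : R) : a <= b -> c <= d ->
  bcont f a b c d -> (forall z, onbd a b c d z -> Cmod (f z) <= M) ->
  Cmod (BInt f a b c d) <= 4 * (M * ((b - a) + (d - c))).
Proof.
  intros Hab Hcd [[F1 F2] [F3 F4]] HM. unfold BInt.
  assert (B : forall z, inrect a b c d z -> fst z = a \/ fst z = b \/ snd z = c \/ snd z = d ->
    Cmod (f z) <= M) by (intros z H1 H2; apply HM; split; auto).
  assert (H1 := CInt_bound (fun x => f (hor c x)) a b M Hab F1
    ltac:(intros; apply B; [split; simpl; lra|simpl; tauto])).
  assert (H2 := CInt_bound (fun x => f (hor d x)) a b M Hab F2
    ltac:(intros; apply B; [split; simpl; lra|simpl; tauto])).
  assert (H3 := CInt_bound (fun x => f (ver a x)) c d M Hcd F3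
    ltac:(intros; apply B; [split; simpl; lra|simpl; tauto])).
  assert (H4 := CInt_bound (fun x => f (ver b x)) c d M Hcd F4
    ltac:(intros; apply B; [split; simpl; lra|simpl; tauto])).
  eapply Rle_trans; [apply Cmod_sub_le|]. rewrite Cmod_mult, Cmod_Ci.
  eapply Rle_trans; [apply Rplus_le_compat_r; apply Cmod_triangle|].
  rewrite Cmod_mult, Cmod_Ci.
  eapply Rle_trans; [apply Rplus_le_compat_r, Rplus_le_compat_r; apply Cmod_sub_le|].
  lra.
Qed.

Lemma BInt_bound (f : C -> C) (a b c d M : R) : a <= b -> c <= d ->
  ccont_on f a b c d -> (forall z, inrect a b c d z -> Cmod (f z) <= M) ->
  Cmod (BInt f a b c d) <= 4 * (M * ((b - a) + (d - c))).
Proof.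
  intros Hab Hcd Hf HM. apply BInt_bound_bd; auto; [now apply bcont_on|].
  intros z [Hz _]. auto.
Qed.

Lemma BInt_split_h (f : C -> C) (a m b c d : R) : a <= m <= b -> c <= d ->
  ccont_on f a b c d -> BInt f a b c d = (BInt f a m c d + BInt f m b c d)%C.
Proof.
  intros Hm Hcd Hf. unfold BInt.
  rewrite (CInt_Chasles (fun x => f (hor c x)) a m b), (CInt_Chasles (fun x => f (hor d x)) a m b).
  ring.
  all: try (eapply rcont_hor; [|eassumption]); lra.
Qed.

Lemma BInt_split_v (f : C -> C) (a b c m d : R) : a <= b -> c <= m <= d ->
  ccont_on f a b c d -> BInt f a b c d = (BInt f a b c m + BInt f a b m d)%C.
Proof.
  intros Hab Hm Hf. unfold BInt.
  rewrite (CInt_Chasles (fun x => f (ver a x)) c m d), (CInt_Chasles (fun x => f (ver b x)) c m d).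
  ring.
  all: try (eapply rcont_ver; [|eassumption]); lra.
Qed.

Lemma ccont_affine (al be z : C) : ccont (fun w => al + be * w)%C z.
Proof.
  apply ccont_plus; [apply ccont_const|apply ccont_mult; [apply ccont_const|apply ccont_id]].
Qed.

(** Opposite sides are combined first: the values on them differ by a constant, and the two
    constants cancel after integration. *)
Lemma BInt_affine (al be : C) (a b c d : R) : a <= b -> c <= d ->
  BInt (fun z => al + be * z)%C a b c d = 0%C.
Proof.
  intros Hab Hcd.
  assert (Hf : ccont_on (fun z => al + be * z)%C a b c d) by (intros z _; apply ccont_affine).
  unfold BInt.
  rewrite <- CInt_minus.
  2: lra.
  2: now apply (rcont_hor (fun z => al + be * z)%C a b c d); [lra|].
  2: now apply (rcont_hor (fun z => al + be * z)%C a b c d); [lra|].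
  match goal with |- (?X + Ci * ?Y - Ci * ?Z)%C = _ =>
    transitivity (X + Ci * (Y - Z))%C; [ring|] end.
  rewrite <- CInt_minus.
  2: lra.
  2: now apply (rcont_ver (fun z => al + be * z)%C a b c d); [lra|].
  2: now apply (rcont_ver (fun z => al + be * z)%C a b c d); [lra|].
  rewrite (CInt_ext _ (fun _ => be * (Ci * RtoC (c - d)))%C); [|lra|].
  2:{ intros x _. unfold hor, RtoC, Ci, Cminus, Cmult, Cplus, Copp; simpl. f_equal; ring. }
  rewrite (CInt_ext (fun x => al + be * ver b x - (al + be * ver a x))%C
    (fun _ => be * RtoC (b - a))%C); [|lra|].
  2:{ intros x _. unfold ver, RtoC, Ci, Cminus, Cmult, Cplus, Copp; simpl. f_equal; ring. }
  rewrite !CInt_const, !RtoC_minus. ring.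
Qed.

Lemma BInt_quarter (f : C -> C) (a b c d : R) : a <= b -> c <= d -> ccont_on f a b c d ->
  exists a' b' c' d', a <= a' /\ a' <= b' /\ b' <= b /\ c <= c' /\ c' <= d' /\ d' <= d /\
    b' - a' = (b - a) / 2 /\ d' - c' = (d - c) / 2 /\
    Cmod (BInt f a b c d) <= 4 * Cmod (BInt f a' b' c' d').
Proof.
  intros Hab Hcd Hf. set (m := (a + b) / 2). set (n := (c + d) / 2).
  assert (Hm : a <= m <= b) by (unfold m; lra). assert (Hn : c <= n <= d) by (unfold n; lra).
  assert (E : BInt f a b c d = (BInt f a m c n + BInt f a m n d
     + (BInt f m b c n + BInt f m b n d))%C).
  { rewrite (BInt_split_h f a m b c d) by auto.
    rewrite (BInt_split_v f a m c n d), (BInt_split_v f m b c n d); auto; try lra;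
      intros z [Hz1 Hz2]; apply Hf; split; lra. }
  assert (L : Cmod (BInt f a b c d) <= Cmod (BInt f a m c n) + Cmod (BInt f a m n d)
     + (Cmod (BInt f m b c n) + Cmod (BInt f m b n d))).
  { rewrite E. eapply Rle_trans; [apply Cmod_triangle|].
    apply Rplus_le_compat; apply Cmod_triangle. }
  destruct (Rle_dec (Cmod (BInt f a b c d)) (4 * Cmod (BInt f a m c n))).
  { exists a, m, c, n. unfold m, n in *. repeat split; lra. }
  destruct (Rle_dec (Cmod (BInt f a b c d)) (4 * Cmod (BInt f a m n d))).
  { exists a, m, n, d. unfold m, n in *. repeat split; lra. }
  destruct (Rle_dec (Cmod (BInt f a b c d)) (4 * Cmod (BInt f m b c n))).
  { exists m, b, c, n. unfold m, n in *. repeat split; lra. }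
  exists m, b, n, d. unfold m, n in *. repeat split; lra.
Qed.

(** Goursat's bisection: some quarter keeps at least a quarter of the integral, while near the
    common point of the nested rectangles [f] is affine up to a small multiple of the distance, and
    affine functions integrate to [0]. *)
Lemma goursat_sub (f : C -> C) (a b c d : R) : a <= b -> c <= d ->
  (forall z, inrect a b c d z -> hol f z) -> BInt f a b c d = 0%C.
Proof.
  intros Hab Hcd Hf.
  assert (Hcf : ccont_on f a b c d) by (intros z Hz; apply hol_cont, Hf, Hz).
  set (V := {s : R * R * R * R | let '(a', b', c', d') := s in
     a <= a' /\ a' <= b' /\ b' <= b /\ c <= c' /\ c' <= d' /\ d' <= d}).
  set (Bs := fun s : V => let '(a', b', c', d') := proj1_sig s in Cmod (BInt f a' b' c' d')).
  assert (step : forall s : V, {s' : V |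
     let '(a1, b1, c1, d1) := proj1_sig s in let '(a2, b2, c2, d2) := proj1_sig s' in
     a1 <= a2 /\ b2 <= b1 /\ c1 <= c2 /\ d2 <= d1 /\
     b2 - a2 = (b1 - a1) / 2 /\ d2 - c2 = (d1 - c1) / 2 /\ Bs s <= 4 * Bs s'}).
  { intros [[[[a1 b1] c1] d1] Hs]. apply constructive_indefinite_description.
    destruct Hs as [S1 [S2 [S3 [S4 [S5 S6]]]]].
    destruct (BInt_quarter f a1 b1 c1 d1) as [a2 [b2 [c2 [d2 H]]]]; auto.
    { intros z [Z1 Z2]. apply Hcf. split; lra. }
    assert (P : a <= a2 /\ a2 <= b2 /\ b2 <= b /\ c <= c2 /\ c2 <= d2 /\ d2 <= d)
      by (repeat split; lra).
    exists (exist _ (a2, b2, c2, d2) P). unfold Bs; simpl. repeat split; lra. }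
  assert (P0 : a <= a /\ a <= b /\ b <= b /\ c <= c /\ c <= d /\ d <= d) by (repeat split; lra).
  set (sq := fix sq n : V := match n with O => exist _ (a, b, c, d) P0
     | S n => proj1_sig (step (sq n)) end).
  set (an := fun n => fst (fst (fst (proj1_sig (sq n))))).
  set (bn := fun n => snd (fst (fst (proj1_sig (sq n))))).
  set (cn := fun n => snd (fst (proj1_sig (sq n)))).
  set (dn := fun n => snd (proj1_sig (sq n))).
  assert (HV : forall n, a <= an n /\ an n <= bn n /\ bn n <= b /\ c <= cn n /\ cn n <= dn n
     /\ dn n <= d).
  { intros n. unfold an, bn, cn, dn. destruct (sq n) as [[[[a1 b1] c1] d1] Hs]. exact Hs. }
  assert (HS : forall n, an n <= an (S n) /\ bn (S n) <= bn n /\ cn n <= cn (S n) /\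
     dn (S n) <= dn n /\ bn (S n) - an (S n) = (bn n - an n) / 2 /\
     dn (S n) - cn (S n) = (dn n - cn n) / 2 /\
     Cmod (BInt f (an n) (bn n) (cn n) (dn n))
       <= 4 * Cmod (BInt f (an (S n)) (bn (S n)) (cn (S n)) (dn (S n)))).
  { intros n. unfold an, bn, cn, dn. simpl sq. destruct (step (sq n)) as [s' H].
    simpl proj1_sig. unfold Bs in H. destruct (proj1_sig (sq n)) as [[[a1 b1] c1] d1].
    destruct (proj1_sig s') as [[[a2 b2] c2] d2]. exact H. }
  assert (H0 : an O = a /\ bn O = b /\ cn O = c /\ dn O = d) by (repeat split).
  clearbody an bn cn dn. clear sq step Bs V P0.
  assert (Hlen : forall n, bn n - an n = (b - a) / 2 ^ n /\ dn n - cn n = (d - c) / 2 ^ n /\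
     Cmod (BInt f a b c d) <= 4 ^ n * Cmod (BInt f (an n) (bn n) (cn n) (dn n))).
  { induction n as [|n [I1 [I2 I3]]].
    - destruct H0 as [E1 [E2 [E3 E4]]]. rewrite E1, E2, E3, E4. simpl. lra.
    - destruct (HS n) as [_ [_ [_ [_ [J1 [J2 J3]]]]]]. rewrite J1, J2, I1, I2.
      assert (0 < 2 ^ n) by (apply pow_lt; lra).
      split; [simpl; field; lra|]. split; [simpl; field; lra|].
      eapply Rle_trans; [apply I3|]. simpl. rewrite (Rmult_comm 4), Rmult_assoc.
      apply Rmult_le_compat_l; [left; apply pow_lt; lra|auto]. }
  assert (Mono : forall (u v : nat -> R), (forall n, u n <= u (S n)) -> (forall n, v (S n) <= v n)
     -> (forall n, u n <= v n) -> exists x, forall n, u n <= x <= v n).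
  { intros u v Hu Hv Huv.
    assert (Hu' : forall n k, u n <= u (k + n)%nat).
    { intros n k. induction k; [simpl; lra|]. eapply Rle_trans; [apply IHk|apply Hu]. }
    assert (Hv' : forall n k, v (k + n)%nat <= v n).
    { intros n k. induction k; [simpl; lra|]. eapply Rle_trans; [apply Hv|apply IHk]. }
    assert (Hx : forall n m, u n <= v m).
    { intros n m. eapply Rle_trans; [apply (Hu' n m)|].
      eapply Rle_trans; [apply Huv|]. rewrite Nat.add_comm. apply Hv'. }
    destruct (completeness (fun x => exists n, x = u n)) as [x [X1 X2]].
    - exists (v O). intros x [n ->]. apply Hx.
    - exists (u O), O. auto.
    - exists x. intros n. split; [apply X1; now exists n|]. apply X2. intros y [m ->]. apply Hx. }
  destruct (Mono an bn) as [x Hx]; try (intros n; apply HS || apply HV).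
  destruct (Mono cn dn) as [y Hy]; try (intros n; apply HS || apply HV).
  assert (Hz : inrect a b c d (x, y)).
  { split; simpl; specialize (Hx O); specialize (Hy O); specialize (HV O); lra. }
  destruct (Hf _ Hz) as [l Hl].
  set (D := (b - a) + (d - c)).
  assert (HD : 0 <= D) by (unfold D; lra).
  apply Cmod_small_eq0. intros e He.
  (* After [n] bisections the integral is at most [4 * e' * (D / 2 ^ n) ^ 2]; multiplied by [4 ^ n]
     this is [4 * D ^ 2 * e']. The [+ 1] covers [D = 0]. *)
  set (e' := e / (4 * (D * D) + 1)).
  assert (He' : 0 < e') by (apply Rdiv_lt_0_compat; nra).
  destruct (Hl e' He') as [dl [Hdl Hd]].
  destruct (pow_lt_1_zero (/ 2)) with (y := dl / (D + 1)) as [n Hn].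
  { rewrite Rabs_pos_eq; lra. } { apply Rdiv_lt_0_compat; lra. }
  specialize (Hn n (Nat.le_refl _)). rewrite Rabs_pos_eq in Hn by (apply pow_le; lra).
  rewrite pow_inv in Hn.
  destruct (Hlen n) as [L1 [L2 L3]]. destruct (HV n) as [V1 [V2 [V3 [V4 [V5 V6]]]]].
  assert (P2 : 0 < 2 ^ n) by (apply pow_lt; lra).
  assert (LD : (bn n - an n) + (dn n - cn n) = D * / 2 ^ n) by (rewrite L1, L2; unfold D; field; lra).
  assert (Hsm : D * / 2 ^ n < dl).
  { assert (0 < / 2 ^ n) by (now apply Rinv_0_lt_compat).
    apply Rle_lt_trans with ((D + 1) * / 2 ^ n); [nra|].
    apply Rmult_lt_compat_l with (r := D + 1) in Hn; [|lra].
    replace ((D + 1) * (dl / (D + 1))) with dl in Hn by (field; lra). auto. }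
  set (aff := fun z : C => ((f (x, y) - l * (x, y)) + l * z)%C).
  assert (Hcn : ccont_on f (an n) (bn n) (cn n) (dn n)).
  { intros z [Z1 Z2]. apply Hcf. split; lra. }
  assert (EB : BInt f (an n) (bn n) (cn n) (dn n) =
     BInt (fun z => f z - aff z)%C (an n) (bn n) (cn n) (dn n)).
  { transitivity (BInt (fun z => f z - aff z)%C (an n) (bn n) (cn n) (dn n)
       + BInt aff (an n) (bn n) (cn n) (dn n))%C.
    2:{ unfold aff at 2. rewrite BInt_affine by auto. ring. }
    rewrite <- BInt_plus; auto.
    - f_equal. apply functional_extensionality. intros z. ring.
    - apply bcont_on; auto. intros z Z. apply ccont_minus; [apply Hcn; auto|apply ccont_affine].
    - apply bcont_on; auto. intros z Z. apply ccont_affine. }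
  assert (BB : Cmod (BInt f (an n) (bn n) (cn n) (dn n)) <= 4 * (e' * (D * / 2 ^ n) * (D * / 2 ^ n))).
  { rewrite EB. replace (4 * (e' * (D * / 2 ^ n) * (D * / 2 ^ n))) with
      (4 * (e' * (D * / 2 ^ n) * ((bn n - an n) + (dn n - cn n)))) by (rewrite LD; ring).
    apply BInt_bound; auto.
    - intros z Z. apply ccont_minus; [apply Hcn; auto|apply ccont_affine].
    - intros z [Z1 Z2].
      assert (Hzz : Cmod (z - (x, y))%C <= D * / 2 ^ n).
      { rewrite <- LD. eapply Rle_trans; [apply Cmod_le_sum|]. simpl.
        specialize (Hx n). specialize (Hy n).
        apply Rplus_le_compat; apply Rabs_le; lra. }
      unfold aff. replace (f z - (f (x, y) - l * (x, y) + l * z))%C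
         with (f z - f (x, y) - (z - (x, y)) * l)%C by ring.
      eapply Rle_trans; [apply Hd; lra|]. apply Rmult_le_compat_l; lra. }
  eapply Rle_trans; [apply L3|].
  apply Rle_trans with (4 ^ n * (4 * (e' * (D * / 2 ^ n) * (D * / 2 ^ n)))).
  { apply Rmult_le_compat_l; [left; apply pow_lt; lra|auto]. }
  replace (4 ^ n) with (2 ^ n * 2 ^ n) by (rewrite <- Rpow_mult_distr; f_equal; lra).
  replace (2 ^ n * 2 ^ n * (4 * (e' * (D * / 2 ^ n) * (D * / 2 ^ n)))) with (4 * (D * D) * e')
    by (field; lra).
  unfold e'. apply Rmult_le_reg_r with (4 * (D * D) + 1); [nra|].
  replace (4 * (D * D) * (e / (4 * (D * D) + 1)) * (4 * (D * D) + 1))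
    with (e * (4 * (D * D))) by (field; nra). nra.
Qed.

(** Continuity suffices at one interior point: the rectangles surrounding a small square about [p]
    have integral [0], and the square contributes at most [16 * M * r]. Difference quotients are fed
    in here before they are known to be differentiable at their base point. *)
Lemma goursat (f : C -> C) (a b c d : R) (p : C) :
  a < fst p < b -> c < snd p < d -> ccont_on f a b c d ->
  (forall z, inrect a b c d z -> z <> p -> hol f z) -> BInt f a b c d = 0%C.
Proof.
  intros Ha Hc Hcf Hf. apply Cmod_small_eq0. intros e He.
  destruct (Hcf p ltac:(split; lra) 1 ltac:(lra)) as [dl [Hdl Hd]].
  set (M := Cmod (f p) + 1). assert (HM : 0 < M) by (unfold M; generalize (Cmod_ge_0 (f p)); lra).
  set (r := Rmin (Rmin (Rmin (fst p - a) (b - fst p)) (Rmin (snd p - c) (d - snd p)))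
               (Rmin (dl / 4) (e / (16 * M)))).
  assert (Hr : 0 < r).
  { repeat apply Rmin_pos; try lra. apply Rdiv_lt_0_compat; lra. }
  assert (R1 : r <= fst p - a /\ r <= b - fst p /\ r <= snd p - c /\ r <= d - snd p /\ r <= dl / 4
     /\ r <= e / (16 * M)).
  { unfold r. repeat split.
    - eapply Rle_trans; [apply Rmin_l|]. eapply Rle_trans; [apply Rmin_l|apply Rmin_l].
    - eapply Rle_trans; [apply Rmin_l|]. eapply Rle_trans; [apply Rmin_l|apply Rmin_r].
    - eapply Rle_trans; [apply Rmin_l|]. eapply Rle_trans; [apply Rmin_r|apply Rmin_l].
    - eapply Rle_trans; [apply Rmin_l|]. eapply Rle_trans; [apply Rmin_r|apply Rmin_r].
    - eapply Rle_trans; [apply Rmin_r|]. apply Rmin_l.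
    - eapply Rle_trans; [apply Rmin_r|]. apply Rmin_r. }
  destruct R1 as [R1 [R2 [R3 [R4 [R5 R6]]]]].
  set (x1 := fst p - r). set (x2 := fst p + r). set (y1 := snd p - r). set (y2 := snd p + r).
  assert (X : a <= x1 /\ x1 < fst p /\ fst p < x2 /\ x2 <= b) by (unfold x1, x2; lra).
  assert (Y : c <= y1 /\ y1 < snd p /\ snd p < y2 /\ y2 <= d) by (unfold y1, y2; lra).
  rewrite (BInt_split_h f a x1 b c d) by (auto; lra).
  rewrite (goursat_sub f a x1 c d); [|lra|lra|].
  2:{ intros z [Z1 Z2]. apply Hf; [split; lra|]. intros ->. lra. }
  rewrite (BInt_split_h f x1 x2 b c d); [|lra|lra|intros z [Z1 Z2]; apply Hcf; split; lra].
  rewrite (goursat_sub f x2 b c d); [|lra|lra|].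
  2:{ intros z [Z1 Z2]. apply Hf; [split; lra|]. intros ->. lra. }
  rewrite (BInt_split_v f x1 x2 c y1 d); [|lra|lra|intros z [Z1 Z2]; apply Hcf; split; lra].
  rewrite (goursat_sub f x1 x2 c y1); [|lra|lra|].
  2:{ intros z [Z1 Z2]. apply Hf; [split; lra|]. intros ->. lra. }
  rewrite (BInt_split_v f x1 x2 y1 y2 d); [|lra|lra|intros z [Z1 Z2]; apply Hcf; split; lra].
  rewrite (goursat_sub f x1 x2 y2 d); [|lra|lra|].
  2:{ intros z [Z1 Z2]. apply Hf; [split; lra|]. intros ->. lra. }
  rewrite !Cplus_0_l, !Cplus_0_r.
  eapply Rle_trans; [apply (BInt_bound f x1 x2 y1 y2 M)|]; try lra.
  - intros z [Z1 Z2]; apply Hcf; split; lra.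
  - intros z [Z1 Z2]. assert (K : Cmod (z - p)%C < dl).
    { eapply Rle_lt_trans; [apply Cmod_le_sum|]. simpl.
      assert (Rabs (fst z + - fst p) <= r) by (apply Rabs_le; unfold x1, x2 in *; lra).
      assert (Rabs (snd z + - snd p) <= r) by (apply Rabs_le; unfold y1, y2 in *; lra). lra. }
    specialize (Hd z K). assert (T := Cmod_rev_triangle (f z) (f p)). unfold M. lra.
  - replace (x2 - x1 + (y2 - y1)) with (4 * r) by (unfold x1, x2, y1, y2; ring).
    apply Rmult_le_compat_l with (r := 16 * M) in R6; [|lra].
    replace (16 * M * (e / (16 * M))) with e in R6 by (field; lra). lra.
Qed.

Definition SInt (f : C -> C) (p : C) (r : R) : C :=
  BInt f (fst p - r) (fst p + r) (snd p - r) (snd p + r).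

Definition onsq (p : C) (r : R) : C -> Prop :=
  onbd (fst p - r) (fst p + r) (snd p - r) (snd p + r).

Lemma onsq_far (p : C) (r : R) (z : C) : 0 < r -> onsq p r z ->
  r <= Cmod (z - p)%C <= 2 * r.
Proof.
  intros Hr [[H1 H2] H3]. split.
  - assert (K := Rmax_Cmod (z - p)%C). simpl in K.
    assert (L1 := Rmax_l (Rabs (fst z + - fst p)) (Rabs (snd z + - snd p))).
    assert (L2 := Rmax_r (Rabs (fst z + - fst p)) (Rabs (snd z + - snd p))).
    generalize (Rle_abs (fst z + - fst p)) (Rle_abs (- (fst z + - fst p)))
      (Rle_abs (snd z + - snd p)) (Rle_abs (- (snd z + - snd p))).
    rewrite !Rabs_Ropp. intros. destruct H3 as [E|[E|[E|E]]]; lra.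
  - eapply Rle_trans; [apply Cmod_le_sum|]. simpl.
    assert (Rabs (fst z + - fst p) <= r) by (apply Rabs_le; lra).
    assert (Rabs (snd z + - snd p) <= r) by (apply Rabs_le; lra). lra.
Qed.

Definition sqcont (f : C -> C) (p : C) (r : R) : Prop := forall z, onsq p r z -> ccont f z.

Lemma SInt_ext (f g : C -> C) (p : C) (r : R) : 0 < r ->
  (forall z, onsq p r z -> f z = g z) -> SInt f p r = SInt g p r.
Proof. intros Hr H. unfold SInt. apply BInt_ext; [lra|lra|exact H]. Qed.

Lemma SInt_plus (f g : C -> C) (p : C) (r : R) : 0 < r -> sqcont f p r -> sqcont g p r ->
  SInt (fun z => f z + g z)%C p r = (SInt f p r + SInt g p r)%C.
Proof.
  intros Hr Hf Hg. unfold SInt. apply BInt_plus; [lra|lra| |]; apply bcont_bd; (lra || assumption).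
Qed.

Lemma SInt_scal (k : C) (f : C -> C) (p : C) (r : R) : 0 < r -> sqcont f p r ->
  SInt (fun z => k * f z)%C p r = (k * SInt f p r)%C.
Proof.
  intros Hr Hf. unfold SInt. apply BInt_scal; [lra|lra|]; apply bcont_bd; (lra || assumption).
Qed.

Lemma SInt_bound (f : C -> C) (p : C) (r M : R) : 0 < r -> sqcont f p r ->
  (forall z, onsq p r z -> Cmod (f z) <= M) -> Cmod (SInt f p r) <= 16 * (M * r).
Proof.
  intros Hr Hf HM. unfold SInt. eapply Rle_trans; [apply (BInt_bound_bd f _ _ _ _ M)|].
  - lra.
  - lra.
  - apply bcont_bd; (lra || assumption).
  - exact HM.
  - lra.
Qed.

Lemma rcont_bounded (g : R -> C) (a b : R) : a <= b -> rcont_on g a b ->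
  exists M, forall x, a <= x <= b -> Cmod (g x) <= M.
Proof.
  intros Hab Hg.
  destruct (continuity_ab_maj (fun x => Rabs (fst (g x)) + Rabs (snd (g x))) a b Hab) as [m [Hm _]].
  - intros x Hx. destruct (Hg x Hx) as [H1 H2].
    apply (continuity_pt_plus (fun t => Rabs (fst (g t))) (fun t => Rabs (snd (g t))));
      apply continuity_pt_filterlim.
    + exact (continuous_comp (fun t => fst (g t)) Rabs x H1 (continuous_Rabs _)).
    + exact (continuous_comp (fun t => snd (g t)) Rabs x H2 (continuous_Rabs _)).
  - exists (Rabs (fst (g m)) + Rabs (snd (g m))). intros x Hx.
    eapply Rle_trans; [apply Cmod_le_sum|]. apply Hm, Hx.
Qed.

Lemma sqcont_bounded (f : C -> C) (p : C) (r : R) : 0 < r -> sqcont f p r ->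
  exists M, 0 < M /\ forall z, onsq p r z -> Cmod (f z) <= M.
Proof.
  intros Hr Hf.
  assert (B := bcont_bd f (fst p - r) (fst p + r) (snd p - r) (snd p + r)
    ltac:(lra) ltac:(lra) Hf).
  destruct B as [[B1 B2] [B3 B4]].
  apply rcont_bounded in B1, B2, B3, B4; try lra.
  destruct B1 as [M1 H1], B2 as [M2 H2], B3 as [M3 H3], B4 as [M4 H4].
  exists (Rabs M1 + Rabs M2 + Rabs M3 + Rabs M4 + 1).
  generalize (Rabs_pos M1) (Rabs_pos M2) (Rabs_pos M3) (Rabs_pos M4)
    (Rle_abs M1) (Rle_abs M2) (Rle_abs M3) (Rle_abs M4). intros.
  split; [lra|].
  intros [x y] [[Z1 Z2] Z3]; simpl in *. destruct Z3 as [E|[E|[E|E]]]; subst.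
  - specialize (H3 y Z2). unfold ver in H3. lra.
  - specialize (H4 y Z2). unfold ver in H4. lra.
  - specialize (H1 x Z1). unfold hor in H1. lra.
  - specialize (H2 x Z1). unfold hor in H2. lra.
Qed.

Lemma onsq_sub_neq (p w z : C) (r : R) : 0 < r -> onsq p r z -> Cmod (w - p)%C <= r / 2 ->
  r / 2 <= Cmod (z - w)%C.
Proof.
  intros Hr Hz Hw. assert (H := onsq_far p r z Hr Hz).
  assert (T := Cmod_rev_triangle (z - p)%C (w - p)%C).
  replace (z - p - (w - p))%C with (z - w)%C in T by ring. lra.
Qed.

Lemma sqcont_kernel (psi : C -> C) (p w : C) (r : R) : 0 < r -> sqcont psi p r ->
  Cmod (w - p)%C <= r / 2 -> sqcont (fun z => psi z / (z - w))%C p r.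
Proof.
  intros Hr Hp Hw z Hz. apply ccont_div; [now apply Hp| |].
  - apply ccont_minus; [apply ccont_id|apply ccont_const].
  - apply Cmod_gt_0. assert (H := onsq_sub_neq p w z r Hr Hz Hw). lra.
Qed.

Lemma Cmod_self (p : C) : Cmod (p - p)%C = 0.
Proof. replace (p - p)%C with (RtoC 0) by ring. apply Cmod_0. Qed.

(** Differentiation under the integral, at the center only: [1 / (z - w) = 1 / (z - p) + (w - p) /
    (z - p)^2 + (w - p)^2 / ((z - p)^2 (z - w))], and the last kernel stays bounded for
    [|w - p| <= r / 2]. *)
Lemma cauchy_kernel_hol (psi : C -> C) (p : C) (r : R) : 0 < r -> sqcont psi p r ->
  hol (fun w => SInt (fun z => psi z / (z - w))%C p r) p.
Proof.
  intros Hr Hp.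
  destruct (sqcont_bounded psi p r Hr Hp) as [M [HM HB]].
  set (psi1 := fun z => (psi z / (z - p))%C).
  set (psi2 := fun z => (psi1 z / (z - p))%C).
  assert (Hpp : Cmod (p - p)%C <= r / 2) by (rewrite Cmod_self; lra).
  assert (C1 : sqcont psi1 p r) by (apply sqcont_kernel; auto).
  assert (C2 : sqcont psi2 p r) by (apply sqcont_kernel; auto).
  exists (SInt psi2 p r). intros e He.
  set (K := 16 * (M / r / r / (r / 2) * r)).
  assert (HK : 0 < K).
  { unfold K. repeat (apply Rdiv_lt_0_compat || apply Rmult_lt_0_compat); lra. }
  exists (Rmin (r / 2) (e / K)). split.
  { apply Rmin_pos; [lra|now apply Rdiv_lt_0_compat]. }
  intros w Hw.
  assert (W1 : Cmod (w - p)%C <= r / 2) by (left; eapply Rlt_le_trans; [apply Hw|apply Rmin_l]).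
  assert (W2 : Cmod (w - p)%C <= e / K) by (left; eapply Rlt_le_trans; [apply Hw|apply Rmin_r]).
  set (psi3 := fun z => (psi2 z / (z - w))%C).
  assert (C3 : sqcont psi3 p r) by (apply sqcont_kernel; auto).
  assert (NZ : forall z, onsq p r z -> (z - p)%C <> 0%C /\ (z - w)%C <> 0%C).
  { intros z Hz. split; apply Cmod_gt_0.
    - assert (T := onsq_far p r z Hr Hz). lra.
    - assert (T := onsq_sub_neq p w z r Hr Hz W1). lra. }
  assert (E : SInt (fun z => psi z / (z - w))%C p r =
    (SInt psi1 p r + (w - p) * (SInt psi2 p r + (w - p) * SInt psi3 p r))%C).
  { assert (C4 : sqcont (fun z => (w - p) * psi3 z)%C p r)
      by (intros z Hz; apply ccont_mult; [apply ccont_const|now apply C3]).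
    assert (C5 : sqcont (fun z => psi2 z + (w - p) * psi3 z)%C p r)
      by (intros z Hz; apply (ccont_plus psi2); [now apply C2|now apply C4]).
    assert (C6 : sqcont (fun z => (w - p) * (psi2 z + (w - p) * psi3 z))%C p r)
      by (intros z Hz; apply ccont_mult; [apply ccont_const|now apply C5]).
    rewrite <- (SInt_scal (w - p)%C psi3 p r Hr C3).
    rewrite <- (SInt_plus psi2 _ p r Hr C2 C4).
    rewrite <- (SInt_scal (w - p)%C _ p r Hr C5).
    rewrite <- (SInt_plus psi1 _ p r Hr C1 C6).
    apply SInt_ext; [exact Hr|]. intros z Hz. destruct (NZ z Hz).
    unfold psi3, psi2, psi1. field. auto. }
  rewrite E. fold psi1.
  replace (SInt psi1 p r + (w - p) * (SInt psi2 p r + (w - p) * SInt psi3 p r)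
     - SInt psi1 p r - (w - p) * SInt psi2 p r)%C with
    (((w - p) * SInt psi3 p r) * (w - p))%C by ring.
  rewrite !Cmod_mult. apply Rmult_le_compat_r; [apply Cmod_ge_0|].
  assert (B3 : Cmod (SInt psi3 p r) <= K).
  { apply SInt_bound; auto. intros z Hz. destruct (NZ z Hz) as [N1 N2].
    assert (T1 := onsq_far p r z Hr Hz). assert (T2 := onsq_sub_neq p w z r Hr Hz W1).
    unfold psi3, psi2, psi1. rewrite !Cmod_div by auto.
    unfold Rdiv.
    repeat (apply Rmult_le_compat); repeat apply Rmult_le_pos; try apply Cmod_ge_0;
      try (left; apply Rinv_0_lt_compat; lra); try (apply Rinv_le_contravar; lra); auto. }
  apply Rle_trans with (e / K * K).
  - apply Rmult_le_compat; auto; apply Cmod_ge_0.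
  - right. field. lra.
Qed.

Lemma im_pos_bound (g : R -> R) (p r : R) : 0 < r ->
  (forall x, p - r <= x <= p + r -> continuous g x) ->
  (forall x, p - r <= x <= p + r -> / (2 * r) <= g x) -> 1 <= RInt g (p - r) (p + r).
Proof.
  intros Hr Hc Hg.
  replace 1 with (RInt (fun _ => / (2 * r)) (p - r) (p + r)).
  - apply RInt_le; try lra.
    + apply ex_RInt_const.
    + apply (@ex_RInt_continuous R_CompleteNormedModule). intros z Hz.
      rewrite Rmin_left, Rmax_right in Hz by lra. auto.
    + intros x Hx. apply Hg. lra.
  - rewrite RInt_const. unfold scal; simpl; unfold mult; simpl. field. lra.
Qed.

(** The exact value [2 pi i] is not computed. On each side the relevant component of [dz / (z - p)]
    has density [r / (r^2 + s^2) >= 1 / (2 r)], so each of the four sides adds at least [1] to the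
    imaginary part. *)
Lemma SInt_index (p : C) (r : R) : 0 < r -> 4 <= Cmod (SInt (fun z => 1 / (z - p))%C p r).
Proof.
  intros Hr.
  assert (Hpp : Cmod (p - p)%C <= r / 2) by (rewrite Cmod_self; lra).
  assert (CC : sqcont (fun z => 1 / (z - p))%C p r).
  { apply sqcont_kernel; auto. intros z _. apply ccont_const. }
  destruct (bcont_bd _ (fst p - r) (fst p + r) (snd p - r) (snd p + r)
    ltac:(lra) ltac:(lra) CC) as [[B1 B2] [B3 B4]].
  eapply Rle_trans; [|apply Rmax_Cmod]. eapply Rle_trans; [|apply Rmax_r].
  eapply Rle_trans; [|apply Rle_abs].
  assert (QB : forall s, - r <= s <= r -> / (2 * r) <= r / (r ^ 2 + s ^ 2)).
  { intros s Hs. assert (H1 : 0 <= s ^ 2 <= r ^ 2) by (split; nra).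
    assert (H2 : 0 < r ^ 2) by nra.
    apply Rmult_le_reg_r with ((2 * r) * (r ^ 2 + s ^ 2)); [nra|].
    replace (/ (2 * r) * (2 * r * (r ^ 2 + s ^ 2))) with (r ^ 2 + s ^ 2) by (field; lra).
    replace (r / (r ^ 2 + s ^ 2) * (2 * r * (r ^ 2 + s ^ 2))) with (2 * r * r).
    2:{ field. apply Rgt_not_eq. lra. }
    nra. }
  assert (NZ' : forall s, 0 < r ^ 2 + s ^ 2) by (intros; nra).
  assert (T1 : 1 <= snd (CInt (fun x => 1 / (hor (snd p - r) x - p))%C (fst p - r) (fst p + r))).
  { apply (im_pos_bound (fun x => snd (1 / (hor (snd p - r) x - p))%C)); [exact Hr| |].
    intros x Hx; exact (proj2 (B1 x Hx)).
    intros x Hx. simpl. eapply Rle_trans; [apply (QB (x - fst p)); lra|]. right.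
    field; repeat split; apply Rgt_not_eq; generalize (NZ' (x - fst p)) (NZ' (x - snd p)); intros; nra. }
  assert (T2 : 1 <= - snd (CInt (fun x => 1 / (hor (snd p + r) x - p))%C (fst p - r) (fst p + r))).
  { unfold CInt; simpl snd at 1. rewrite <- (RInt_opp (V := R_CompleteNormedModule)).
    2:{ exact (proj2 (rcont_on_ex _ (fst p - r) (fst p + r) ltac:(lra) B2)). }
    apply (im_pos_bound (fun x => opp (snd (1 / (hor (snd p + r) x - p))%C))); [exact Hr| |].
    - intros x Hx. apply (continuous_opp (V := R_NormedModule)). exact (proj2 (B2 x Hx)).
    - intros x Hx. unfold opp; simpl. eapply Rle_trans; [apply (QB (x - fst p)); lra|]. right.
      field; repeat split; apply Rgt_not_eq; generalize (NZ' (x - fst p)) (NZ' (x - snd p)); intros; nra. }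
  assert (T3 : 1 <= fst (CInt (fun x => 1 / (ver (fst p + r) x - p))%C (snd p - r) (snd p + r))).
  { apply (im_pos_bound (fun x => fst (1 / (ver (fst p + r) x - p))%C)); [exact Hr| |].
    intros x Hx; exact (proj1 (B4 x Hx)).
    intros x Hx. simpl. eapply Rle_trans; [apply (QB (x - snd p)); lra|]. right.
    field; repeat split; apply Rgt_not_eq; generalize (NZ' (x - fst p)) (NZ' (x - snd p)); intros; nra. }
  assert (T4 : 1 <= - fst (CInt (fun x => 1 / (ver (fst p - r) x - p))%C (snd p - r) (snd p + r))).
  { unfold CInt; simpl fst at 1. rewrite <- (RInt_opp (V := R_CompleteNormedModule)).
    2:{ exact (proj1 (rcont_on_ex _ (snd p - r) (snd p + r) ltac:(lra) B3)). }
    apply (im_pos_bound (fun x => opp (fst (1 / (ver (fst p - r) x - p))%C))); [exact Hr| |].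
    - intros x Hx. apply (continuous_opp (V := R_NormedModule)). exact (proj1 (B3 x Hx)).
    - intros x Hx. unfold opp; simpl. eapply Rle_trans; [apply (QB (x - snd p)); lra|]. right.
      field; repeat split; apply Rgt_not_eq; generalize (NZ' (x - fst p)) (NZ' (x - snd p)); intros; nra. }
  unfold SInt, BInt. 
  generalize dependent (CInt (fun x => 1 / (hor (snd p - r) x - p))%C (fst p - r) (fst p + r)).
  generalize dependent (CInt (fun x => 1 / (hor (snd p + r) x - p))%C (fst p - r) (fst p + r)).
  generalize dependent (CInt (fun x => 1 / (ver (fst p + r) x - p))%C (snd p - r) (snd p + r)).
  generalize dependent (CInt (fun x => 1 / (ver (fst p - r) x - p))%C (snd p - r) (snd p + r)).
  intros. unfold Cminus, Cplus, Copp, Cmult, Ci; simpl. lra.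
Qed.

Definition diffquot (f : C -> C) (w l z : C) : C :=
  if excluded_middle_informative (z = w) then l else ((f z - f w) / (z - w))%C.

Lemma diffquot_mul (f : C -> C) (w l z : C) : ((z - w) * diffquot f w l z)%C = (f z - f w)%C.
Proof.
  unfold diffquot. destruct (excluded_middle_informative (z = w)) as [->|E]; [ring|].
  field. now apply Cminus_neq0.
Qed.

Lemma diffquot_off (f : C -> C) (w l z : C) : z <> w ->
  diffquot f w l z = ((f z - f w) / (z - w))%C.
Proof. intros E. unfold diffquot. now destruct (excluded_middle_informative (z = w)). Qed.

Lemma diffquot_at (f : C -> C) (w l : C) : diffquot f w l w = l.
Proof. unfold diffquot. now destruct (excluded_middle_informative (w = w)). Qed.

Lemma diffquot_hol_off (f : C -> C) (w l z : C) : hol f z -> z <> w -> hol (diffquot f w l) z.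
Proof.
  intros Hf Hz. apply hol_ext_loc with (fun z => (f z - f w) / (z - w))%C (Cmod (z - w)%C).
  - now apply Cmod_sub_pos.
  - intros y Hy. symmetry. apply diffquot_off. intros ->. rewrite Cmod_sub_sym in Hy. lra.
  - apply hol_div; [apply hol_minus; [auto|apply hol_const]|apply hol_minus;
      [apply hol_id|apply hol_const]|now apply Cminus_neq0].
Qed.

Lemma diffquot_cont (f : C -> C) (w l : C) : (forall z, hol f z) -> cderiv f w l ->
  forall z, ccont (diffquot f w l) z.
Proof.
  intros Hf Hl z. destruct (classic (z = w)) as [->|E].
  - apply cderiv_carath in Hl. destruct Hl as [phi [H1 [H2 H3]]].
    apply ccont_ext_loc with phi 1; [lra| |auto]. intros y _.
    destruct (classic (y = w)) as [->|E]; [now rewrite diffquot_at|].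
    rewrite diffquot_off, H3 by auto. field. now apply Cminus_neq0.
  - apply hol_cont, diffquot_hol_off; auto.
Qed.

Lemma diffquot_SInt (f : C -> C) (p w l : C) (r : R) : 0 < r -> (forall z, hol f z) ->
  cderiv f w l -> Cmod (w - p)%C <= r / 2 -> SInt (diffquot f w l) p r = 0%C.
Proof.
  intros Hr Hf Hl Hw. unfold SInt.
  assert (H1 := Rmax_Cmod (w - p)%C). simpl in H1.
  assert (L1 := Rmax_l (Rabs (fst w + - fst p)) (Rabs (snd w + - snd p))).
  assert (L2 := Rmax_r (Rabs (fst w + - fst p)) (Rabs (snd w + - snd p))).
  generalize (Rle_abs (fst w + - fst p)) (Rle_abs (- (fst w + - fst p)))
    (Rle_abs (snd w + - snd p)) (Rle_abs (- (snd w + - snd p))).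
  rewrite !Rabs_Ropp. intros. apply goursat with w.
  - lra.
  - lra.
  - intros z _. now apply diffquot_cont.
  - intros z _ Hz. now apply diffquot_hol_off.
Qed.

(* Cauchy's formula: [(f w - f p) J(w) = (w - p) L(w)] for the Cauchy integrals [J] of [1] and [L] of
   [(f z - f p) / (z - p)], and both are differentiable at [p]. *)
Lemma diffquot_hol (f : C -> C) (p l : C) : (forall z, hol f z) -> cderiv f p l ->
  forall z, hol (diffquot f p l) z.
Proof.
  intros Hf Hl z. destruct (classic (z = p)) as [->|E]; [|now apply diffquot_hol_off].
  set (psi := diffquot f p l).
  set (J := fun w => SInt (fun z => 1 / (z - w))%C p 1).
  set (L := fun w => SInt (fun z => psi z / (z - w))%C p 1).
  assert (CP : sqcont psi p 1) by (intros y _; now apply diffquot_cont).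
  assert (C1 : sqcont (fun _ => RtoC 1) p 1) by (intros y _; apply ccont_const).
  assert (HJ : hol J p) by exact (cauchy_kernel_hol _ p 1 ltac:(lra) C1).
  assert (HL : hol L p) by exact (cauchy_kernel_hol _ p 1 ltac:(lra) CP).
  assert (J0 : J p <> 0%C).
  { apply Cmod_gt_0. unfold J. assert (T := SInt_index p 1 ltac:(lra)). lra. }
  destruct (ccont_nonzero J p (hol_cont _ _ HJ) J0) as [d [Hd Hn]].
  assert (PJ := proj1 (Cmod_gt_0 _) J0).
  assert (KEY : forall w, Cmod (w - p)%C <= 1 / 2 -> ((f w - f p) * J w = (w - p) * L w)%C).
  { intros w Hw. destruct (Hf w) as [lw Hlw].
    assert (CK1 := sqcont_kernel _ p w 1 ltac:(lra) C1 Hw).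
    assert (CKP := sqcont_kernel _ p w 1 ltac:(lra) CP Hw).
    assert (A1 : sqcont (fun z => (f w - f p) * (1 / (z - w)))%C p 1)
      by (intros y Hy; apply ccont_mult; [apply ccont_const|now apply CK1]).
    assert (A2 : sqcont (diffquot f w lw) p 1) by (intros y _; now apply diffquot_cont).
    assert (A3 : sqcont (fun z => (w - p) * (psi z / (z - w)))%C p 1)
      by (intros y Hy; apply ccont_mult; [apply ccont_const|now apply CKP]).
    (* Both integrands are [(f z - f p) / (z - w)] on the square; the difference quotients with base
       points [w] and [p] integrate to [0], which leaves the two Cauchy integrals. *)
    assert (E : SInt (fun z => (f w - f p) * (1 / (z - w)) + diffquot f w lw z)%C p 1
      = SInt (fun z => psi z + (w - p) * (psi z / (z - w)))%C p 1).
    { apply SInt_ext; [lra|]. intros y Hy.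
      assert (T1 := onsq_far p 1 y ltac:(lra) Hy).
      assert (T2 := onsq_sub_neq p w y 1 ltac:(lra) Hy Hw).
      assert (N1 : (y - p)%C <> 0%C) by (apply Cmod_gt_0; lra).
      assert (N2 : (y - w)%C <> 0%C) by (apply Cmod_gt_0; lra).
      unfold psi. rewrite !diffquot_off.
      - field. auto.
      - intros ->. apply N1. ring.
      - intros ->. apply N2. ring. }
    rewrite (SInt_plus _ _ p 1 ltac:(lra) A1 A2), (SInt_plus _ _ p 1 ltac:(lra) CP A3) in E.
    rewrite (SInt_scal _ _ p 1 ltac:(lra) CK1), (SInt_scal _ _ p 1 ltac:(lra) CKP) in E.
    unfold psi at 1 in E. rewrite !diffquot_SInt, Cplus_0_l, Cplus_0_r in E; auto; try lra.
    rewrite Cmod_self. lra. }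
  apply hol_ext_loc with (fun w => L w / J w)%C (Rmin (Rmin d (1 / 2)) 1).
  { repeat apply Rmin_pos; lra. }
  2:{ apply hol_div; auto. }
  assert (OFF : forall w, Cmod (w - p)%C < Rmin d (1 / 2) -> w <> p -> (L w / J w)%C = psi w).
  { intros w Hw Hne.
    assert (W1 : Cmod (w - p)%C < d) by (eapply Rlt_le_trans; [apply Hw|apply Rmin_l]).
    assert (W2 : Cmod (w - p)%C < 1 / 2) by (eapply Rlt_le_trans; [apply Hw|apply Rmin_r]).
    assert (NJ : J w <> 0%C) by (apply Cmod_gt_0; specialize (Hn w W1); lra).
    unfold psi. rewrite diffquot_off by auto.
    assert (N := Cminus_neq0 _ _ Hne). specialize (KEY w ltac:(lra)).
    replace (L w) with ((f w - f p) * J w / (w - p))%C by (rewrite KEY; field; auto).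
    field. auto. }
  intros w Hw.
  assert (W1 : Cmod (w - p)%C < Rmin d (1 / 2)) by (eapply Rlt_le_trans; [apply Hw|apply Rmin_l]).
  destruct (classic (w = p)) as [->|E]; [|now apply OFF].
  apply (ccont_eq_at (fun w => L w / J w)%C psi p (Rmin d (1 / 2))).
  - apply Rmin_pos; lra.
  - apply hol_cont, hol_div; auto.
  - now apply diffquot_cont.
  - intros y Hy1 Hy2. now apply OFF.
Qed.

Lemma entire_divide (f : C -> C) (w : C) : (forall z, hol f z) -> f w = 0%C ->
  exists q, (forall z, hol q z) /\ forall z, f z = ((z - w) * q z)%C.
Proof.
  intros Hf Hw. destruct (Hf w) as [l Hl]. exists (diffquot f w l).
  split; [now apply diffquot_hol|]. intros z. rewrite diffquot_mul, Hw. ring.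
Qed.

(** Cauchy's formula with an index known only to have modulus at least [4]:
    [4 |f p| <= |index * f p| <= 16 M]. This weak maximum principle stands in for the sharp one. *)
Lemma entire_center_bound (f : C -> C) (p : C) (r M : R) : 0 < r -> (forall z, hol f z) ->
  (forall z, onsq p r z -> Cmod (f z) <= M) -> Cmod (f p) <= 4 * M.
Proof.
  intros Hr Hf HM. destruct (Hf p) as [l Hl].
  assert (Hpp : Cmod (p - p)%C <= r / 2) by (rewrite Cmod_self; lra).
  assert (CF : sqcont f p r) by (intros z _; apply hol_cont, Hf).
  assert (C1 : sqcont (fun _ => RtoC 1) p r) by (intros y _; apply ccont_const).
  assert (CK1 := sqcont_kernel _ p p r Hr C1 Hpp).
  assert (CKF := sqcont_kernel _ p p r Hr CF Hpp).
  assert (A1 : sqcont (fun z => f p * (1 / (z - p)))%C p r)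
    by (intros y Hy; apply ccont_mult; [apply ccont_const|now apply CK1]).
  assert (A2 : sqcont (diffquot f p l) p r) by (intros y _; now apply diffquot_cont).
  assert (E : SInt (fun z => f z / (z - p))%C p r
    = SInt (fun z => f p * (1 / (z - p)) + diffquot f p l z)%C p r).
  { apply SInt_ext; [exact Hr|]. intros y Hy. assert (T1 := onsq_far p r y Hr Hy).
    assert (N1 : (y - p)%C <> 0%C) by (apply Cmod_gt_0; lra).
    rewrite diffquot_off by (intros ->; apply N1; ring). field. auto. }
  rewrite (SInt_plus _ _ p r Hr A1 A2), (SInt_scal _ _ p r Hr CK1), diffquot_SInt, Cplus_0_r in E; auto.
  assert (B : Cmod (SInt (fun z => f z / (z - p))%C p r) <= 16 * (M / r * r)).
  { apply SInt_bound; auto. intros z Hz. assert (T1 := onsq_far p r z Hr Hz).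
    assert (N1 : (z - p)%C <> 0%C) by (apply Cmod_gt_0; lra).
    rewrite Cmod_div by auto. apply Rmult_le_compat; auto; [apply Cmod_ge_0| |].
    - left. apply Rinv_0_lt_compat. lra.
    - apply Rinv_le_contravar; lra. }
  rewrite E, Cmod_mult in B. assert (I := SInt_index p r Hr).
  replace (16 * (M / r * r)) with (16 * M) in B by (field; lra).
  assert (T := Cmod_ge_0 (f p)). nra.
Qed.

(** * Finiteness of zeros and roots of polynomials *)

Definition prodl (ws : list C) (z : C) : C := fold_right (fun w acc => ((z - w) * acc)%C) 1%C ws.

Lemma entire_divide_list (ws : list C) : forall f, (forall z, hol f z) -> NoDup ws ->
  (forall w, In w ws -> f w = 0%C) ->
  exists q, (forall z, hol q z) /\ forall z, f z = (prodl ws z * q z)%C.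
Proof.
  induction ws as [|w ws IH]; intros f Hf Hnd H0.
  - exists f. split; auto. intros z. simpl. ring.
  - inversion Hnd as [|? ? N1 N2]; subst.
    destruct (entire_divide f w Hf) as [q [Hq Eq]]; [apply H0; now left|].
    destruct (IH q Hq N2) as [q' [Hq' Eq']].
    + intros u Hu. assert (T := H0 u (or_intror Hu)). rewrite Eq in T.
      apply Cmult_integral in T. destruct T as [T|T]; [|auto].
      apply Cminus_eq0 in T. subst. contradiction.
    + exists q'. split; auto. intros z. rewrite Eq, Eq'. simpl. ring.
Qed.

Lemma prodl_upper (ws : list C) (z : C) (r : R) : 0 <= r ->
  (forall w, In w ws -> Cmod (z - w)%C <= r) -> Cmod (prodl ws z) <= r ^ length ws.
Proof.
  intros Hr. induction ws as [|w ws IH]; intros H; simpl.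
  - rewrite Cmod_1. lra.
  - rewrite Cmod_mult. apply Rmult_le_compat; try apply Cmod_ge_0.
    + apply H. now left.
    + apply IH. intros u Hu. apply H. now right.
Qed.

Lemma prodl_lower (ws : list C) (z : C) (r : R) : 0 <= r ->
  (forall w, In w ws -> r <= Cmod (z - w)%C) -> r ^ length ws <= Cmod (prodl ws z).
Proof.
  intros Hr. induction ws as [|w ws IH]; intros H; simpl.
  - rewrite Cmod_1. lra.
  - rewrite Cmod_mult. apply Rmult_le_compat; auto.
    + now apply pow_le.
    + apply H. now left.
    + apply IH. intros u Hu. apply H. now right.
Qed.

Lemma bounded_NoDup_list (P : C -> Prop) (K : nat) :
  (forall l, NoDup l -> (forall z, In z l -> P z) -> (length l <= K)%nat) ->
  exists L, forall z, P z -> In z L.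
Proof.
  intros H. apply NNPP. intros HN.
  assert (B : forall n, exists l, NoDup l /\ (forall z, In z l -> P z) /\ length l = n).
  { induction n as [|n [l [L1 [L2 L3]]]].
    - exists []. split; [constructor|split; [intros z []|auto]].
    - apply NNPP. intros HN'. apply HN. exists l. intros z Hz. apply NNPP. intros Hin.
      apply HN'. exists (z :: l). split; [now constructor|]. split; [|simpl; lia].
      intros u [<-|Hu]; auto. }
  destruct (B (S K)) as [l [L1 [L2 L3]]]. specialize (H l L1 L2). lia.
Qed.

(** Jensen's argument: the product over [k] zeros within [rho] of [z0] is at most [rho ^ k] at [z0]
    but at least [(2 rho) ^ k] on the square of half side [3 rho]. Hence [|f z0| <= 4 M / 2 ^ k],
    which bounds [k]. *)
Lemma entire_zeros_finite (f : C -> C) (z0 : C) (r : R) : (forall z, hol f z) -> f z0 <> 0%C ->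
  exists L, forall z, f z = 0%C -> Cmod (z - z0)%C <= r -> In z L.
Proof.
  intros Hf Hz0. set (rho := Rabs r + 1).
  assert (Hrho : 0 < rho) by (unfold rho; generalize (Rabs_pos r); lra).
  assert (Hr : r <= rho) by (unfold rho; generalize (Rle_abs r); lra).
  destruct (sqcont_bounded f z0 (3 * rho)) as [M [HM HB]]; [lra|intros z _; apply hol_cont, Hf|].
  assert (P0 := proj1 (Cmod_gt_0 _) Hz0).
  destruct (Pow_x_infinity 2) with (b := 4 * M / Cmod (f z0) + 1) as [K HK].
  { rewrite Rabs_pos_eq; lra. }
  destruct (bounded_NoDup_list (fun z => f z = 0%C /\ Cmod (z - z0)%C <= r) K) as [L HL].
  2:{ exists L. intros z H1 H2. apply HL. auto. }
  intros ws Hnd Hws. apply Nat.nlt_ge. intros Hlt.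
  destruct (entire_divide_list ws f Hf Hnd) as [q [Hq Eq]]; [intros w Hw; apply Hws, Hw|].
  assert (Q : Cmod (q z0) <= 4 * (M / (2 * rho) ^ length ws)).
  { apply (entire_center_bound q z0 (3 * rho)); [lra|auto|]. intros z Hz.
    assert (T := onsq_far z0 (3 * rho) z ltac:(lra) Hz).
    assert (Lw : (2 * rho) ^ length ws <= Cmod (prodl ws z)).
    { apply prodl_lower; [lra|]. intros w Hw. destruct (Hws w Hw) as [_ W].
      assert (T2 := Cmod_rev_triangle (z - z0)%C (w - z0)%C).
      replace (z - z0 - (w - z0))%C with (z - w)%C in T2 by ring. lra. }
    assert (P : 0 < (2 * rho) ^ length ws) by (apply pow_lt; lra).
    apply Rmult_le_reg_r with ((2 * rho) ^ length ws); [auto|].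
    unfold Rdiv. rewrite Rmult_assoc, Rinv_l, Rmult_1_r by lra.
    eapply Rle_trans; [|apply (HB z Hz)]. rewrite Eq, Cmod_mult, Rmult_comm.
    apply Rmult_le_compat_r; [apply Cmod_ge_0|auto]. }
  assert (U : Cmod (prodl ws z0) <= rho ^ length ws).
  { apply prodl_upper; [lra|]. intros w Hw. destruct (Hws w Hw) as [_ W].
    rewrite Cmod_sub_sym. lra. }
  assert (F : Cmod (f z0) <= rho ^ length ws * (4 * (M / (2 * rho) ^ length ws))).
  { rewrite Eq, Cmod_mult. apply Rmult_le_compat; auto; apply Cmod_ge_0. }
  rewrite Rpow_mult_distr in F.
  assert (P1 : 0 < 2 ^ length ws) by (apply pow_lt; lra).
  assert (P2 : 0 < rho ^ length ws) by (apply pow_lt; lra).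
  replace (rho ^ length ws * (4 * (M / (2 ^ length ws * rho ^ length ws))))
    with (4 * M / 2 ^ length ws) in F by (field; lra).
  specialize (HK (length ws) ltac:(lia)). rewrite Rabs_pos_eq in HK by lra.
  apply Rmult_le_compat_r with (r := 2 ^ length ws) in F; [|lra].
  replace (4 * M / 2 ^ length ws * 2 ^ length ws) with (4 * M) in F by (field; lra).
  apply Rge_le in HK. apply Rmult_le_compat_r with (r := Cmod (f z0)) in HK; [|lra].
  replace ((4 * M / Cmod (f z0) + 1) * Cmod (f z0)) with (4 * M + Cmod (f z0)) in HK by (field; lra).
  lra.
Qed.

Lemma peval_hol (p : list C) (z : C) : hol (peval p) z.
Proof.
  induction p as [|a p IH].
  - apply (hol_const 0%C).
  - apply (hol_plus (fun _ => a) (fun z => z * peval p z)%C); [apply hol_const|].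
    apply hol_mult; [apply hol_id|auto].
Qed.

Lemma peval_const_or_grow (p : list C) :
  (exists c, forall z, peval p z = c) \/
  (forall B, exists r, forall z, r <= Cmod z -> B <= Cmod (peval p z)).
Proof.
  induction p as [|a p [[c Hc]|IH]].
  - left. exists 0%C. auto.
  - destruct (classic (c = 0%C)) as [->|E].
    + left. exists a. intros z. simpl. rewrite Hc. ring.
    + right. intros B. apply Cmod_gt_0 in E. exists ((Rabs B + Cmod a) / Cmod c). intros z Hz.
      simpl. rewrite Hc. assert (T := Cmod_rev_triangle (z * c)%C (- a)%C).
      replace (z * c - - a)%C with (a + z * c)%C in T by ring.
      rewrite Cmod_opp, Cmod_mult in T.
      apply Rmult_le_compat_r with (r := Cmod c) in Hz; [|lra].
      replace ((Rabs B + Cmod a) / Cmod c * Cmod c) with (Rabs B + Cmod a) in Hz by (field; lra).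
      generalize (Rle_abs B). lra.
  - right. intros B. destruct (IH (Rabs B + Cmod a)) as [r Hr]. exists (Rmax r 1). intros z Hz.
    simpl. assert (T := Cmod_rev_triangle (z * peval p z)%C (- a)%C).
    replace (z * peval p z - - a)%C with (a + z * peval p z)%C in T by ring.
    rewrite Cmod_opp, Cmod_mult in T.
    assert (r <= Cmod z) by (eapply Rle_trans; [apply Rmax_l|apply Hz]).
    assert (1 <= Cmod z) by (eapply Rle_trans; [apply Rmax_r|apply Hz]).
    specialize (Hr z H). generalize (Rle_abs B) (Rabs_pos B) (Cmod_ge_0 a). intros. nra.
Qed.

(** Liouville's proof of the fundamental theorem of algebra: on a square where [|p| >= 8 |p 0|], the
    bound at the center for [1 / p] would give [1 / |p 0| <= 1 / (2 |p 0|)]. *)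
Lemma peval_root (p : list C) : (exists c, forall z, peval p z = c) \/ exists w, peval p w = 0%C.
Proof.
  destruct (peval_const_or_grow p) as [H|H]; [now left|right].
  apply NNPP. intros HN.
  assert (NZ : forall z, peval p z <> 0%C) by (intros z Hz; apply HN; now exists z).
  assert (P0 := proj1 (Cmod_gt_0 _) (NZ 0%C)).
  assert (PI := Rinv_0_lt_compat _ P0).
  destruct (H (8 * Cmod (peval p 0%C))) as [r Hr].
  assert (B : Cmod (/ peval p 0%C) <= 4 * / (8 * Cmod (peval p 0%C))).
  { apply (entire_center_bound (fun z => / peval p z)%C 0%C (Rmax r 1)).
    - eapply Rlt_le_trans; [|apply Rmax_r]. lra.
    - intros z. apply hol_inv; [apply peval_hol|auto].
    - intros z Hz. rewrite Cmod_inv by auto. apply Rinv_le_contravar; [lra|]. apply Hr.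
      apply onsq_far in Hz; [|eapply Rlt_le_trans; [|apply Rmax_r]; lra].
      replace (z - 0)%C with z in Hz by ring. eapply Rle_trans; [apply Rmax_l|apply Hz]. }
  rewrite Cmod_inv, Rinv_mult in B by auto. lra.
Qed.

(** * Series *)

Fixpoint rsum (u : nat -> R) (N : nat) : R :=
  match N with O => 0 | S N => rsum u N + u N end.

Fixpoint psum (a : nat -> C) (N : nat) : C :=
  match N with O => RtoC 0 | S N => (psum a N + a N)%C end.

Lemma sum_n_rsum (u : nat -> R) (N : nat) : sum_n u N = rsum u (S N).
Proof.
  induction N as [|N IH]; [rewrite sum_O; simpl; ring|].
  rewrite sum_Sn, IH. reflexivity.
Qed.

Lemma rsum_le (u v : nat -> R) (N : nat) : (forall n, (n < N)%nat -> u n <= v n) ->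
  rsum u N <= rsum v N.
Proof.
  induction N as [|N IH]; intros H; simpl; [lra|].
  apply Rplus_le_compat; [apply IH; intros; apply H; lia|apply H; lia].
Qed.

Lemma rsum_ext (u v : nat -> R) (N : nat) : (forall n, (n < N)%nat -> u n = v n) ->
  rsum u N = rsum v N.
Proof. induction N as [|N IH]; intros H; simpl; [auto|]. rewrite IH, H; auto. Qed.

Lemma rsum_plus (u v : nat -> R) (N : nat) : rsum (fun n => u n + v n) N = rsum u N + rsum v N.
Proof. induction N as [|N IH]; simpl; [ring|]. rewrite IH. ring. Qed.

Lemma rsum_mono (u : nat -> R) (M N : nat) : (forall n, 0 <= u n) -> (M <= N)%nat ->
  rsum u M <= rsum u N.
Proof. intros Hu. induction 1; simpl; [lra|]. specialize (Hu m). lra. Qed.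

Lemma rsum_pos (u : nat -> R) (N : nat) : (forall n, 0 <= u n) -> 0 <= rsum u N.
Proof. intros Hu. apply (rsum_mono u 0 N Hu). lia. Qed.

Lemma rsum_scal (k : R) (u : nat -> R) (N : nat) : rsum (fun n => k * u n) N = k * rsum u N.
Proof. induction N as [|N IH]; simpl; [ring|]. rewrite IH. ring. Qed.

Lemma ex_series_pos (u : nat -> R) (B : R) : (forall n, 0 <= u n) ->
  (forall N, rsum u N <= B) -> ex_series u.
Proof.
  intros Hu HB. destruct (ex_finite_lim_seq_incr (sum_n u) B) as [l Hl].
  - intros n. rewrite !sum_n_rsum. apply rsum_mono; auto.
  - intros n. rewrite sum_n_rsum. apply HB.
  - exists l. exact Hl.
Qed.

Lemma ex_series_dom (u v : nat -> R) : (forall n, 0 <= u n <= v n) -> ex_series v -> ex_series u.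
Proof.
  intros H Hv. apply (@ex_series_le R_AbsRing R_CompleteNormedModule u v); auto.
  intros n. unfold norm; simpl. unfold abs; simpl. rewrite Rabs_pos_eq; apply H.
Qed.

Lemma rex_ext (u v : nat -> R) : (forall n, u n = v n) -> ex_series u -> ex_series v.
Proof. exact (ex_series_ext u v). Qed.

Lemma ex_series_mul (k : R) (u : nat -> R) : ex_series u -> ex_series (fun n => k * u n).
Proof. intros. now apply (ex_series_scal_l k u). Qed.

Lemma ex_series_add (u v : nat -> R) : ex_series u -> ex_series v ->
  ex_series (fun n => u n + v n).
Proof. intros. now apply (ex_series_plus u v). Qed.

Lemma ex_series_shift (u : nat -> R) (N : nat) :
  ex_series (fun n => u (N + n)%nat) -> ex_series u.
Proof. intros H. now apply ex_series_incr_n with N. Qed.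

Lemma ex_series_fin (u : nat -> R) (N : nat) : (forall n, (N <= n)%nat -> u n = 0) -> ex_series u.
Proof.
  intros H. apply ex_series_shift with N.
  apply ex_series_dom with (fun n => (1 / 2) ^ n).
  - intros n. rewrite H by lia. split; [lra|]. apply pow_le. lra.
  - apply ex_series_geom. rewrite Rabs_pos_eq; lra.
Qed.

Lemma ex_series_dom_ev (u v : nat -> R) (N : nat) :
  (forall n, (N <= n)%nat -> 0 <= u n <= v n) -> ex_series v -> ex_series u.
Proof.
  intros H Hv. apply ex_series_shift with N.
  apply ex_series_dom with (fun n => v (N + n)%nat).
  - intros n. apply H. lia.
  - now apply ex_series_incr_n.
Qed.

Lemma Series_fin (u : nat -> R) (N : nat) : (forall n, (N <= n)%nat -> u n = 0) ->
  Series u = rsum u N.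
Proof.
  intros H. apply is_series_unique, is_series_Reals. intros e He. exists N. intros n Hn.
  replace (sum_f_R0 u n) with (rsum u N).
  - unfold Rdist. rewrite Rminus_diag, Rabs_R0. lra.
  - rewrite <- sum_n_Reals, sum_n_rsum.
    assert (E : forall k, rsum u N = rsum u (k + N)%nat).
    { induction k; [auto|]. simpl. rewrite <- IHk, H by lia. ring. }
    rewrite (E (S n - N)%nat). f_equal. lia.
Qed.

Lemma Series_0 (u : nat -> R) : (forall n, u n = 0) -> Series u = 0.
Proof. intros H. rewrite (Series_fin u 0); auto. Qed.

Lemma Series_pos (u : nat -> R) : (forall n, 0 <= u n) -> ex_series u -> 0 <= Series u.
Proof.
  intros Hu He. rewrite <- (Series_0 (fun _ => 0)) by auto. apply Series_le; auto.
  intros n. split; [lra|auto].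
Qed.

Lemma Series_tail (u : nat -> R) (N : nat) : ex_series u ->
  Series u = rsum u N + Series (fun n => u (N + n)%nat).
Proof.
  intros Hu. destruct N as [|N]; [simpl; rewrite Rplus_0_l; reflexivity|].
  rewrite (Series_incr_n u (S N)) by (auto; lia). f_equal.
  simpl Nat.pred. rewrite <- sum_n_Reals, sum_n_rsum. auto.
Qed.

Lemma rsum_Series (u : nat -> R) (N : nat) : (forall n, 0 <= u n) -> ex_series u ->
  rsum u N <= Series u.
Proof.
  intros Hu He. rewrite (Series_tail u N He).
  assert (0 <= Series (fun n => u (N + n)%nat)); [|lra].
  apply Series_pos; auto. now apply ex_series_incr_n.
Qed.

Lemma Series_bound (u : nat -> R) (B : R) : (forall n, 0 <= u n) -> (forall N, rsum u N <= B) ->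
  Series u <= B.
Proof.
  intros Hu HB. assert (He := ex_series_pos u B Hu HB).
  assert (L := Series_correct u He).
  apply (is_lim_seq_le (sum_n u) (fun _ => B) (Series u) B).
  - intros n. rewrite sum_n_rsum. auto.
  - exact L.
  - apply is_lim_seq_const.
Qed.

Lemma Series_term (u : nat -> R) (n : nat) : (forall n, 0 <= u n) -> ex_series u -> u n <= Series u.
Proof.
  intros Hu He. eapply Rle_trans; [|apply (rsum_Series u (S n) Hu He)]. simpl.
  assert (T := rsum_pos u n Hu). lra.
Qed.

Lemma Series_tail_small (u : nat -> R) (e : R) : 0 < e -> (forall n, 0 <= u n) -> ex_series u ->
  exists N, forall M, (N <= M)%nat -> Series (fun n => u (M + n)%nat) <= e.
Proof.
  intros He Hu Hs. assert (L := Series_correct u Hs). apply is_series_Reals in L.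
  destruct (L e He) as [N HN]. exists (S N). intros M HM.
  specialize (HN (pred M) ltac:(lia)). rewrite <- sum_n_Reals, sum_n_rsum in HN.
  replace (S (pred M)) with M in HN by lia.
  rewrite (Series_tail u M Hs) in HN. unfold Rdist in HN.
  replace (rsum u M - (rsum u M + Series (fun n => u (M + n)%nat)))
    with (- Series (fun n => u (M + n)%nat)) in HN by ring.
  rewrite Rabs_Ropp in HN. eapply Rle_trans; [apply Rle_abs|lra].
Qed.

(** * Absolutely convergent complex series *)

Definition csum (a : nat -> C) : C := (Series (fun n => fst (a n)), Series (fun n => snd (a n))).

Definition csmb (a : nat -> C) : Prop := ex_series (fun n => Cmod (a n)).

Lemma fst_le_Cmod (z : C) : Rabs (fst z) <= Cmod z.
Proof. eapply Rle_trans; [|apply Rmax_Cmod]. apply Rmax_l. Qed.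

Lemma snd_le_Cmod (z : C) : Rabs (snd z) <= Cmod z.
Proof. eapply Rle_trans; [|apply Rmax_Cmod]. apply Rmax_r. Qed.

Lemma csmb_abs (a : nat -> C) : csmb a ->
  ex_series (fun n => Rabs (fst (a n))) /\ ex_series (fun n => Rabs (snd (a n))).
Proof.
  intros H. split; apply ex_series_dom with (fun n => Cmod (a n)); auto; intros n;
    (split; [apply Rabs_pos|]); [apply fst_le_Cmod|apply snd_le_Cmod].
Qed.

Lemma csmb_parts (a : nat -> C) : csmb a ->
  ex_series (fun n => fst (a n)) /\ ex_series (fun n => snd (a n)).
Proof. intros H. destruct (csmb_abs a H). split; now apply ex_series_Rabs. Qed.

Lemma sum_n_parts (a : nat -> C) (N : nat) :
  @sum_n (NormedModule.AbelianGroup C_AbsRing C_NormedModule) a N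
    = (sum_n (fun n => fst (a n)) N, sum_n (fun n => snd (a n)) N).
Proof.
  induction N as [|N IH].
  - rewrite !sum_O. now destruct (a O).
  - rewrite !sum_Sn, IH. reflexivity.
Qed.

(** Links the convergence used in the statement of the theorem to the total, componentwise function
    [csum], with which all computations are done. *)
Lemma cseries_eq (a : nat -> C) (l : C) : cseries a l -> l = csum a.
Proof.
  intros H. unfold cseries, is_series in H.
  assert (P : forall p : C -> R, (forall z, Rabs (p z) <= Cmod z) ->
    (forall z w, p (z - w)%C = p z - p w) ->
    (forall N, p (@sum_n (NormedModule.AbelianGroup C_AbsRing C_NormedModule) a N)
      = sum_n (fun n => p (a n)) N) ->
    is_series (fun n => p (a n)) (p l)).
  { intros p Hp Hl Hs. apply is_series_Reals. intros e He.
    assert (HL := proj1 (filterlim_locally _ _) H (mkposreal (e / 2) ltac:(lra))).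
    destruct HL as [N HN]. exists N. intros n Hn. specialize (HN n Hn).
    rewrite <- sum_n_Reals, <- Hs. unfold Rdist. rewrite <- Hl.
    apply C_NormedModule_mixin_compat2 in HN.
    eapply Rle_lt_trans; [apply Hp|]. eapply Rlt_le_trans; [apply HN|]. simpl.
    (* The balls of [C] come from a product of lines, so a ball of radius [e / 2] bounds the modulus
       only by [sqrt 2 * (e / 2)]. *)
    assert (sqrt 2 <= 2); [|nra].
    rewrite <- (sqrt_Rsqr 2) at 2 by lra. apply sqrt_le_1_alt. unfold Rsqr. lra. }
  unfold csum. destruct l as [l1 l2]. f_equal; symmetry; apply is_series_unique.
  - apply (P fst).
    + apply fst_le_Cmod.
    + intros z w. simpl. ring.
    + intros N. now rewrite sum_n_parts.
  - apply (P snd).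
    + apply snd_le_Cmod.
    + intros z w. simpl. ring.
    + intros N. now rewrite sum_n_parts.
Qed.

Lemma csum_cseries (a : nat -> C) : csmb a -> cseries a (csum a).
Proof.
  intros H. destruct (@ex_series_le C_AbsRing C_CompleteNormedModule a (fun n => Cmod (a n))) as [l Hl].
  - intros n. exact (Rle_refl (Cmod (a n))).
  - exact H.
  - change (cseries a l) in Hl. now rewrite <- (cseries_eq a l Hl).
Qed.

Lemma csum_ext (a b : nat -> C) : (forall n, a n = b n) -> csum a = csum b.
Proof. intros H. unfold csum. f_equal; apply Series_ext; intros n; now rewrite H. Qed.

Lemma csum_plus (a b : nat -> C) : csmb a -> csmb b ->
  csum (fun n => a n + b n)%C = (csum a + csum b)%C.
Proof.
  intros Ha Hb. destruct (csmb_parts a Ha), (csmb_parts b Hb).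
  unfold csum, Cplus; simpl. f_equal; now apply Series_plus.
Qed.

Lemma csum_scal (k : C) (a : nat -> C) : csmb a ->
  csum (fun n => k * a n)%C = (k * csum a)%C.
Proof.
  intros Ha. destruct (csmb_parts a Ha) as [H1 H2].
  unfold csum, Cmult; simpl. f_equal.
  - rewrite Series_minus by (now apply ex_series_mul). now rewrite !Series_scal_l.
  - rewrite Series_plus by (now apply ex_series_mul). now rewrite !Series_scal_l.
Qed.

Lemma csmb_dom (a : nat -> C) (v : nat -> R) : (forall n, Cmod (a n) <= v n) -> ex_series v -> csmb a.
Proof. intros H Hv. apply ex_series_dom with v; auto. intros n. split; [apply Cmod_ge_0|auto]. Qed.

Lemma csmb_plus (a b : nat -> C) : csmb a -> csmb b -> csmb (fun n => a n + b n)%C.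
Proof.
  intros Ha Hb. apply csmb_dom with (fun n => Cmod (a n) + Cmod (b n)).
  - intros n. apply Cmod_triangle.
  - now apply ex_series_add.
Qed.

Lemma csmb_scal (k : C) (a : nat -> C) : csmb a -> csmb (fun n => k * a n)%C.
Proof.
  intros Ha. apply csmb_dom with (fun n => Cmod k * Cmod (a n)).
  - intros n. rewrite Cmod_mult. lra.
  - now apply ex_series_mul.
Qed.

Lemma csmb_ext (a b : nat -> C) : (forall n, a n = b n) -> csmb a -> csmb b.
Proof. intros H Ha. apply ex_series_ext with (fun n => Cmod (a n)); auto. intros n. now rewrite H. Qed.

Lemma csmb_minus (a b : nat -> C) : csmb a -> csmb b -> csmb (fun n => a n - b n)%C.
Proof.
  intros Ha Hb. apply csmb_ext with (fun n => a n + (-(1)) * b n)%C; [intros; ring|].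
  apply csmb_plus; [auto|now apply csmb_scal].
Qed.

Lemma csum_minus (a b : nat -> C) : csmb a -> csmb b ->
  csum (fun n => a n - b n)%C = (csum a - csum b)%C.
Proof.
  intros Ha Hb. rewrite (csum_ext _ (fun n => a n + (-(1)) * b n)%C) by (intros; ring).
  rewrite csum_plus, csum_scal by (auto; now apply csmb_scal). ring.
Qed.

Lemma csum_bound (a : nat -> C) : csmb a -> Cmod (csum a) <= 2 * Series (fun n => Cmod (a n)).
Proof.
  intros Ha. destruct (csmb_abs a Ha) as [H1 H2].
  eapply Rle_trans; [apply Cmod_le_sum|]. unfold csum; simpl fst; simpl snd.
  assert (Rabs (Series (fun n => fst (a n))) <= Series (fun n => Cmod (a n))).
  { eapply Rle_trans; [apply Series_Rabs; auto|]. apply Series_le; auto.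
    intros n. split; [apply Rabs_pos|apply fst_le_Cmod]. }
  assert (Rabs (Series (fun n => snd (a n))) <= Series (fun n => Cmod (a n))).
  { eapply Rle_trans; [apply Series_Rabs; auto|]. apply Series_le; auto.
    intros n. split; [apply Rabs_pos|apply snd_le_Cmod]. }
  lra.
Qed.

Lemma csum_bound_dom (a : nat -> C) (v : nat -> R) : (forall n, Cmod (a n) <= v n) -> ex_series v ->
  Cmod (csum a) <= 2 * Series v.
Proof.
  intros H Hv. eapply Rle_trans; [apply csum_bound; now apply csmb_dom with v|].
  apply Rmult_le_compat_l; [lra|]. apply Series_le; auto. intros n. split; [apply Cmod_ge_0|auto].
Qed.

Lemma csmb_fin (a : nat -> C) (N : nat) : (forall n, (N <= n)%nat -> a n = 0%C) -> csmb a.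
Proof. intros H. apply ex_series_fin with N. intros n Hn. rewrite H by auto. apply Cmod_0. Qed.

Lemma psum_parts (a : nat -> C) (N : nat) :
  psum a N = (rsum (fun n => fst (a n)) N, rsum (fun n => snd (a n)) N).
Proof. induction N as [|N IH]; simpl; [reflexivity|]. rewrite IH. reflexivity. Qed.

Lemma csum_fin (a : nat -> C) (N : nat) : (forall n, (N <= n)%nat -> a n = 0%C) -> csum a = psum a N.
Proof.
  intros H. rewrite psum_parts. unfold csum.
  f_equal; apply Series_fin; intros n Hn; now rewrite H.
Qed.

Lemma csum_tail (a : nat -> C) (N : nat) : csmb a ->
  csum a = (psum a N + csum (fun n => a (N + n)%nat))%C.
Proof.
  intros Ha. destruct (csmb_parts a Ha). rewrite psum_parts. unfold csum, Cplus; simpl.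
  f_equal; now apply Series_tail.
Qed.

Lemma csum_psum_lim (a : nat -> C) (e : R) : csmb a -> 0 < e ->
  exists N, forall M, (N <= M)%nat -> Cmod (csum a - psum a M)%C <= e.
Proof.
  intros Ha He. destruct (Series_tail_small (fun n => Cmod (a n)) (e / 2)) as [N HN]; auto.
  { lra. } { intros; apply Cmod_ge_0. }
  exists N. intros M HM. rewrite (csum_tail a M Ha).
  replace (psum a M + csum (fun n => a (M + n)%nat) - psum a M)%C
    with (csum (fun n => a (M + n)%nat)) by ring.
  eapply Rle_trans; [apply csum_bound|].
  - now apply (ex_series_incr_n (fun n => Cmod (a n))).
  - specialize (HN M HM). simpl in HN. lra.
Qed.

(** Deleting one coefficient separates the pole at [t k] from the rest of a Cauchy transform. *)
Definition del (k : nat) (a : nat -> C) (n : nat) : C := if Nat.eqb n k then RtoC 0 else a n.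

Lemma del_same (k : nat) (a : nat -> C) : del k a k = 0%C.
Proof. unfold del. now rewrite Nat.eqb_refl. Qed.

Lemma del_other (k : nat) (a : nat -> C) (n : nat) : n <> k -> del k a n = a n.
Proof. intros H. unfold del. apply Nat.eqb_neq in H. now rewrite H. Qed.

Lemma Cmod_del_le (k : nat) (a : nat -> C) (n : nat) : Cmod (del k a n) <= Cmod (a n).
Proof.
  destruct (Nat.eq_dec n k) as [->|H]; [rewrite del_same, Cmod_0; apply Cmod_ge_0|].
  rewrite del_other by auto. lra.
Qed.

Lemma csum_del (k : nat) (a : nat -> C) : csmb a -> csum a = (a k + csum (del k a))%C.
Proof.
  intros Ha. set (s := fun n => if Nat.eqb n k then a k else RtoC 0).
  assert (Hs : forall n, (S k <= n)%nat -> s n = 0%C).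
  { intros n Hn. unfold s. assert (E : n <> k) by lia. apply Nat.eqb_neq in E. now rewrite E. }
  rewrite (csum_ext a (fun n => s n + del k a n)%C).
  2:{ intros n. unfold s, del. destruct (Nat.eqb_spec n k); [subst; ring|ring]. }
  rewrite csum_plus.
  - f_equal. rewrite (csum_fin s (S k) Hs). simpl.
    replace (psum s k) with (RtoC 0); [unfold s; rewrite Nat.eqb_refl; ring|].
    assert (E : forall m, (m <= k)%nat -> psum s m = 0%C).
    { induction m as [|m IH]; intros Hm; simpl; [auto|]. rewrite IH by lia.
      unfold s. assert (E : m <> k) by lia. apply Nat.eqb_neq in E. rewrite E. ring. }
    now rewrite E.
  - now apply csmb_fin with (S k).
  - apply csmb_dom with (fun n => Cmod (a n)); auto. intros n. apply Cmod_del_le.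
Qed.

(** * The space and its residues *)

Existing Class admissible_data.
Existing Class generating_function.

(** Stands in for the Cauchy-Schwarz inequality: a sequence square summable against [1 / mu] and one
    square summable against [mu] have a summable product, and rescaling [m] shifts the estimate from
    one to the other. *)
Lemma amgm (x y m : R) : 0 < m -> x * y <= x ^ 2 / m + m * y ^ 2.
Proof.
  intros Hm. apply Rmult_le_reg_r with m; [auto|].
  replace ((x ^ 2 / m + m * y ^ 2) * m) with (x ^ 2 + (m * y) ^ 2) by (field; lra).
  nra.
Qed.

Lemma Cmod_sq_plus (x y : C) : Cmod (x + y)%C ^ 2 <= 2 * Cmod x ^ 2 + 2 * Cmod y ^ 2.
Proof.
  apply Rle_trans with ((Cmod x + Cmod y) ^ 2).
  - apply pow_incr. split; [apply Cmod_ge_0|apply Cmod_triangle].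
  - assert (T := pow2_ge_0 (Cmod x - Cmod y)). lra.
Qed.

(** At least [1], so that its powers increase with the exponent and growth conditions can be
    compared. *)
Definition weight (t : nat -> C) (n : nat) : R := 1 + Cmod (t n).

(* [alpha] is [A'(t_n)], and [qn] is [A / (z - t_n)] continued to [t_n]. *)
Definition alpha (t : nat -> C) (A : C -> C) (n : nat) : C :=
  epsilon (inhabits (RtoC 0)) (fun l => cderiv A (t n) l).

Definition qn (t : nat -> C) (A : C -> C) (n : nat) : C -> C := diffquot A (t n) (alpha t A n).

Definition CT (t : nat -> C) (a : nat -> C) (z : C) : C := csum (fun n => a n / (z - t n))%C.

Definition l2mu (mu : nat -> R) (a : nat -> C) : Prop := ex_series (fun n => Cmod (a n) ^ 2 / mu n).

(** The inverse of taking residues. At a point [t n] the product [A * CT] is replaced by its limit;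
    the index found there is the only one because [t] is injective. *)
Definition synth (t : nat -> C) (A : C -> C) (a : nat -> C) (z : C) : C :=
  match excluded_middle_informative (exists n, z = t n) with
  | left H => let n := proj1_sig (constructive_indefinite_description _ H) in (alpha t A n * a n)%C
  | right _ => (A z * CT t a z)%C
  end.

(* The numbers [c_n mu_n^{1/2}] of the element [F]. *)
Definition residue (t : nat -> C) (A : C -> C) (F : C -> C) (n : nat) : C := (F (t n) / alpha t A n)%C.

Section Space.
Context {t : nat -> C} {A : C -> C} {mu : nat -> R}.
Context {Hdata : admissible_data t mu} {HA : generating_function t A}.

Lemma t_inj (n m : nat) : t n = t m -> n = m.
Proof. apply Hdata. Qed.

Lemma t_far (M : R) : exists N, forall n, (N <= n)%nat -> M <= Cmod (t n).
Proof. apply Hdata. Qed.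

Lemma mu_pos (n : nat) : 0 < mu n.
Proof. apply Hdata. Qed.

Lemma W_ge1 (n : nat) : 1 <= weight t n.
Proof. unfold weight. generalize (Cmod_ge_0 (t n)). lra. Qed.

Lemma mu_W : ex_series (fun n => mu n / weight t n ^ 2).
Proof.
  destruct Hdata as [_ [_ [Hm Hs]]]. apply ex_series_dom with (2 := Hs). intros n.
  specialize (Hm n). assert (T := Cmod_ge_0 (t n)). unfold weight. split.
  - apply Rdiv_le_0_compat; [lra|]. apply pow_lt. lra.
  - apply Rmult_le_compat_l; [lra|]. apply Rinv_le_contravar; nra.
Qed.

Lemma A_hol (z : C) : hol A z.
Proof. apply entire_hol, HA. Qed.

Lemma A_zero (z : C) : A z = 0%C <-> exists n, z = t n.
Proof. apply HA. Qed.

Lemma A_off (z : C) : (forall n, z <> t n) -> A z <> 0%C.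
Proof. intros H E. apply A_zero in E. destruct E as [n E]. exact (H n E). Qed.

Lemma alpha_deriv (n : nat) : cderiv A (t n) (alpha t A n) /\ alpha t A n <> 0%C.
Proof.
  assert (H : exists l, cderiv A (t n) l) by apply A_hol.
  assert (H1 := epsilon_spec (inhabits (RtoC 0)) _ H). split; [exact H1|].
  destruct HA as [_ [_ Hs]]. destruct (Hs n) as [_ [l [Hl N]]]. apply is_derive_cderiv in Hl.
  intros Z. apply N. rewrite <- (cderiv_unique _ _ _ _ H1 Hl). exact Z.
Qed.

Lemma alpha_neq (n : nat) : alpha t A n <> 0%C.
Proof. apply alpha_deriv. Qed.

Lemma A_qn (n : nat) (z : C) : A z = ((z - t n) * qn t A n z)%C.
Proof.
  unfold qn. rewrite diffquot_mul. replace (A (t n)) with (RtoC 0); [ring|].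
  symmetry. apply A_zero. now exists n.
Qed.

Lemma qn_hol (n : nat) (z : C) : hol (qn t A n) z.
Proof. apply diffquot_hol; [apply A_hol|apply alpha_deriv]. Qed.

Lemma qn_at (n : nat) : qn t A n (t n) = alpha t A n.
Proof. apply diffquot_at. Qed.

Lemma qn_neq (n : nat) (z : C) : (forall m, m <> n -> z <> t m) -> qn t A n z <> 0%C.
Proof.
  intros H E. destruct (classic (z = t n)) as [->|Hz].
  - rewrite qn_at in E. now apply alpha_neq in E.
  - assert (A0 : A z = 0%C) by (rewrite (A_qn n), E; ring).
    apply A_zero in A0. destruct A0 as [m ->].
    apply (H m); [intros ->; now apply Hz|reflexivity].
Qed.

(** Finitely many [t n] contribute a positive minimum; from [|t n| >= 2 |z| + 2] on, the distance is
    at least half of the weight. *)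
Lemma kappa (z : C) : exists k, 0 < k /\ k <= 1 /\ forall n, t n <> z -> k * weight t n <= Cmod (z - t n)%C.
Proof.
  destruct (t_far (2 * Cmod z + 2)) as [N HN].
  assert (F : forall N, exists k, 0 < k /\ k <= 1 /\
    forall n, (n < N)%nat -> t n <> z -> k * weight t n <= Cmod (z - t n)%C).
  { clear. induction N as [|N [k [K1 [K2 K3]]]].
    - exists 1. split; [lra|]. split; [lra|]. intros; lia.
    - destruct (classic (t N = z)) as [E|E].
      + exists k. split; [auto|split; [auto|]]. intros n Hn Hz. apply K3; auto.
        assert (n <> N) by congruence. lia.
      + assert (P : 0 < Cmod (z - t N)%C) by (apply Cmod_sub_pos; congruence).
        assert (PW := W_ge1 N).
        set (k' := Rmin k (Cmod (z - t N)%C / weight t N)).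
        assert (Q : 0 < Cmod (z - t N)%C / weight t N) by (apply Rdiv_lt_0_compat; lra).
        exists k'. split; [now apply Rmin_pos|]. split; [eapply Rle_trans; [apply Rmin_l|auto]|].
        intros n Hn Hz. assert (PWn := W_ge1 n). destruct (Nat.eq_dec n N) as [->|D].
        * apply Rle_trans with (Cmod (z - t N)%C / weight t N * weight t N).
          { apply Rmult_le_compat_r; [lra|apply Rmin_r]. }
          right. field. lra.
        * eapply Rle_trans; [|apply K3; auto; lia]. apply Rmult_le_compat_r; [lra|apply Rmin_l]. }
  destruct (F N) as [k [K1 [K2 K3]]]. exists (Rmin k (1 / 2)).
  split; [apply Rmin_pos; lra|]. split; [eapply Rle_trans; [apply Rmin_l|auto]|].
  intros n Hz. assert (PW := W_ge1 n). destruct (Nat.lt_ge_cases n N) as [L|L].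
  - eapply Rle_trans; [|apply K3; auto]. apply Rmult_le_compat_r; [lra|apply Rmin_l].
  - specialize (HN n L). apply Rle_trans with (1 / 2 * weight t n).
    { apply Rmult_le_compat_r; [lra|apply Rmin_r]. }
    rewrite Cmod_sub_sym. assert (T := Cmod_rev_triangle (t n) z). unfold weight. lra.
Qed.

Lemma kappa_near (z y : C) (k : R) (n : nat) : 0 < k -> k * weight t n <= Cmod (z - t n)%C ->
  Cmod (y - z)%C <= k / 2 -> k / 2 * weight t n <= Cmod (y - t n)%C.
Proof.
  intros Hk H Hy. assert (PW := W_ge1 n).
  assert (T := Cmod_rev_triangle (z - t n)%C (z - y)%C).
  replace (z - t n - (z - y))%C with (y - t n)%C in T by ring.
  rewrite (Cmod_sub_sym z y) in T. nra.
Qed.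

Lemma isolated (n : nat) : exists r, 0 < r /\ forall m, m <> n -> r <= Cmod (t n - t m)%C.
Proof.
  destruct (kappa (t n)) as [k [K1 [K2 K3]]]. exists k. split; auto. intros m Hm.
  eapply Rle_trans; [|apply K3; intros E; apply Hm, t_inj, E].
  assert (PW := W_ge1 m). nra.
Qed.

Lemma l2mu_W (a : nat -> C) : l2mu mu a -> ex_series (fun n => Cmod (a n) / weight t n).
Proof.
  intros Ha. apply ex_series_dom with (fun n => Cmod (a n) ^ 2 / mu n + mu n / weight t n ^ 2).
  - intros n. assert (PW := W_ge1 n). split; [apply Rdiv_le_0_compat; [apply Cmod_ge_0|lra]|].
    eapply Rle_trans; [apply (amgm _ _ (mu n) (mu_pos n))|]. right. field.
    assert (PM := mu_pos n). lra.
  - apply ex_series_add; [exact Ha|apply mu_W].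
Qed.

Lemma CT_term (a : nat -> C) (z : C) (k : R) (n : nat) : 0 < k ->
  (t n = z -> a n = 0%C) -> (t n <> z -> k * weight t n <= Cmod (z - t n)%C) ->
  Cmod (a n / (z - t n))%C <= / k * (Cmod (a n) / weight t n).
Proof.
  intros Hk H1 H2. assert (PW := W_ge1 n).
  destruct (classic (t n = z)) as [E|E].
  - rewrite (H1 E). replace (0 / (z - t n))%C with (RtoC 0) by (unfold Cdiv; ring).
    rewrite Cmod_0. right. field. lra.
  - rewrite Cmod_div by (apply Cminus_neq0; congruence).
    specialize (H2 E). unfold Rdiv.
    replace (/ k * (Cmod (a n) * / weight t n)) with (Cmod (a n) * / (k * weight t n)) by (field; lra).
    apply Rmult_le_compat_l; [apply Cmod_ge_0|]. apply Rinv_le_contravar; nra.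
Qed.

Lemma CT_csmb (a : nat -> C) (z : C) : ex_series (fun n => Cmod (a n) / weight t n) ->
  (forall n, t n = z -> a n = 0%C) -> csmb (fun n => a n / (z - t n))%C.
Proof.
  intros Ha Hz. destruct (kappa z) as [k [K1 [K2 K3]]].
  apply csmb_dom with (fun n => / k * (Cmod (a n) / weight t n)).
  - intros n. apply CT_term; auto.
  - now apply ex_series_mul.
Qed.

Lemma CT_hol (a : nat -> C) (z : C) : ex_series (fun n => Cmod (a n) / weight t n) ->
  (forall n, t n = z -> a n = 0%C) -> hol (CT t a) z.
Proof.
  intros Ha Hz. destruct (kappa z) as [k [K1 [K2 K3]]].
  set (a1 := fun n => (a n / (z - t n))%C). set (a2 := fun n => (a1 n / (z - t n))%C).
  assert (Z1 : forall n, t n = z -> a1 n = 0%C).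
  { intros n E. unfold a1. rewrite (Hz n E). unfold Cdiv. ring. }
  assert (Z2 : forall n, t n = z -> a2 n = 0%C).
  { intros n E. unfold a2. rewrite (Z1 n E). unfold Cdiv. ring. }
  assert (DD : forall b : nat -> C, (forall n, t n = z -> b n = 0%C) ->
     ex_series (fun n => Cmod (b n) / weight t n) ->
     ex_series (fun n => Cmod (b n / (z - t n))%C / weight t n)).
  { intros b Hb Hs. apply ex_series_dom with (fun n => / k * (Cmod (b n) / weight t n)).
    - intros n. assert (PW := W_ge1 n). split; [apply Rdiv_le_0_compat; [apply Cmod_ge_0|lra]|].
      eapply Rle_trans; [|apply (CT_term b z k n); auto].
      rewrite <- (Rmult_1_r (Cmod (b n / (z - t n))%C)) at 2.
      apply Rmult_le_compat_l; [apply Cmod_ge_0|]. rewrite <- Rinv_1.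
      apply Rinv_le_contravar; lra.
    - now apply ex_series_mul. }
  assert (S1 := DD a Hz Ha). fold a1 in S1.
  assert (S2 : ex_series (fun n => Cmod (a2 n) / weight t n)) by exact (DD a1 Z1 S1).
  assert (C1 : csmb a2) by (apply (CT_csmb a1); auto).
  set (B := Series (fun n => / (k / 2) * (Cmod (a2 n) / weight t n))).
  assert (HB : 0 <= B).
  { apply Series_pos; [|now apply ex_series_mul]. intros n. assert (PW := W_ge1 n).
    apply Rmult_le_pos; [left; apply Rinv_0_lt_compat; lra|].
    apply Rdiv_le_0_compat; [apply Cmod_ge_0|lra]. }
  exists (- csum a2)%C. intros e He.
  exists (Rmin (k / 2) (e / (2 * B + 1))). split.
  { apply Rmin_pos; [lra|]. apply Rdiv_lt_0_compat; lra. }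
  intros y Hy.
  assert (Y1 : Cmod (y - z)%C <= k / 2) by (left; eapply Rlt_le_trans; [apply Hy|apply Rmin_l]).
  assert (Y2 : Cmod (y - z)%C <= e / (2 * B + 1))
    by (left; eapply Rlt_le_trans; [apply Hy|apply Rmin_r]).
  assert (NN : forall n, t n <> z -> (y - t n)%C <> 0%C /\ (z - t n)%C <> 0%C).
  { intros n Hn. assert (PW := W_ge1 n). specialize (K3 n Hn).
    split; apply Cmod_gt_0; [|nra].
    assert (T := kappa_near z y k n K1 K3 Y1). nra. }
  assert (TB : forall n, Cmod (a2 n / (y - t n))%C <= / (k / 2) * (Cmod (a2 n) / weight t n)).
  { intros n. assert (PW := W_ge1 n). destruct (classic (t n = z)) as [E|E].
    - rewrite (Z2 n E). replace (0 / (y - t n))%C with (RtoC 0) by (unfold Cdiv; ring).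
      rewrite Cmod_0. right. field. lra.
    - apply CT_term; [lra| |].
      + intros E2. exfalso. apply (proj1 (NN n E)). rewrite E2. ring.
      + intros _. apply kappa_near with z; auto. }
  assert (CS3 : csmb (fun n => a2 n / (y - t n))%C)
    by (apply csmb_dom with (1 := TB); now apply ex_series_mul).
  assert (CS1 : csmb a1) by (apply (CT_csmb a); auto).
  assert (E : CT t a y = (CT t a z - (y - z) * csum a2
     + (y - z) * (y - z) * csum (fun n => a2 n / (y - t n)))%C).
  { unfold CT at 2. fold a1. rewrite <- (csum_scal (y - z) a2 C1), <- (csum_scal _ _ CS3).
    assert (C2 := csmb_scal (y - z) a2 C1). assert (C3 := csmb_scal ((y - z) * (y - z)) _ CS3).
    rewrite <- (csum_minus _ _ CS1 C2), <- (csum_plus _ _ (csmb_minus _ _ CS1 C2) C3).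
    apply csum_ext. intros n. destruct (classic (t n = z)) as [E|E].
    - unfold a2, a1. rewrite (Hz n E). unfold Cdiv. ring.
    - destruct (NN n E). unfold a2, a1. field. auto. }
  rewrite E.
  replace (CT t a z - (y - z) * csum a2 + (y - z) * (y - z) * csum (fun n => a2 n / (y - t n))
    - CT t a z - (y - z) * - csum a2)%C
    with ((y - z) * csum (fun n => a2 n / (y - t n)) * (y - z))%C by ring.
  rewrite !Cmod_mult. apply Rmult_le_compat_r; [apply Cmod_ge_0|].
  assert (BB : Cmod (csum (fun n => a2 n / (y - t n))%C) <= 2 * B)
    by (apply csum_bound_dom; auto; now apply ex_series_mul).
  apply Rle_trans with (e / (2 * B + 1) * (2 * B)).
  { apply Rmult_le_compat; auto; apply Cmod_ge_0. }
  apply Rmult_le_reg_r with (2 * B + 1); [lra|].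
  replace (e / (2 * B + 1) * (2 * B) * (2 * B + 1)) with (e * (2 * B)) by (field; lra). nra.
Qed.

Lemma synth_at (a : nat -> C) (n : nat) : synth t A a (t n) = (alpha t A n * a n)%C.
Proof.
  unfold synth. destruct (excluded_middle_informative (exists m, t n = t m)) as [H|H].
  - destruct (constructive_indefinite_description _ H) as [m Hm]. simpl.
    apply t_inj in Hm. now subst.
  - elim H. now exists n.
Qed.

Lemma synth_off (a : nat -> C) (z : C) : (forall n, z <> t n) -> synth t A a z = (A z * CT t a z)%C.
Proof.
  intros Hz. unfold synth. destruct (excluded_middle_informative (exists m, z = t m)) as [H|H]; auto.
  destruct H as [n Hn]. elim (Hz n Hn).
Qed.

Lemma del_W (k : nat) (a : nat -> C) : ex_series (fun n => Cmod (a n) / weight t n) ->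
  ex_series (fun n => Cmod (del k a n) / weight t n).
Proof.
  intros Ha. apply ex_series_dom with (2 := Ha). intros n. assert (PW := W_ge1 n).
  split; [apply Rdiv_le_0_compat; [apply Cmod_ge_0|lra]|].
  apply Rmult_le_compat_r; [left; apply Rinv_0_lt_compat; lra|apply Cmod_del_le].
Qed.

Lemma CT_del (k : nat) (a : nat -> C) (z : C) : ex_series (fun n => Cmod (a n) / weight t n) ->
  (forall n, z <> t n) -> CT t a z = (a k / (z - t k) + CT t (del k a) z)%C.
Proof.
  intros Ha Hz. unfold CT. rewrite (csum_del k).
  - f_equal. apply csum_ext. intros n. destruct (Nat.eq_dec n k) as [->|E].
    + rewrite !del_same. unfold Cdiv. ring.
    + now rewrite !del_other by auto.
  - apply CT_csmb; auto. intros n E. elim (Hz n). auto.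
Qed.

(** The pole at [t k] cancels against the zero of [A]. The right side is regular at [t k], which
    yields the differentiability of [synth] there. *)
Lemma synth_near (k : nat) (a : nat -> C) (z : C) : ex_series (fun n => Cmod (a n) / weight t n) ->
  (forall n, n <> k -> z <> t n) ->
  synth t A a z = (qn t A k z * (a k + (z - t k) * CT t (del k a) z))%C.
Proof.
  intros Ha Hz. destruct (classic (z = t k)) as [->|E].
  - rewrite synth_at, qn_at. ring.
  - assert (Hz' : forall n, z <> t n) by (intros n; destruct (Nat.eq_dec n k); [subst; auto|auto]).
    rewrite synth_off by auto. rewrite (CT_del k) by auto.
    rewrite (A_qn k). field. now apply Cminus_neq0.
Qed.

Lemma synth_hol (a : nat -> C) (z : C) : ex_series (fun n => Cmod (a n) / weight t n) ->
  hol (synth t A a) z.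
Proof.
  intros Ha. destruct (classic (exists n, z = t n)) as [[k ->]|Hz].
  - destruct (isolated k) as [r [Hr1 Hr2]].
    apply hol_ext_loc with (fun z => qn t A k z * (a k + (z - t k) * CT t (del k a) z))%C r; auto.
    + intros y Hy. symmetry. apply synth_near; auto. intros n Hn ->.
      specialize (Hr2 n Hn). rewrite Cmod_sub_sym in Hr2. lra.
    + apply hol_mult; [apply qn_hol|]. apply hol_plus; [apply hol_const|].
      apply hol_mult; [apply hol_minus; [apply hol_id|apply hol_const]|].
      apply CT_hol; [now apply del_W|]. intros n E. apply t_inj in E. subst. apply del_same.
  - assert (Hz' : forall n, z <> t n) by (intros n E; apply Hz; now exists n).
    destruct (kappa z) as [k [K1 [K2 K3]]].
    apply hol_ext_loc with (fun z => A z * CT t a z)%C (k / 2); [lra| |].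
    + intros y Hy. symmetry. apply synth_off. intros n ->.
      assert (T := kappa_near z (t n) k n K1 (K3 n (fun E => Hz' n (eq_sym E))) ltac:(lra)).
      rewrite Cmod_self in T. assert (PW := W_ge1 n). nra.
    + apply hol_mult; [apply A_hol|]. apply CT_hol; auto. intros n E. elim (Hz' n). auto.
Qed.

(** [T] is discrete and stays so with one more point [w], which will be the place of a zero that has
    been divided out. *)
Lemma eq_off_T (F G : C -> C) (w : C) : (forall z, ccont F z) -> (forall z, ccont G z) ->
  (forall z, (forall n, z <> t n) -> z <> w -> F z = G z) -> F = G.
Proof.
  intros HF HG E. apply functional_extensionality. intros z.
  destruct (kappa z) as [k [K1 [K2 K3]]].
  assert (exists r, 0 < r /\ r <= k / 2 /\ (z <> w -> r <= Cmod (z - w)%C)) as [r [R1 [R2 R3]]].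
  { destruct (classic (z = w)) as [Ez|Ez].
    - exists (k / 2). split; [lra|split; [lra|tauto]].
    - exists (Rmin (k / 2) (Cmod (z - w)%C)). assert (T := Cmod_sub_pos _ _ Ez).
      split; [apply Rmin_pos; lra|split; [apply Rmin_l|intros _; apply Rmin_r]]. }
  apply (ccont_eq_at F G z r); auto. intros y Hy1 Hy2. apply E.
  - intros n ->. destruct (classic (t n = z)) as [Ez|Ez]; [auto|].
    assert (T := kappa_near z (t n) k n K1 (K3 n Ez) ltac:(lra)).
    rewrite Cmod_self in T. assert (PW := W_ge1 n). nra.
  - intros ->. assert (T := R3 (fun Ez => Hy1 (eq_sym Ez))). rewrite Cmod_sub_sym in T. lra.
Qed.

(** Membership by residues, without square roots of [mu] and without a coefficient sequence to
    choose; [inH_iff] is the equivalence with [inH]. *)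
Definition inHr (F : C -> C) : Prop := l2mu mu (residue t A F) /\ F = synth t A (residue t A F).

Lemma res_synth (a : nat -> C) : residue t A (synth t A a) = a.
Proof.
  apply functional_extensionality. intros n. unfold residue. rewrite synth_at. field. apply alpha_neq.
Qed.

Lemma synth_inHr (a : nat -> C) : l2mu mu a -> inHr (synth t A a).
Proof. intros Ha. split; rewrite res_synth; auto. Qed.

Lemma sqrt_mu_neq (n : nat) : RtoC (sqrt (mu n)) <> 0%C.
Proof.
  intros E. apply RtoC_inj in E. assert (T := sqrt_lt_R0 _ (mu_pos n)). lra.
Qed.

Lemma Cmod_sqrt_mu (c : C) (n : nat) : Cmod (c * RtoC (sqrt (mu n)))%C ^ 2 / mu n = Cmod c ^ 2.
Proof.
  assert (P := mu_pos n). rewrite Cmod_mult, Cmod_R, Rabs_pos_eq, Rpow_mult_distr by apply sqrt_pos.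
  rewrite pow2_sqrt by lra. field. lra.
Qed.

Lemma represents_res (c : nat -> C) (F : C -> C) : represents t A mu c F ->
  inHr F /\ forall n, residue t A F n = (c n * RtoC (sqrt (mu n)))%C.
Proof.
  intros [Hc [HF HS]]. set (a := fun n => (c n * RtoC (sqrt (mu n)))%C).
  assert (Ha : l2mu mu a).
  { apply rex_ext with (2 := Hc). intros n. symmetry. apply Cmod_sqrt_mu. }
  assert (E : F = synth t A a).
  { apply (eq_off_T F (synth t A a) (t 0%nat)).
    - intros z. apply hol_cont. now apply entire_hol.
    - intros z. apply hol_cont, synth_hol. now apply l2mu_W.
    - intros z Hz _. rewrite synth_off by auto. assert (Q := cseries_eq _ _ (HS z Hz)).
      unfold CT, a. rewrite <- Q. field. now apply A_off. }
  rewrite E, res_synth. split; auto. now apply synth_inHr.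
Qed.

Lemma inHr_represents (F : C -> C) : inHr F ->
  represents t A mu (fun n => residue t A F n / RtoC (sqrt (mu n)))%C F.
Proof.
  intros [Ha E]. set (a := residue t A F) in *.
  assert (R : forall n, (a n / RtoC (sqrt (mu n)) * RtoC (sqrt (mu n)))%C = a n).
  { intros n. field. apply sqrt_mu_neq. }
  split; [|split].
  - apply rex_ext with (2 := Ha). intros n. rewrite <- (R n) at 1. apply Cmod_sqrt_mu.
  - apply entire_hol. rewrite E. intros z. apply synth_hol. now apply l2mu_W.
  - intros z Hz. rewrite E, synth_off by auto.
    replace (A z * CT t a z / A z)%C with (CT t a z) by (field; now apply A_off).
    unfold CT. rewrite (csum_ext _ (fun n => a n / RtoC (sqrt (mu n)) * RtoC (sqrt (mu n)) / (z - t n))%C)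
      by (intros n; now rewrite R).
    apply csum_cseries. apply csmb_ext with (fun n => a n / (z - t n))%C.
    + intros n. now rewrite R.
    + apply CT_csmb; [now apply l2mu_W|]. intros n En. elim (Hz n). auto.
Qed.

Lemma inH_iff (F : C -> C) : inH t A mu F <-> inHr F.
Proof.
  split.
  - intros [c Hc]. now apply represents_res in Hc.
  - intros H. eexists. now apply inHr_represents.
Qed.

Lemma inHr_hol (F : C -> C) (z : C) : inHr F -> hol F z.
Proof. intros [Ha ->]. apply synth_hol. now apply l2mu_W. Qed.

Lemma inHr_ext (F G : C -> C) : inHr F -> inHr G -> (forall n, residue t A F n = residue t A G n) -> F = G.
Proof.
  intros [_ E1] [_ E2] H. rewrite E1, E2. f_equal. now apply functional_extensionality.
Qed.

Lemma res_plus (F G : C -> C) (n : nat) :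
  residue t A (fun z => F z + G z)%C n = (residue t A F n + residue t A G n)%C.
Proof. unfold residue. field. apply alpha_neq. Qed.

Lemma res_scal (k : C) (F : C -> C) (n : nat) : residue t A (fun z => k * F z)%C n = (k * residue t A F n)%C.
Proof. unfold residue. field. apply alpha_neq. Qed.

Lemma inHr_plus (F G : C -> C) : inHr F -> inHr G -> inHr (fun z => F z + G z)%C.
Proof.
  intros [F1 F2] [G1 G2].
  set (a := residue t A F) in *. set (b := residue t A G) in *.
  assert (Hab : l2mu mu (fun n => a n + b n)%C).
  { apply ex_series_dom with (fun n => 2 * (Cmod (a n) ^ 2 / mu n) + 2 * (Cmod (b n) ^ 2 / mu n)).
    - intros n. assert (P := mu_pos n). split.
      + apply Rdiv_le_0_compat; [|auto]. apply pow2_ge_0.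
      + unfold Rdiv. rewrite <- !Rmult_assoc, <- Rmult_plus_distr_r.
        apply Rmult_le_compat_r; [left; now apply Rinv_0_lt_compat|]. apply Cmod_sq_plus.
    - apply ex_series_add; now apply ex_series_mul. }
  replace (fun z => F z + G z)%C with (synth t A (fun n => a n + b n)%C); [now apply synth_inHr|].
  apply (eq_off_T _ _ (t 0%nat)).
  - intros z. apply hol_cont, synth_hol. now apply l2mu_W.
  - intros z. rewrite F2, G2. apply hol_cont, hol_plus; apply synth_hol; now apply l2mu_W.
  - intros z Hz _. rewrite F2, G2, !synth_off by auto.
    unfold CT. rewrite (csum_ext _ (fun n => a n / (z - t n) + b n / (z - t n))%C).
    + rewrite csum_plus; [ring| |]; (apply CT_csmb; [now apply l2mu_W|]; intros n E; elim (Hz n); auto).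
    + intros n. unfold Cdiv. ring.
Qed.

Lemma inHr_scal (k : C) (F : C -> C) : inHr F -> inHr (fun z => k * F z)%C.
Proof.
  intros [F1 F2]. set (a := residue t A F) in *.
  assert (Ha : l2mu mu (fun n => k * a n)%C).
  { apply rex_ext with (fun n => Cmod k ^ 2 * (Cmod (a n) ^ 2 / mu n)).
    - intros n. rewrite Cmod_mult. unfold Rdiv. ring.
    - now apply ex_series_mul. }
  replace (fun z => k * F z)%C with (synth t A (fun n => k * a n)%C); [now apply synth_inHr|].
  apply (eq_off_T _ _ (t 0%nat)).
  - intros z. apply hol_cont, synth_hol. now apply l2mu_W.
  - intros z. rewrite F2. apply hol_cont, hol_mult; [apply hol_const|]. apply synth_hol; now apply l2mu_W.
  - intros z Hz _. rewrite F2, !synth_off by auto.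
    unfold CT. rewrite (csum_ext _ (fun n => k * (a n / (z - t n)))%C).
    + rewrite csum_scal; [ring|]. apply CT_csmb; [now apply l2mu_W|]; intros n E; elim (Hz n); auto.
    + intros n. unfold Cdiv. ring.
Qed.

Lemma inHr_minus (F G : C -> C) : inHr F -> inHr G -> inHr (fun z => F z - G z)%C.
Proof.
  intros HF HG. replace (fun z => F z - G z)%C with (fun z => F z + (-(1)) * G z)%C.
  - apply inHr_plus; auto. now apply inHr_scal.
  - apply functional_extensionality. intros z. ring.
Qed.

Lemma fin_inHr (a : nat -> C) (N : nat) : (forall n, (N <= n)%nat -> a n = 0%C) ->
  inHr (synth t A a).
Proof.
  intros H. apply synth_inHr, ex_series_fin with N. intros n Hn. rewrite H, Cmod_0 by auto.
  unfold Rdiv. ring.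
Qed.

Lemma inHr_zero : inHr (fun _ => RtoC 0).
Proof.
  replace (fun _ : C => RtoC 0) with (fun z => 0 * synth t A (fun _ => RtoC 0) z)%C.
  - apply inHr_scal. now apply fin_inHr with O.
  - apply functional_extensionality. intros z. ring.
Qed.

(* The sum of the residues of [F/(z-w)] vanishes: this is [F(w) = 0]. *)
Lemma inHr_divide (F : C -> C) (w : C) : inHr F -> F w = 0%C ->
  exists G, inHr G /\ (forall z, F z = ((z - w) * G z)%C) /\
    csmb (residue t A G) /\ csum (residue t A G) = 0%C.
Proof.
  intros HF Hw. destruct (entire_divide F w) as [G [HG EG]]; [intros; now apply inHr_hol|auto|].
  set (a := residue t A F). set (b := residue t A G).
  assert (Eab : forall n, a n = ((t n - w) * b n)%C).
  { intros n. unfold a, b, residue. rewrite EG. field. apply alpha_neq. }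
  destruct (kappa w) as [k [K1 [K2 K3]]].
  (* If [w = t j], then [a j = 0] says nothing about [b j]; a single index does not affect
     summability. *)
  assert (Hj : exists j, forall n, n <> j -> t n <> w).
  { destruct (classic (exists j, t j = w)) as [[j Hj]|Hj].
    - exists j. intros n Hn E. apply Hn, t_inj. congruence.
    - exists O. intros n _ E. apply Hj. now exists n. }
  destruct Hj as [j Hj].
  assert (BB : forall n, n <> j -> Cmod (b n) <= / k * (Cmod (a n) / weight t n)).
  { intros n Hn. specialize (Hj n Hn). assert (PW := W_ge1 n). specialize (K3 n Hj).
    replace (b n) with (a n / (t n - w))%C by (rewrite Eab; field; now apply Cminus_neq0).
    rewrite Cmod_div by now apply Cminus_neq0.
    rewrite Cmod_sub_sym in K3. unfold Rdiv.
    replace (/ k * (Cmod (a n) * / weight t n)) with (Cmod (a n) * / (k * weight t n)) by (field; lra).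
    apply Rmult_le_compat_l; [apply Cmod_ge_0|]. apply Rinv_le_contravar; nra. }
  assert (SW : ex_series (fun n => Cmod (a n) / weight t n)) by apply l2mu_W, HF.
  assert (Sb : csmb b).
  { apply ex_series_dom_ev with (N := S j) (v := fun n => / k * (Cmod (a n) / weight t n)).
    - intros n Hn. split; [apply Cmod_ge_0|apply BB; lia].
    - now apply ex_series_mul. }
  assert (Hb : l2mu mu b).
  { apply ex_series_dom_ev with (N := S j) (v := fun n => / k ^ 2 * (Cmod (a n) ^ 2 / mu n)).
    - intros n Hn. assert (P := mu_pos n). assert (PW := W_ge1 n). split.
      + apply Rdiv_le_0_compat; [apply pow2_ge_0|auto].
      + unfold Rdiv. rewrite <- Rmult_assoc. apply Rmult_le_compat_r; [left; now apply Rinv_0_lt_compat|].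
        replace (/ k ^ 2 * Cmod (a n) ^ 2) with ((/ k * Cmod (a n)) ^ 2) by (field; lra).
        apply pow_incr. split; [apply Cmod_ge_0|]. eapply Rle_trans; [apply BB; lia|].
        apply Rmult_le_compat_l; [left; now apply Rinv_0_lt_compat|].
        unfold Rdiv. rewrite <- (Rmult_1_r (Cmod (a n))) at 2.
        apply Rmult_le_compat_l; [apply Cmod_ge_0|]. rewrite <- Rinv_1. apply Rinv_le_contravar; lra.
    - apply ex_series_mul, HF. }
  assert (SWb : ex_series (fun n => Cmod (b n) / weight t n)) by now apply l2mu_W.
  (* Since [a n = (t n - w) * b n], one has [a n / (z - t n) = - b n + (z - w) * b n / (z - t
     n)]. *)
  assert (FE : forall z, (forall n, z <> t n) -> F z = (A z * (- csum b + (z - w) * CT t b z))%C).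
  { intros z Hz. replace (F z) with (synth t A a z) by (unfold a; now rewrite <- (proj2 HF)).
    rewrite synth_off by auto. f_equal. unfold CT.
    assert (CB : csmb (fun n => b n / (z - t n))%C)
      by (apply CT_csmb; auto; intros n E; elim (Hz n); auto).
    rewrite <- csum_scal by auto.
    replace (- csum b)%C with ((-(1)) * csum b)%C by ring.
    rewrite <- csum_scal by auto. rewrite <- csum_plus by now apply csmb_scal.
    apply csum_ext. intros n. rewrite Eab. field. apply Cminus_neq0, Hz. }
  (* For [w] off [T], evaluate the formula at [w]. For [w = t i], divide it by [z - w] and let [z]
     tend to [w]: the limit is [alpha * (- csum b + b i)], whereas [G (t i) = alpha * b i]. *)
  assert (S0 : csum b = 0%C).
  { destruct (classic (exists j, w = t j)) as [[i ->]|Hw'].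
    - destruct (isolated i) as [r [R1 R2]].
      set (H := fun z => (qn t A i z * (- csum b + b i + (z - t i) * CT t (del i b) z))%C).
      assert (HE : G (t i) = H (t i)).
      { apply (ccont_eq_at G H (t i) r); auto.
        - apply hol_cont, HG.
        - apply hol_cont, hol_mult; [apply qn_hol|]. apply hol_plus; [apply hol_const|].
          apply hol_mult; [apply hol_minus; [apply hol_id|apply hol_const]|].
          apply CT_hol; [now apply del_W|]. intros n E. apply t_inj in E. subst. apply del_same.
        - intros y Hy1 Hy2.
          assert (Hy : forall n, y <> t n).
          { intros n ->. destruct (Nat.eq_dec n i) as [->|E]; [now apply Hy1|].
            specialize (R2 n E). rewrite Cmod_sub_sym in R2. lra. }
          assert (N := Cminus_neq0 _ _ Hy1).
          assert (Q := FE y Hy). rewrite EG, (A_qn i), (CT_del i) in Q by auto.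
          unfold H. transitivity ((y - t i) * G y / (y - t i))%C; [field; auto|].
          rewrite Q. field. auto. }
      unfold H in HE. rewrite qn_at in HE. 
      replace (G (t i)) with (alpha t A i * b i)%C in HE by (unfold b, residue; field; apply alpha_neq).
      assert (P : (alpha t A i * csum b)%C = 0%C).
      { transitivity (alpha t A i * b i - alpha t A i * (- csum b + b i + (t i - t i) * CT t (del i b) (t i)))%C.
        - ring.
        - rewrite <- HE. ring. }
      apply Cmult_integral in P. destruct P as [P|P]; [|auto]. now apply alpha_neq in P.
    - assert (Hw'' : forall n, w <> t n) by (intros n E; apply Hw'; now exists n).
      assert (Q := FE w Hw''). rewrite Hw in Q.
      assert (P : (A w * csum b)%C = 0%C).
      { transitivity (- (A w * (- csum b + (w - w) * CT t b w)))%C; [ring|]. rewrite <- Q. ring. }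
      apply Cmult_integral in P. destruct P as [P|P]; [|auto]. now apply A_off in P. }
  exists G. split; [|split; auto]. split; [auto|]. fold b.
  apply (eq_off_T _ _ w).
  - intros z. apply hol_cont, HG.
  - intros z. apply hol_cont. now apply synth_hol.
  - intros z Hz1 Hz2. rewrite synth_off by auto. assert (N := Cminus_neq0 _ _ Hz2).
    assert (Q := FE z Hz1). rewrite EG, S0 in Q.
    transitivity ((z - w) * G z / (z - w))%C; [field; auto|]. rewrite Q. field. auto.
Qed.

End Space.

(** * Consequences of power separation *)

Lemma W_pow_pos (t : nat -> C) (n p : nat) : 1 <= weight t n ^ p.
Proof. apply pow_R1_Rle. unfold weight. generalize (Cmod_ge_0 (t n)). lra. Qed.

(** The real exponent is rounded up to a natural number, which weakens the bound only, as the weight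
    is at least [1]. *)
Lemma power_separated_nat (t : nat -> C) : power_separated t ->
  exists (c : R) (p : nat), 0 < c /\ c <= 1 /\
    forall n m, n <> m -> c / weight t n ^ p <= Cmod (t n - t m)%C.
Proof.
  intros [c [N [Hc [_ H]]]].
  destruct (nfloor_ex (Rabs N) (Rabs_pos N)) as [p0 [_ Hp]].
  exists (Rmin c 1), (S p0). split; [apply Rmin_pos; lra|]. split; [apply Rmin_r|].
  intros n m Hnm. eapply Rle_trans; [|apply (H n m Hnm)].
  assert (P := W_pow_pos t n (S p0)).
  unfold Rdiv. apply Rmult_le_compat.
  - apply Rlt_le, Rmin_pos; lra.
  - left. apply Rinv_0_lt_compat. lra.
  - apply Rmin_l.
  - replace (Cmod (t n) + 1) with (weight t n) by (unfold weight; ring).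
    assert (PW : 1 <= weight t n) by (unfold weight; generalize (Cmod_ge_0 (t n)); lra).
    rewrite <- Rpower_pow, <- Rpower_Ropp by lra. apply Rle_Rpower; auto.
    rewrite S_INR. generalize (Rle_abs N). lra.
Qed.

Fixpoint lsum {T : Type} (f : T -> R) (l : list T) : R :=
  match l with [] => 0 | x :: l => f x + lsum f l end.

Lemma lsum_app {T : Type} (f : T -> R) (l l' : list T) : lsum f (l ++ l') = lsum f l + lsum f l'.
Proof. induction l as [|x l IH]; simpl; [ring|]. rewrite IH. ring. Qed.

Lemma lsum_incl {T : Type} (f : T -> R) (l : list T) : (forall x, 0 <= f x) -> NoDup l ->
  forall l', incl l l' -> lsum f l <= lsum f l'.
Proof.
  intros Hf. assert (P : forall l, 0 <= lsum f l).
  { induction l0 as [|x l0 IH]; simpl; [lra|]. specialize (Hf x). lra. }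
  induction 1 as [|x l Hx Hl IH]; intros l' Hi; [apply P|].
  destruct (in_split x l') as [l1 [l2 ->]]; [apply Hi; now left|].
  rewrite lsum_app. simpl.
  assert (lsum f l <= lsum f (l1 ++ l2)).
  { apply IH. intros y Hy. assert (T1 := Hi y (or_intror Hy)).
    apply in_app_or in T1. apply in_or_app. destruct T1 as [T1|[->|T1]]; auto. contradiction. }
  rewrite lsum_app in H. lra.
Qed.

Lemma lsum_map {T U : Type} (f : U -> R) (g : T -> U) (l : list T) :
  lsum f (map g l) = lsum (fun x => f (g x)) l.
Proof. induction l as [|x l IH]; simpl; [auto|]. now rewrite IH. Qed.

Lemma lsum_scal {T : Type} (k : R) (f : T -> R) (l : list T) : lsum (fun x => k * f x) l = k * lsum f l.
Proof. induction l as [|x l IH]; simpl; [ring|]. rewrite IH. ring. Qed.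

Lemma lsum_list_prod {T U : Type} (f : T -> R) (g : U -> R) (l : list T) (l' : list U) :
  lsum (fun x => f (fst x) * g (snd x)) (list_prod l l') = lsum f l * lsum g l'.
Proof.
  induction l as [|x l IH]; simpl; [ring|].
  rewrite lsum_app, lsum_map, IH. simpl. rewrite lsum_scal. ring.
Qed.

Lemma lsum_inv_sq (M : nat) : lsum (fun i => / (INR i + 1) ^ 2) (seq 0 M) <= 2.
Proof.
  assert (H : forall M, lsum (fun i => / (INR i + 1) ^ 2) (seq 0 (S M)) <= 2 - / (INR M + 1)).
  { clear. induction M as [|M IH].
    - simpl. rewrite !Rplus_0_l, Rmult_1_r, Rmult_1_r, Rinv_1. lra.
    - rewrite seq_S, lsum_app. replace (lsum _ [(0 + S M)%nat]) with (/ (INR (S M) + 1) ^ 2)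
      by (unfold lsum; rewrite Nat.add_0_l; ring).
    rewrite S_INR.
      assert (P := pos_INR M).
      assert (/ (INR M + 1 + 1) ^ 2 <= / (INR M + 1) - / (INR M + 1 + 1)); [|lra].
      replace (/ (INR M + 1) - / (INR M + 1 + 1)) with (/ ((INR M + 1) * (INR M + 1 + 1))) by (field; lra).
      apply Rinv_le_contravar; nra. }
  destruct M as [|M]; [simpl; lra|]. eapply Rle_trans; [apply H|].
  assert (P := pos_INR M). assert (0 < / (INR M + 1)) by (apply Rinv_0_lt_compat; lra). lra.
Qed.

Lemma rsum_lsum (u : nat -> R) (N : nat) : rsum u N = lsum u (seq 0 N).
Proof.
  induction N as [|N IH]; [auto|]. rewrite seq_S, lsum_app, <- IH. simpl. ring.
Qed.

Definition nfl (x : R) : nat :=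
  match Rle_dec 0 x with left H => proj1_sig (nfloor_ex x H) | right _ => O end.

Lemma nfl_spec (x : R) : 0 <= x -> INR (nfl x) <= x < INR (nfl x) + 1.
Proof.
  intros H. unfold nfl. destruct (Rle_dec 0 x) as [H'|H']; [|contradiction].
  exact (proj2_sig (nfloor_ex x H')).
Qed.

(* Separated points: sending [t n] to its level [k = ceil W] and to its cell in a grid of mesh
   [c / (2 k^p)] is injective. *)
Lemma sum_inv_W (t : nat -> C) : power_separated t ->
  exists L, ex_series (fun n => / weight t n ^ L).
Proof.
  intros Hs. destruct (power_separated_nat t Hs) as [c [p [Hc [Hc1 Hsep]]]].
  set (lv := fun n => S (nfl (weight t n))).
  assert (WP : forall n, 1 <= weight t n) by (intros n; unfold weight; generalize (Cmod_ge_0 (t n)); lra).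
  assert (LV : forall n, weight t n <= INR (lv n) /\ INR (lv n) <= 2 * weight t n).
  { intros n. unfold lv. rewrite S_INR. specialize (WP n).
    destruct (nfl_spec (weight t n)); lra. }
  set (s := fun n => 2 * INR (lv n) ^ p / c).
  assert (SP : forall n, 0 < s n).
  { intros n. apply Rdiv_lt_0_compat; [|auto].
    assert (0 < INR (lv n) ^ p); [|lra]. apply pow_lt. destruct (LV n). specialize (WP n). lra. }
  set (ix := fun n => nfl ((fst (t n) + INR (lv n)) * s n)).
  set (iy := fun n => nfl ((snd (t n) + INR (lv n)) * s n)).
  assert (CO : forall n, Rabs (fst (t n)) <= weight t n /\ Rabs (snd (t n)) <= weight t n).
  { intros n. assert (A1 := fst_le_Cmod (t n)). assert (A2 := snd_le_Cmod (t n)). unfold weight. lra. }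
  assert (FX : forall n x, Rabs x <= weight t n -> 0 <= (x + INR (lv n)) * s n <= 2 * INR (lv n) * s n).
  { intros n x Hx. destruct (LV n) as [L1 L2]. specialize (SP n). apply Rabs_le_between in Hx. split.
    - apply Rmult_le_pos; lra.
    - apply Rmult_le_compat_r; lra. }
  (* Two points in the same cell of the same level would be closer than [2 / s n = c / lv n ^ p],
     which is below the separation because the weight is at most [lv n]. *)
  assert (INJ : forall n m, lv n = lv m -> ix n = ix m -> iy n = iy m -> n = m).
  { intros n m E1 E2 E3. apply NNPP. intros Hnm.
    assert (Es : s n = s m) by (unfold s; now rewrite E1).
    destruct (nfl_spec _ (proj1 (FX n _ (proj1 (CO n))))) as [X1 X2].
    destruct (nfl_spec _ (proj1 (FX m _ (proj1 (CO m))))) as [X3 X4].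
    destruct (nfl_spec _ (proj1 (FX n _ (proj2 (CO n))))) as [Y1 Y2].
    destruct (nfl_spec _ (proj1 (FX m _ (proj2 (CO m))))) as [Y3 Y4].
    fold (ix n) in X1, X2. fold (ix m) in X3, X4. fold (iy n) in Y1, Y2. fold (iy m) in Y3, Y4.
    rewrite <- E2, <- Es, <- E1 in X3, X4. rewrite <- E3, <- Es, <- E1 in Y3, Y4.
    assert (P := SP n).
    assert (DX : Rabs (fst (t n) - fst (t m)) < / s n).
    { apply Rmult_lt_reg_r with (s n); [auto|]. rewrite Rinv_l by lra.
      rewrite <- (Rabs_pos_eq (s n)) by lra. rewrite <- Rabs_mult. apply Rabs_lt_between. lra. }
    assert (DY : Rabs (snd (t n) - snd (t m)) < / s n).
    { apply Rmult_lt_reg_r with (s n); [auto|]. rewrite Rinv_l by lra.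
      rewrite <- (Rabs_pos_eq (s n)) by lra. rewrite <- Rabs_mult. apply Rabs_lt_between. lra. }
    assert (D : Cmod (t n - t m)%C < 2 * / s n).
    { eapply Rle_lt_trans; [apply Cmod_le_sum|]. simpl. unfold Rminus in *. lra. }
    specialize (Hsep n m Hnm).
    assert (Q : 2 * / s n <= c / weight t n ^ p); [|lra].
    assert (P1 := W_pow_pos t n p). destruct (LV n) as [L1 L2]. specialize (WP n).
    assert (P2 : weight t n ^ p <= INR (lv n) ^ p) by (apply pow_incr; lra).
    replace (2 * / s n) with (c / INR (lv n) ^ p) by (unfold s; field; lra).
    apply Rmult_le_compat_l; [lra|]. apply Rinv_le_contravar; lra. }
  set (f := fun i : nat => / (INR i + 1) ^ 2).
  assert (F0 : forall i, 0 <= f i).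
  { intros i. left. apply Rinv_0_lt_compat, pow_lt. generalize (pos_INR i). lra. }
  (* Both grid coordinates are of order at most [W ^ (p + 1)] and the level is of order [W]; the
     product of the three squares has exponent [4 (p + 1) + 2]. Each of the three sums of inverse
     squares is at most [2]. *)
  set (K := (5 / c * 2 ^ (S p)) ^ 4 * 9).
  exists (4 * S p + 2)%nat.
  apply ex_series_pos with (K * (2 * (2 * 2))).
  { intros n. left. apply Rinv_0_lt_compat. assert (P := W_pow_pos t n (4 * S p + 2)). lra. }
  assert (TB : forall n, / weight t n ^ (4 * S p + 2) <= K * (f (lv n) * (f (ix n) * f (iy n)))).
  { intros n. destruct (LV n) as [L1 L2]. assert (P := WP n).
    assert (IB : forall x, Rabs x <= weight t n ->
       INR (nfl ((x + INR (lv n)) * s n)) + 1 <= 5 / c * 2 ^ S p * weight t n ^ S p).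
    { intros x Hx. destruct (FX n x Hx) as [G1 G2]. destruct (nfl_spec _ G1) as [G3 _].
      assert (Q1 : INR (lv n) ^ S p <= 2 ^ S p * weight t n ^ S p).
      { rewrite <- Rpow_mult_distr. apply pow_incr. lra. }
      assert (Q2 : 2 * INR (lv n) * s n = 4 / c * INR (lv n) ^ S p) by (unfold s; simpl; field; lra).
      assert (Q3 : 1 <= 1 / c * (2 ^ S p * weight t n ^ S p)).
      { assert (1 <= 2 ^ S p) by (apply pow_R1_Rle; lra). assert (Q := W_pow_pos t n (S p)).
        assert (1 <= 1 / c). { unfold Rdiv. rewrite Rmult_1_l, <- Rinv_1. apply Rinv_le_contravar; lra. }
        rewrite <- (Rmult_1_r 1) at 1. apply Rmult_le_compat; try lra.
        rewrite <- (Rmult_1_r 1) at 1. apply Rmult_le_compat; lra. }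
      apply Rle_trans with (4 / c * (2 ^ S p * weight t n ^ S p) + 1 / c * (2 ^ S p * weight t n ^ S p)).
      - apply Rplus_le_compat; [|auto]. eapply Rle_trans; [apply G3|]. eapply Rle_trans; [apply G2|].
        rewrite Q2. apply Rmult_le_compat_l; [|auto]. apply Rlt_le, Rdiv_lt_0_compat; lra.
      - right. field. lra. }
    assert (I1 := IB _ (proj1 (CO n))). assert (I2 := IB _ (proj2 (CO n))).
    fold (ix n) in I1. fold (iy n) in I2.
    assert (I3 : INR (lv n) + 1 <= 3 * weight t n) by lra.
    set (B := 5 / c * 2 ^ S p * weight t n ^ S p) in *.
    assert (N1 := pos_INR (ix n)). assert (N2 := pos_INR (iy n)). assert (N3 := pos_INR (lv n)).
    assert (R1 : (INR (ix n) + 1) ^ 2 <= B ^ 2) by (apply pow_incr; lra).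
    assert (R2 : (INR (iy n) + 1) ^ 2 <= B ^ 2) by (apply pow_incr; lra).
    assert (R3 : (INR (lv n) + 1) ^ 2 <= (3 * weight t n) ^ 2) by (apply pow_incr; lra).
    assert (T1 : 0 < (INR (ix n) + 1) ^ 2) by (apply pow_lt; lra).
    assert (T2 : 0 < (INR (iy n) + 1) ^ 2) by (apply pow_lt; lra).
    assert (T3 : 0 < (INR (lv n) + 1) ^ 2) by (apply pow_lt; lra).
    assert (TW : 0 < weight t n ^ (4 * S p + 2)) by (apply pow_lt; lra).
    assert (MM : (INR (lv n) + 1) ^ 2 * ((INR (ix n) + 1) ^ 2 * (INR (iy n) + 1) ^ 2)
       <= K * weight t n ^ (4 * S p + 2)).
    { apply Rle_trans with ((3 * weight t n) ^ 2 * (B ^ 2 * B ^ 2)).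
      - apply Rmult_le_compat; [lra| |exact R3|].
        + apply Rmult_le_pos; lra.
        + apply Rmult_le_compat; lra.
      - right. unfold K, B. rewrite pow_add, (Nat.mul_comm 4), pow_mult.
        set (X := weight t n ^ S p). set (Y := 2 ^ S p). ring. }
    unfold f. rewrite <- !Rinv_mult.
    apply Rmult_le_reg_r with (weight t n ^ (4 * S p + 2)); [auto|]. rewrite Rinv_l by lra.
    apply Rmult_le_reg_r with ((INR (lv n) + 1) ^ 2 * ((INR (ix n) + 1) ^ 2 * (INR (iy n) + 1) ^ 2)).
    { apply Rmult_lt_0_compat; [exact T3|apply Rmult_lt_0_compat; [exact T1|exact T2]]. }
    rewrite Rmult_1_l.
    eapply Rle_trans; [apply MM|]. right. field. repeat split; lra. }
  intros N. eapply Rle_trans; [apply rsum_le; intros n _; apply TB|].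
  rewrite rsum_scal. apply Rmult_le_compat_l.
  { unfold K. apply Rmult_le_pos; [|lra]. apply pow_le.
    apply Rmult_le_pos; [apply Rlt_le, Rdiv_lt_0_compat; lra|apply pow_le; lra]. }
  rewrite rsum_lsum.
  set (g := fun x : nat * (nat * nat) => f (fst x) * (f (fst (snd x)) * f (snd (snd x)))).
  set (h := fun n => (lv n, (ix n, iy n))).
  change (lsum (fun n => g (h n)) (seq 0 N) <= 2 * (2 * 2)).
  rewrite <- lsum_map.
  set (M := S (list_max (map lv (seq 0 N) ++ map ix (seq 0 N) ++ map iy (seq 0 N)))).
  assert (LM := list_max_le (map lv (seq 0 N) ++ map ix (seq 0 N) ++ map iy (seq 0 N)) (pred M)).
  assert (LM' := proj1 LM (le_n _)). clear LM. rewrite Forall_forall in LM'.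
  apply Rle_trans with (lsum g (list_prod (seq 0 M) (list_prod (seq 0 M) (seq 0 M)))).
  - apply lsum_incl.
    + intros x. unfold g. repeat apply Rmult_le_pos; apply F0.
    + apply NoDup_map_NoDup_ForallPairs; [|apply seq_NoDup].
      intros n m _ _ E. unfold h in E.
      apply INJ; [exact (f_equal fst E)|exact (f_equal (fun x => fst (snd x)) E)
        |exact (f_equal (fun x => snd (snd x)) E)].
    + intros x Hx. apply in_map_iff in Hx. destruct Hx as [n [<- Hn]].
      assert (Q : forall k : nat -> nat, In (k n) (map lv (seq 0 N) ++ map ix (seq 0 N) ++ map iy (seq 0 N))
         -> In (k n) (seq 0 M)).
      { intros k Hk. apply in_seq. specialize (LM' _ Hk). unfold M in *. simpl in *. lia. }
      unfold h. apply in_prod; [|apply in_prod]; apply Q; rewrite !in_app_iff.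
      * left. now apply in_map.
      * right. left. now apply in_map.
      * right. right. now apply in_map.
  - unfold g.
    rewrite (lsum_list_prod f (fun y => f (fst y) * f (snd y))).
    rewrite (lsum_list_prod f f).
    assert (B := lsum_inv_sq M). fold f in B.
    assert (B0 : 0 <= lsum f (seq 0 M)).
    { clear - F0. induction (seq 0 M) as [|x l IH]; simpl; [lra|]. specialize (F0 x). lra. }
    apply Rmult_le_compat; auto; [now apply Rmult_le_pos|]. apply Rmult_le_compat; auto.
Qed.

(** * Closed subspaces and moments *)

Existing Class closed_subspace.
Existing Class nearly_invariant.

Definition N2 (t : nat -> C) (A : C -> C) (mu : nat -> R) (F : C -> C) : R :=
  Series (fun n => Cmod (residue t A F n) ^ 2 / mu n).

Definition convH t A mu (Fk : nat -> C -> C) (F : C -> C) : Prop :=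
  forall e, 0 < e -> exists K, forall k, (K <= k)%nat -> N2 t A mu (fun z => Fk k z - F z)%C <= e.

Definition gL2 (t : nat -> C) (mu : nat -> R) (g : C -> C) : Prop :=
  ex_series (fun n => mu n * Cmod (g (t n)) ^ 2).

(** The bilinear pairing between residue sequences, square summable against [1 / mu], and functions
    in [L^2(mu)]. *)
Definition mom (t : nat -> C) (A : C -> C) (g F : C -> C) : C :=
  csum (fun n => residue t A F n * g (t n))%C.

Fixpoint nu (x : nat -> C) (k : nat) (z : C) : C :=
  match k with O => RtoC 1 | S k => (nu x k z * (z - x k))%C end.

Lemma nu_zero (x : nat -> C) (k i : nat) : (i < k)%nat -> nu x k (x i) = 0%C.
Proof.
  induction k as [|k IH]; intros H; [lia|]. simpl.
  destruct (Nat.eq_dec i k) as [->|E]; [ring|]. rewrite IH by lia. ring.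
Qed.

Lemma nu_neq (x : nat -> C) (k : nat) (z : C) : (forall i, (i < k)%nat -> z <> x i) -> nu x k z <> 0%C.
Proof.
  induction k as [|k IH]; intros H; simpl.
  - intros E. apply RtoC_inj in E. lra.
  - intros E. apply Cmult_integral in E. destruct E as [E|E].
    + apply IH in E; auto.
    + apply Cminus_eq0 in E. apply (H k); auto.
Qed.

Lemma nu_hol (x : nat -> C) (k : nat) (z : C) : hol (nu x k) z.
Proof.
  induction k as [|k IH]; [apply (hol_const 1%C)|].
  apply (hol_mult (nu x k) (fun z => z - x k)%C); auto.
  apply hol_minus; [apply hol_id|apply hol_const].
Qed.

Section Moments.
Context {t : nat -> C} {A : C -> C} {mu : nat -> R}.
Context {Hdata : admissible_data t mu} {HA : generating_function t A}.

Notation inHr := (@inHr t A mu).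

Lemma N2_pos (F : C -> C) : inHr F -> 0 <= N2 t A mu F.
Proof.
  intros HF. apply Series_pos; [|apply HF]. intros n.
  apply Rdiv_le_0_compat; [apply pow2_ge_0|apply mu_pos].
Qed.

Lemma N2_plus (F G : C -> C) : inHr F -> inHr G ->
  N2 t A mu (fun z => F z + G z)%C <= 2 * N2 t A mu F + 2 * N2 t A mu G.
Proof.
  intros HF HG. unfold N2. rewrite <- !Series_scal_l, <- Series_plus
    by (apply ex_series_mul; first [apply HF|apply HG]).
  apply Series_le.
  - intros n. assert (P := mu_pos n). split; [apply Rdiv_le_0_compat; [apply pow2_ge_0|auto]|].
    rewrite res_plus. unfold Rdiv. rewrite <- !Rmult_assoc, <- Rmult_plus_distr_r.
    apply Rmult_le_compat_r; [left; now apply Rinv_0_lt_compat|]. apply Cmod_sq_plus.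
  - apply ex_series_add; apply ex_series_mul; [apply HF|apply HG].
Qed.

Lemma N2_scal (k : C) (F : C -> C) : N2 t A mu (fun z => k * F z)%C = Cmod k ^ 2 * N2 t A mu F.
Proof.
  unfold N2. rewrite <- Series_scal_l. apply Series_ext. intros n.
  rewrite res_scal, Cmod_mult, Rpow_mult_distr. unfold Rdiv. ring.
Qed.

Lemma fun_ext_C (F G : C -> C) : (forall z, F z = G z) -> F = G.
Proof. apply functional_extensionality. Qed.

Lemma N2_ext (F G : C -> C) : (forall z, F z = G z) -> N2 t A mu F = N2 t A mu G.
Proof. intros H. now rewrite (fun_ext_C F G H). Qed.

Lemma res_ext (F G : C -> C) (n : nat) : (forall z, F z = G z) -> residue t A F n = residue t A G n.
Proof. intros H. now rewrite (fun_ext_C F G H). Qed.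

Lemma mom_ext (g F G : C -> C) : (forall z, F z = G z) -> mom t A g F = mom t A g G.
Proof. intros H. now rewrite (fun_ext_C F G H). Qed.

Lemma res_minus (F G : C -> C) (n : nat) :
  residue t A (fun z => F z - G z)%C n = (residue t A F n - residue t A G n)%C.
Proof. unfold residue. field. apply alpha_neq. Qed.

Lemma convH_plus (Fk Gk : nat -> C -> C) (F G : C -> C) :
  (forall k, inHr (Fk k)) -> (forall k, inHr (Gk k)) -> inHr F -> inHr G ->
  convH t A mu Fk F -> convH t A mu Gk G ->
  convH t A mu (fun k z => Fk k z + Gk k z)%C (fun z => F z + G z)%C.
Proof.
  intros H1 H2 H3 H4 CF CG e He.
  destruct (CF (e / 4)) as [K1 HK1]; [lra|]. destruct (CG (e / 4)) as [K2 HK2]; [lra|].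
  exists (max K1 K2). intros k Hk.
  specialize (HK1 k ltac:(lia)). specialize (HK2 k ltac:(lia)).
  rewrite (N2_ext _ (fun z => (Fk k z - F z) + (Gk k z - G z))%C) by (intros; ring).
  eapply Rle_trans; [apply N2_plus; now apply inHr_minus|]. lra.
Qed.

Lemma convH_scal (ak : nat -> C) (a : C) (F : C -> C) : inHr F ->
  (forall e, 0 < e -> exists K, forall k, (K <= k)%nat -> Cmod (ak k - a)%C <= e) ->
  convH t A mu (fun k z => ak k * F z)%C (fun z => a * F z)%C.
Proof.
  intros HF Ha e He. assert (P := N2_pos F HF).
  destruct (Ha (Rmin 1 (e / (N2 t A mu F + 1)))) as [K HK].
  { apply Rmin_pos; [lra|]. apply Rdiv_lt_0_compat; lra. }
  exists K. intros k Hk. specialize (HK k Hk).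
  rewrite (N2_ext _ (fun z => (ak k - a) * F z)%C) by (intros; ring).
  rewrite N2_scal. assert (M0 := Cmod_ge_0 (ak k - a)%C).
  assert (M1 : Cmod (ak k - a)%C <= 1) by (eapply Rle_trans; [apply HK|apply Rmin_l]).
  assert (M2 : Cmod (ak k - a)%C <= e / (N2 t A mu F + 1)) by (eapply Rle_trans; [apply HK|apply Rmin_r]).
  apply Rle_trans with (e / (N2 t A mu F + 1) * (N2 t A mu F + 1)).
  - apply Rmult_le_compat; try lra; [apply pow2_ge_0|]. nra.
  - right. field. lra.
Qed.

(** The coefficients are the residues divided by [sqrt (mu n)], so the [l^2] distance in the
    definition of closedness is [N2] of the difference. *)
Lemma closed_subspace_intro (S : (C -> C) -> Prop) :
  (forall F, S F -> inHr F) -> S (fun _ => RtoC 0) ->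
  (forall F G, S F -> S G -> S (fun z => F z + G z)%C) ->
  (forall a F, S F -> S (fun z => a * F z)%C) ->
  (forall Fk F, (forall k, S (Fk k)) -> inHr F -> convH t A mu Fk F -> S F) ->
  closed_subspace t A mu S.
Proof.
  intros H1 H2 H3 H4 H5. split; [|split; [|split; [|split]]]; auto.
  - intros F HF. apply inH_iff. auto.
  - intros ck Fk c F Hk HS HF HL. apply (H5 Fk); auto.
    + now apply represents_res in HF.
    + intros e He. apply is_lim_seq_spec in HL. destruct (HL (mkposreal e He)) as [K HK].
      exists K. intros k Hk'. specialize (HK k Hk'). simpl in HK. rewrite Rminus_0_r in HK.
      left. eapply Rle_lt_trans; [|apply HK]. eapply Rle_trans; [|apply Rle_abs]. right.
      unfold N2. apply Series_ext. intros n.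
      destruct (represents_res _ _ HF) as [_ R1]. destruct (represents_res _ _ (Hk k)) as [_ R2].
      rewrite res_minus, R1, R2.
      transitivity (Cmod ((ck k n - c n) * RtoC (sqrt (mu n)))%C ^ 2 / mu n); [|apply Cmod_sqrt_mu].
      do 3 f_equal. ring.
Qed.

Section Subspace.
Context {S : (C -> C) -> Prop} {HS : closed_subspace t A mu S}.

Lemma sub_inHr (F : C -> C) : S F -> inHr F.
Proof. intros H. apply inH_iff. now apply HS. Qed.

Lemma sub_zero : S (fun _ => RtoC 0).
Proof. apply HS. Qed.

Lemma sub_plus (F G : C -> C) : S F -> S G -> S (fun z => F z + G z)%C.
Proof. apply HS. Qed.

Lemma sub_scal (a : C) (F : C -> C) : S F -> S (fun z => a * F z)%C.
Proof. apply HS. Qed.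

Lemma sub_psum (F : nat -> C -> C) (N : nat) : (forall n, (n < N)%nat -> S (F n)) ->
  S (fun z => psum (fun n => F n z) N).
Proof.
  induction N as [|N IH]; intros H; simpl; [apply sub_zero|].
  apply (sub_plus (fun z => psum (fun n => F n z) N) (F N)); auto.
Qed.

Lemma sub_closed (Fk : nat -> C -> C) (F : C -> C) : (forall k, S (Fk k)) -> inHr F ->
  convH t A mu Fk F -> S F.
Proof.
  intros Hk HF HC. destruct HS as [_ [_ [_ [_ Hcl]]]].
  eapply (Hcl (fun k n => residue t A (Fk k) n / RtoC (sqrt (mu n)))%C Fk
    (fun n => residue t A F n / RtoC (sqrt (mu n)))%C F).
  - intros k. apply inHr_represents. now apply sub_inHr.
  - exact Hk.
  - now apply inHr_represents.
  - apply is_lim_seq_spec. intros e. destruct (HC (e / 2)) as [K HK].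
    { generalize (cond_pos e). lra. }
    exists K. intros k Hk'. specialize (HK k Hk').
    replace (Series _) with (N2 t A mu (fun z => Fk k z - F z)%C).
    + rewrite Rminus_0_r, Rabs_pos_eq.
      * generalize (cond_pos e). lra.
      * apply N2_pos, inHr_minus; auto. now apply sub_inHr.
    + unfold N2. apply Series_ext. intros n.
      rewrite res_minus.
      etransitivity; [|apply (Cmod_sqrt_mu _ n)]. do 3 f_equal. field. apply sqrt_mu_neq.
Qed.

End Subspace.

Lemma ni_closed (S : (C -> C) -> Prop) : nearly_invariant t A mu S -> closed_subspace t A mu S.
Proof. now intros [H _]. Qed.

Lemma ni_divide (S : (C -> C) -> Prop) (F : C -> C) (w : C) : nearly_invariant t A mu S ->
  S F -> F w = 0%C -> exists G, S G /\ forall z, F z = ((z - w) * G z)%C.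
Proof.
  intros [_ H] HF Hw. destruct (H F w HF Hw) as [G [HG E]]. exists G. split; auto.
  intros z. destruct (classic (z = w)) as [->|Hz]; [rewrite Hw; ring|].
  rewrite (E z Hz). field. now apply Cminus_neq0.
Qed.

(** [(z - u) / (z - w) = 1 + (w - u) / (z - w)]: division by a zero and linearity allow a zero to be
    moved anywhere. *)
Lemma ni_move (S : (C -> C) -> Prop) (F : C -> C) (w u : C) : nearly_invariant t A mu S ->
  S F -> F w = 0%C -> exists G, S G /\ forall z, ((z - w) * G z = (z - u) * F z)%C.
Proof.
  intros HS HF Hw. destruct (ni_divide S F w HS HF Hw) as [G [HG E]].
  assert (HC := ni_closed S HS).
  exists (fun z => F z + (w - u) * G z)%C. split.
  - apply (sub_plus (S := S)); auto. now apply (sub_scal (S := S)).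
  - intros z. rewrite E. ring.
Qed.

Lemma fin_ni (F : C -> C) (w : C) : inHr F -> F w = 0%C ->
  exists G, inHr G /\ forall z, F z = ((z - w) * G z)%C.
Proof.
  intros HF Hw. destruct (inHr_divide F w HF Hw) as [G [H1 [H2 _]]]. now exists G.
Qed.

Lemma res_divide (F G : C -> C) (w : C) : (forall z, F z = ((z - w) * G z)%C) ->
  forall n, residue t A F n = ((t n - w) * residue t A G n)%C.
Proof. intros E n. unfold residue. rewrite E. field. apply alpha_neq. Qed.

Lemma mom_csmb (g F : C -> C) : gL2 t mu g -> inHr F -> csmb (fun n => residue t A F n * g (t n))%C.
Proof.
  intros Hg HF.
  apply csmb_dom with (fun n => Cmod (residue t A F n) ^ 2 / mu n + mu n * Cmod (g (t n)) ^ 2).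
  - intros n. rewrite Cmod_mult. apply amgm, mu_pos.
  - apply ex_series_add; [apply HF|exact Hg].
Qed.

Lemma mom_plus (g F G : C -> C) : gL2 t mu g -> inHr F -> inHr G ->
  mom t A g (fun z => F z + G z)%C = (mom t A g F + mom t A g G)%C.
Proof.
  intros Hg HF HG. unfold mom. rewrite <- csum_plus by now apply mom_csmb.
  apply csum_ext. intros n. rewrite res_plus. ring.
Qed.

Lemma mom_scal (g F : C -> C) (k : C) : gL2 t mu g -> inHr F ->
  mom t A g (fun z => k * F z)%C = (k * mom t A g F)%C.
Proof.
  intros Hg HF. unfold mom. rewrite <- csum_scal by now apply mom_csmb.
  apply csum_ext. intros n. rewrite res_scal. ring.
Qed.

Lemma mom_minus (g F G : C -> C) : gL2 t mu g -> inHr F -> inHr G ->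
  mom t A g (fun z => F z - G z)%C = (mom t A g F - mom t A g G)%C.
Proof.
  intros Hg HF HG. rewrite (mom_ext g _ (fun z => F z + (-(1)) * G z)%C) by (intros; ring).
  rewrite mom_plus, mom_scal by (auto; now apply inHr_scal). ring.
Qed.

(** Continuity of the moment functional, by [amgm] with weight [s * mu n]: a small [s] controls the
    part of [g], then a small norm controls [1 / s] times that of [F]. *)
Lemma mom_small (g : C -> C) (e : R) : gL2 t mu g -> 0 < e ->
  exists d, 0 < d /\ forall F, inHr F -> N2 t A mu F <= d -> Cmod (mom t A g F) <= e.
Proof.
  intros Hg He. set (M := Series (fun n => mu n * Cmod (g (t n)) ^ 2)).
  assert (HM : 0 <= M).
  { apply Series_pos; auto. intros n. apply Rmult_le_pos; [left; apply mu_pos|apply pow2_ge_0]. }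
  set (s := e / (4 * (M + 1))). assert (Hs : 0 < s) by (apply Rdiv_lt_0_compat; lra).
  exists (s * e / 4). split; [apply Rdiv_lt_0_compat; [now apply Rmult_lt_0_compat|lra]|].
  intros F HF HN. unfold mom.
  eapply Rle_trans.
  { apply (csum_bound_dom _
      (fun n => / s * (Cmod (residue t A F n) ^ 2 / mu n) + s * (mu n * Cmod (g (t n)) ^ 2))).
    - intros n. rewrite Cmod_mult. assert (P := mu_pos n).
      eapply Rle_trans; [apply (amgm _ _ (s * mu n)); now apply Rmult_lt_0_compat|].
      right. field. lra.
    - apply ex_series_add; apply ex_series_mul; [apply HF|exact Hg]. }
  rewrite Series_plus by (apply ex_series_mul; first [apply HF|exact Hg]).
  rewrite !Series_scal_l. fold M. fold (N2 t A mu F).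
  assert (Q1 : / s * N2 t A mu F <= e / 4).
  { apply Rmult_le_reg_l with s; [auto|]. rewrite <- Rmult_assoc, Rinv_r by lra. lra. }
  assert (Q2 : s * M <= e / 4).
  { unfold s. apply Rmult_le_reg_r with (4 * (M + 1)); [lra|].
    replace (e / (4 * (M + 1)) * M * (4 * (M + 1))) with (e * M) by (field; lra). nra. }
  lra.
Qed.

(* [nu_{k+1}(t) = nu_k(t) (t - w) + (w - x_k) nu_k(t)] *)
Lemma mom_rec (x : nat -> C) (k : nat) (F G : C -> C) (w : C) :
  (forall z, F z = ((z - w) * G z)%C) ->
  csmb (fun n => residue t A F n * nu x k (t n))%C -> csmb (fun n => residue t A G n * nu x k (t n))%C ->
  mom t A (nu x (S k)) G = (mom t A (nu x k) F + (w - x k) * mom t A (nu x k) G)%C.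
Proof.
  intros E H1 H2. unfold mom. rewrite <- csum_scal by auto.
  rewrite <- csum_plus by (auto; now apply csmb_scal).
  apply csum_ext. intros n. rewrite (res_divide F G w E). simpl. ring.
Qed.

Definition Smom (x : nat -> C) (P : nat -> Prop) (F : C -> C) : Prop :=
  inHr F /\ forall k, P k -> mom t A (nu x k) F = 0%C.

(** By [mom_rec], the moment of order [k + 1] of [F / (z - w)] comes from those of order [k] of [F]
    and of the quotient; the moment of order [0] of the quotient is the sum of its residues, hence
    [0]. The induction runs through all smaller orders, so [P] is closed under predecessors. *)
Lemma Smom_ni (x : nat -> C) (P : nat -> Prop) : (forall k, P (S k) -> P k) ->
  (forall k, P k -> gL2 t mu (nu x k)) -> nearly_invariant t A mu (Smom x P).
Proof.
  intros HP Hg. split.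
  - apply closed_subspace_intro.
    + now intros F [HF _].
    + split; [apply inHr_zero|]. intros k Hk.
      rewrite (mom_ext _ _ (fun z => 0 * (fun _ => RtoC 0) z)%C) by (intros; ring).
      rewrite mom_scal; [ring|auto|apply inHr_zero].
    + intros F G [HF MF] [HG MG]. split; [now apply inHr_plus|]. intros k Hk.
      rewrite mom_plus, MF, MG by auto. ring.
    + intros a F [HF MF]. split; [now apply inHr_scal|]. intros k Hk.
      rewrite mom_scal, MF by auto. ring.
    + intros Fk F Hk HF HC. split; [auto|]. intros k Pk. apply Cmod_small_eq0. intros e He.
      destruct (mom_small (nu x k) e (Hg k Pk) He) as [d [Hd HB]].
      destruct (HC d Hd) as [K HK]. specialize (HK K (le_n _)).
      destruct (Hk K) as [HFK MFK].
      assert (B := HB _ (inHr_minus _ _ HFK HF) HK).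
      rewrite mom_minus, MFK in B by auto. rewrite Cmod_sub_sym in B.
      replace (mom t A (nu x k) F - 0)%C with (mom t A (nu x k) F) in B by ring. exact B.
  - intros F w [HF MF] Hw. destruct (inHr_divide F w HF Hw) as [G [HG [E [SG ZG]]]].
    exists G. split.
    + split; [auto|]. induction k as [|k IH]; intros Pk.
      * unfold mom. simpl. rewrite <- ZG. apply csum_ext. intros n. ring.
      * assert (Pk' := HP k Pk).
        rewrite (mom_rec x k F G w E); [|now apply mom_csmb; [apply Hg|]..].
        rewrite MF, IH by auto. ring.
    + intros z Hz. rewrite E. field. now apply Cminus_neq0.
Qed.

(** * Elements dual to the Newton polynomials *)

Definition injb (s : nat -> nat) (k : nat) : Prop :=
  forall i j, (i < k)%nat -> (j < k)%nat -> s i = s j -> i = j.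

Lemma qn_synth (k : nat) : qn t A k = synth t A (fun n => if Nat.eqb n k then RtoC 1 else RtoC 0).
Proof.
  set (d := fun n => if Nat.eqb n k then RtoC 1 else RtoC 0).
  assert (Hd : forall n, (S k <= n)%nat -> d n = 0%C).
  { intros n Hn. unfold d. assert (E : n <> k) by lia. apply Nat.eqb_neq in E. now rewrite E. }
  assert (HI := fin_inHr d (S k) Hd).
  apply (eq_off_T _ _ (t 0%nat)).
  - intros z. apply hol_cont, qn_hol.
  - intros z. apply hol_cont. now apply inHr_hol.
  - intros z Hz _. rewrite (synth_near k).
    + unfold CT. rewrite (csum_fin _ 0).
      2:{ intros n _. destruct (Nat.eq_dec n k) as [->|E]; [rewrite del_same; unfold Cdiv; ring|].
          rewrite del_other by auto. unfold d. apply Nat.eqb_neq in E. rewrite E. unfold Cdiv. ring. }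
      unfold d. rewrite Nat.eqb_refl. simpl. ring.
    + apply l2mu_W. rewrite <- (res_synth d). apply HI.
    + intros n _. apply Hz.
Qed.

Lemma qn_inHr (k : nat) : inHr (qn t A k).
Proof.
  rewrite qn_synth. apply fin_inHr with (S k). intros n Hn.
  assert (E : n <> k) by lia. apply Nat.eqb_neq in E. now rewrite E.
Qed.

Lemma res_qn (k n : nat) : residue t A (qn t A k) n = if Nat.eqb n k then 1%C else 0%C.
Proof. now rewrite qn_synth, res_synth. Qed.

(** The residues of [V = A / nu_{l+1}] are [1 / nu_{l+1}'(x_i)], so its moment against [g] is the
    divided difference of [g] at [x_0, ..., x_l]: it is [1] on [nu_l] and [0] on the other Newton
    polynomials. The proof divides out one node at a time and follows the moments by [mom_rec]. *)
Lemma newton_dual (s : nat -> nat) (l : nat) : injb s (S l) ->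
  exists V, inHr V /\ (forall z, A z = (nu (fun i => t (s i)) (S l) z * V z)%C) /\
    (forall n, (forall i, (i <= l)%nat -> n <> s i) -> residue t A V n = 0%C) /\
    (forall j, mom t A (nu (fun i => t (s i)) j) V = if Nat.eqb j l then 1%C else 0%C).
Proof.
  set (x := fun i => t (s i)).
  assert (RF : forall l V, (forall z, A z = (nu x (S l) z * V z)%C) ->
    forall n, (forall i, (i <= l)%nat -> n <> s i) -> residue t A V n = 0%C).
  { intros k V E n Hn. assert (A0 : A (t n) = 0%C) by (apply A_zero; now exists n).
    rewrite E in A0. apply Cmult_integral in A0. destruct A0 as [A0|A0].
    - apply nu_neq in A0; [tauto|]. intros i Hi Ei. apply (Hn i); [lia|]. now apply t_inj.
    - unfold residue. rewrite A0. unfold Cdiv. ring. }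
  induction l as [|l IH]; intros Hinj.
  - exists (qn t A (s 0%nat)).
    assert (E : forall z, A z = (nu x 1 z * qn t A (s 0%nat) z)%C).
    { intros z. simpl. rewrite (A_qn (s 0%nat)). unfold x. ring. }
    split; [apply qn_inHr|]. split; [exact E|]. split; [now apply RF|].
    intros j. unfold mom. rewrite (csum_del (s 0%nat)).
    + rewrite (csum_fin _ 0).
      * rewrite res_qn, Nat.eqb_refl. destruct j as [|j]; [simpl; ring|].
        change (t (s 0%nat)) with (x 0%nat). rewrite nu_zero by lia. simpl. ring.
      * intros n _. destruct (Nat.eq_dec n (s 0%nat)) as [->|En]; [apply del_same|].
        rewrite del_other, res_qn by auto. apply Nat.eqb_neq in En. rewrite En. ring.
    + apply csmb_fin with (S (s 0%nat)). intros n Hn. rewrite res_qn.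
      assert (En : n <> s 0%nat) by lia. apply Nat.eqb_neq in En. rewrite En. ring.
  - destruct IH as [V [HV [EV [RV MV]]]].
    { intros i j Hi Hj. apply Hinj; lia. }
    assert (V0 : V (x (S l)) = 0%C).
    { assert (A0 : A (x (S l)) = 0%C) by (apply A_zero; now exists (s (S l))).
      rewrite EV in A0. apply Cmult_integral in A0. destruct A0 as [A0|A0]; [|auto].
      apply nu_neq in A0; [tauto|]. intros i Hi Ei. apply (t_inj (s (S l)) (s i)) in Ei.
      apply Hinj in Ei; lia. }
    destruct (inHr_divide V (x (S l)) HV V0) as [G [HG [EG [SG ZG]]]].
    assert (EG' : forall z, A z = (nu x (S (S l)) z * G z)%C).
    { intros z. rewrite EV, EG. simpl. ring. }
    exists G. split; [auto|]. split; [exact EG'|]. split; [now apply RF|].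
    (* Only finitely many residues are nonzero, so these moments converge whatever the growth of the
       polynomial. *)
    assert (FIN : forall V l, (forall n, (forall i, (i <= l)%nat -> n <> s i) -> residue t A V n = 0%C) ->
       forall j, csmb (fun n => residue t A V n * nu x j (t n))%C).
    { intros V' k Hk j. apply csmb_fin with (S (list_max (map s (seq 0 (S k))))). intros n Hn.
      rewrite Hk; [ring|]. intros i Hi ->.
      assert (T := proj1 (list_max_le (map s (seq 0 (S k))) _) (le_n _)).
      rewrite Forall_forall in T.
      specialize (T (s i) (in_map s _ _ (proj2 (in_seq (S k) 0 i) ltac:(lia)))). lia. }
    induction j as [|j IHj].
    + unfold mom. simpl. rewrite <- ZG. apply csum_ext. intros n. ring.
    + rewrite (mom_rec x j V G _ EG); [|now apply (FIN V l)|apply (FIN G (S l)); now apply RF].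
      rewrite MV, IHj. destruct (Nat.eq_dec j (S l)) as [E1|E1].
      * subst j. rewrite Nat.eqb_refl, (proj2 (Nat.eqb_neq (S l) l)) by lia.
        rewrite (proj2 (Nat.eqb_neq (S (S l)) (S l))) by lia. ring.
      * rewrite (proj2 (Nat.eqb_neq j (S l))) by auto. destruct (Nat.eq_dec j l) as [E2|E2].
        -- subst j. rewrite !Nat.eqb_refl. ring.
        -- rewrite (proj2 (Nat.eqb_neq j l)), (proj2 (Nat.eqb_neq (S j) (S l))) by lia. ring.
Qed.

End Moments.

(** * Codimension *)

Lemma psum_ext (f g : nat -> C) (m : nat) : (forall i, (i < m)%nat -> f i = g i) ->
  psum f m = psum g m.
Proof.
  induction m as [|m IH]; intros H; simpl; [auto|]. rewrite IH, H; auto.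
Qed.

Lemma psum_plus (f g : nat -> C) (m : nat) : psum (fun i => f i + g i)%C m = (psum f m + psum g m)%C.
Proof. induction m as [|m IH]; simpl; [ring|]. rewrite IH. ring. Qed.

Lemma psum_scal (k : C) (f : nat -> C) (m : nat) : psum (fun i => k * f i)%C m = (k * psum f m)%C.
Proof. induction m as [|m IH]; simpl; [ring|]. rewrite IH. ring. Qed.

Lemma psum_0 (f : nat -> C) (m : nat) : (forall i, (i < m)%nat -> f i = 0%C) -> psum f m = 0%C.
Proof. induction m as [|m IH]; intros H; simpl; [auto|]. rewrite IH, H by auto. ring. Qed.

Lemma psum_exchange (f : nat -> nat -> C) (m k : nat) :
  psum (fun i => psum (fun j => f i j) k) m = psum (fun j => psum (fun i => f i j) m) k.
Proof.
  induction m as [|m IH]; simpl.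
  - symmetry. now apply psum_0.
  - rewrite IH, <- psum_plus. reflexivity.
Qed.

Lemma lincomb_psum (m : nat) (a : nat -> C) (v : nat -> C -> C) (z : C) :
  lincomb m a v z = psum (fun i => a i * v i z)%C m.
Proof.
  unfold lincomb.
  assert (H : forall m c, fold_right (fun i acc => (a i * v i z + acc)%C) c (seq 0 m)
     = (psum (fun i => a i * v i z)%C m + c)%C).
  { clear m. induction m as [|m IH]; intros c; [simpl; ring|].
    rewrite seq_S, fold_right_app. simpl. rewrite IH. ring. }
  rewrite H. ring.
Qed.

Definition skip (p i : nat) : nat := if Nat.ltb i p then i else S i.

Lemma psum_skip (f : nat -> C) (m p : nat) : (p <= m)%nat ->
  psum f (S m) = (f p + psum (fun i => f (skip p i)) m)%C.
Proof.
  induction m as [|m IH]; intros H.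
  - replace p with 0%nat by lia. simpl. ring.
  - destruct (Nat.eq_dec p (S m)) as [E|E].
    + subst p. change (psum f (S (S m))) with (psum f (S m) + f (S m))%C.
      rewrite (psum_ext (fun i => f (skip (S m) i)) f (S m)); [ring|].
      intros i Hi. unfold skip. apply Nat.ltb_lt in Hi. now rewrite Hi.
    + change (psum f (S (S m))) with (psum f (S m) + f (S m))%C. rewrite IH by lia. simpl.
      replace (skip p m) with (S m); [ring|]. unfold skip.
      rewrite (proj2 (Nat.ltb_ge m p)) by lia. auto.
Qed.

Definition insert_at (p : nat) (x : C) (b : nat -> C) (j : nat) : C :=
  if Nat.ltb j p then b j else if Nat.eqb j p then x else b (pred j).

Lemma insert_at_same (p : nat) (x : C) (b : nat -> C) : insert_at p x b p = x.
Proof. unfold insert_at. now rewrite Nat.ltb_irrefl, Nat.eqb_refl. Qed.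

Lemma insert_at_skip (p : nat) (x : C) (b : nat -> C) (i : nat) : insert_at p x b (skip p i) = b i.
Proof.
  unfold insert_at, skip. destruct (Nat.ltb_spec i p) as [H|H].
  - now rewrite (proj2 (Nat.ltb_lt i p) H).
  - rewrite (proj2 (Nat.ltb_ge (S i) p)), (proj2 (Nat.eqb_neq (S i) p)) by lia. auto.
Qed.

(** Elimination: an unknown with nonzero coefficient in the last equation is expressed by the
    others, and the remaining equations are solved by induction. *)
Lemma homogeneous_solution (k : nat) : forall m (c : nat -> nat -> C), (k < m)%nat ->
  exists a : nat -> C, (exists i, (i < m)%nat /\ a i <> 0%C) /\
    forall j, (j < k)%nat -> psum (fun i => a i * c i j)%C m = 0%C.
Proof.
  induction k as [|k IH]; intros m c Hm.
  - exists (fun _ => 1%C). split; [|intros; lia]. exists O. split; [lia|].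
    intros E. apply RtoC_inj in E. lra.
  - destruct (classic (exists p, (p < m)%nat /\ c p k <> 0%C)) as [[p [Hp Hc]]|Hn].
    + destruct m as [|m]; [lia|].
      destruct (IH m (fun i j => c (skip p i) j - c (skip p i) k / c p k * c p j)%C) as [b [[i [Hi Hb]] Hs]];
        [lia|].
      set (x := (- psum (fun i => b i * (c (skip p i) k / c p k)) m)%C).
      assert (E : forall j, psum (fun i => insert_at p x b i * c i j)%C (S m)
         = psum (fun i => b i * (c (skip p i) j - c (skip p i) k / c p k * c p j))%C m).
      { intros j. rewrite (psum_skip _ m p) by lia. rewrite insert_at_same. unfold x.
        transitivity (psum (fun i => (- c p j) * (b i * (c (skip p i) k / c p k))
           + b i * c (skip p i) j)%C m).
        - rewrite psum_plus, psum_scal.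
          rewrite (psum_ext (fun i => insert_at p _ b (skip p i) * c (skip p i) j)%C
            (fun i => b i * c (skip p i) j)%C); [ring|].
          intros i' _. now rewrite insert_at_skip.
        - apply psum_ext. intros; ring. }
      exists (insert_at p x b). split.
      * exists (skip p i). rewrite insert_at_skip. split; auto.
        unfold skip. destruct (Nat.ltb i p); lia.
      * intros j Hj. rewrite E. destruct (Nat.eq_dec j k) as [->|Ej]; [|apply Hs; lia].
        apply psum_0. intros i' _. field. auto.
    + destruct (IH m c) as [a [Ha Hs]]; [lia|]. exists a. split; auto. intros j Hj.
      destruct (Nat.eq_dec j k) as [->|Ej]; [|apply Hs; lia].
      apply psum_0. intros i Hi. replace (c i k) with (RtoC 0); [ring|].
      symmetry. apply NNPP. intros N. apply Hn. now exists i.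
Qed.

Section Codimension.
Context {t : nat -> C} {A : C -> C} {mu : nat -> R}.
Context {Hdata : admissible_data t mu} {HA : generating_function t A}.
Context {S : (C -> C) -> Prop} {HS : closed_subspace t A mu S}.

(** The [v i] generate the quotient by [S]; unlike in [codim], independence modulo [S] is not
    asked. *)
Definition spans (k : nat) (v : nat -> C -> C) : Prop :=
  forall F, inH t A mu F -> exists a : nat -> C, S (fun z => F z - psum (fun i => a i * v i z)%C k)%C.

(** Modulo [S], each [u i] is a combination of the [k] elements [v j], and a relation among the
    coefficient vectors is a relation modulo [S]. *)
Lemma dependent_mod (k m : nat) (v u : nat -> C -> C) : spans k v -> (k < m)%nat ->
  (forall i, (i < m)%nat -> inH t A mu (u i)) ->
  exists a : nat -> C, (exists i, (i < m)%nat /\ a i <> 0%C) /\ S (fun z => psum (fun i => a i * u i z)%C m).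
Proof.
  intros Hv Hkm Hu.
  assert (HC : forall i, exists c : nat -> C, (i < m)%nat -> S (fun z => u i z - psum (fun j => c j * v j z) k)%C).
  { intros i. destruct (Nat.lt_ge_cases i m) as [L|L].
    - destruct (Hv (u i) (Hu i L)) as [c Hc]. now exists c.
    - exists (fun _ => 0%C). intros; lia. }
  set (c := fun i => proj1_sig (constructive_indefinite_description _ (HC i))).
  assert (Hc : forall i, (i < m)%nat -> S (fun z => u i z - psum (fun j => c i j * v j z) k)%C).
  { intros i. exact (proj2_sig (constructive_indefinite_description _ (HC i))). }
  destruct (homogeneous_solution k m c Hkm) as [a [Ha Hs]].
  exists a. split; [exact Ha|].
  rewrite (fun_ext_C _ (fun z => psum (fun i => a i * (u i z - psum (fun j => c i j * v j z) k)) m)%C).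
  - apply (sub_psum (S := S) (fun i z => a i * (u i z - psum (fun j => c i j * v j z) k))%C).
    intros i Hi. apply (sub_scal (S := S)). now apply Hc.
  - intros z.
    rewrite (psum_ext (fun i => a i * (u i z - psum (fun j => c i j * v j z) k))%C
      (fun i => a i * u i z + (-(1)) * psum (fun j => a i * c i j * v j z) k)%C).
    + rewrite psum_plus, psum_scal, psum_exchange, (psum_0 _ k); [ring|].
      intros j Hj. rewrite (psum_ext _ (fun i => v j z * (a i * c i j))%C) by (intros; ring).
      rewrite psum_scal, Hs by auto. ring.
    + intros i _. rewrite (psum_ext (fun j => a i * c i j * v j z)%C (fun j => a i * (c i j * v j z))%C)
        by (intros; ring).
      rewrite psum_scal. ring.
Qed.

Lemma codim_spans (m : nat) : codim t A mu S m -> exists v, spans m v.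
Proof.
  intros [v [_ [H _]]]. exists v. intros F HF. destruct (H F HF) as [a Ha]. exists a.
  rewrite (fun_ext_C _ (fun z => F z - lincomb m a v z)%C); auto.
  intros z. now rewrite lincomb_psum.
Qed.

Lemma codim_le_spans (m k : nat) (w : nat -> C -> C) : codim t A mu S m -> spans k w -> (m <= k)%nat.
Proof.
  intros [v [Hv [_ Hi]]] Hw. apply Nat.nlt_ge. intros Hlt.
  destruct (dependent_mod k m w v Hw Hlt Hv) as [a [[i [Hi1 Hi2]] Ha]].
  apply Hi2. apply Hi; auto.
  rewrite (fun_ext_C _ (fun z => psum (fun i => a i * v i z)%C m)); auto.
  intros z. apply lincomb_psum.
Qed.

Lemma spans_codim (k : nat) : forall v, (forall i, (i < k)%nat -> inH t A mu (v i)) -> spans k v ->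
  exists m, codim t A mu S m.
Proof.
  induction k as [|k IH]; intros v Hv Hs.
  - exists O, v. split; [intros; lia|]. split; [|intros; lia].
    intros F HF. destruct (Hs F HF) as [a Ha]. exists a. exact Ha.
  - destruct (classic (exists a : nat -> C, S (fun z => psum (fun i => a i * v i z)%C (Datatypes.S k)) /\
       exists p, (p < Datatypes.S k)%nat /\ a p <> 0%C)) as [[a [Sa [p [Hp Ha]]]]|Hn].
    + apply (IH (fun i => v (skip p i))).
      * intros i Hi. apply Hv. unfold skip. destruct (Nat.ltb i p); lia.
      * intros F HF. destruct (Hs F HF) as [b Hb].
        set (g := fun i => (b i - b p / a p * a i)%C).
        exists (fun i => g (skip p i)).
        rewrite (fun_ext_C _ (fun z => (F z - psum (fun i => b i * v i z) (Datatypes.S k))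
           + b p / a p * psum (fun i => a i * v i z) (Datatypes.S k))%C).
        -- apply (sub_plus (S := S)); auto. now apply (sub_scal (S := S)).
        -- intros z.
           assert (E : psum (fun i => g i * v i z)%C (Datatypes.S k)
             = psum (fun i => g (skip p i) * v (skip p i) z)%C k).
           { rewrite (psum_skip _ k p) by lia. replace (g p) with (RtoC 0); [ring|].
             unfold g. field. auto. }
           rewrite <- E. unfold g.
           rewrite (psum_ext _ (fun i => b i * v i z + (- (b p / a p)) * (a i * v i z))%C)
             by (intros; ring).
           rewrite psum_plus, psum_scal. ring.
    + exists (Datatypes.S k), v. split; [auto|]. split.
      * intros F HF. destruct (Hs F HF) as [a Ha]. exists a.
        rewrite (fun_ext_C _ (fun z => F z - psum (fun i => a i * v i z) (Datatypes.S k))%C); auto.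
        intros z. now rewrite lincomb_psum.
      * intros a Ha i Hi. apply NNPP. intros N. apply Hn. exists a. split; [|now exists i].
        rewrite (fun_ext_C _ (lincomb (Datatypes.S k) a v)); auto.
        intros z. symmetry. apply lincomb_psum.
Qed.

End Codimension.

(** * Elements with finitely many residues *)

Lemma lin_cancel (F G : C -> C) (w : C) : (forall z, ccont F z) -> (forall z, ccont G z) ->
  (forall z, ((z - w) * F z = (z - w) * G z)%C) -> forall z, F z = G z.
Proof.
  intros HF HG E.
  assert (O : forall z, z <> w -> F z = G z).
  { intros z Hz. assert (N := Cminus_neq0 _ _ Hz).
    transitivity ((z - w) * F z / (z - w))%C; [field; auto|]. rewrite E. field. auto. }
  intros z. destruct (classic (z = w)) as [->|Hz]; [|auto].
  apply (ccont_eq_at F G w 1); auto. lra.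
Qed.

Lemma nu_cancel (x : nat -> C) (k : nat) (F G : C -> C) : (forall z, ccont F z) ->
  (forall z, ccont G z) -> (forall z, (nu x k z * F z = nu x k z * G z)%C) -> forall z, F z = G z.
Proof.
  revert F G. induction k as [|k IH]; intros F G HF HG E.
  - intros z. specialize (E z). simpl in E. rewrite !Cmult_1_l in E. exact E.
  - apply (lin_cancel F G (x k)); auto.
    apply (IH (fun z => (z - x k) * F z)%C (fun z => (z - x k) * G z)%C).
    + intros z. apply ccont_mult; auto. apply ccont_minus; [apply ccont_id|apply ccont_const].
    + intros z. apply ccont_mult; auto. apply ccont_minus; [apply ccont_id|apply ccont_const].
    + intros z. specialize (E z). simpl in E. rewrite !Cmult_assoc. exact E.
Qed.

Lemma nu_factor (x : nat -> C) (k i : nat) : (i < k)%nat ->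
  (forall j, (j < k)%nat -> j <> i -> x j <> x i) ->
  exists g, (forall z, hol g z) /\ (forall z, nu x k z = ((z - x i) * g z)%C) /\ g (x i) <> 0%C.
Proof.
  induction k as [|k IH]; intros Hi Hx; [lia|].
  destruct (Nat.eq_dec i k) as [->|E].
  - exists (nu x k). split; [apply nu_hol|]. split; [intros z; simpl; ring|].
    apply nu_neq. intros j Hj. apply not_eq_sym, Hx; lia.
  - destruct IH as [g [G1 [G2 G3]]]; [lia|intros j Hj; apply Hx; lia|].
    exists (fun z => g z * (z - x k))%C. split; [|split].
    + intros z. apply hol_mult; auto. apply hol_minus; [apply hol_id|apply hol_const].
    + intros z. simpl. rewrite G2. ring.
    + intros Z. apply Cmult_integral in Z. destruct Z as [Z|Z]; [auto|].
      apply Cminus_eq0 in Z. apply (Hx k); [lia|auto|auto].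
Qed.

Fixpoint padd (p q : list C) : list C :=
  match p, q with
  | [], q => q
  | p, [] => p
  | a :: p, b :: q => (a + b)%C :: padd p q
  end.

Lemma peval_padd (p q : list C) (z : C) : peval (padd p q) z = (peval p z + peval q z)%C.
Proof.
  revert q. induction p as [|a p IH]; intros [|b q]; simpl; try ring. rewrite IH. ring.
Qed.

Lemma peval_map (k : C) (p : list C) (z : C) :
  peval (map (fun a => k * a)%C p) z = (k * peval p z)%C.
Proof. induction p as [|a p IH]; simpl; [ring|]. rewrite IH. ring. Qed.

Lemma peval_mul_lin (p : list C) (u : C) : exists q, forall z, peval q z = ((z - u) * peval p z)%C.
Proof.
  exists (padd (RtoC 0 :: p) (map (fun a => - u * a)%C p)). intros z.
  rewrite peval_padd, peval_map. simpl. ring.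
Qed.

Lemma nu_peval (x : nat -> C) (k : nat) : exists p, forall z, peval p z = nu x k z.
Proof.
  induction k as [|k [p Hp]].
  - exists [RtoC 1]. intros z. simpl. ring.
  - destruct (peval_mul_lin p (x k)) as [q Hq]. exists q. intros z. rewrite Hq, Hp. simpl. ring.
Qed.

Lemma peval_divide (p : list C) (w : C) : exists q,
  forall z, peval p z = (peval p w + (z - w) * peval q z)%C.
Proof.
  induction p as [|a p [q Hq]].
  - exists []. intros z. simpl. ring.
  - exists (peval p w :: q). intros z. simpl. rewrite (Hq z). ring.
Qed.

Lemma nu_ratio (x : nat -> C) (z : C) (r : R) (l j : nat) : 1 <= r -> (l < j)%nat ->
  (forall i, (i < j)%nat -> r <= Cmod (z - x i)%C) -> Cmod (nu x l z) * r <= Cmod (nu x j z).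
Proof.
  intros Hr. induction j as [|j IH]; intros Hl Hx; [lia|].
  simpl. rewrite Cmod_mult. assert (T := Hx j ltac:(lia)). assert (P := Cmod_ge_0 (nu x l z)).
  destruct (Nat.eq_dec l j) as [->|E].
  - apply Rmult_le_compat_l; auto.
  - assert (Q := IH ltac:(lia) ltac:(intros; apply Hx; lia)).
    apply Rle_trans with (Cmod (nu x l z) * r * 1); [lra|]. apply Rmult_le_compat; try lra.
    apply Rmult_le_pos; lra.
Qed.

Lemma Cmod_psum (f : nat -> C) (m : nat) : Cmod (psum f m) <= rsum (fun n => Cmod (f n)) m.
Proof.
  induction m as [|m IH]; simpl; [rewrite Cmod_0; lra|].
  eapply Rle_trans; [apply Cmod_triangle|]. lra.
Qed.

Lemma psum_RtoC (f : nat -> R) (m : nat) : psum (fun n => RtoC (f n)) m = RtoC (rsum f m).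
Proof. induction m as [|m IH]; simpl; [auto|]. now rewrite IH, RtoC_plus. Qed.

Lemma finite_bound (f : nat -> R) (m : nat) : exists B, forall i, (i < m)%nat -> f i <= B.
Proof.
  induction m as [|m [B HB]]; [exists 0; intros; lia|].
  exists (Rmax B (f m)). intros i Hi. destruct (Nat.eq_dec i m) as [->|E]; [apply Rmax_r|].
  eapply Rle_trans; [apply HB; lia|apply Rmax_l].
Qed.

Section MinimalSupport.
Context {t : nat -> C} {A : C -> C} {mu : nat -> R}.
Context {Hdata : admissible_data t mu} {HA : generating_function t A}.

Notation inHr := (@inHr t A mu).

Definition lin (M : nat) (b : nat -> C) (z : C) : C := psum (fun n => b n * qn t A n z)%C M.

Lemma lin_inHr (M : nat) (b : nat -> C) : inHr (lin M b).
Proof.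
  induction M as [|M IH]; [apply inHr_zero|].
  apply (inHr_plus (lin M b) (fun z => b M * qn t A M z)%C); auto.
  apply inHr_scal, qn_inHr.
Qed.

Lemma res_zero (n : nat) : residue t A (fun _ => RtoC 0) n = 0%C.
Proof. unfold residue, Cdiv. ring. Qed.

Lemma res_lin (M : nat) (b : nat -> C) (n : nat) :
  residue t A (lin M b) n = if Nat.ltb n M then b n else 0%C.
Proof.
  induction M as [|M IH]; [apply res_zero|].
  rewrite (res_plus (lin M b) (fun z => b M * qn t A M z)%C), IH, res_scal, res_qn.
  destruct (Nat.ltb_spec n M) as [H1|H1].
  - rewrite (proj2 (Nat.ltb_lt n (S M))), (proj2 (Nat.eqb_neq n M)) by lia. ring.
  - destruct (Nat.eq_dec n M) as [->|E].
    + rewrite Nat.eqb_refl, (proj2 (Nat.ltb_lt M (S M))) by lia. ring.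
    + rewrite (proj2 (Nat.eqb_neq n M)), (proj2 (Nat.ltb_ge n (S M))) by lia. ring.
Qed.

Lemma N2_lin (M : nat) (b : nat -> C) : N2 t A mu (lin M b) = rsum (fun n => Cmod (b n) ^ 2 / mu n) M.
Proof.
  unfold N2. rewrite (Series_fin _ M).
  - apply Rle_antisym; apply rsum_le; intros n Hn; rewrite res_lin;
      apply Nat.ltb_lt in Hn; rewrite Hn; lra.
  - intros n Hn. rewrite res_lin. rewrite (proj2 (Nat.ltb_ge n M)) by auto.
    rewrite Cmod_0. unfold Rdiv. ring.
Qed.

Lemma lin_conv (F : C -> C) : inHr F -> convH t A mu (fun M => lin M (residue t A F)) F.
Proof.
  intros HF e He.
  destruct (Series_tail_small (fun n => Cmod (residue t A F n) ^ 2 / mu n) e He) as [K HK].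
  { intros n. apply Rdiv_le_0_compat; [apply pow2_ge_0|apply mu_pos]. }
  { apply HF. }
  exists K. intros M HM. specialize (HK M HM). unfold N2.
  assert (E : forall n, Cmod (residue t A (fun z => lin M (residue t A F) z - F z)%C n) ^ 2 / mu n
    = if Nat.ltb n M then 0 else Cmod (residue t A F n) ^ 2 / mu n).
  { intros n. rewrite res_minus, res_lin. destruct (Nat.ltb n M).
    - replace (residue t A F n - residue t A F n)%C with (RtoC 0) by ring. rewrite Cmod_0. unfold Rdiv. ring.
    - replace (0 - residue t A F n)%C with (- residue t A F n)%C by ring. now rewrite Cmod_opp. }
  rewrite (Series_ext _ _ E).
  destruct M as [|M].
  - rewrite (Series_ext _ (fun n => Cmod (residue t A F n) ^ 2 / mu n)); auto.
  - rewrite (Series_incr_n_aux _ (S M)).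
    + rewrite (Series_ext _ (fun n => Cmod (residue t A F (S M + n)) ^ 2 / mu (S M + n)%nat)); auto.
      intros n. rewrite (proj2 (Nat.ltb_ge (S M + n) (S M))) by lia. auto.
    + intros n Hn. apply Nat.ltb_lt in Hn. now rewrite Hn.
Qed.

Lemma lin_peval (M : nat) (b : nat -> C) : exists p, forall z, (nu t M z * lin M b z = A z * peval p z)%C.
Proof.
  induction M as [|M [p Hp]].
  - exists []. intros z. unfold lin. simpl. ring.
  - destruct (peval_mul_lin p (t M)) as [q Hq]. destruct (nu_peval t M) as [r Hr].
    exists (padd q (map (fun a => b M * a)%C r)). intros z.
    rewrite peval_padd, peval_map, Hq, Hr. change (lin (S M) b z) with (lin M b z + b M * qn t A M z)%C.
    simpl nu. transitivity ((nu t M z * lin M b z) * (z - t M) + b M * nu t M z * ((z - t M) * qn t A M z))%C;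
      [ring|]. rewrite Hp, <- A_qn. ring.
Qed.

(* [S] contains a nonzero element with residues at no more than [d] of the points [t n]. *)
Definition fin_supp (S : (C -> C) -> Prop) (d : nat) : Prop :=
  exists s F p, injb s d /\ S F /\ (exists z, F z <> 0%C) /\
    forall z, (nu (fun i => t (s i)) d z * F z = A z * peval p z)%C.

Section NI.
Context {S : (C -> C) -> Prop} {HS : nearly_invariant t A mu S}.

Lemma ni_inHr (F : C -> C) : S F -> inHr F.
Proof. intros H. apply inH_iff. now apply HS. Qed.

Lemma ni_cont (F : C -> C) (z : C) : S F -> ccont F z.
Proof. intros H. apply hol_cont. apply inHr_hol. now apply ni_inHr. Qed.

Lemma zero_of_res (F : C -> C) : inHr F -> (forall n, F (t n) = 0%C) -> forall z, F z = 0%C.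
Proof.
  intros HF H z. rewrite (inHr_ext F (fun _ => RtoC 0) HF inHr_zero); auto.
  intros n. rewrite res_zero. unfold residue. rewrite H. unfold Cdiv. ring.
Qed.

(** A root [w] of [p] is a zero of [F], even when [w] is a node: there the simple zero of [nu] is
    compensated by the zero of [A]. Moving this zero to the last node [x d] cancels the factor
    [z - x d]. *)
Lemma fin_supp_step (d : nat) (s : nat -> nat) (F : C -> C) (p : list C) (w : C) :
  injb s (Datatypes.S d) -> S F -> (exists z, F z <> 0%C) ->
  (forall z, (nu (fun i => t (s i)) (Datatypes.S d) z * F z = A z * peval p z)%C) ->
  peval p w = 0%C -> fin_supp S d.
Proof.
  intros Hs HF HN E Hw. set (x := fun i => t (s i)) in *.
  destruct (peval_divide p w) as [q Hq].
  assert (Hq' : forall z, peval p z = ((z - w) * peval q z)%C).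
  { intros z. rewrite Hq, Hw. ring. }
  assert (Fw : F w = 0%C).
  { destruct (classic (exists i, (i < Datatypes.S d)%nat /\ w = x i)) as [[i [Hi Ew]]|Hi].
    - destruct (nu_factor x (Datatypes.S d) i Hi) as [g [G1 [G2 G3]]].
      { intros j Hj Hne Ej. apply Hne, Hs; auto. apply t_inj. exact Ej. }
      assert (Q : forall z, (g z * F z)%C = (A z * peval q z)%C).
      { apply (lin_cancel _ _ w).
        - intros z. apply ccont_mult; [apply hol_cont, G1|now apply ni_cont].
        - intros z. apply ccont_mult; apply hol_cont; [apply A_hol|apply peval_hol].
        - intros z. transitivity (nu x (Datatypes.S d) z * F z)%C; [rewrite G2, Ew; ring|].
          rewrite E, Hq'. ring. }
      specialize (Q w). replace (A w) with (RtoC 0) in Q by (symmetry; apply A_zero; exists (s i); exact Ew).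
      rewrite Cmult_0_l in Q. apply Cmult_integral in Q. destruct Q as [Q|Q]; [|auto].
      rewrite Ew in Q. contradiction.
    - assert (Q := E w). rewrite Hw in Q. rewrite Cmult_0_r in Q. apply Cmult_integral in Q.
      destruct Q as [Q|Q]; [|auto]. apply nu_neq in Q; [tauto|].
      intros i Hi' Ei. apply Hi. now exists i. }
  destruct (ni_move S F w (x d) HS HF Fw) as [G [HG EG]].
  exists s, G, q. split; [intros i j Hi Hj; apply Hs; lia|]. split; [auto|]. split.
  - apply NNPP. intros N. destruct HN as [z0 Hz0]. apply Hz0.
    apply (lin_cancel F (fun _ => RtoC 0) (x d)).
    + intros z. now apply ni_cont.
    + intros z. apply ccont_const.
    + intros z. rewrite <- EG. replace (G z) with (RtoC 0); [ring|].
      symmetry. apply NNPP. intros Ng. apply N. now exists z.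
  - intros z. apply (lin_cancel (fun z => nu x d z * G z)%C (fun z => A z * peval q z)%C w).
    + intros y. apply ccont_mult; [apply hol_cont, nu_hol|now apply ni_cont].
    + intros y. apply ccont_mult; apply hol_cont; [apply A_hol|apply peval_hol].
    + intros y. transitivity (nu x d y * ((y - w) * G y))%C; [ring|]. rewrite EG.
      transitivity (nu x (Datatypes.S d) y * F y)%C; [simpl; ring|]. rewrite E, Hq'. ring.
Qed.

(** For the least number of nodes, [p] has no root by [fin_supp_step], so it is a nonzero constant.
    The number is not [0], since [A * p] vanishes on [T] and an element with all residues [0] is
    [0]. *)
Lemma min_support (d0 : nat) : fin_supp S d0 ->
  exists k s E, injb s (Datatypes.S k) /\ S E /\
    (forall z, A z = (nu (fun i => t (s i)) (Datatypes.S k) z * E z)%C) /\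
    forall d, (d <= k)%nat -> ~ fin_supp S d.
Proof.
  intros H0.
  assert (Hmin : exists d, fin_supp S d /\ forall d', (d' < d)%nat -> ~ fin_supp S d').
  { revert H0. induction d0 as [d0 IH] using (well_founded_ind Wf_nat.lt_wf). intros H0.
    destruct (classic (exists d', (d' < d0)%nat /\ fin_supp S d')) as [[d' [H1 H2]]|Hn].
    - now apply (IH d').
    - exists d0. split; auto. intros d' Hd H. apply Hn. now exists d'. }
  destruct Hmin as [d [[s [F [p [Hs [HF [HN E]]]]]] Hmin]].
  destruct d as [|k].
  - exfalso. destruct HN as [z Hz]. apply Hz. apply zero_of_res; [now apply ni_inHr|].
    intros n. specialize (E (t n)). simpl in E. rewrite Cmult_1_l in E. rewrite E.
    replace (A (t n)) with (RtoC 0) by (symmetry; apply A_zero; now exists n). ring.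
  - destruct (peval_root p) as [[c Hc]|[w Hw]].
    + assert (Hc0 : c <> 0%C).
      { intros ->. destruct HN as [z Hz]. apply Hz.
        apply (nu_cancel (fun i => t (s i)) (Datatypes.S k) F (fun _ => RtoC 0)).
        - intros y. now apply ni_cont.
        - intros y. apply ccont_const.
        - intros y. rewrite E, Hc. ring. }
      exists k, s, (fun z => / c * F z)%C. split; [auto|]. split; [|split].
      * assert (HC := ni_closed S HS). now apply (sub_scal (S := S)).
      * intros z. transitivity (/ c * (nu (fun i => t (s i)) (Datatypes.S k) z * F z))%C; [|ring].
        rewrite E, Hc. field. auto.
      * intros d Hd. apply Hmin. lia.
    + exfalso. apply (Hmin k); [lia|]. now apply (fin_supp_step k s F p w).
Qed.

Lemma sub_approx (F : C -> C) : inHr F ->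
  (forall e, 0 < e -> exists G, S G /\ N2 t A mu (fun z => G z - F z)%C <= e) -> S F.
Proof.
  intros HF H. assert (HC := ni_closed S HS).
  assert (H' : forall n : nat, exists G, S G /\ N2 t A mu (fun z => G z - F z)%C <= / (INR n + 1)).
  { intros n. apply H, Rinv_0_lt_compat. generalize (pos_INR n). lra. }
  apply (sub_closed (S := S) (fun n => proj1_sig (constructive_indefinite_description _ (H' n)))); auto.
  - intros n. now destruct (constructive_indefinite_description _ (H' n)) as [G [H1 H2]].
  - intros e He. destruct (nfloor_ex (/ e)) as [N [_ HN]]; [left; now apply Rinv_0_lt_compat|].
    exists N. intros n Hn. destruct (constructive_indefinite_description _ (H' n)) as [G [H1 H2]]. simpl.
    eapply Rle_trans; [apply H2|]. rewrite <- (Rinv_inv e).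
    assert (0 < / e) by now apply Rinv_0_lt_compat. apply le_INR in Hn.
    apply Rinv_le_contravar; lra.
Qed.

Lemma N2_comb (V : nat -> C -> C) (m : nat) : (forall l, (l < m)%nat -> inHr (V l)) ->
  exists c, 0 <= c /\ forall g d, 0 <= d -> (forall l, (l < m)%nat -> Cmod (g l) <= d) ->
    inHr (fun z => psum (fun l => g l * V l z)%C m) /\
    N2 t A mu (fun z => psum (fun l => g l * V l z)%C m) <= d ^ 2 * c.
Proof.
  induction m as [|m IH]; intros HV.
  - exists 0. split; [lra|]. intros g d Hd _. split; [apply inHr_zero|].
    unfold N2. rewrite Series_0; [lra|]. intros n. simpl. rewrite res_zero, Cmod_0. unfold Rdiv. ring.
  - destruct IH as [c [C0 HB]]; [intros; apply HV; lia|]. assert (HVm := HV m ltac:(lia)).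
    assert (P := N2_pos (V m) HVm).
    exists (2 * c + 2 * N2 t A mu (V m)). split; [lra|]. intros g d Hd Hg.
    destruct (HB g d Hd) as [H1 H2]; [intros; apply Hg; lia|].
    assert (H3 : inHr (fun z => g m * V m z)%C) by now apply inHr_scal.
    split; [now apply (inHr_plus (fun z => psum (fun l => g l * V l z)%C m))|].
    eapply Rle_trans; [apply (N2_plus (fun z => psum (fun l => g l * V l z)%C m) _ H1 H3)|].
    rewrite N2_scal.
    assert (Q : Cmod (g m) ^ 2 <= d ^ 2).
    { apply pow_incr. split; [apply Cmod_ge_0|apply Hg; lia]. }
    assert (Cmod (g m) ^ 2 * N2 t A mu (V m) <= d ^ 2 * N2 t A mu (V m))
      by (apply Rmult_le_compat_r; lra).
    lra.
Qed.

(** * Newton expansion modulo the subspace *)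

Section Newton.
Context {k : nat} {s : nat -> nat} {E : C -> C}.
Context (Hs : injb s (Datatypes.S k)) (SE : S E).
Context (HE : forall z, A z = (nu (fun i => t (s i)) (Datatypes.S k) z * E z)%C).

Let x := fun i => t (s i).

(** If [t n] is not a node, it is a zero of [E], and [ni_move] trades it for the last node. *)
Lemma swap_last (n : nat) : (forall i, (i < k)%nat -> n <> s i) ->
  exists G, S G /\ forall z, A z = (nu x k z * (z - t n) * G z)%C.
Proof.
  intros Hn. destruct (Nat.eq_dec n (s k)) as [->|Hk].
  - exists E. split; auto.
  - assert (E0 : E (t n) = 0%C).
    { assert (A0 : A (t n) = 0%C) by (apply A_zero; now exists n).
      rewrite HE in A0. apply Cmult_integral in A0. destruct A0 as [A0|A0]; [|auto].
      apply nu_neq in A0; [tauto|]. intros i Hi Ei. apply t_inj in Ei.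
      destruct (Nat.eq_dec i k) as [->|D]; [auto|]. apply (Hn i); auto. lia. }
    destruct (ni_move S E (t n) (x k) HS SE E0) as [G [HG EG]].
    exists G. split; auto. intros z.
    transitivity (nu x k z * ((z - t n) * G z))%C; [|ring]. rewrite EG, HE. simpl. unfold x. ring.
Qed.

(** These quotients by at most [k] of the [k + 1] nodes lie in the space; they will generate it
    modulo [S]. *)
Lemma newton_family : exists V : nat -> C -> C,
  (forall l, (l < k)%nat -> inHr (V l) /\
     (forall z, A z = (nu x (Datatypes.S l) z * V l z)%C)).
Proof.
  assert (H : forall l, exists V, (l < k)%nat -> inHr V /\
     (forall z, A z = (nu x (Datatypes.S l) z * V z)%C)).
  { intros l. destruct (Nat.lt_ge_cases l k) as [L|L].
    - destruct (newton_dual s l) as [V [H1 [H2 _]]].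
      { intros i j Hi Hj. apply Hs; lia. }
      now exists V.
    - exists A. intros; lia. }
  exists (fun l => proj1_sig (constructive_indefinite_description _ (H l))).
  intros l. exact (proj2_sig (constructive_indefinite_description _ (H l))).
Qed.

Context {V : nat -> C -> C}.
Context (HV : forall l, (l < k)%nat -> inHr (V l) /\
     (forall z, A z = (nu x (Datatypes.S l) z * V l z)%C)).

Lemma newton_step (l : nat) (z : C) : (Datatypes.S l < k)%nat ->
  V l z = ((z - x (Datatypes.S l)) * V (Datatypes.S l) z)%C.
Proof.
  intros Hl. destruct (HV l) as [H1 H2]; [lia|]. destruct (HV (Datatypes.S l) Hl) as [H3 H4].
  apply (nu_cancel x (Datatypes.S l) (V l) (fun z => (z - x (Datatypes.S l)) * V (Datatypes.S l) z)%C).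
  - intros y. apply hol_cont. now apply inHr_hol.
  - intros y. apply hol_cont, hol_mult; [apply hol_minus; [apply hol_id|apply hol_const]|].
    now apply inHr_hol.
  - intros y. rewrite <- H2, H4. simpl. ring.
Qed.

(** [z - t_n = (z - x_l) - (t_n - x_l)] turns each term into the difference of [nu_l(t_n) V_{l-1}]
    and [nu_{l+1}(t_n) V_l], with [A] in the place of [V_{-1}]. *)
Lemma newton_telescope (n j : nat) (z : C) : (j < k)%nat ->
  ((z - t n) * psum (fun l => nu x l (t n) * V l z) (Datatypes.S j)
    = A z - nu x (Datatypes.S j) (t n) * V j z)%C.
Proof.
  induction j as [|j IH]; intros Hj.
  - destruct (HV 0%nat Hj) as [_ H2]. rewrite H2. simpl. ring.
  - change (psum (fun l => nu x l (t n) * V l z)%C (Datatypes.S (Datatypes.S j)))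
      with (psum (fun l => nu x l (t n) * V l z)%C (Datatypes.S j)
        + nu x (Datatypes.S j) (t n) * V (Datatypes.S j) z)%C.
    rewrite Cmult_plus_distr_l, IH by lia. rewrite (newton_step j z Hj). simpl. ring.
Qed.

Lemma newton_telescope_all (n : nat) (z : C) : (0 < k)%nat ->
  ((z - t n) * psum (fun l => nu x l (t n) * V l z) k
    = A z - nu x k (t n) * V (pred k) z)%C.
Proof.
  intros Hk. assert (T := newton_telescope n (pred k) z ltac:(lia)).
  replace (Datatypes.S (pred k)) with k in T by lia. exact T.
Qed.

(* Newton's interpolation formula for [1 / (z - t_n)]. *)
Lemma newton_formula (n : nat) : exists G, S G /\
  (forall z, qn t A n z = (psum (fun l => nu x l (t n) * V l z) k + nu x k (t n) * G z)%C).
Proof.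
  assert (HC := ni_closed S HS).
  destruct (classic (exists i, (i < k)%nat /\ n = s i)) as [[i [Hi ->]]|Hn].
  - exists (fun _ => RtoC 0). split; [apply (sub_zero (S := S))|].
    intros z. rewrite Cmult_0_r, Cplus_0_r.
    apply (lin_cancel (qn t A (s i)) (fun z => psum (fun l => nu x l (t (s i)) * V l z)%C k) (t (s i))).
    + intros y. apply hol_cont, qn_hol.
    + intros y. apply hol_cont.
      assert (H : forall m, (m <= k)%nat -> hol (fun z => psum (fun l => nu x l (t (s i)) * V l z)%C m) y).
      { induction m as [|m IHm]; intros Hm; [apply (hol_const 0%C)|].
        apply (hol_plus (fun z => psum (fun l => nu x l (t (s i)) * V l z)%C m)); [apply IHm; lia|].
        apply hol_mult; [apply hol_const|]. apply inHr_hol. apply HV. lia. }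
      now apply H.
    + intros y. rewrite <- A_qn. rewrite newton_telescope_all by lia. change (t (s i)) with (x i). rewrite nu_zero by lia. ring.
  - destruct (swap_last n) as [G [HG EG]].
    { intros i Hi En. apply Hn. now exists i. }
    exists G. split; auto.
    apply (lin_cancel (qn t A n)
      (fun z => psum (fun l => nu x l (t n) * V l z) k + nu x k (t n) * G z)%C (t n)).
    + intros y. apply hol_cont, qn_hol.
    + intros y. apply ccont_plus; [|apply ccont_mult; [apply ccont_const|now apply ni_cont]].
      apply hol_cont.
      assert (H : forall m, (m <= k)%nat -> hol (fun z => psum (fun l => nu x l (t n) * V l z)%C m) y).
      { induction m as [|m IHm]; intros Hm; [apply (hol_const 0%C)|].
        apply (hol_plus (fun z => psum (fun l => nu x l (t n) * V l z)%C m)); [apply IHm; lia|].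
        apply hol_mult; [apply hol_const|]. apply inHr_hol. apply HV. lia. }
      now apply H.
    + intros y. rewrite <- A_qn. destruct (Nat.eq_dec k 0) as [K0|K0].
      * rewrite (EG y). rewrite K0. simpl. ring.
      * rewrite Cmult_plus_distr_l, newton_telescope_all by lia.
        assert (U : V (pred k) y = ((y - t n) * G y)%C).
        { destruct (HV (pred k)) as [H1 H2]; [lia|].
          replace (Datatypes.S (pred k)) with k in H2 by lia.
          apply (nu_cancel x k (V (pred k)) (fun y => (y - t n) * G y)%C).
          - intros u. apply hol_cont. now apply inHr_hol.
          - intros u. apply ccont_mult; [|now apply ni_cont].
            apply ccont_minus; [apply ccont_id|apply ccont_const].
          - intros u. rewrite <- H2, EG. ring. }
        rewrite U. ring.
Qed.

(** By [newton_formula], a partial sum of [sum a_n A / (z - t_n)] minus its partial moments times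
    the [V_l] is a combination of elements of [S]. Square summability of the [nu_l] makes the
    partial moments converge, and [S] is closed. *)
Lemma newton_spans : (forall l, (l < k)%nat -> gL2 t mu (nu x l)) ->
  forall F, inHr F -> S (fun z => F z - psum (fun l => mom t A (nu x l) F * V l z) k)%C.
Proof.
  intros Hg F HF. assert (HC := ni_closed S HS). set (a := residue t A F).
  set (m := fun M l => psum (fun n => a n * nu x l (t n))%C M).
  apply (sub_closed (S := S) (fun M z => lin M a z - psum (fun l => m M l * V l z) k)%C).
  - intros M.
    assert (HG : forall n, exists G, S G /\
      (forall z, qn t A n z = (psum (fun l => nu x l (t n) * V l z) k + nu x k (t n) * G z)%C))
      by apply newton_formula.
    set (G := fun n => proj1_sig (constructive_indefinite_description _ (HG n))).
    assert (G1 : forall n, S (G n)).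
    { intros n. unfold G. now destruct (constructive_indefinite_description _ (HG n)). }
    assert (G2 : forall n z, qn t A n z
      = (psum (fun l => nu x l (t n) * V l z) k + nu x k (t n) * G n z)%C).
    { intros n. unfold G. now destruct (constructive_indefinite_description _ (HG n)). }
    rewrite (fun_ext_C _ (fun z => psum (fun n => a n * nu x k (t n) * G n z) M)%C).
    + apply (sub_psum (S := S) (fun n z => a n * nu x k (t n) * G n z)%C). intros n _.
      now apply (sub_scal (S := S)).
    + intros z. unfold lin, m.
      rewrite (psum_ext (fun n => a n * qn t A n z)%C
        (fun n => psum (fun l => a n * nu x l (t n) * V l z) k + a n * nu x k (t n) * G n z)%C).
      * rewrite psum_plus, psum_exchange.
        rewrite (psum_ext (fun l => psum (fun n => a n * nu x l (t n) * V l z) M)%C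
          (fun l => psum (fun n => a n * nu x l (t n)) M * V l z)%C); [ring|].
        intros l _. rewrite (psum_ext _ (fun n => V l z * (a n * nu x l (t n)))%C) by (intros; ring).
        rewrite psum_scal. ring.
      * intros n _. rewrite G2.
        rewrite (psum_ext (fun l => a n * nu x l (t n) * V l z)%C
          (fun l => a n * (nu x l (t n) * V l z))%C) by (intros; ring).
        rewrite psum_scal. ring.
  - apply inHr_minus; auto.
    assert (H : forall j, (j <= k)%nat -> inHr (fun z => psum (fun l => mom t A (nu x l) F * V l z)%C j)).
    { induction j as [|j IHj]; intros Hj; [apply inHr_zero|].
      apply (inHr_plus (fun z => psum (fun l => mom t A (nu x l) F * V l z)%C j)); [apply IHj; lia|].
      apply inHr_scal, HV. lia. }
    now apply H.
  - assert (H : forall j, (j <= k)%nat ->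
      (forall M, inHr (fun z => lin M a z - psum (fun l => m M l * V l z) j)%C) /\
      inHr (fun z => F z - psum (fun l => mom t A (nu x l) F * V l z) j)%C /\
      convH t A mu (fun M z => lin M a z - psum (fun l => m M l * V l z) j)%C
        (fun z => F z - psum (fun l => mom t A (nu x l) F * V l z) j)%C).
    { induction j as [|j IHj]; intros Hj.
      - simpl. rewrite (fun_ext_C (fun z => F z - 0)%C F) by (intros; ring).
        assert (E1 : (fun M z => lin M a z - 0)%C = (fun M => lin M a)).
        { apply functional_extensionality. intros M. apply functional_extensionality. intros z. ring. }
        rewrite E1. split; [|split; [auto|now apply lin_conv]].
        intros M. rewrite (fun_ext_C (fun z => lin M a z - 0)%C (lin M a)) by (intros; ring).
        apply lin_inHr.
      - destruct IHj as [I1 [I2 I3]]; [lia|]. destruct (HV j) as [H1 _]; [lia|].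
        assert (J1 : forall M, inHr (fun z => (- m M j) * V j z)%C) by (intros; now apply inHr_scal).
        assert (J2 : inHr (fun z => (- mom t A (nu x j) F) * V j z)%C) by now apply inHr_scal.
        assert (J3 : convH t A mu (fun M z => (- m M j) * V j z)%C
          (fun z => (- mom t A (nu x j) F) * V j z)%C).
        { apply (convH_scal (fun M => (- m M j)%C)); auto. intros e He.
          destruct (csum_psum_lim (fun n => a n * nu x j (t n))%C e) as [N HN]; auto.
          - apply mom_csmb; auto. 
          - exists N. intros M HM. specialize (HN M HM). unfold mom. fold a.
            replace (- m M j - - csum (fun n => a n * nu x j (t n)))%C
              with (csum (fun n => a n * nu x j (t n)) - psum (fun n => a n * nu x j (t n)) M)%C
              by (unfold m; ring). exact HN. }
        assert (E1 : forall M, (fun z => lin M a z - psum (fun l => m M l * V l z) (Datatypes.S j))%C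
          = (fun z => (lin M a z - psum (fun l => m M l * V l z) j) + (- m M j) * V j z)%C).
        { intros M. apply functional_extensionality. intros z. simpl. ring. }
        assert (E2 : (fun z => F z - psum (fun l => mom t A (nu x l) F * V l z) (Datatypes.S j))%C
          = (fun z => (F z - psum (fun l => mom t A (nu x l) F * V l z) j)
              + (- mom t A (nu x j) F) * V j z)%C).
        { apply functional_extensionality. intros z. simpl. ring. }
        rewrite E2. split; [|split].
        + intros M. rewrite E1. now apply (inHr_plus (fun z => lin M a z - psum (fun l => m M l * V l z) j)%C).
        + now apply (inHr_plus (fun z => F z - psum (fun l => mom t A (nu x l) F * V l z) j)%C).
        + assert (E3 : (fun M z => lin M a z - psum (fun l => m M l * V l z) (Datatypes.S j))%C
            = (fun M z => (lin M a z - psum (fun l => m M l * V l z) j) + (- m M j) * V j z)%C)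
            by (apply functional_extensionality; exact E1).
          rewrite E3. now apply convH_plus. }
    now apply H.
Qed.

(* With weights [b_n = mu_n |nu_j(t_n)|^2 / sum], the averages of [A / (nu_j(z) (z - t_n))] tend to
   [0] in norm, while each of them differs from [V_j] by an element of [S]. *)
Lemma newton_unsummable (j : nat) : k = Datatypes.S j -> ~ gL2 t mu (nu x j) -> S (V j).
Proof.
  intros Hk Hj. assert (HC := ni_closed S HS).
  assert (HVj : inHr (V j)) by (apply HV; lia).
  apply sub_approx; auto. intros e He.
  destruct (N2_comb V j) as [c [C0 HB]]; [intros; apply HV; lia|].
  (* Prepares the final estimate [2 * (1 / r) + 2 * (1 / r)^2 * c <= e] for [r = INR K + 1]. *)
  destruct (nfloor_ex ((2 + 2 * c + 1) / e)) as [K [_ HK]].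
  { apply Rdiv_le_0_compat; lra. }
  set (r := INR K + 1). assert (Hr : 1 <= r) by (unfold r; generalize (pos_INR K); lra).
  destruct (finite_bound (fun i => Cmod (x i)) k) as [B Bx].
  destruct (t_far (r + B)) as [N0 HN0].
  assert (FAR : forall n i, (N0 <= n)%nat -> (i < k)%nat -> r <= Cmod (t n - x i)%C).
  { intros n i Hn Hi. specialize (HN0 n Hn). specialize (Bx i Hi).
    assert (T := Cmod_rev_triangle (t n) (x i)). lra. }
  set (w := fun n => mu n * Cmod (nu x j (t n)) ^ 2).
  assert (W0 : forall n, 0 <= w n).
  { intros n. apply Rmult_le_pos; [left; apply mu_pos|apply pow2_ge_0]. }
  (* Indices below [N0] are dropped because [nu x j (t n)] may vanish there; from [N0] on,
     [|nu_l / nu_j| <= 1 / r] for [l < j]. *)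
  set (wm := fun n => if Nat.leb N0 n then w n else 0).
  assert (WM0 : forall n, 0 <= wm n) by (intros n; unfold wm; destruct (Nat.leb N0 n); [auto|lra]).
  assert (exists M, r <= rsum wm M) as [M HM].
  { apply NNPP. intros Hn. apply Hj. apply ex_series_dom_ev with (N := N0) (v := wm).
    - intros n Hn0. split; [apply W0|]. unfold wm. apply Nat.leb_le in Hn0. rewrite Hn0.
      unfold w. lra.
    - apply ex_series_pos with r; auto. intros N. apply Rnot_lt_le. intros L. apply Hn.
      exists N. lra. }
  set (Om := rsum wm M) in *.
  set (be := fun n => wm n / Om).
  assert (BE0 : forall n, 0 <= be n) by (intros n; apply Rdiv_le_0_compat; [auto|lra]).
  assert (BE1 : rsum be M = 1).
  { unfold be. rewrite (rsum_ext _ (fun n => / Om * wm n)) by (intros; unfold Rdiv; ring).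
    rewrite rsum_scal. fold Om. field. lra. }
  set (b := fun n => (RtoC (be n) / nu x j (t n))%C).
  assert (NU : forall n, (N0 <= n)%nat -> nu x j (t n) <> 0%C).
  { intros n Hn. apply nu_neq. intros i Hi Ei. assert (T := FAR n i Hn ltac:(lia)).
    rewrite Ei, Cmod_self in T. lra. }
  assert (BEz : forall n, ~ (N0 <= n)%nat -> be n = 0).
  { intros n Hn. unfold be, wm. rewrite (proj2 (Nat.leb_gt N0 n)) by lia. unfold Rdiv. ring. }
  set (g := fun l => psum (fun n => b n * nu x l (t n))%C M).
  assert (HG : forall n, exists G, S G /\
      (forall z, qn t A n z = (psum (fun l => nu x l (t n) * V l z) k + nu x k (t n) * G z)%C))
      by apply newton_formula.
  set (G := fun n => proj1_sig (constructive_indefinite_description _ (HG n))).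
  assert (G1 : forall n, S (G n)).
  { intros n. unfold G. now destruct (constructive_indefinite_description _ (HG n)). }
  assert (G2 : forall n z, qn t A n z
      = (psum (fun l => nu x l (t n) * V l z) k + nu x k (t n) * G n z)%C).
  { intros n. unfold G. now destruct (constructive_indefinite_description _ (HG n)). }
  set (H := fun z => psum (fun n => - (RtoC (be n) * (t n - x j)) * G n z)%C M).
  assert (SH : S H).
  { apply (sub_psum (S := S) (fun n z => - (RtoC (be n) * (t n - x j)) * G n z)%C).
    intros n _. now apply (sub_scal (S := S)). }
  exists H. split; auto.
  (* Sum [newton_formula] with the coefficients [b n]: [V j] receives [rsum be M = 1], the lower
     [V l] receive the small numbers [g l], and the elements of [S] add up to [- H]. *)
  assert (ID : forall z, (H z - V j z = (-(1)) * lin M b z + psum (fun l => g l * V l z) j)%C).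
  { intros z.
    assert (L : lin M b z = (psum (fun l => g l * V l z) j + V j z - H z)%C).
    { unfold lin.
      rewrite (psum_ext (fun n => b n * qn t A n z)%C (fun n =>
         (psum (fun l => b n * nu x l (t n) * V l z) j + RtoC (be n) * V j z)
         + (-(1)) * (- (RtoC (be n) * (t n - x j)) * G n z))%C).
      - rewrite !psum_plus, psum_scal. fold (H z). rewrite psum_exchange.
        rewrite (psum_ext (fun n => RtoC (be n) * V j z)%C (fun n => V j z * RtoC (be n))%C)
          by (intros; ring).
        rewrite psum_scal, psum_RtoC, BE1.
        rewrite (psum_ext (fun l => psum (fun n => b n * nu x l (t n) * V l z) M)%C
          (fun l => g l * V l z)%C); [ring|].
        intros l _. rewrite (psum_ext _ (fun n => V l z * (b n * nu x l (t n)))%C) by (intros; ring).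
        rewrite psum_scal. unfold g. ring.
      - intros n _.
        rewrite (psum_ext (fun l => b n * nu x l (t n) * V l z)%C
          (fun l => b n * (nu x l (t n) * V l z))%C) by (intros; ring).
        rewrite psum_scal, G2.
        replace (psum (fun l => nu x l (t n) * V l z)%C k)
          with (psum (fun l => nu x l (t n) * V l z)%C j + nu x j (t n) * V j z)%C
          by (rewrite Hk at 1; reflexivity).
        replace (nu x k (t n)) with (nu x j (t n) * (t n - x j))%C by (rewrite Hk; reflexivity).
        destruct (Nat.le_gt_cases N0 n) as [Ln|Ln].
        + unfold b. field. now apply NU.
        + unfold b. rewrite BEz by lia. unfold Cdiv. ring. }
    rewrite L. ring. }
  assert (GB : forall l, (l < j)%nat -> Cmod (g l) <= / r).
  { intros l Hl. unfold g. eapply Rle_trans; [apply Cmod_psum|].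
    apply Rle_trans with (rsum (fun n => / r * be n) M).
    - apply rsum_le. intros n _. rewrite Cmod_mult. unfold b.
      destruct (Nat.le_gt_cases N0 n) as [Ln|Ln].
      + rewrite Cmod_div, Cmod_R, (Rabs_pos_eq (be n)) by auto.
        assert (P := proj1 (Cmod_gt_0 _) (NU n Ln)).
        assert (T := nu_ratio x (t n) r l j Hr Hl ltac:(intros; apply FAR; [auto|lia])).
        unfold Rdiv. rewrite Rmult_assoc, (Rmult_comm (/ r)). apply Rmult_le_compat_l; [auto|].
        apply Rmult_le_reg_l with (Cmod (nu x j (t n))); [auto|].
        rewrite <- Rmult_assoc, Rinv_r, Rmult_1_l by lra.
        apply Rmult_le_reg_r with r; [lra|]. rewrite Rmult_assoc, Rinv_l, Rmult_1_r by lra. exact T.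
      + rewrite BEz by lia. replace (0 / nu x j (t n))%C with (RtoC 0) by (unfold Cdiv; ring).
        rewrite Cmod_0. lra.
    - rewrite rsum_scal, BE1. lra. }
  assert (Hr' : / r <= 1) by (rewrite <- Rinv_1; apply Rinv_le_contravar; lra).
  assert (Hr0 : 0 < / r) by (apply Rinv_0_lt_compat; lra).
  destruct (HB g (/ r)) as [HB1 HB2]; [lra|exact GB|].
  (* [|b n|^2 / mu n = be n / Om], so the squared norm is [1 / Om], and divergence of the series
     made [Om] at least [r]. *)
  assert (NL : N2 t A mu (lin M b) <= / r).
  { rewrite N2_lin. apply Rle_trans with (rsum (fun n => / Om * be n) M).
    - apply rsum_le. intros n _. unfold b. destruct (Nat.le_gt_cases N0 n) as [Ln|Ln].
      + assert (P := proj1 (Cmod_gt_0 _) (NU n Ln)). assert (PM := mu_pos n).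
        rewrite Cmod_div, Cmod_R, (Rabs_pos_eq (be n)) by auto.
        right. unfold be, wm. rewrite (proj2 (Nat.leb_le N0 n)) by auto. unfold w. field. lra.
      + rewrite BEz by lia. replace (0 / nu x j (t n))%C with (RtoC 0) by (unfold Cdiv; ring).
        rewrite Cmod_0. unfold Rdiv. lra.
    - rewrite rsum_scal, BE1, Rmult_1_r. apply Rinv_le_contravar; lra. }
  rewrite (N2_ext _ _ ID).
  eapply Rle_trans; [apply N2_plus; [apply inHr_scal, lin_inHr|exact HB1]|].
  rewrite N2_scal.
  assert (T1 : Cmod (-(1))%C ^ 2 = 1) by (rewrite Cmod_opp, Cmod_1; ring). rewrite T1.
  assert (T2 : (/ r) ^ 2 * c <= / r * c) by (apply Rmult_le_compat_r; [auto|nra]).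
  assert (T3 : / r * (2 + 2 * c + 1) <= e).
  { apply Rmult_le_reg_l with r; [lra|]. rewrite <- Rmult_assoc, Rinv_r, Rmult_1_l by lra.
    fold r in HK. apply Rmult_lt_compat_r with (r := e) in HK; [|auto].
    replace ((2 + 2 * c + 1) / e * e) with (2 + 2 * c + 1) in HK by (field; lra). lra. }
  lra.
Qed.

End Newton.
End NI.
End MinimalSupport.

(** * Moving zeros to poles *)

Lemma dependent_choice_nat {X : Type} (P : nat -> X -> Prop) (Q : nat -> X -> X -> Prop) (x0 : X) :
  P 0%nat x0 -> (forall k x, P k x -> exists y, P (S k) y /\ Q k x y) ->
  exists f : nat -> X, f 0%nat = x0 /\ forall k, P k (f k) /\ Q k (f k) (f (S k)).
Proof.
  intros H0 Hs.
  set (st := fun k (s : {x | P k x}) =>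
    constructive_indefinite_description _ (Hs k (proj1_sig s) (proj2_sig s))).
  set (f := fix f k : {x | P k x} := match k with
    | O => exist _ x0 H0
    | S k => exist _ (proj1_sig (st k (f k))) (proj1 (proj2_sig (st k (f k)))) end).
  exists (fun k => proj1_sig (f k)). split; [reflexivity|]. intros k.
  split; [exact (proj2_sig (f k))|]. exact (proj2 (proj2_sig (st k (f k)))).
Qed.

Lemma finite_eventually (P : nat -> nat -> Prop) (N : nat) :
  (forall n, (n < N)%nat -> exists K, forall k, (K <= k)%nat -> P n k) ->
  exists K, forall n k, (n < N)%nat -> (K <= k)%nat -> P n k.
Proof.
  induction N as [|N IH]; intros H; [exists O; intros; lia|].
  destruct IH as [K1 H1]; [intros; apply H; lia|]. destruct (H N ltac:(lia)) as [K2 H2].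
  exists (max K1 K2). intros n k Hn Hk. destruct (Nat.eq_dec n N) as [->|E]; [apply H2; lia|].
  apply H1; lia.
Qed.

Section Pairing.
Context {t : nat -> C} {A : C -> C} {mu : nat -> R}.
Context {Hdata : admissible_data t mu} {HA : generating_function t A}.
Context {S : (C -> C) -> Prop} {HS : nearly_invariant t A mu S}.

Notation inHr := (@inHr t A mu).
Notation res := (residue t A).

(* The zeros [s i] are moved to [t i], one after the other; the limit has finitely many residues. *)
Lemma move_zeros (F : C -> C) (s : nat -> C) (eps : nat -> R) (N0 : nat) :
  S F -> (exists z, F z <> 0%C) ->
  (forall i, (N0 <= i)%nat -> F (s i) = 0%C) ->
  (forall i j, (N0 <= i)%nat -> (N0 <= j)%nat -> i <> j -> s i <> s j) ->
  (forall n, 0 <= eps n) -> ex_series eps ->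
  (forall i n, (N0 <= i)%nat -> n <> i -> t n <> s i /\
     Cmod (s i - t i)%C <= eps i * Cmod (t n - s i)%C) ->
  exists d, fin_supp (t := t) (A := A) S d.
Proof.
  intros HF HN Hz Hd He0 Hes Hpair.
  assert (HFi : inHr F) by now apply ni_inHr.
  assert (exists n0, res F n0 <> 0%C) as [n0 Hn0].
  { apply NNPP. intros H. destruct HN as [z Hz']. apply Hz'. apply zero_of_res; auto. intros n.
    assert (R0 : res F n = 0%C) by (apply NNPP; intros R0; apply H; now exists n).
    unfold residue in R0. replace (F (t n)) with (F (t n) / alpha t A n * alpha t A n)%C.
    - rewrite R0. ring.
    - field. apply alpha_neq. }
  destruct (Series_tail_small eps (1 / 2) ltac:(lra) He0 Hes) as [N1 HN1].
  (* The relative errors beyond [N] sum to at most [1 / 2] and [n0 < N], so the residue at [t n0] is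
     perturbed but never killed. *)
  set (N := max (max N0 N1) (Datatypes.S n0)).
  set (ep := fun k => eps (N + k)%nat).
  assert (EP : ex_series ep) by now apply ex_series_incr_n.
  assert (EP0 : forall k, 0 <= ep k) by (intros; apply He0).
  assert (Ek : forall k, rsum ep k <= 1 / 2).
  { intros k. eapply Rle_trans; [now apply rsum_Series|]. apply HN1. lia. }
  destruct (dependent_choice_nat
    (fun k G => S G /\ forall j, (N + k <= j)%nat -> G (s j) = 0%C)
    (fun k G G' => forall z, ((z - s (N + k)%nat) * G' z = (z - t (N + k)%nat) * G z)%C) F)
    as [f [f0 Hf]].
  { split; auto. intros j Hj. apply Hz. lia. }
  { intros k G [HG HGz]. destruct (ni_move S G (s (N + k)%nat) (t (N + k)%nat) HS HG) as [G' [HG' EG']].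
    - apply HGz. lia.
    - exists G'. split; [split; [auto|]|auto]. intros j Hj. specialize (EG' (s j)).
      rewrite (HGz j), Cmult_0_r in EG' by lia. apply Cmult_integral in EG'.
      destruct EG' as [E|E]; [|auto]. apply Cminus_eq0 in E. exfalso. revert E. apply Hd; lia. }
  set (c := fun k n => res (f k) n).
  assert (SF : forall k, S (f k)) by (intros k; apply Hf).
  (* With [i = N + k], the residue at [t n] is multiplied by [(t n - t i) / (t n - s i)], which
     differs from [1] by [(s i - t i) / (t n - s i)]. *)
  assert (C1 : forall k n, n <> (N + k)%nat ->
     Cmod (c (Datatypes.S k) n - c k n)%C <= ep k * Cmod (c k n)).
  { intros k n Hn. destruct (Hpair (N + k)%nat n ltac:(lia) Hn) as [P1 P2].
    destruct (Hf k) as [_ E]. specialize (E (t n)). assert (Q := Cmod_sub_pos _ _ P1).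
    assert (Q' := Cminus_neq0 _ _ P1).
    assert (R1 : ((t n - s (N + k)%nat) * c (Datatypes.S k) n = (t n - t (N + k)%nat) * c k n)%C).
    { unfold c, residue. transitivity ((t n - s (N + k)%nat) * f (Datatypes.S k) (t n) / alpha t A n)%C.
      - field. apply alpha_neq.
      - rewrite E. field. apply alpha_neq. }
    assert (R2 : ((t n - s (N + k)%nat) * (c (Datatypes.S k) n - c k n)
      = (s (N + k)%nat - t (N + k)%nat) * c k n)%C).
    { transitivity ((t n - s (N + k)%nat) * c (Datatypes.S k) n - (t n - s (N + k)%nat) * c k n)%C;
        [ring|]. rewrite R1. ring. }
    apply (f_equal Cmod) in R2. rewrite !Cmod_mult in R2.
    apply Rmult_le_reg_l with (Cmod (t n - s (N + k)%nat)%C); [auto|]. rewrite R2.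
    fold (ep k) in P2.
    apply Rle_trans with (ep k * Cmod (t n - s (N + k)%nat)%C * Cmod (c k n)); [|right; ring].
    apply Rmult_le_compat_r; [apply Cmod_ge_0|auto]. }
  (* The zero that arrives at [t i] kills the residue there. If [s i = t i] already, nothing moves
     and the residue was [0] before. *)
  assert (C2 : forall k, c (Datatypes.S k) (N + k)%nat = 0%C).
  { intros k. unfold c, residue. destruct (Hf k) as [[_ Z] E].
    replace (f (Datatypes.S k) (t (N + k)%nat)) with (RtoC 0); [unfold Cdiv; ring|]. symmetry.
    destruct (classic (t (N + k)%nat = s (N + k)%nat)) as [Et|Et].
    - rewrite (lin_cancel (f (Datatypes.S k)) (f k) (t (N + k)%nat)).
      + rewrite Et. apply Z. lia.
      + intros z. now apply ni_cont.
      + intros z. now apply ni_cont.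
      + intros z. rewrite Et at 1. apply E.
    - specialize (E (t (N + k)%nat)).
      replace (t (N + k)%nat - t (N + k)%nat)%C with (RtoC 0) in E by ring. rewrite Cmult_0_l in E.
      apply Cmult_integral in E. destruct E as [E|E]; [|auto]. apply Cminus_eq0 in E. contradiction. }
  assert (C3 : forall k n, (N <= n < N + k)%nat -> c k n = 0%C).
  { induction k as [|k IH]; intros n Hn; [lia|]. destruct (Nat.eq_dec n (N + k)) as [->|E]; [apply C2|].
    assert (T := C1 k n E). rewrite IH, Cmod_0, Rmult_0_r in T by lia.
    replace (c (Datatypes.S k) n - 0)%C with (c (Datatypes.S k) n) in T by ring.
    apply Cmod_eq_0. assert (P := Cmod_ge_0 (c (Datatypes.S k) n)). lra. }
  assert (C4 : forall k n, Cmod (c k n) <= (1 + 2 * rsum ep k) * Cmod (c 0%nat n)).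
  { induction k as [|k IH]; intros n; [simpl; lra|]. simpl rsum.
    assert (P0 := Cmod_ge_0 (c 0%nat n)). assert (P1 := Cmod_ge_0 (c k n)).
    assert (PE := rsum_pos ep k EP0). assert (PK := EP0 k). assert (PB := Ek k).
    destruct (Nat.eq_dec n (N + k)) as [->|E].
    - rewrite C2, Cmod_0. apply Rmult_le_pos; lra.
    - assert (T := C1 k n E). assert (T2 := Cmod_rev_triangle (c (Datatypes.S k) n) (c k n)).
      specialize (IH n).
      assert (ep k * Cmod (c k n) <= ep k * (2 * Cmod (c 0%nat n))); [|lra].
      apply Rmult_le_compat_l; [auto|]. eapply Rle_trans; [apply IH|].
      apply Rmult_le_compat_r; lra. }
  assert (C5 : forall k n, Cmod (c k n) <= 2 * Cmod (c 0%nat n)).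
  { intros k n. eapply Rle_trans; [apply C4|]. apply Rmult_le_compat_r; [apply Cmod_ge_0|].
    assert (PB := Ek k). lra. }
  assert (C6 : forall k n, (n < N)%nat -> (1 - rsum ep k) * Cmod (c 0%nat n) <= Cmod (c k n)).
  { induction k as [|k IH]; intros n Hn; [simpl; lra|]. simpl rsum.
    assert (T := C1 k n ltac:(lia)). assert (T2 := Cmod_rev_triangle (c k n) (c (Datatypes.S k) n)).
    rewrite Cmod_sub_sym in T. specialize (IH n Hn).
    assert (P0 := Cmod_ge_0 (c 0%nat n)). assert (PE := rsum_pos ep k EP0).
    assert (PK := EP0 k). assert (PB := Ek k).
    assert (Q1 : (1 - ep k) * Cmod (c k n) <= Cmod (c (Datatypes.S k) n)) by lra.
    assert (PB' := Ek (Datatypes.S k)). simpl in PB'.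
    assert (Q2 : (1 - ep k) * ((1 - rsum ep k) * Cmod (c 0%nat n)) <= (1 - ep k) * Cmod (c k n))
      by (apply Rmult_le_compat_l; lra).
    assert (Q3 : (1 - (rsum ep k + ep k)) * Cmod (c 0%nat n)
       <= (1 - ep k) * ((1 - rsum ep k) * Cmod (c 0%nat n))).
    { rewrite <- Rmult_assoc. apply Rmult_le_compat_r; [auto|]. nra. }
    lra. }
  set (L := fun n => (c 0%nat n + csum (fun k => c (Datatypes.S k) n - c k n))%C).
  assert (CV : forall n e, (n < N)%nat -> 0 < e ->
     exists K, forall k, (K <= k)%nat -> Cmod (L n - c k n)%C <= e).
  { intros n e Hn He.
    assert (CS : csmb (fun k => c (Datatypes.S k) n - c k n)%C).
    { apply csmb_dom with (fun k => 2 * Cmod (c 0%nat n) * ep k).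
      - intros k. eapply Rle_trans; [apply C1; lia|]. rewrite Rmult_comm.
        apply Rmult_le_compat_r; [auto|]. apply C5.
      - now apply ex_series_mul. }
    destruct (csum_psum_lim _ e CS He) as [K HK]. exists K. intros k Hk. specialize (HK k Hk).
    assert (TS : forall k, psum (fun k => c (Datatypes.S k) n - c k n)%C k = (c k n - c 0%nat n)%C).
    { clear. induction k as [|k IH]; simpl; [ring|]. rewrite IH. ring. }
    rewrite TS in HK. unfold L.
    replace (c 0%nat n + csum (fun k => c (Datatypes.S k) n - c k n) - c k n)%C
      with (csum (fun k => c (Datatypes.S k) n - c k n) - (c k n - c 0%nat n))%C by ring.
    exact HK. }
  destruct (lin_peval (t := t) (A := A) N L) as [p Hp].
  exists N, (fun i => i), (lin (t := t) (A := A) N L), p.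
  split; [now intros i j|]. split; [|split; [|exact Hp]].
  - assert (HLi : inHr (lin N L)) by apply lin_inHr.
    apply sub_approx; auto. intros e He.
    set (u0 := fun n => 4 * (Cmod (c 0%nat n) ^ 2 / mu n)).
    assert (U0 : forall n, 0 <= u0 n).
    { intros n. apply Rmult_le_pos; [lra|]. apply Rdiv_le_0_compat; [apply pow2_ge_0|apply mu_pos]. }
    assert (U1 : ex_series u0).
    { apply ex_series_mul. unfold c. rewrite f0. apply HFi. }
    destruct (Series_tail_small u0 (e / 2) ltac:(lra) U0 U1) as [K1 HK1].
    set (B := rsum (fun n => / mu n) N).
    assert (B0 : 0 <= B) by (apply rsum_pos; intros n; left; apply Rinv_0_lt_compat, mu_pos).
    set (eta := Rmin 1 (e / (2 * (B + 1)))).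
    assert (ET : 0 < eta) by (apply Rmin_pos; [lra|apply Rdiv_lt_0_compat; lra]).
    destruct (finite_eventually (fun n k => Cmod (L n - c k n)%C <= eta) N) as [K2 HK2].
    { intros n Hn. now apply CV. }
    (* Residues of [f k] below [N] are close to their limits, those from [N] to [N + k - 1] vanish
       by [C3], and the later ones are at most twice the original ones, whose tail is small. *)
    set (k := max K1 K2). exists (f k). split; [apply SF|].
    unfold N2.
    set (u := fun n => Cmod (res (fun z => f k z - lin (t := t) (A := A) N L z)%C n) ^ 2 / mu n).
    assert (Ru : forall n, u n = Cmod (c k n - (if Nat.ltb n N then L n else 0))%C ^ 2 / mu n).
    { intros n. unfold u. rewrite res_minus, res_lin. reflexivity. }
    assert (Hu : ex_series u).
    { apply (inHr_minus (f k) (lin N L)); auto. now apply ni_inHr. }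
    rewrite (Series_tail u (N + k) Hu).
    assert (Z : rsum u (N + k) = rsum u N).
    { assert (ZZ : forall m, (m <= k)%nat -> rsum u (N + m) = rsum u N).
      { induction m as [|m IH]; intros Hm; [now rewrite Nat.add_0_r|].
        rewrite Nat.add_succ_r. simpl. rewrite IH by lia. rewrite Ru, C3 by lia.
        rewrite (proj2 (Nat.ltb_ge (N + m) N)) by lia.
        replace (0 - 0)%C with (RtoC 0) by ring. rewrite Cmod_0. unfold Rdiv. ring. }
      now apply ZZ. }
    rewrite Z.
    assert (Q1 : rsum u N <= e / 2).
    { apply Rle_trans with (rsum (fun n => eta ^ 2 * / mu n) N).
      - apply rsum_le. intros n Hn. rewrite Ru. apply Nat.ltb_lt in Hn as Hn'. rewrite Hn'.
        apply Rmult_le_compat_r; [left; apply Rinv_0_lt_compat, mu_pos|].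
        apply pow_incr. split; [apply Cmod_ge_0|]. rewrite Cmod_sub_sym. apply HK2; [auto|lia].
      - rewrite rsum_scal. fold B.
        assert (E1 : eta <= 1) by apply Rmin_l. assert (E2 : eta <= e / (2 * (B + 1))) by apply Rmin_r.
        apply Rle_trans with (e / (2 * (B + 1)) * (B + 1)).
        + apply Rmult_le_compat; try lra. apply pow2_ge_0. nra.
        + right. field. lra. }
    assert (Q2 : Series (fun n => u (N + k + n)%nat) <= e / 2).
    { eapply Rle_trans; [|apply (HK1 (N + k)%nat); lia]. apply Series_le.
      - intros n. split.
        + rewrite Ru. apply Rdiv_le_0_compat; [apply pow2_ge_0|apply mu_pos].
        + rewrite Ru. rewrite (proj2 (Nat.ltb_ge (N + k + n) N)) by lia.
          replace (c k (N + k + n)%nat - 0)%C with (c k (N + k + n)%nat) by ring.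
          unfold u0, Rdiv. rewrite <- Rmult_assoc.
          apply Rmult_le_compat_r; [left; apply Rinv_0_lt_compat, mu_pos|].
          replace (4 * Cmod (c 0%nat (N + k + n)%nat) ^ 2)
            with ((2 * Cmod (c 0%nat (N + k + n)%nat)) ^ 2) by ring.
          apply pow_incr. split; [apply Cmod_ge_0|apply C5].
      - now apply (ex_series_incr_n u0). }
    lra.
  - exists (t n0). intros Z0.
    assert (R0 : res (lin (t := t) (A := A) N L) n0 = 0%C) by (unfold residue; rewrite Z0; unfold Cdiv; ring).
    rewrite (res_lin (mu := mu)) in R0. rewrite (proj2 (Nat.ltb_lt n0 N)) in R0 by lia.
    assert (P := proj1 (Cmod_gt_0 _) Hn0).
    assert (E0 : c 0%nat n0 = res F n0) by (unfold c; now rewrite f0).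
    destruct (CV n0 (Cmod (res F n0) / 4)) as [K HK]; [lia|lra|].
    specialize (HK K (le_n _)). rewrite R0 in HK.
    replace (0 - c K n0)%C with (- c K n0)%C in HK by ring. rewrite Cmod_opp in HK.
    assert (T := C6 K n0 ltac:(lia)). rewrite E0 in T. assert (PB := Ek K). nra.
Qed.

End Pairing.

(** * Density of the polynomials *)

Section Density.
Context {t : nat -> C} {A : C -> C} {mu : nat -> R}.
Context {Hdata : admissible_data t mu} {HA : generating_function t A}.

Notation inHr := (@inHr t A mu).
Notation res := (residue t A).
Notation nrm2 d := (Series (fun n => Cmod (d n) ^ 2 * mu n)).
Notation L2 := (inL2 t mu).

Lemma L2_plus (d e : nat -> C) : L2 d -> L2 e -> L2 (fun n => d n + e n)%C.
Proof.
  intros Hd He. apply ex_series_dom with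
    (fun n => 2 * (Cmod (d n) ^ 2 * mu n) + 2 * (Cmod (e n) ^ 2 * mu n)).
  - intros n. assert (P := mu_pos n). split; [apply Rmult_le_pos; [apply pow2_ge_0|lra]|].
    rewrite <- !Rmult_assoc, <- Rmult_plus_distr_r. apply Rmult_le_compat_r; [lra|apply Cmod_sq_plus].
  - apply ex_series_add; now apply ex_series_mul.
Qed.

Lemma L2_scal (k : C) (d : nat -> C) : L2 d -> L2 (fun n => k * d n)%C.
Proof.
  intros Hd. apply rex_ext with (fun n => Cmod k ^ 2 * (Cmod (d n) ^ 2 * mu n)).
  - intros n. rewrite Cmod_mult. ring.
  - now apply ex_series_mul.
Qed.

Lemma L2_ext (d e : nat -> C) : (forall n, d n = e n) -> L2 d -> L2 e.
Proof. intros H. apply rex_ext. intros n. now rewrite H. Qed.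

Lemma L2_minus (d e : nat -> C) : L2 d -> L2 e -> L2 (fun n => d n - e n)%C.
Proof.
  intros Hd He. apply L2_ext with (fun n => d n + (-(1)) * e n)%C; [intros; ring|].
  apply L2_plus; auto. now apply L2_scal.
Qed.

Lemma nrm2_pos (d : nat -> C) : L2 d -> 0 <= nrm2 d.
Proof.
  intros Hd. apply Series_pos; auto. intros n.
  apply Rmult_le_pos; [apply pow2_ge_0|left; apply mu_pos].
Qed.

Lemma pair_csmb (d q : nat -> C) : L2 d -> L2 q -> csmb (fun n => Cconj (d n) * RtoC (mu n) * q n)%C.
Proof.
  intros Hd Hq. apply csmb_dom with (fun n => Cmod (d n) ^ 2 * mu n + Cmod (q n) ^ 2 * mu n).
  - intros n. assert (P := mu_pos n). rewrite !Cmod_mult, Cmod_conj, Cmod_R, Rabs_pos_eq by lra.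
    assert (T := pow2_ge_0 (Cmod (d n) - Cmod (q n))).
    assert (T1 := pow2_ge_0 (Cmod (d n))). assert (T2 := pow2_ge_0 (Cmod (q n))).
    replace (Cmod (d n) * mu n * Cmod (q n)) with (Cmod (d n) * Cmod (q n) * mu n) by ring.
    rewrite <- Rmult_plus_distr_r. apply Rmult_le_compat_r; lra.
  - now apply ex_series_add.
Qed.

Lemma pair_bound (d q : nat -> C) (s : R) : 0 < s -> L2 d -> L2 q ->
  Cmod (csum (fun n => Cconj (d n) * RtoC (mu n) * q n)%C) <= 2 * (s * nrm2 d + / s * nrm2 q).
Proof.
  intros Hs Hd Hq. rewrite <- !Series_scal_l, <- Series_plus by now apply ex_series_mul.
  apply csum_bound_dom; [|apply ex_series_add; now apply ex_series_mul].
  intros n. assert (P := mu_pos n). rewrite !Cmod_mult, Cmod_conj, Cmod_R, Rabs_pos_eq by lra.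
  eapply Rle_trans; [|right; apply Rmult_plus_distr_r || reflexivity].
  assert (T := amgm (Cmod (d n)) (Cmod (q n)) (/ s) (Rinv_0_lt_compat _ Hs)).
  unfold Rdiv in T. rewrite Rinv_inv in T.
  replace (Cmod (d n) * mu n * Cmod (q n)) with (Cmod (d n) * Cmod (q n) * mu n) by ring.
  replace (s * (Cmod (d n) ^ 2 * mu n) + / s * (Cmod (q n) ^ 2 * mu n))
    with ((Cmod (d n) ^ 2 * s + / s * Cmod (q n) ^ 2) * mu n) by ring.
  apply Rmult_le_compat_r; lra.
Qed.

Lemma pair_self (d : nat -> C) : L2 d ->
  csum (fun n => Cconj (d n) * RtoC (mu n) * d n)%C = RtoC (nrm2 d).
Proof.
  intros Hd. unfold csum, RtoC. f_equal.
  - apply Series_ext. intros n. rewrite Cmod2_alt. unfold Re, Im. destruct (d n); simpl. ring.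
  - apply Series_0. intros n. destruct (d n); simpl. ring.
Qed.

(** The sequence [d = conj a / mu] lies in [L^2(mu)] and is orthogonal to the polynomials, so its
    squared norm is its inner product with [d - p] for every polynomial [p]; density makes this
    arbitrarily small. *)
Lemma dense_annihilator (F : C -> C) : polys_in_and_dense t mu -> inHr F ->
  (forall p, mom t A (peval p) F = 0%C) -> forall z, F z = 0%C.
Proof.
  intros [HP HD] HF HM. set (a := res F).
  set (d := fun n => (Cconj (a n) / RtoC (mu n))%C).
  assert (MN : forall n, RtoC (mu n) <> 0%C).
  { intros n E. apply RtoC_inj in E. assert (P := mu_pos n). lra. }
  assert (Ea : forall n, a n = (Cconj (d n) * RtoC (mu n))%C).
  { intros n. unfold d. assert (P := mu_pos n). destruct (a n) as [u v].
    unfold Cconj, Cdiv, Cinv, Cmult, RtoC; simpl. f_equal; field; lra. }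
  assert (Hd : L2 d).
  { apply rex_ext with (2 := proj1 HF). fold a. intros n. rewrite (Ea n), Cmod_mult, Cmod_conj, Cmod_R.
    assert (P := mu_pos n). rewrite Rabs_pos_eq by lra. field. lra. }
  assert (D0 := nrm2_pos d Hd).
  assert (Z : nrm2 d = 0).
  { apply Rle_antisym; [|auto]. apply le_epsilon. intros e He. rewrite Rplus_0_l.
    (* With [s = 1 / 4], [pair_bound] reads [nrm2 d <= nrm2 d / 2 + 8 * nrm2 (d - p)], hence
       [e / 16]. *)
    destruct (HD d Hd (e / 16)) as [p Hp]; [lra|].
    assert (Hq := HP p).
    assert (Hdq := L2_minus _ _ Hd Hq).
    assert (E : csum (fun n => Cconj (d n) * RtoC (mu n) * (d n - peval p (t n)))%C = RtoC (nrm2 d)).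
    { rewrite <- (pair_self d Hd). rewrite (csum_ext _ (fun n =>
        Cconj (d n) * RtoC (mu n) * d n - res F n * peval p (t n))%C).
      - rewrite csum_minus.
        + specialize (HM p). unfold mom in HM. rewrite HM. ring.
        + now apply pair_csmb.
        + apply csmb_ext with (2 := pair_csmb d _ Hd Hq). intros n. fold (a n). now rewrite Ea.
      - intros n. fold (a n). rewrite (Ea n). ring. }
    assert (B := pair_bound d _ (1 / 4) ltac:(lra) Hd Hdq). cbv beta in B. rewrite E, Cmod_R, Rabs_pos_eq in B by auto.
    replace (/ (1 / 4)) with 4 in B by lra. lra. }
  apply zero_of_res; auto. intros n.
  assert (Dn : Cmod (d n) ^ 2 * mu n <= 0).
  { rewrite <- Z. apply (Series_term (fun n => Cmod (d n) ^ 2 * mu n)); auto.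
    intros m. apply Rmult_le_pos; [apply pow2_ge_0|left; apply mu_pos]. }
  assert (P := mu_pos n). assert (d0 : d n = 0%C).
  { apply Cmod_eq_0. assert (T := pow2_ge_0 (Cmod (d n))).
    assert (T2 : Cmod (d n) ^ 2 = 0) by nra. nra. }
  assert (A0 : a n = 0%C).
  { rewrite Ea, d0. unfold Cconj; simpl. rewrite Ropp_0. change (RtoC 0 * RtoC (mu n) = 0)%C. ring. }
  unfold a, residue in A0. replace (F (t n)) with (F (t n) / alpha t A n * alpha t A n)%C.
  - rewrite A0. ring.
  - field. apply alpha_neq.
Qed.

Lemma expand_sq (e q : nat -> C) (s : C) : L2 e -> L2 q ->
  nrm2 (fun n => e n - s * q n)%C
    = nrm2 e - 2 * fst (s * csum (fun n => Cconj (e n) * RtoC (mu n) * q n))%C + Cmod s ^ 2 * nrm2 q.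
Proof.
  intros He Hq. assert (CS := pair_csmb e q He Hq).
  rewrite <- csum_scal by auto.
  assert (CS' := csmb_scal s _ CS). destruct (csmb_parts _ CS') as [CP _].
  unfold csum; simpl fst. rewrite <- !Series_scal_l.
  rewrite <- Series_minus, <- Series_plus.
  - apply Series_ext. intros n. rewrite !Cmod2_alt. unfold Re, Im.
    destruct (e n), (q n), s; simpl. ring.
  - apply (ex_series_minus (fun n => Cmod (e n) ^ 2 * mu n)); auto.
    apply (ex_series_mul 2) in CP. exact CP.
  - now apply ex_series_mul.
  - exact He.
  - apply (ex_series_mul 2) in CP. exact CP.
Qed.

Lemma parallelogram (d e : nat -> C) : L2 d -> L2 e ->
  nrm2 (fun n => d n - e n)%C = 2 * nrm2 d + 2 * nrm2 e - 4 * nrm2 (fun n => (d n + e n) / 2)%C.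
Proof.
  intros Hd He.
  assert (Hm : L2 (fun n => (d n + e n) / 2)%C).
  { apply L2_ext with (fun n => / 2 * (d n + e n))%C; [intros; unfold Cdiv; ring|].
    apply L2_scal. now apply L2_plus. }
  rewrite <- !Series_scal_l, <- Series_plus, <- Series_minus.
  - apply Series_ext. intros n. rewrite !Cmod2_alt. unfold Re, Im.
    destruct (d n), (e n). unfold Cdiv, Cinv, Cmult, Cplus; simpl. field.
  - apply ex_series_add; now apply ex_series_mul.
  - now apply ex_series_mul.
  - now apply ex_series_mul.
  - now apply ex_series_mul.
Qed.

(* By the parallelogram law, a sequence minimizing the distance to the polynomials is Cauchy. *)
Lemma not_dense_annihilator : (forall p, L2 (fun n => peval p (t n))) -> ~ polys_in_and_dense t mu ->
  exists F, inHr F /\ (exists z, F z <> 0%C) /\ forall p, mom t A (peval p) F = 0%C.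
Proof.
  intros HP HND.
  assert (exists d ep, L2 d /\ 0 < ep /\ forall p, ep <= nrm2 (fun n => d n - peval p (t n))%C)
    as [d [ep [Hd [Hep HB]]]].
  { apply NNPP. intros H. apply HND. split; auto. intros d Hd eps He. apply NNPP. intros H'.
    apply H. exists d, eps. split; auto. split; auto. intros p. apply Rnot_lt_le. intros L.
    apply H'. now exists p. }
  (* [completeness] yields suprema, so the infimum [de] of the squared distances is obtained as
     minus a supremum. *)
  destruct (completeness (fun x => exists p, x = - nrm2 (fun n => d n - peval p (t n))%C)) as [m [M1 M2]].
  { exists (- ep). intros x [p ->]. specialize (HB p). lra. }
  { exists (- nrm2 (fun n => d n - peval [] (t n))%C). now exists []. }
  set (de := - m).
  assert (D1 : forall p, de <= nrm2 (fun n => d n - peval p (t n))%C).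
  { intros p. unfold de.
    assert (T : - nrm2 (fun n => d n - peval p (t n))%C <= m) by (apply M1; now exists p). lra. }
  assert (D2 : forall k : nat, exists p, nrm2 (fun n => d n - peval p (t n))%C <= de + / (INR k + 1)).
  { intros k. apply NNPP. intros H. assert (K : 0 < / (INR k + 1)).
    { apply Rinv_0_lt_compat. generalize (pos_INR k). lra. }
    assert (T : m <= m - / (INR k + 1)); [|lra]. apply M2. intros x [p ->].
    apply Rnot_lt_le. intros L. apply H. exists p. unfold de. lra. }
  assert (Dep : ep <= de).
  { unfold de. assert (T : m <= - ep); [|lra]. apply M2. intros x [p ->]. specialize (HB p). lra. }
  set (pk := fun k => proj1_sig (constructive_indefinite_description _ (D2 k))).
  set (ek := fun k n => (d n - peval (pk k) (t n))%C).
  set (ik := fun k : nat => / (INR k + 1)).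
  assert (IK : forall k, 0 < ik k).
  { intros k. apply Rinv_0_lt_compat. generalize (pos_INR k). lra. }
  assert (IKm : forall k l, (k <= l)%nat -> ik l <= ik k).
  { intros k l H. apply le_INR in H. apply Rinv_le_contravar; generalize (pos_INR k); lra. }
  assert (IK0 : forall e, 0 < e -> exists K, forall k, (K <= k)%nat -> ik k <= e).
  { intros e He. destruct (nfloor_ex (/ e)) as [K [_ HK]]; [left; now apply Rinv_0_lt_compat|].
    exists K. intros k Hk. apply (Rle_trans _ (ik K)); [auto|]. unfold ik. rewrite <- (Rinv_inv e).
    assert (0 < / e) by now apply Rinv_0_lt_compat. apply Rinv_le_contravar; lra. }
  assert (E1 : forall k, nrm2 (ek k) <= de + ik k).
  { intros k. exact (proj2_sig (constructive_indefinite_description _ (D2 k))). }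
  assert (EL : forall k, L2 (ek k)) by (intros k; now apply L2_minus).
  assert (Eq : forall k p (s : C), de <= nrm2 (fun n => ek k n - s * peval p (t n))%C).
  { intros k p s. eapply Rle_trans; [apply (D1 (padd (pk k) (map (fun a => s * a)%C p)))|].
    right. apply Series_ext. intros n. rewrite peval_padd, peval_map. unfold ek. do 3 f_equal. ring. }
  assert (Ecau : forall k l, nrm2 (fun n => ek k n - ek l n)%C <= 2 * ik k + 2 * ik l).
  { intros k l. rewrite parallelogram by auto. assert (T1 := E1 k). assert (T2 := E1 l).
    assert (T3 : de <= nrm2 (fun n => (ek k n + ek l n) / 2)%C); [|lra].
    eapply Rle_trans; [apply (D1 (map (fun a => / 2 * a)%C (padd (pk k) (pk l))))|].
    right. apply Series_ext. intros n. rewrite peval_map, peval_padd. unfold ek. do 3 f_equal.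
    unfold Cdiv. field. }
  assert (Epn : forall n k l, Cmod (ek k n - ek l n)%C ^ 2 * mu n <= 2 * ik k + 2 * ik l).
  { intros n k l. eapply Rle_trans; [|apply Ecau].
    apply (Series_term (fun n => Cmod (ek k n - ek l n)%C ^ 2 * mu n)).
    - intros i. apply Rmult_le_pos; [apply pow2_ge_0|left; apply mu_pos].
    - now apply L2_minus. }
  assert (LIM : forall n, exists e : C, forall eta, 0 < eta ->
     exists K, forall k, (K <= k)%nat -> Cmod (ek k n - e)%C <= eta).
  { intros n. assert (P := mu_pos n).
    assert (CAU : forall pr : C -> R, (forall z, Rabs (pr z) <= Cmod z) ->
       (forall z w, pr (z - w)%C = pr z - pr w) ->
       exists l, forall eta, 0 < eta -> exists K, forall k, (K <= k)%nat -> Rabs (pr (ek k n) - l) <= eta).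
    { intros pr Hp1 Hp2. assert (EX : ex_finite_lim_seq (fun k => pr (ek k n))).
      { apply ex_lim_seq_cauchy_corr. intros e. assert (He := cond_pos e).
        destruct (IK0 (e ^ 2 * mu n / 8)) as [K HK].
        { apply Rdiv_lt_0_compat; [|lra]. apply Rmult_lt_0_compat; [nra|auto]. }
        exists K. intros k l Hk Hl. rewrite <- Hp2. eapply Rle_lt_trans; [apply Hp1|].
        assert (T := Epn n k l). assert (Q1 := HK k Hk). assert (Q2 := HK l Hl).
        assert (T2 : Cmod (ek k n - ek l n)%C ^ 2 <= e ^ 2 / 2).
        { apply Rmult_le_reg_r with (mu n); [auto|]. lra. }
        assert (T3 := Cmod_ge_0 (ek k n - ek l n)%C). nra. }
      destruct EX as [l Hl]. exists l. intros eta He. apply is_lim_seq_spec in Hl.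
      destruct (Hl (mkposreal eta He)) as [K HK]. exists K. intros k Hk. left. exact (HK k Hk). }
    destruct (CAU fst) as [l1 L1]; [apply fst_le_Cmod|intros; simpl; ring|].
    destruct (CAU snd) as [l2 L2']; [apply snd_le_Cmod|intros; simpl; ring|].
    exists (l1, l2). intros eta He.
    destruct (L1 (eta / 2)) as [K1 HK1]; [lra|]. destruct (L2' (eta / 2)) as [K2 HK2]; [lra|].
    exists (max K1 K2). intros k Hk. eapply Rle_trans; [apply Cmod_le_sum|].
    change (Rabs (fst (ek k n) - l1) + Rabs (snd (ek k n) - l2) <= eta).
    specialize (HK1 k ltac:(lia)). specialize (HK2 k ltac:(lia)). lra. }
  set (e := fun n => proj1_sig (constructive_indefinite_description _ (LIM n))).
  assert (He : forall n eta, 0 < eta ->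
     exists K, forall k, (K <= k)%nat -> Cmod (ek k n - e n)%C <= eta).
  { intros n. exact (proj2_sig (constructive_indefinite_description _ (LIM n))). }
  (* Fatou's lemma: the Cauchy estimate on finitely many indices passes to the pointwise limit, so
     [e] is also the limit in norm. *)
  assert (FAT : forall k N, rsum (fun n => Cmod (ek k n - e n)%C ^ 2 * mu n) N <= 4 * ik k).
  { intros k N. apply le_epsilon. intros eps Heps.
    set (M := rsum mu N). assert (HM : 0 <= M) by (apply rsum_pos; intros; left; apply mu_pos).
    set (eta := Rmin 1 (eps / (4 * (M + 1)))).
    assert (Heta : 0 < eta) by (apply Rmin_pos; [lra|apply Rdiv_lt_0_compat; lra]).
    destruct (finite_eventually (fun n l => Cmod (ek l n - e n)%C <= eta) N) as [K1 HK1].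
    { intros n _. now apply He. }
    destruct (IK0 (eps / 8)) as [K2 HK2]; [lra|].
    set (l := max K1 K2). assert (Il := HK2 l ltac:(lia)).
    apply Rle_trans with (rsum (fun n => 2 * (Cmod (ek k n - ek l n)%C ^ 2 * mu n)) N
      + rsum (fun n => 2 * eta ^ 2 * mu n) N).
    - rewrite <- rsum_plus. apply rsum_le. intros n Hn.
      assert (P := mu_pos n). assert (T := Cmod_sq_plus (ek k n - ek l n)%C (ek l n - e n)%C).
      replace (ek k n - ek l n + (ek l n - e n))%C with (ek k n - e n)%C in T by ring.
      assert (T2 : Cmod (ek l n - e n)%C ^ 2 <= eta ^ 2).
      { apply pow_incr. split; [apply Cmod_ge_0|]. apply HK1; [auto|lia]. }
      rewrite <- Rmult_assoc, <- Rmult_plus_distr_r. apply Rmult_le_compat_r; lra.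
    - rewrite !rsum_scal. fold M.
      assert (T1 : rsum (fun n => Cmod (ek k n - ek l n)%C ^ 2 * mu n) N <= 2 * ik k + 2 * ik l).
      { eapply Rle_trans; [|apply Ecau].
        apply (rsum_Series (fun n => Cmod (ek k n - ek l n)%C ^ 2 * mu n)).
        - intros i. apply Rmult_le_pos; [apply pow2_ge_0|left; apply mu_pos].
        - now apply L2_minus. }
      assert (T2 : eta ^ 2 * M <= eps / 4).
      { assert (Q1 : eta <= 1) by apply Rmin_l.
        assert (Q2 : eta <= eps / (4 * (M + 1))) by apply Rmin_r.
        apply Rle_trans with (eps / (4 * (M + 1)) * (M + 1)).
        - apply Rmult_le_compat; try lra. apply pow2_ge_0. nra.
        - right. field. lra. }
      lra. }
  assert (Fpos : forall k n, 0 <= Cmod (ek k n - e n)%C ^ 2 * mu n).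
  { intros k n. apply Rmult_le_pos; [apply pow2_ge_0|left; apply mu_pos]. }
  assert (DL : forall k, L2 (fun n => ek k n - e n)%C).
  { intros k. now apply ex_series_pos with (4 * ik k). }
  assert (DN : forall k, nrm2 (fun n => ek k n - e n)%C <= 4 * ik k).
  { intros k. apply Series_bound; auto. }
  assert (eL : L2 e).
  { apply L2_ext with (fun n => ek 0%nat n - (ek 0%nat n - e n))%C; [intros; ring|].
    now apply L2_minus. }
  (* Subtracting [s * p] with [s = tau * conj B] lowers the squared norm by about [tau * |B|^2];
     since [ek k] is minimal up to [ik k], its inner product [B] with [p] is small. *)
  assert (OR : forall k p, Cmod (csum (fun n => Cconj (ek k n) * RtoC (mu n) * peval p (t n))%C) ^ 2
     <= (nrm2 (fun n => peval p (t n)) + 1) * ik k).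
  { intros k p. set (B := csum (fun n => Cconj (ek k n) * RtoC (mu n) * peval p (t n))%C).
    set (Q := nrm2 (fun n => peval p (t n))). assert (HQ : 0 <= Q) by (apply nrm2_pos; auto).
    set (tau := / (Q + 1)). assert (HT : 0 < tau) by (apply Rinv_0_lt_compat; lra).
    assert (X := Eq k p (RtoC tau * Cconj B)%C).
    assert (XE := expand_sq (ek k) (fun n => peval p (t n)) (RtoC tau * Cconj B)%C (EL k) (HP p)).
    cbv beta in X, XE. rewrite XE in X. fold B in X. fold Q in X.
    rewrite Cmod_mult, Cmod_R, Rabs_pos_eq, Cmod_conj in X by lra.
    assert (EB : fst (RtoC tau * Cconj B * B)%C = tau * Cmod B ^ 2).
    { rewrite Cmod2_alt. unfold Re, Im. destruct B. simpl. ring. }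
    rewrite EB in X. assert (T := E1 k). set (b := Cmod B ^ 2) in *.
    assert (Hb : 0 <= b) by apply pow2_ge_0.
    replace ((tau * Cmod B) ^ 2 * Q) with (tau * b * (tau * Q)) in X by (unfold b; ring).
    assert (TQ : tau * Q <= 1).
    { unfold tau. apply Rmult_le_reg_l with (Q + 1); [lra|]. rewrite <- Rmult_assoc, Rinv_r by lra. lra. }
    assert (T3 : tau * b <= ik k).
    { assert (tau * b * (tau * Q) <= tau * b * 1) by (apply Rmult_le_compat_l; [nra|auto]). lra. }
    apply Rmult_le_reg_l with tau; [auto|]. unfold tau at 2. rewrite <- Rmult_assoc, Rinv_l by lra. lra. }
  assert (ORe : forall p, csum (fun n => Cconj (e n) * RtoC (mu n) * peval p (t n))%C = 0%C).
  { intros p. apply Cmod_small_eq0. intros eps Heps.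
    set (Q := nrm2 (fun n => peval p (t n))). assert (HQ : 0 <= Q) by (apply nrm2_pos; auto).
    set (s := (4 * (Q + 1)) / eps). assert (Hs : 0 < s) by (apply Rdiv_lt_0_compat; lra).
    destruct (IK0 (Rmin (eps / (64 * s)) (eps ^ 2 / (16 * (Q + 1))))) as [k Hk].
    { apply Rmin_pos; apply Rdiv_lt_0_compat; nra. }
    specialize (Hk k (le_n _)).
    assert (K1 : ik k <= eps / (64 * s)) by (eapply Rle_trans; [apply Hk|apply Rmin_l]).
    assert (K2 : ik k <= eps ^ 2 / (16 * (Q + 1))) by (eapply Rle_trans; [apply Hk|apply Rmin_r]).
    replace (csum (fun n => Cconj (e n) * RtoC (mu n) * peval p (t n))%C)
      with (csum (fun n => Cconj (ek k n) * RtoC (mu n) * peval p (t n))%C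
        - csum (fun n => Cconj (ek k n - e n) * RtoC (mu n) * peval p (t n))%C)%C.
    2:{ rewrite <- csum_minus.
        - apply csum_ext. intros n. rewrite Cminus_conj. ring.
        - apply (pair_csmb (ek k) (fun n => peval p (t n))); auto.
        - apply (pair_csmb (fun n => ek k n - e n)%C (fun n => peval p (t n))); auto. }
    eapply Rle_trans; [apply Cmod_sub_le|].
    assert (B1 : Cmod (csum (fun n => Cconj (ek k n) * RtoC (mu n) * peval p (t n))%C) <= eps / 4).
    { apply Rsqr_incr_0; [|apply Cmod_ge_0|lra]. rewrite !Rsqr_pow2.
      eapply Rle_trans; [apply OR|]. fold Q.
      apply Rle_trans with ((Q + 1) * (eps ^ 2 / (16 * (Q + 1)))).
      - apply Rmult_le_compat_l; lra.
      - right. field. lra. }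
    assert (B2 := pair_bound (fun n => ek k n - e n)%C (fun n => peval p (t n)) s Hs (DL k) (HP p)).
    cbv beta in B2. fold Q in B2.
    assert (T1 : s * nrm2 (fun n => ek k n - e n)%C <= eps / 16).
    { apply Rle_trans with (s * (4 * (eps / (64 * s)))).
      - apply Rmult_le_compat_l; [lra|]. eapply Rle_trans; [apply DN|]. lra.
      - right. field. lra. }
    assert (T2 : / s * Q <= eps / 4).
    { unfold s. apply Rmult_le_reg_l with (4 * (Q + 1) / eps); [auto|].
      rewrite <- Rmult_assoc, Rinv_r by (unfold s in Hs; lra).
      replace (4 * (Q + 1) / eps * (eps / 4)) with (Q + 1) by (field; lra). lra. }
    lra. }
  (* With these residues, orthogonality of [e] to a polynomial is the vanishing of the corresponding
     moment. *)
  set (a := fun n => (Cconj (e n) * RtoC (mu n))%C).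
  assert (Ha : l2mu mu a).
  { apply rex_ext with (2 := eL). intros n. assert (P := mu_pos n). unfold a.
    rewrite Cmod_mult, Cmod_conj, Cmod_R, Rabs_pos_eq by lra. field. lra. }
  exists (synth t A a). split; [now apply synth_inHr|]. split.
  - apply NNPP. intros N.
    assert (E0 : forall n, e n = 0%C).
    { intros n. assert (R0 : a n = 0%C).
      { rewrite <- (res_synth a). unfold residue. replace (synth t A a (t n)) with (RtoC 0).
        - unfold Cdiv. ring.
        - symmetry. apply NNPP. intros N'. apply N. now exists (t n). }
      unfold a in R0. apply Cmult_integral in R0. destruct R0 as [R0|R0].
      - apply Cmod_eq_0. rewrite <- Cmod_conj, R0. apply Cmod_0.
      - apply RtoC_inj in R0. assert (P := mu_pos n). lra. }
    destruct (IK0 (ep / 8)) as [k Hk]; [lra|]. specialize (Hk k (le_n _)).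
    assert (T := DN k).
    assert (T2 : ep <= nrm2 (ek k)).
    { unfold ek. apply HB. }
    rewrite (Series_ext _ (fun n => Cmod (ek k n) ^ 2 * mu n)) in T.
    + lra.
    + intros n. rewrite E0. do 3 f_equal. ring.
  - intros p. unfold mom. rewrite res_synth. apply ORe.
Qed.

End Density.

(** * Zeros under density of the polynomials *)

Lemma contraction_fixpoint (T : C -> C) (c : C) (r : R) : 0 <= r ->
  (forall z, Cmod (z - c)%C <= r -> Cmod (T z - c)%C <= r) ->
  (forall z w, Cmod (z - c)%C <= r -> Cmod (w - c)%C <= r ->
     Cmod (T z - T w)%C <= 1 / 2 * Cmod (z - w)%C) ->
  exists w, Cmod (w - c)%C <= r /\ T w = w.
Proof.
  intros Hr HT HL. set (x := fix x k := match k with O => c | S k => T (x k) end).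
  assert (X : forall k, Cmod (x k - c)%C <= r).
  { induction k as [|k IH]; [simpl; rewrite Cmod_self; auto|]. now apply HT. }
  assert (D : forall k, Cmod (x (S k) - x k)%C <= r * (1 / 2) ^ k).
  { induction k as [|k IH]; [simpl; rewrite Rmult_1_r; now apply (X 1%nat)|].
    assert (L := HL (x (S k)) (x k) (X _) (X _)). change (x (S (S k))) with (T (x (S k))).
    change (T (x k)) with (x (S k)) in L. simpl pow. lra. }
  assert (CS : csmb (fun k => x (S k) - x k)%C).
  { apply csmb_dom with (1 := D). apply ex_series_mul, ex_series_geom. rewrite Rabs_pos_eq; lra. }
  assert (TS : forall k, psum (fun k => x (S k) - x k)%C k = (x k - c)%C).
  { induction k as [|k IH]; [simpl; ring|].
    change (psum (fun k => x (S k) - x k)%C (S k)) with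
      (psum (fun k => x (S k) - x k)%C k + (x (S k) - x k))%C. rewrite IH. ring. }
  set (w := (c + csum (fun k => x (S k) - x k))%C).
  assert (LIM : forall e, 0 < e -> exists K, forall k, (K <= k)%nat -> Cmod (w - x k)%C <= e).
  { intros e He. destruct (csum_psum_lim _ e CS He) as [K HK]. exists K. intros k Hk.
    specialize (HK k Hk). rewrite TS in HK. unfold w.
    replace (c + csum (fun k => x (S k) - x k) - x k)%C
      with (csum (fun k => x (S k) - x k) - (x k - c))%C by ring. exact HK. }
  assert (Wr : Cmod (w - c)%C <= r).
  { apply le_epsilon. intros e He. destruct (LIM e He) as [K HK]. specialize (HK K (le_n _)).
    specialize (X K). replace (w - c)%C with ((w - x K) + (x K - c))%C by ring.
    eapply Rle_trans; [apply Cmod_triangle|]. lra. }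
  exists w. split; auto. apply Cminus_eq0, Cmod_small_eq0. intros e He.
  destruct (LIM (e / 2) ltac:(lra)) as [K HK].
  assert (H1 := HK K (le_n _)). assert (H2 := HK (S K) (le_S _ _ (le_n _))).
  assert (L := HL w (x K) Wr (X K)). change (T (x K)) with (x (S K)) in L.
  replace (T w - w)%C with ((T w - x (S K)) - (w - x (S K)))%C by ring.
  eapply Rle_trans; [apply Cmod_sub_le|]. assert (P := Cmod_ge_0 (w - x K)%C). lra.
Qed.

(** * Moment expansions of Cauchy transforms *)

Section Localization.
Context {t : nat -> C} {A : C -> C} {mu : nat -> R}.
Context {Hdata : admissible_data t mu} {HA : generating_function t A}.

Notation inHr := (@inHr t A mu).
Notation res := (residue t A).
Notation W := (weight t).

(** Equivalent to the polynomials lying in [L^2(mu)], in the form that comparison of series can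
    use. *)
Definition all_moments (t : nat -> C) (mu : nat -> R) : Prop :=
  forall k, ex_series (fun n => mu n * weight t n ^ k).

(** The polynomials [1] and [z^k] are enough, since [(1 + y)^k <= 4^k (1 + y^(2k))] for [y >= 0]. *)
Lemma polys_all_moments : (forall p, inL2 t mu (fun n => peval p (t n))) -> all_moments t mu.
Proof.
  intros HP k.
  assert (H0 := HP [RtoC 1]). assert (Hk := HP (repeat (RtoC 0) k ++ [RtoC 1])).
  assert (E0 : forall z, peval [RtoC 1] z = 1%C) by (intros; simpl; ring).
  assert (Ek : forall z, peval (repeat (RtoC 0) k ++ [RtoC 1]) z = (z ^ k)%C).
  { intros z. induction k as [|k IH]; simpl; [ring|]. rewrite IH; [ring|]. apply HP. }
  apply ex_series_dom with (fun n => 4 ^ k *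
    (Cmod (peval [RtoC 1] (t n)) ^ 2 * mu n
     + Cmod (peval (repeat (RtoC 0) k ++ [RtoC 1]) (t n)) ^ 2 * mu n)).
  - intros n. assert (P := mu_pos n). assert (W1 := W_ge1 (t := t) n).
    split; [apply Rmult_le_pos; [lra|apply pow_le; lra]|].
    rewrite E0, Ek, Cmod_pow, Cmod_1, <- Rmult_plus_distr_r, <- Rmult_assoc.
    rewrite (Rmult_comm (mu n)). apply Rmult_le_compat_r; [lra|].
    rewrite <- pow_mult, Nat.mul_comm, pow_mult. assert (T := Cmod_ge_0 (t n)).
    assert (T2 : 0 <= Cmod (t n) ^ 2) by apply pow2_ge_0.
    unfold weight. set (y := Cmod (t n)) in *.
    destruct (Rle_lt_dec y 1) as [L|L].
    + apply Rle_trans with (4 ^ k * 1).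
      * rewrite Rmult_1_r. apply pow_incr. lra.
      * apply Rmult_le_compat_l; [apply pow_le; lra|].
        assert (Q : 0 <= (y ^ 2) ^ k) by now apply pow_le. lra.
    + apply Rle_trans with ((4 * y ^ 2) ^ k).
      * apply pow_incr. split; [lra|]. nra.
      * rewrite Rpow_mult_distr. apply Rmult_le_compat_l; [apply pow_le; lra|]. lra.
  - apply ex_series_mul, ex_series_add; auto.
Qed.

Lemma peval_growth (p : list C) : exists c, forall n, Cmod (peval p (t n)) <= c * W n ^ length p.
Proof.
  induction p as [|a p [c Hc]].
  - exists 0. intros n. simpl. rewrite Cmod_0. lra.
  - exists (Cmod a + c). intros n. specialize (Hc n). simpl.
    eapply Rle_trans; [apply Cmod_triangle|]. rewrite Cmod_mult.
    assert (W1 := W_ge1 (t := t) n). assert (P := W_pow_pos t n (length p)).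
    assert (T : Cmod (t n) <= W n) by (unfold weight; lra).
    assert (Q0 := Cmod_ge_0 (peval p (t n))). assert (Q1 := Cmod_ge_0 a).
    assert (Cmod (t n) * Cmod (peval p (t n)) <= W n * (c * W n ^ length p))
      by (apply Rmult_le_compat; auto; apply Cmod_ge_0).
    assert (Cmod a * 1 <= Cmod a * (W n * W n ^ length p)) by (apply Rmult_le_compat_l; nra).
    lra.
Qed.

Lemma all_moments_gL2 (p : list C) : all_moments t mu -> gL2 t mu (peval p).
Proof.
  intros HM. destruct (peval_growth p) as [c Hc].
  apply ex_series_dom with (fun n => c ^ 2 * (mu n * W n ^ (length p * 2))).
  - intros n. assert (P := mu_pos n). split; [apply Rmult_le_pos; [lra|apply pow2_ge_0]|].
    replace (c ^ 2 * (mu n * W n ^ (length p * 2))) with (mu n * (c * W n ^ length p) ^ 2).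
    + apply Rmult_le_compat_l; [lra|]. apply pow_incr. split; [apply Cmod_ge_0|auto].
    + rewrite pow_mult, Rpow_mult_distr. ring.
  - apply ex_series_mul, HM.
Qed.

Lemma all_moments_nu (x : nat -> C) (k : nat) : all_moments t mu -> gL2 t mu (nu x k).
Proof.
  intros HM. destruct (nu_peval x k) as [p Hp].
  apply rex_ext with (2 := all_moments_gL2 p HM). intros n. now rewrite Hp.
Qed.

Lemma all_moments_polys : all_moments t mu -> forall p, inL2 t mu (fun n => peval p (t n)).
Proof. intros HM p. apply rex_ext with (2 := all_moments_gL2 p HM). intros n. ring. Qed.

Lemma all_moments_abs (F : C -> C) (k : nat) : all_moments t mu -> inHr F ->
  ex_series (fun n => Cmod (res F n) * W n ^ k).
Proof.
  intros HM HF. apply ex_series_dom with (fun n => Cmod (res F n) ^ 2 / mu n + mu n * W n ^ (k * 2)).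
  - intros n. assert (P := W_pow_pos t n k). split; [apply Rmult_le_pos; [apply Cmod_ge_0|lra]|].
    rewrite pow_mult. apply amgm, mu_pos.
  - apply ex_series_add; [apply HF|apply HM].
Qed.

(** Induction on [p] in Horner form for the products [nu_k * p], all [k] at once: the factor [z] is
    [(z - x_k) + x_k], and [nu_k * (z - x_k) = nu_{k+1}]. *)
Lemma all_moments_newton (x : nat -> C) (F : C -> C) : all_moments t mu -> inHr F ->
  (forall k, mom t A (nu x k) F = 0%C) -> forall p, mom t A (peval p) F = 0%C.
Proof.
  intros HM HF H0.
  assert (G : forall p k, gL2 t mu (fun z => nu x k z * peval p z)%C).
  { intros p k. destruct (nu_peval x k) as [q Hq].
    assert (E : exists r, forall z, peval r z = (peval q z * peval p z)%C).
    { clear Hq. induction q as [|b q [r Hr]].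
      - exists []. intros z. simpl. ring.
      - exists (padd (map (fun a => b * a)%C p) (RtoC 0 :: r)). intros z.
        rewrite peval_padd, peval_map. simpl. rewrite Hr. ring. }
    destruct E as [r Hr]. apply rex_ext with (2 := all_moments_gL2 r HM). intros n.
    now rewrite Hr, Hq. }
  assert (H : forall p k, mom t A (fun z => nu x k z * peval p z)%C F = 0%C).
  { induction p as [|a p IH]; intros k.
    - unfold mom. rewrite (csum_fin _ 0); [reflexivity|]. intros n _. simpl. ring.
    - assert (S1 := mom_csmb _ F (G p (S k)) HF). assert (S2 := mom_csmb _ F (G p k) HF).
      assert (S3 := mom_csmb _ F (all_moments_nu x k HM) HF).
      unfold mom. rewrite (csum_ext _ (fun n => (res F n * (nu x (S k) (t n) * peval p (t n))
         + x k * (res F n * (nu x k (t n) * peval p (t n)))) + a * (res F n * nu x k (t n)))%C).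
      + assert (S2' := csmb_scal (x k) _ S2). assert (S3' := csmb_scal a _ S3).
        rewrite (csum_plus _ _ (csmb_plus _ _ S1 S2') S3'), (csum_plus _ _ S1 S2').
        rewrite (csum_scal (x k) _ S2), (csum_scal a _ S3).
        assert (Q1 := IH (S k)). assert (Q2 := IH k). assert (Q3 := H0 k). unfold mom in *.
        rewrite Q1, Q2, Q3. ring.
      + intros n. simpl. ring. }
  intros p. rewrite <- (H p 0%nat). unfold mom. apply csum_ext. intros n. simpl. ring.
Qed.

(** [z / (z - t) = 1 + t / (z - t)]: one step of the expansion at infinity in moments. *)
Lemma CT_mul (b : nat -> C) (z : C) : csmb b -> csmb (fun n => b n / (z - t n))%C ->
  (forall n, t n = z -> b n = 0%C) ->
  (z * CT t b z = csum b + CT t (fun n => b n * t n)%C z)%C.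
Proof.
  intros Hb Hc Hz. unfold CT.
  rewrite (csum_ext (fun n => b n * t n / (z - t n))%C
    (fun n => z * (b n / (z - t n)) - b n)%C).
  - rewrite csum_minus by (auto; now apply csmb_scal). rewrite csum_scal by auto. ring.
  - intros n. destruct (classic (t n = z)) as [E|E].
    + rewrite (Hz n E). unfold Cdiv. ring.
    + field. apply Cminus_neq0. congruence.
Qed.

Context {rho : nat -> R} {M : nat} {c0 : R}.
Context (Hc0 : 0 < c0) (Hrho : forall n, rho n = c0 / W n ^ M).

Lemma rho_pos (n : nat) : 0 < rho n.
Proof. rewrite Hrho. apply Rdiv_lt_0_compat; [auto|]. generalize (W_pow_pos t n M). lra. Qed.

Definition awayb (b : nat -> C) (z : C) : Prop := forall n, b n = 0%C \/ rho n <= Cmod (z - t n)%C.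

Lemma away_neq (b : nat -> C) (z : C) : awayb b z -> forall n, t n = z -> b n = 0%C.
Proof.
  intros H n E. destruct (H n) as [H1|H1]; auto. rewrite E, Cmod_self in H1.
  generalize (rho_pos n). lra.
Qed.

(** Off the disks [|z / (z - t_n)| <= 1 + W_n^(M+1) / c0]; the moments of [v] outweigh the smallness
    of the disks. *)
Lemma CT_decay (b : nat -> C) (v : nat -> R) : (forall n, Cmod (b n) <= v n) ->
  (forall k, ex_series (fun n => v n * W n ^ k)) ->
  forall z, awayb b z ->
    Cmod z * Cmod (CT t b z) <= 2 * Series (fun n => v n * (1 + / c0 * W n ^ S M)).
Proof.
  intros Hbv Hv z Hz. rewrite <- Cmod_mult.
  assert (SV : ex_series (fun n => v n * (1 + / c0 * W n ^ S M))).
  { apply rex_ext with (fun n => v n * W n ^ 0 + / c0 * (v n * W n ^ S M)).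
    - intros n. simpl. ring.
    - apply ex_series_add; [apply Hv|apply ex_series_mul, Hv]. }
  unfold CT.
  assert (NW : forall n, b n <> 0%C -> (z - t n)%C <> 0%C /\ rho n <= Cmod (z - t n)%C).
  { intros n Hn. destruct (Hz n) as [H|H]; [contradiction|]. split; auto.
    apply Cmod_gt_0. generalize (rho_pos n). lra. }
  assert (CS : csmb (fun n => b n / (z - t n))%C).
  { apply csmb_dom with (fun n => / c0 * (v n * W n ^ M)); [|apply ex_series_mul, Hv].
    intros n. assert (P := W_pow_pos t n M). assert (B0 := Cmod_ge_0 (b n)). specialize (Hbv n).
    destruct (classic (b n = 0%C)) as [E|E].
    - rewrite E. replace (0 / (z - t n))%C with (RtoC 0) by (unfold Cdiv; ring). rewrite Cmod_0.
      apply Rmult_le_pos; [left; now apply Rinv_0_lt_compat|]. apply Rmult_le_pos; lra.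
    - destruct (NW n E) as [N1 N2]. rewrite Cmod_div by auto. rewrite Hrho in N2.
      replace (/ c0 * (v n * W n ^ M)) with (v n * / (c0 / W n ^ M)) by (field; lra).
      apply Rmult_le_compat; auto.
      + left. now apply Rinv_0_lt_compat, Cmod_gt_0.
      + apply Rinv_le_contravar; [apply Rdiv_lt_0_compat; lra|auto]. }
  rewrite <- csum_scal by auto. apply csum_bound_dom; auto. intros n.
  assert (P := W_pow_pos t n M). assert (W1 := W_ge1 (t := t) n). specialize (Hbv n).
  assert (B0 := Cmod_ge_0 (b n)). destruct (classic (b n = 0%C)) as [E|E].
  - rewrite E. replace (z * (0 / (z - t n)))%C with (RtoC 0) by (unfold Cdiv; ring). rewrite Cmod_0.
    apply Rmult_le_pos; [lra|]. assert (0 < / c0) by now apply Rinv_0_lt_compat.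
    assert (0 <= / c0 * W n ^ S M) by (apply Rmult_le_pos; [lra|apply pow_le; lra]). lra.
  - destruct (NW n E) as [N1 N2]. assert (D := proj1 (Cmod_gt_0 _) N1).
    replace (z * (b n / (z - t n)))%C with (b n * (1 + t n / (z - t n)))%C by (field; auto).
    rewrite Cmod_mult. apply Rmult_le_compat; auto; try apply Cmod_ge_0.
    eapply Rle_trans; [apply Cmod_triangle|]. rewrite Cmod_1. apply Rplus_le_compat_l.
    rewrite Cmod_div by auto. rewrite Hrho in N2.
    replace (/ c0 * W n ^ S M) with (W n * / (c0 / W n ^ M)) by (simpl; field; lra).
    apply Rmult_le_compat; try apply Cmod_ge_0.
    + left. now apply Rinv_0_lt_compat.
    + unfold weight. lra.
    + apply Rinv_le_contravar; [apply Rdiv_lt_0_compat; lra|auto].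
Qed.

Lemma CT_lip (b : nat -> C) (v : nat -> R) : (forall n, Cmod (b n) <= v n) ->
  (forall k, ex_series (fun n => v n * W n ^ k)) ->
  forall z w, awayb b z -> awayb b w ->
    Cmod (CT t b z - CT t b w)%C <=
      2 * Series (fun n => v n * (/ c0 ^ 2 * W n ^ (M * 2))) * Cmod (z - w)%C.
Proof.
  intros Hbv Hv z w Hz Hw.
  assert (NW : forall y, awayb b y -> forall n, b n <> 0%C ->
    (y - t n)%C <> 0%C /\ rho n <= Cmod (y - t n)%C).
  { intros y Hy n Hn. destruct (Hy n) as [H|H]; [contradiction|]. split; auto.
    apply Cmod_gt_0. generalize (rho_pos n). lra. }
  assert (CS : forall y, awayb b y -> csmb (fun n => b n / (y - t n))%C).
  { intros y Hy. apply CT_csmb; [|now apply away_neq].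
    apply ex_series_dom with (fun n => v n * W n ^ 0); [|apply Hv].
    intros n. assert (W1 := W_ge1 (t := t) n). assert (B0 := Cmod_ge_0 (b n)). specialize (Hbv n).
    split; [apply Rdiv_le_0_compat; lra|]. simpl. rewrite Rmult_1_r.
    apply Rle_trans with (Cmod (b n) / 1); [|lra]. apply Rmult_le_compat_l; [auto|].
    apply Rinv_le_contravar; lra. }
  assert (SV : ex_series (fun n => v n * (/ c0 ^ 2 * W n ^ (M * 2)))).
  { apply rex_ext with (fun n => / c0 ^ 2 * (v n * W n ^ (M * 2))).
    - intros n. ring.
    - apply ex_series_mul, Hv. }
  assert (TB : forall n, Cmod (- (b n / ((z - t n) * (w - t n))))%C <= v n * (/ c0 ^ 2 * W n ^ (M * 2))).
  { intros n. rewrite Cmod_opp. assert (P := W_pow_pos t n M). assert (B0 := Cmod_ge_0 (b n)).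
    specialize (Hbv n). destruct (classic (b n = 0%C)) as [E|E].
    - rewrite E. replace (0 / ((z - t n) * (w - t n)))%C with (RtoC 0) by (unfold Cdiv; ring).
      rewrite Cmod_0. apply Rmult_le_pos; [lra|]. apply Rmult_le_pos.
      + left. apply Rinv_0_lt_compat. now apply pow_lt.
      + apply pow_le. generalize (W_ge1 (t := t) n). lra.
    - destruct (NW z Hz n E) as [N1 N2]. destruct (NW w Hw n E) as [N3 N4].
      rewrite Cmod_div by (intros Z; apply Cmult_integral in Z; tauto).
      rewrite Cmod_mult. apply Rmult_le_compat; auto.
      + left. apply Rinv_0_lt_compat. apply Rmult_lt_0_compat; now apply Cmod_gt_0.
      + replace (/ c0 ^ 2 * W n ^ (M * 2)) with (/ (rho n * rho n)).
        2:{ rewrite Hrho, pow_mult. field. lra. }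
        assert (R0 := rho_pos n). apply Rinv_le_contravar; [now apply Rmult_lt_0_compat|].
        apply Rmult_le_compat; lra. }
  replace (CT t b z - CT t b w)%C
    with ((z - w) * csum (fun n => - (b n / ((z - t n) * (w - t n)))))%C.
  - rewrite Cmod_mult, Rmult_comm. apply Rmult_le_compat_r; [apply Cmod_ge_0|].
    now apply csum_bound_dom.
  - unfold CT. rewrite <- csum_scal by (now apply csmb_dom with (1 := TB)).
    rewrite <- csum_minus by now apply CS.
    apply csum_ext. intros n. destruct (classic (b n = 0%C)) as [E|E].
    + rewrite E. unfold Cdiv. ring.
    + destruct (NW z Hz n E). destruct (NW w Hw n E). field. auto.
Qed.

Lemma rho_disjoint (c : R) (p : nat) : 0 < c -> c0 = c / 4 -> (p <= M)%nat ->
  (forall n m, n <> m -> c / W n ^ p <= Cmod (t n - t m)%C) ->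
  forall n m z, n <> m -> in_disk (t n) (rho n) z -> rho m <= Cmod (z - t m)%C.
Proof.
  intros Hc Ec Hp Hs n m z Hnm Hz. unfold in_disk in Hz.
  assert (R : forall n, rho n <= (c / W n ^ p) / 4).
  { intros k. rewrite Hrho, Ec. assert (W1 := W_ge1 (t := t) k). assert (P := W_pow_pos t k p).
    assert (Q : W k ^ p <= W k ^ M) by now apply Rle_pow.
    apply Rle_trans with (c / 4 / W k ^ p).
    - apply Rmult_le_compat_l; [lra|]. apply Rinv_le_contravar; lra.
    - right. field. lra. }
  assert (H1 := Hs n m Hnm). assert (H2 := Hs m n (not_eq_sym Hnm)). rewrite Cmod_sub_sym in H2.
  assert (R1 := R n). assert (R2 := R m).
  assert (T := Cmod_rev_triangle (t n - t m)%C (t n - z)%C).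
  replace (t n - t m - (t n - z))%C with (z - t m)%C in T by ring.
  rewrite (Cmod_sub_sym (t n) z) in T.
  assert (P1 := rho_pos n). assert (P2 := rho_pos m). lra.
Qed.

Lemma ex_series_small (u : nat -> R) (e : R) : 0 < e -> ex_series u ->
  exists N, forall n, (N <= n)%nat -> u n < e.
Proof.
  intros He Hu. apply ex_series_lim_0, is_lim_seq_spec in Hu. destruct (Hu (mkposreal e He)) as [N HN].
  exists N. intros n Hn. specialize (HN n Hn). simpl in HN. rewrite Rminus_0_r in HN.
  eapply Rle_lt_trans; [apply Rle_abs|auto].
Qed.

Section OneFunction.
Context (HM : all_moments t mu) {F : C -> C} (HF : inHr F).
Context (Hdisj : forall n m z, n <> m -> in_disk (t n) (rho n) z -> rho m <= Cmod (z - t m)%C).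
Context (K : nat) (HK : csum (fun n => res F n * t n ^ K)%C <> 0%C).
Context (HK0 : forall k, (k < K)%nat -> csum (fun n => res F n * t n ^ k)%C = 0%C).

Let a := res F.
Let b (n : nat) : C := (a n * t n ^ S K)%C.
Let v (n : nat) : R := Cmod (a n) * W n ^ S K.
Let m : C := csum (fun n => a n * t n ^ K)%C.

Lemma lead_pos : 0 < Cmod m.
Proof. now apply Cmod_gt_0. Qed.

Lemma lead_v (n : nat) : Cmod (b n) <= v n.
Proof.
  unfold b, v. rewrite Cmod_mult, Cmod_pow. apply Rmult_le_compat_l; [apply Cmod_ge_0|].
  apply pow_incr. split; [apply Cmod_ge_0|]. unfold weight. lra.
Qed.

Lemma lead_vs (k : nat) : ex_series (fun n => v n * W n ^ k).
Proof.
  apply rex_ext with (2 := all_moments_abs F (S K + k) HM HF). intros n. unfold v, a.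
  rewrite pow_add. ring.
Qed.

Lemma pow_csmb (k : nat) : csmb (fun n => a n * t n ^ k)%C.
Proof.
  apply csmb_dom with (2 := all_moments_abs F k HM HF). intros n. rewrite Cmod_mult, Cmod_pow.
  apply Rmult_le_compat_l; [apply Cmod_ge_0|]. apply pow_incr. split; [apply Cmod_ge_0|].
  unfold weight. lra.
Qed.

(** [CT_mul] is applied [K + 1] times; the moments split off are [0] up to order [K - 1], and the
    last one is [m]. *)
Lemma lead_expansion (z : C) : (forall n, z <> t n) ->
  (z ^ S K * CT t a z = m + CT t b z)%C.
Proof.
  intros Hz.
  assert (H : forall k, (k <= K)%nat -> (z ^ k * CT t a z = CT t (fun n => a n * t n ^ k) z)%C).
  { assert (HH : forall k, (z * CT t (fun n => a n * t n ^ k) z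
        = csum (fun n => a n * t n ^ k) + CT t (fun n => a n * t n ^ S k) z)%C).
    { intros k. rewrite CT_mul.
      - f_equal. unfold CT. apply csum_ext. intros n. f_equal. simpl. ring.
      - apply pow_csmb.
      - apply CT_csmb.
        + apply ex_series_dom with (2 := pow_csmb k). intros n. assert (W1 := W_ge1 (t := t) n).
          assert (P := Cmod_ge_0 (a n * t n ^ k)%C). split; [apply Rdiv_le_0_compat; lra|].
          apply Rle_trans with (Cmod (a n * t n ^ k)%C / 1); [|lra].
          apply Rmult_le_compat_l; [auto|]. apply Rinv_le_contravar; lra.
        + intros n E. elim (Hz n). auto.
      - intros n E. elim (Hz n). auto. }
    induction k as [|k IH]; intros Hk.
    - simpl. rewrite Cmult_1_l. unfold CT. apply csum_ext. intros n. f_equal. ring.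
    - simpl. rewrite <- Cmult_assoc, IH by lia. rewrite HH.
      unfold a at 1. rewrite HK0 by lia. rewrite Cplus_0_l. reflexivity. }
  simpl. rewrite <- Cmult_assoc, H by lia. rewrite CT_mul.
  - f_equal. unfold CT. apply csum_ext. intros n. unfold b. f_equal. simpl. ring.
  - apply pow_csmb.
  - apply CT_csmb.
    + apply ex_series_dom with (2 := pow_csmb K). intros n. assert (W1 := W_ge1 (t := t) n).
      assert (P := Cmod_ge_0 (a n * t n ^ K)%C). split; [apply Rdiv_le_0_compat; lra|].
      apply Rle_trans with (Cmod (a n * t n ^ K)%C / 1); [|lra].
      apply Rmult_le_compat_l; [auto|]. apply Rinv_le_contravar; lra.
    + intros n E. elim (Hz n). auto.
  - intros n E. elim (Hz n). auto.
Qed.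

(** At a zero off the disks [CT t b] equals [- m], but it is [O(1 / |z|)] there, so these zeros lie
    in a bounded set. *)
Lemma outer_zeros : (exists z, F z <> 0%C) -> exists L : list C, forall z, F z = 0%C ->
  (forall n, ~ in_disk (t n) (rho n) z) -> In z L.
Proof.
  intros [z0 Hz0].
  set (B := 2 * Series (fun n => v n * (1 + / c0 * W n ^ S M))).
  destruct (entire_zeros_finite F z0 (B / Cmod m + Cmod z0)) as [L HL]; auto.
  { intros z. now apply inHr_hol. }
  exists L. intros z Hz Hout. apply HL; auto.
  assert (AW : awayb b z).
  { intros n. right. apply Rnot_lt_le. intros H. now apply (Hout n). }
  assert (Hzt : forall n, z <> t n).
  { intros n ->. apply (Hout n). unfold in_disk. rewrite Cmod_self. apply rho_pos. }
  assert (D := CT_decay b v lead_v lead_vs z AW). fold B in D.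
  assert (E := lead_expansion z Hzt).
  assert (CZ : CT t a z = 0%C).
  { rewrite (proj2 HF), synth_off in Hz by auto. apply Cmult_integral in Hz.
    destruct Hz as [Hz|Hz]; [|exact Hz]. now apply A_off in Hz. }
  rewrite CZ, Cmult_0_r in E.
  assert (E2 : Cmod (CT t b z) = Cmod m).
  { rewrite <- (Cmod_opp m). f_equal. transitivity ((m + CT t b z) - m)%C; [ring|].
    rewrite <- E. ring. }
  rewrite E2 in D. assert (P := lead_pos).
  assert (Cmod z <= B / Cmod m).
  { apply Rmult_le_reg_r with (Cmod m); [auto|]. unfold Rdiv. rewrite Rmult_assoc, Rinv_l by lra. lra. }
  eapply Rle_trans; [apply Cmod_sub_le|]. lra.
Qed.

Lemma disk_away (n : nat) (z : C) : in_disk (t n) (rho n) z -> awayb (del n b) z.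
Proof.
  intros Hz k. destruct (Nat.eq_dec k n) as [->|E]; [left; apply del_same|].
  right. apply (Hdisj n k z); auto.
Qed.

Lemma rho_le : forall n, rho n <= c0.
Proof.
  intros n. rewrite Hrho. assert (P := W_pow_pos t n M).
  apply Rle_trans with (c0 / 1); [|lra]. apply Rmult_le_compat_l; [lra|]. apply Rinv_le_contravar; lra.
Qed.

Lemma disk_expansion (n : nat) (z : C) : in_disk (t n) (rho n) z ->
  (z ^ S K * F z = qn t A n z * ((z - t n) * (m + CT t (del n b) z) + b n))%C.
Proof.
  intros Hz.
  assert (Hzt : forall k, k <> n -> z <> t k).
  { intros k Hk ->. assert (T := Hdisj n k (t k) (not_eq_sym Hk) Hz). rewrite Cmod_self in T.
    generalize (rho_pos k). lra. }
  assert (SW : ex_series (fun n => Cmod (a n) / W n)) by apply l2mu_W, HF.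
  rewrite (proj2 HF). fold a. rewrite (synth_near n) by auto.
  destruct (classic (z = t n)) as [->|E].
  - unfold b. ring.
  - assert (Hz' : forall k, z <> t k).
    { intros k. destruct (Nat.eq_dec k n) as [->|Hk]; auto. }
    assert (X := lead_expansion z Hz').
    rewrite (CT_del n a), (CT_del n b) in X; auto.
    2:{ apply ex_series_dom with (fun n => v n * W n ^ 0); [|apply lead_vs]. intros k.
        assert (W1 := W_ge1 (t := t) k). assert (P := Cmod_ge_0 (b k)). assert (Q := lead_v k).
        split; [apply Rdiv_le_0_compat; lra|]. rewrite Rmult_1_r.
        apply Rle_trans with (Cmod (b k) / 1); [|lra].
        apply Rmult_le_compat_l; [auto|]. apply Rinv_le_contravar; lra. }
    assert (N := Cminus_neq0 _ _ E).
    transitivity (qn t A n z * ((z - t n) * (z ^ S K * (a n / (z - t n) + CT t (del n a) z))))%C.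
    + field. auto.
    + rewrite X. f_equal. field. auto.
Qed.

(** With [h = CT t (del n b)], the function [z^(K+1) F] is [qn * (m + h) * (z - T z)] in the [n]-th
    disk, where [T z = t_n - b_n / (m + h z)]. The Lipschitz constant of [h] does not depend on [n],
    while [b_n] decays. *)
Lemma inner_zeros : exists N, forall n, (N <= n)%nat ->
  exists w, in_disk (t n) (rho n) w /\ simple_zero F w /\
    forall z, in_disk (t n) (rho n) z -> F z = 0%C -> z = w.
Proof.
  set (B := 2 * Series (fun n => v n * (1 + / c0 * W n ^ S M))).
  set (Lp := 2 * Series (fun n => v n * (/ c0 ^ 2 * W n ^ (M * 2)))).
  assert (PM := lead_pos). set (mm := Cmod m) in *.
  assert (HL0 : 0 <= Lp).
  { apply Rmult_le_pos; [lra|]. apply Series_pos.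
    - intros n. assert (Q := lead_v n). assert (P := Cmod_ge_0 (b n)).
      apply Rmult_le_pos; [lra|]. apply Rmult_le_pos.
      + left. apply Rinv_0_lt_compat. now apply pow_lt.
      + apply pow_le. generalize (W_ge1 (t := t) n). lra.
    - apply rex_ext with (fun n => / c0 ^ 2 * (v n * W n ^ (M * 2))); [intros; ring|].
      apply ex_series_mul, lead_vs. }
  (* [N1] ensures [|h| <= |m| / 2] in the disk, [N2] that [T] maps it into the concentric disk of
     half the radius, and [N3] that [|b_n| * Lp / (|m| / 2)^2 <= 1 / 2], the contraction
     constant. *)
  destruct (t_far (c0 + 1 + 2 * Rabs B / mm)) as [N1 HN1].
  destruct (ex_series_small (fun n => v n * W n ^ M) (c0 * mm / 4)) as [N2 HN2].
  { apply Rdiv_lt_0_compat; [now apply Rmult_lt_0_compat|lra]. }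
  { apply lead_vs. }
  destruct (ex_series_small (fun n => v n * W n ^ 0) (mm ^ 2 / (8 * (Lp + 1)))) as [N3 HN3].
  { apply Rdiv_lt_0_compat; [now apply pow_lt|lra]. }
  { apply lead_vs. }
  exists (max N1 (max N2 N3)). intros n Hn.
  specialize (HN1 n ltac:(lia)). specialize (HN2 n ltac:(lia)). specialize (HN3 n ltac:(lia)).
  rewrite Rmult_1_r in HN3.
  assert (R0 := rho_pos n). assert (R1 := rho_le n). assert (PW := W_pow_pos t n M).
  set (h := CT t (del n b)).
  assert (ZB : forall z, in_disk (t n) (rho n) z -> 1 <= Cmod z /\ Cmod (h z) <= mm / 2).
  { intros z Hz. assert (T := Cmod_rev_triangle (t n) (t n - z)%C).
    replace (t n - (t n - z))%C with z in T by ring. rewrite (Cmod_sub_sym (t n) z) in T.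
    unfold in_disk in Hz.
    assert (Q : 0 <= 2 * Rabs B / mm).
    { apply Rdiv_le_0_compat; [generalize (Rabs_pos B); lra|auto]. }
    assert (Z1 : 1 + 2 * Rabs B / mm <= Cmod z) by lra. split; [lra|].
    assert (D := CT_decay (del n b) v).
    assert (D' : Cmod z * Cmod (h z) <= B).
    { apply D; [|apply lead_vs|now apply disk_away]. intros k.
      eapply Rle_trans; [apply Cmod_del_le|apply lead_v]. }
    assert (D2 : Cmod z * Cmod (h z) <= Cmod z * (mm / 2)).
    { eapply Rle_trans; [apply D'|]. eapply Rle_trans; [apply Rle_abs|].
      apply Rle_trans with (2 * Rabs B / mm * (mm / 2)); [right; field; lra|].
      apply Rmult_le_compat_r; lra. }
    apply Rmult_le_reg_l with (Cmod z); lra. }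
  assert (MH : forall z, in_disk (t n) (rho n) z -> mm / 2 <= Cmod (m + h z)%C).
  { intros z Hz. destruct (ZB z Hz) as [_ H]. assert (T := Cmod_rev_triangle m (- h z)%C).
    replace (m - - h z)%C with (m + h z)%C in T by ring. rewrite Cmod_opp in T. fold mm in T. lra. }
  assert (MH0 : forall z, in_disk (t n) (rho n) z -> (m + h z)%C <> 0%C).
  { intros z Hz. apply Cmod_gt_0. specialize (MH z Hz). lra. }
  assert (HLip : forall z w, in_disk (t n) (rho n) z -> in_disk (t n) (rho n) w ->
     Cmod (h z - h w)%C <= Lp * Cmod (z - w)%C).
  { intros z w Hz Hw. apply CT_lip; [|apply lead_vs|now apply disk_away|now apply disk_away].
    intros k. eapply Rle_trans; [apply Cmod_del_le|apply lead_v]. }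
  set (T := fun z => (t n - b n / (m + h z))%C).
  assert (BN := lead_v n). assert (BN0 := Cmod_ge_0 (b n)).
  assert (T1 : forall z, in_disk (t n) (rho n) z -> Cmod (T z - t n)%C <= rho n / 2).
  { intros z Hz. unfold T. replace (t n - b n / (m + h z) - t n)%C with (- (b n / (m + h z)))%C by ring.
    rewrite Cmod_opp, Cmod_div by auto. specialize (MH z Hz).
    apply Rle_trans with (Cmod (b n) * / (mm / 2)).
    - apply Rmult_le_compat_l; [auto|]. apply Rinv_le_contravar; lra.
    - rewrite Hrho. apply Rmult_le_reg_r with (W n ^ M * (mm / 2)); [nra|].
      replace (Cmod (b n) * / (mm / 2) * (W n ^ M * (mm / 2))) with (Cmod (b n) * W n ^ M) by (field; lra).
      replace (c0 / W n ^ M / 2 * (W n ^ M * (mm / 2))) with (c0 * mm / 4) by (field; lra).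
      left. eapply Rle_lt_trans; [|apply HN2]. apply Rmult_le_compat_r; lra. }
  assert (T2 : forall z w, in_disk (t n) (rho n) z -> in_disk (t n) (rho n) w ->
     Cmod (T z - T w)%C <= 1 / 2 * Cmod (z - w)%C).
  { intros z w Hz Hw. unfold T.
    replace (t n - b n / (m + h z) - (t n - b n / (m + h w)))%C
      with (b n * (h z - h w) / ((m + h z) * (m + h w)))%C by (field; auto).
    rewrite Cmod_div, !Cmod_mult by (intros Z; apply Cmult_integral in Z; destruct Z as [Z|Z];
      [now apply (MH0 z)|now apply (MH0 w)]).
    assert (Hzw := HLip z w Hz Hw). assert (P := Cmod_ge_0 (z - w)%C).
    assert (Q1 := MH z Hz). assert (Q2 := MH w Hw).
    apply Rle_trans with (mm ^ 2 / (8 * (Lp + 1)) * (Lp * Cmod (z - w)%C) * / (mm / 2 * (mm / 2))).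
    - apply Rmult_le_compat.
      + apply Rmult_le_pos; apply Cmod_ge_0.
      + left. apply Rinv_0_lt_compat. nra.
      + apply Rmult_le_compat; auto; try apply Cmod_ge_0. lra.
      + apply Rinv_le_contravar; [nra|]. apply Rmult_le_compat; lra.
    - replace (mm ^ 2 / (8 * (Lp + 1)) * (Lp * Cmod (z - w)%C) * / (mm / 2 * (mm / 2)))
        with (Lp / (Lp + 1) * (1 / 2 * Cmod (z - w)%C)) by (field; lra).
      rewrite <- (Rmult_1_l (1 / 2 * Cmod (z - w)%C)) at 2.
      apply Rmult_le_compat_r; [lra|]. apply Rmult_le_reg_r with (Lp + 1); [lra|].
      unfold Rdiv. rewrite Rmult_assoc, Rinv_l by lra. lra. }
  assert (INh : forall z, Cmod (z - t n)%C <= rho n / 2 -> in_disk (t n) (rho n) z).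
  { intros z Hz. unfold in_disk. lra. }
  destruct (contraction_fixpoint T (t n) (rho n / 2)) as [w [W1 W2]]; [lra|auto|auto|].
  assert (Iw := INh w W1).
  assert (EX : forall z, in_disk (t n) (rho n) z ->
     (z ^ S K * F z = qn t A n z * ((m + h z) * (z - T z)))%C).
  { intros z Hz. rewrite (disk_expansion n z Hz). fold h. f_equal. unfold T. field. auto. }
  assert (QN : forall z, in_disk (t n) (rho n) z -> qn t A n z <> 0%C).
  { intros z Hz. apply qn_neq. intros k Hk ->.
    assert (Q := Hdisj n k (t k) (not_eq_sym Hk) Hz). rewrite Cmod_self in Q.
    generalize (rho_pos k). lra. }
  assert (ZP : forall z, in_disk (t n) (rho n) z -> (z ^ S K)%C <> 0%C).
  { intros z Hz. apply Cmod_gt_0. rewrite Cmod_pow. apply pow_lt. destruct (ZB z Hz). lra. }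
  assert (UN : forall z, in_disk (t n) (rho n) z -> F z = 0%C -> z = w).
  { intros z Hz Fz. specialize (EX z Hz). rewrite Fz, Cmult_0_r in EX. symmetry in EX.
    apply Cmult_integral in EX. destruct EX as [EX|EX]; [now apply QN in EX|].
    apply Cmult_integral in EX. destruct EX as [EX|EX]; [now apply MH0 in EX|].
    apply Cminus_eq0 in EX. assert (Q := T2 z w Hz Iw). rewrite <- EX, W2 in Q.
    apply Cminus_eq0, Cmod_eq_0. assert (P := Cmod_ge_0 (z - w)%C). lra. }
  assert (Fw : F w = 0%C).
  { assert (E := EX w Iw). rewrite W2 in E. replace (w - w)%C with (RtoC 0) in E by ring.
    rewrite !Cmult_0_r in E. apply Cmult_integral in E. destruct E as [E|E]; [now apply ZP in E|auto]. }
  exists w. split; [auto|split; [|auto]]. split; [auto|].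
  (* If the derivative were [0], then [|F z| <= kk * |z - w|] near [w]. But
     [|z - T z| >= |z - w| / 2] bounds [|F z|] below by a multiple of [|z - w|], and [kk] is half of
     that factor. *)
  destruct (inHr_hol F w HF) as [l Hl]. exists l. split; [now apply is_derive_cderiv|].
  intros ->.
  assert (Qc := hol_cont _ _ (qn_hol (A := A) n w)).
  destruct (ccont_nonzero _ w Qc (QN w Iw)) as [d1 [D1 Hd1]].
  assert (PQ := proj1 (Cmod_gt_0 _) (QN w Iw)). set (qq := Cmod (qn t A n w)) in *.
  set (U := (Cmod w + 1) ^ S K).
  assert (PU : 0 < U) by (apply pow_lt; generalize (Cmod_ge_0 w); lra).
  set (kk := qq * mm / (16 * U)).
  assert (Pk : 0 < kk) by (apply Rdiv_lt_0_compat; [now apply Rmult_lt_0_compat|lra]).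
  destruct (Hl kk Pk) as [d2 [D2 Hd2]].
  set (d := Rmin (Rmin d1 d2) (Rmin 1 (rho n / 2))).
  assert (Hd : 0 < d) by (repeat apply Rmin_pos; lra).
  assert (Dd : d <= d1 /\ d <= d2 /\ d <= 1 /\ d <= rho n / 2).
  { unfold d. repeat split.
    - eapply Rle_trans; [apply Rmin_l|apply Rmin_l].
    - eapply Rle_trans; [apply Rmin_l|apply Rmin_r].
    - eapply Rle_trans; [apply Rmin_r|apply Rmin_l].
    - eapply Rle_trans; [apply Rmin_r|apply Rmin_r]. }
  set (z := (w + RtoC (d / 2))%C).
  assert (Zw : Cmod (z - w)%C = d / 2).
  { unfold z. replace (w + RtoC (d / 2) - w)%C with (RtoC (d / 2)) by ring.
    rewrite Cmod_R. apply Rabs_pos_eq. lra. }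
  assert (Iz : in_disk (t n) (rho n) z).
  { unfold in_disk. replace (z - t n)%C with ((z - w) + (w - t n))%C by ring.
    eapply Rle_lt_trans; [apply Cmod_triangle|]. lra. }
  specialize (Hd1 z ltac:(lra)). specialize (Hd2 z ltac:(lra)).
  rewrite Fw in Hd2. replace (F z - 0 - (z - w) * 0)%C with (F z) in Hd2 by ring.
  assert (E := EX z Iz). apply (f_equal Cmod) in E. rewrite !Cmod_mult, Cmod_pow in E.
  assert (Q1 := MH z Iz). assert (Q2 := T2 z w Iz Iw). rewrite W2 in Q2.
  assert (Q3 : 1 / 2 * Cmod (z - w)%C <= Cmod (z - T z)%C).
  { assert (Q := Cmod_rev_triangle (z - w)%C (T z - w)%C).
    replace (z - w - (T z - w))%C with (z - T z)%C in Q by ring. lra. }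
  assert (Q4 : Cmod z ^ S K <= U).
  { apply pow_incr. split; [apply Cmod_ge_0|].
    assert (Q := Cmod_rev_triangle z w). lra. }
  assert (LOW : qq / 2 * (mm / 2 * (1 / 2 * Cmod (z - w)%C)) <= U * (kk * Cmod (z - w)%C)).
  { apply Rle_trans with (Cmod (qn t A n z) * (Cmod (m + h z)%C * Cmod (z - T z)%C)).
    - apply Rmult_le_compat; try lra.
      + apply Rmult_le_pos; lra.
      + apply Rmult_le_compat; lra.
    - rewrite <- E. apply Rmult_le_compat; auto; [apply pow_le, Cmod_ge_0|apply Cmod_ge_0]. }
  replace (U * (kk * Cmod (z - w)%C)) with (qq * mm / 16 * Cmod (z - w)%C) in LOW
    by (unfold kk; field; lra).
  rewrite Zw in LOW. assert (0 < qq * mm * d) by (repeat apply Rmult_lt_0_compat; auto). nra.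
Qed.

End OneFunction.
End Localization.

(** * Localization from density *)

Section DenseLocalization.
Context {t : nat -> C} {A : C -> C} {mu : nat -> R}.
Context {Hdata : admissible_data t mu} {HA : generating_function t A}.

Notation inHr := (@inHr t A mu).

(** Powers are Newton polynomials with all nodes [0]; if all their moments vanished, so would those
    of all polynomials, and density would force [F = 0]. *)
Lemma first_moment (F : C -> C) : polys_in_and_dense t mu -> inHr F -> (exists z, F z <> 0%C) ->
  exists K, csum (fun n => residue t A F n * t n ^ K)%C <> 0%C /\
    forall k, (k < K)%nat -> csum (fun n => residue t A F n * t n ^ k)%C = 0%C.
Proof.
  intros HP HF [z Hz].
  assert (HM := polys_all_moments (mu := mu) (proj1 HP)).
  assert (E0 : forall k u, nu (fun _ => RtoC 0) k u = (u ^ k)%C).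
  { induction k as [|k IH]; intros u; simpl; [auto|]. rewrite IH. ring. }
  assert (H : exists k, csum (fun n => residue t A F n * t n ^ k)%C <> 0%C).
  { apply NNPP. intros HN. apply Hz. apply dense_annihilator; auto.
    apply (all_moments_newton (fun _ => RtoC 0) F HM HF). intros k.
    apply NNPP. intros Hk. apply HN. exists k. intros E. apply Hk. unfold mom.
    rewrite (csum_ext _ (fun n => residue t A F n * t n ^ k)%C); [exact E|].
    intros n. f_equal. apply E0. }
  destruct H as [k Hk]. revert Hk. induction k as [k IH] using (well_founded_ind lt_wf). intros Hk.
  destruct (classic (exists j, (j < k)%nat /\ csum (fun n => residue t A F n * t n ^ j)%C <> 0%C))
    as [[j [H1 H2]]|HN].
  - now apply (IH j).
  - exists k. split; auto. intros j Hj. apply NNPP. intros H. apply HN. now exists j.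
Qed.

(** The exponent [M] is free: the disks may shrink like any power of the weight. A large [M] later
    makes the displacements of the zeros summable. *)
Lemma dense_localizes (c : R) (p M : nat) (F : C -> C) :
  0 < c -> (p <= M)%nat -> (forall n m, n <> m -> c / weight t n ^ p <= Cmod (t n - t m)%C) ->
  polys_in_and_dense t mu -> inHr F -> (exists z, F z <> 0%C) ->
  (exists L : list C, forall z, F z = 0%C ->
     (forall n, ~ in_disk (t n) (c / 4 / weight t n ^ M) z) -> In z L) /\
  (exists N, forall n, (N <= n)%nat ->
     exists w, in_disk (t n) (c / 4 / weight t n ^ M) w /\ simple_zero F w /\
       forall z, in_disk (t n) (c / 4 / weight t n ^ M) z -> F z = 0%C -> z = w).
Proof.
  intros Hc Hp Hs HP HF HN.
  assert (HM := polys_all_moments (mu := mu) (proj1 HP)).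
  destruct (first_moment F HP HF HN) as [K [HK HK0]].
  set (rho := fun n => c / 4 / weight t n ^ M).
  assert (Hc0 : 0 < c / 4) by lra.
  assert (Hrho : forall n, rho n = c / 4 / weight t n ^ M) by reflexivity.
  assert (Hd := rho_disjoint (rho := rho) Hc0 Hrho c p Hc eq_refl Hp Hs).
  split.
  - apply (outer_zeros (rho := rho) Hc0 Hrho HM HF K HK HK0 HN).
  - apply (inner_zeros (rho := rho) Hc0 Hrho HM HF Hd K HK HK0).
Qed.

Lemma dense_strong_localization : power_separated t -> polys_in_and_dense t mu ->
  strong_localization t A mu.
Proof.
  intros Hsep HP. destruct (power_separated_nat t Hsep) as [c [p [Hc [_ Hs]]]].
  (* A positive exponent makes the radii tend to [0]. *)
  set (M := S p). exists (fun n => c / 4 / weight t n ^ M).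
  assert (Hc0 : 0 < c / 4) by lra.
  assert (Hr : forall n, 0 < c / 4 / weight t n ^ M).
  { intros n. apply Rdiv_lt_0_compat; [auto|]. generalize (W_pow_pos t n M). lra. }
  split; [exact Hr|]. split; [|split].
  - apply is_lim_seq_spec. intros e. destruct (t_far (c / 4 / e)) as [N HN]. exists N. intros n Hn.
    specialize (HN n Hn). assert (He := cond_pos e). rewrite Rminus_0_r, Rabs_pos_eq by (left; apply Hr).
    assert (W1 := W_ge1 (t := t) n). assert (P := W_pow_pos t n p).
    apply Rmult_lt_reg_r with (weight t n ^ M); [generalize (W_pow_pos t n M); lra|].
    unfold Rdiv at 1. rewrite Rmult_assoc, Rinv_l, Rmult_1_r by (generalize (W_pow_pos t n M); lra).
    apply Rmult_le_compat_r with (r := e) in HN; [|lra].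
    replace (c / 4 / e * e) with (c / 4) in HN by (field; lra).
    assert (weight t n <= weight t n ^ M).
    { unfold M. simpl. rewrite <- (Rmult_1_r (weight t n)) at 1. apply Rmult_le_compat_l; lra. }
    unfold weight at 1 in H. apply Rle_lt_trans with (Cmod (t n) * e); [auto|]. nra.
  - intros n m z Hnm Hn Hm.
    assert (Q := rho_disjoint (rho := fun n => c / 4 / weight t n ^ M) (M := M) Hc0 (fun _ => eq_refl)
      c p Hc eq_refl (le_S _ _ (le_n _)) Hs n m z Hnm Hn). unfold in_disk in Hm. lra.
  - intros F HF HN. apply inH_iff in HF.
    apply (dense_localizes c p M F Hc); auto. unfold M. lia.
Qed.

End DenseLocalization.

(** * Exchanging zeros *)

(** Normalized to [1] at [0]: exchanging the zeros [s], [s'] for [p] multiplies by [Nf p / Qf s s'],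
    which is close to [1] on bounded sets when the three points are far away. For [s' = p] it is the
    mere removal of [s]. *)
Definition Nf (p z : C) : C := (1 - z / p)%C.
Definition Qf (s s' z : C) : C := ((1 - z / s) * (1 - z / s'))%C.

Lemma Nf_hol (p z : C) : hol (Nf p) z.
Proof.
  apply hol_minus; [apply hol_const|].
  apply hol_mult; [apply hol_id|apply hol_const].
Qed.

Lemma Qf_hol (s s' z : C) : hol (Qf s s') z.
Proof. apply hol_mult; apply (Nf_hol _ z). Qed.

Lemma Nf_neq (p z : C) : p <> 0%C -> z <> p -> Nf p z <> 0%C.
Proof.
  intros Hp Hz E. apply Hz. unfold Nf in E.
  transitivity (p - p * (1 - z / p))%C; [field; auto|]. rewrite E. ring.
Qed.

Lemma Qf_neq (s s' z : C) : s <> 0%C -> s' <> 0%C -> z <> s -> z <> s' -> Qf s s' z <> 0%C.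
Proof.
  intros H1 H2 H3 H4 E. apply Cmult_integral in E.
  destruct E as [E|E]; revert E; now apply Nf_neq.
Qed.

Lemma Qf_cancel (s s' : C) (F G : C -> C) : s <> 0%C -> s' <> 0%C ->
  (forall z, ccont F z) -> (forall z, ccont G z) ->
  (forall z, (F z * Qf s s' z = G z * Qf s s' z)%C) -> forall z, F z = G z.
Proof.
  intros H1 H2 HF HG E. apply (lin_cancel F G s); auto.
  apply (lin_cancel (fun z => (z - s) * F z)%C (fun z => (z - s) * G z)%C s').
  - intros z. apply ccont_mult; auto. apply ccont_minus; [apply ccont_id|apply ccont_const].
  - intros z. apply ccont_mult; auto. apply ccont_minus; [apply ccont_id|apply ccont_const].
  - intros z. transitivity (s * s' * (F z * Qf s s' z))%C.
    + unfold Qf. field. auto.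
    + rewrite E. unfold Qf. field. auto.
Qed.

Lemma Cmod_ratio_le (z s : C) (r : R) : 0 < r -> r <= Cmod s -> Cmod (z / s)%C <= Cmod z / r.
Proof.
  intros Hr Hs. rewrite Cmod_div by (apply Cmod_gt_0; lra).
  apply Rmult_le_compat_l; [apply Cmod_ge_0|]. apply Rinv_le_contravar; auto.
Qed.

(** Both factors of [Qf] are at least [1 / 3] and the difference is at most [4 |z| / r], which gives
    [4 * 9 = 36]. *)
Lemma NQ_near (s s' p z : C) (r : R) : 0 < r -> r <= Cmod s -> r <= Cmod s' -> r <= Cmod p ->
  Cmod z <= 2 / 3 * r ->
  / 9 <= Cmod (Qf s s' z) /\
  Cmod (Nf p z - Qf s s' z)%C <= 36 * (Cmod z / r) * Cmod (Qf s s' z).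
Proof.
  intros Hr H1 H2 H3 Hz. set (x := Cmod z / r).
  assert (X0 : 0 <= x) by (apply Rdiv_le_0_compat; [apply Cmod_ge_0|auto]).
  assert (X1 : x <= 2 / 3).
  { unfold x. apply Rmult_le_reg_r with r; [auto|]. unfold Rdiv at 1.
    rewrite Rmult_assoc, Rinv_l by lra. lra. }
  assert (A1 := Cmod_ratio_le z s r Hr H1). assert (A2 := Cmod_ratio_le z s' r Hr H2).
  assert (A3 := Cmod_ratio_le z p r Hr H3). fold x in A1, A2, A3.
  assert (B1 := Cmod_rev_triangle 1%C (z / s)%C). assert (B2 := Cmod_rev_triangle 1%C (z / s')%C).
  rewrite Cmod_1 in B1, B2.
  assert (Q : / 9 <= Cmod (Qf s s' z)).
  { unfold Qf. rewrite Cmod_mult. replace (/ 9) with (/ 3 * / 3) by lra.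
    apply Rmult_le_compat; lra. }
  split; auto.
  replace (Nf p z - Qf s s' z)%C with ((z / s + z / s' - z / p) - z / s * (z / s'))%C
    by (unfold Nf, Qf; ring).
  assert (T : Cmod ((z / s + z / s' - z / p) - z / s * (z / s'))%C <= 4 * x).
  { eapply Rle_trans; [apply Cmod_sub_le|]. rewrite Cmod_mult.
    assert (T1 := Cmod_sub_le (z / s + z / s')%C (z / p)%C).
    assert (T2 := Cmod_triangle (z / s)%C (z / s')%C).
    assert (T3 : Cmod (z / s)%C * Cmod (z / s')%C <= x * 1)
      by (apply Rmult_le_compat; try apply Cmod_ge_0; lra).
    lra. }
  eapply Rle_trans; [apply T|]. nra.
Qed.

(** With [x = |z| / r >= 4], the numerator is at most [1 + 2 x] and the denominator at least
    [(x - 1)^2], which is no smaller. Two zeros against one make the multiplier harmless far out. *)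
Lemma NQ_far (s s' p z : C) (r : R) : 0 < r -> s <> 0%C -> s' <> 0%C -> Cmod s <= r -> Cmod s' <= r ->
  r / 2 <= Cmod p -> 4 * r <= Cmod z ->
  Qf s s' z <> 0%C /\ Cmod (Nf p z) <= Cmod (Qf s s' z).
Proof.
  intros Hr N1 N2 H1 H2 H3 Hz. set (x := Cmod z / r).
  assert (X1 : 4 <= x).
  { unfold x. apply Rmult_le_reg_r with r; [auto|]. unfold Rdiv.
    rewrite Rmult_assoc, Rinv_l by lra. lra. }
  assert (LB : forall u : C, u <> 0%C -> Cmod u <= r -> x - 1 <= Cmod (1 - z / u)%C).
  { intros u Hu Hr'. assert (T := Cmod_rev_triangle (z / u)%C 1%C). rewrite Cmod_1 in T.
    rewrite Cmod_sub_sym in T. rewrite Cmod_div in T by auto.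
    assert (P := proj1 (Cmod_gt_0 _) Hu).
    assert (x <= Cmod z / Cmod u); [|lra].
    apply Rmult_le_compat_l; [apply Cmod_ge_0|]. apply Rinv_le_contravar; auto. }
  assert (L1 := LB s N1 H1). assert (L2 := LB s' N2 H2).
  assert (Q : (x - 1) * (x - 1) <= Cmod (Qf s s' z)).
  { unfold Qf. rewrite Cmod_mult. apply Rmult_le_compat; lra. }
  assert (NB : Cmod (Nf p z) <= 1 + 2 * x).
  { unfold Nf. eapply Rle_trans; [apply Cmod_sub_le|]. rewrite Cmod_1.
    assert (T := Cmod_ratio_le z p (r / 2) ltac:(lra) H3).
    replace (Cmod z / (r / 2)) with (2 * x) in T by (unfold x; field; lra). lra. }
  split; [apply Cmod_gt_0; nra|nra].
Qed.

Section Quotient.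
Context {t : nat -> C} {A : C -> C} {mu : nat -> R}.
Context {Hdata : admissible_data t mu} {HA : generating_function t A}.

Notation inHr := (@inHr t A mu).
Notation res := (residue t A).
Notation W := (weight t).

(** Partial fractions: the multiplier is a combination of [1 / (z - s)] and
    [1 / ((z - s) (z - s'))], so at most two divisions by zeros suffice. *)
Lemma quotient_exists (F : C -> C) (s s' p : C) : inHr F -> s <> 0%C -> s' <> 0%C -> p <> 0%C ->
  F s = 0%C -> (s' = p \/ (F s' = 0%C /\ s' <> s)) ->
  exists G, inHr G /\ forall z, (G z * Qf s s' z = F z * Nf p z)%C.
Proof.
  intros HF Hs Hs' Hp Fs H. destruct (fin_ni F s HF Fs) as [G1 [HG1 E1]].
  destruct H as [->|[Fs' Hne]].
  - exists (fun z => - s * G1 z)%C. split; [now apply inHr_scal|].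
    intros z. rewrite E1. unfold Qf, Nf. field. auto.
  - assert (G10 : G1 s' = 0%C).
    { rewrite E1 in Fs'. apply Cmult_integral in Fs'. destruct Fs' as [Z|Z]; [|auto].
      apply Cminus_eq0 in Z. contradiction. }
    destruct (fin_ni G1 s' HG1 G10) as [G2 [HG2 E2]].
    exists (fun z => s * s' * (G2 z + (- / p) * (G1 z + s' * G2 z)))%C. split.
    + apply inHr_scal. apply (inHr_plus G2); auto. apply inHr_scal.
      apply (inHr_plus G1); auto. now apply inHr_scal.
    + intros z. rewrite E1, E2. unfold Qf, Nf. field. auto.
Qed.

Lemma quotient_res (F G : C -> C) (s s' p : C) :
  (forall z, (G z * Qf s s' z = F z * Nf p z)%C) ->
  forall m, (res G m * Qf s s' (t m) = res F m * Nf p (t m))%C.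
Proof.
  intros E m. unfold residue.
  transitivity (G (t m) * Qf s s' (t m) / alpha t A m)%C; [unfold Cdiv; ring|].
  rewrite E. unfold Cdiv. ring.
Qed.

Lemma inHr_cont (F : C -> C) (z : C) : inHr F -> ccont F z.
Proof. intros HF. apply hol_cont. now apply inHr_hol. Qed.

(** Evaluation at a point is continuous for a weighted supremum of the residues; the corrections of
    the removal process are controlled in this way, residue by residue. *)
Lemma eval_small (L : nat) (z : C) : ex_series (fun n => / W n ^ L) ->
  exists c, 0 <= c /\ forall D e, inHr D -> 0 <= e ->
    (forall m, Cmod (res D m) * W m ^ L <= e * sqrt (mu m)) -> Cmod (D z) <= e * c.
Proof.
  intros HL. destruct (classic (exists m, z = t m)) as [[m ->]|Hz].
  - exists (Cmod (alpha t A m) * sqrt (mu m)). split; [apply Rmult_le_pos; [apply Cmod_ge_0|apply sqrt_pos]|].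
    intros D e HD He H. replace (D (t m)) with (alpha t A m * res D m)%C
      by (unfold residue; field; apply alpha_neq).
    rewrite Cmod_mult. specialize (H m). assert (P := W_pow_pos t m L).
    assert (Q := Cmod_ge_0 (res D m)).
    assert (Cmod (res D m) <= e * sqrt (mu m)) by nra.
    replace (e * (Cmod (alpha t A m) * sqrt (mu m))) with (Cmod (alpha t A m) * (e * sqrt (mu m))) by ring.
    apply Rmult_le_compat_l; [apply Cmod_ge_0|auto].
  - assert (Hz' : forall m, z <> t m) by (intros m E; apply Hz; now exists m).
    destruct (kappa z) as [k [K1 [K2 K3]]].
    set (v := fun m => mu m / W m ^ 2 + / W m ^ L).
    assert (SV : ex_series v) by (apply ex_series_add; [apply mu_W|exact HL]).
    assert (V0 : 0 <= Series v).
    { apply Series_pos; auto. intros m. assert (P := mu_pos m). assert (W1 := W_ge1 (t := t) m).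
      assert (PL := W_pow_pos t m L). unfold v.
      assert (0 <= mu m / W m ^ 2) by (apply Rdiv_le_0_compat; [lra|apply pow_lt; lra]).
      assert (0 < / W m ^ L) by (apply Rinv_0_lt_compat; lra). lra. }
    exists (Cmod (A z) * (2 * (/ k * Series v))). split.
    { apply Rmult_le_pos; [apply Cmod_ge_0|]. apply Rmult_le_pos; [lra|].
      apply Rmult_le_pos; [left; now apply Rinv_0_lt_compat|auto]. }
    intros D e HD He H. rewrite (proj2 HD), synth_off, Cmod_mult by auto.
    replace (e * (Cmod (A z) * (2 * (/ k * Series v))))
      with (Cmod (A z) * (2 * (e * / k * Series v))) by ring.
    apply Rmult_le_compat_l; [apply Cmod_ge_0|]. rewrite <- Series_scal_l.
    apply csum_bound_dom; [|now apply ex_series_mul].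
    intros m. assert (P := mu_pos m). assert (W1 := W_ge1 (t := t) m). assert (PL := W_pow_pos t m L).
    eapply Rle_trans; [apply (CT_term _ z k m); auto|].
    { intros E. elim (Hz' m). auto. }
    rewrite (Rmult_comm e), Rmult_assoc. apply Rmult_le_compat_l; [left; now apply Rinv_0_lt_compat|].
    specialize (H m).
    assert (S1 : sqrt (mu m) * / (W m * W m ^ L) <= v m).
    { unfold v. set (y := sqrt (mu m)). assert (Y : y ^ 2 = mu m) by (unfold y; rewrite pow2_sqrt; lra).
      rewrite <- Y. rewrite Rinv_mult.
      assert (IW : / W m ^ L <= 1) by (rewrite <- Rinv_1; apply Rinv_le_contravar; lra).
      assert (IW0 : 0 < / W m ^ L) by (apply Rinv_0_lt_compat; lra).
      replace (y ^ 2 / W m ^ 2) with ((y * / W m) ^ 2) by (field; lra).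
      replace (y * (/ W m * / W m ^ L)) with ((y * / W m) * / W m ^ L) by ring.
      assert (T := pow2_ge_0 (y * / W m - / W m ^ L)). nra. }
    apply Rle_trans with (e * (sqrt (mu m) * / (W m * W m ^ L))).
    + unfold Rdiv. apply Rmult_le_reg_r with (W m * W m ^ L); [nra|].
      replace (Cmod (res D m) * / W m * (W m * W m ^ L)) with (Cmod (res D m) * W m ^ L) by (field; lra).
      replace (e * (sqrt (mu m) * / (W m * W m ^ L)) * (W m * W m ^ L)) with (e * sqrt (mu m)) by (field; lra).
      exact H.
    + apply Rmult_le_compat_l; auto.
Qed.

End Quotient.

Lemma eventual_bound (x y : nat -> R) (N : nat) (c : R) : (forall m, 0 < y m) ->
  (forall m, (N <= m)%nat -> x m <= c * y m) -> exists c', 0 <= c' /\ forall m, x m <= c' * y m.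
Proof.
  intros Hy H. destruct (finite_bound (fun m => x m / y m) N) as [B HB].
  exists (Rmax 0 (Rmax c B)). split; [apply Rmax_l|]. intros m. assert (P := Hy m).
  assert (T1 := Rmax_r 0 (Rmax c B)). assert (T2 := Rmax_l c B). assert (T3 := Rmax_r c B).
  destruct (Nat.lt_ge_cases m N) as [Hm|Hm].
  - specialize (HB m Hm). simpl in HB.
    replace (x m) with (x m / y m * y m) by (field; lra). apply Rmult_le_compat_r; lra.
  - eapply Rle_trans; [apply H, Hm|]. apply Rmult_le_compat_r; lra.
Qed.

(** The exponent [k + 2] leaves room for the factor [2] of [csum_bound_dom] and the sum [2] of the
    geometric series. *)
Lemma geometric_limit (a : nat -> C) (e : R) :
  (forall k, Cmod (a (S k) - a k)%C <= (1 / 2) ^ (k + 2) * e) ->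
  exists l, forall k, Cmod (a k - l)%C <= (1 / 2) ^ k * e.
Proof.
  intros H. set (d := fun k => (a (S k) - a k)%C).
  assert (G0 : Rabs (1 / 2) < 1) by (rewrite Rabs_pos_eq; lra).
  assert (G : ex_series (fun n => (1 / 2) ^ n)) by (now exists (/ (1 - 1 / 2)); apply is_series_geom).
  assert (GS : Series (fun n => (1 / 2) ^ n) = 2).
  { rewrite Series_geom by auto. field. }
  assert (Hd : csmb d).
  { apply csmb_dom with (fun k => e / 4 * (1 / 2) ^ k); [|now apply ex_series_mul].
    intros k. eapply Rle_trans; [apply H|]. rewrite pow_add. right. field. }
  exists (a O + csum d)%C. intros k.
  assert (T : forall k, psum d k = (a k - a O)%C).
  { induction k0 as [|k0 IH]; simpl; [ring|]. rewrite IH. unfold d. ring. }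
  rewrite (csum_tail d k Hd), T.
  replace (a k - (a O + (a k - a O + csum (fun n => d (k + n)%nat))))%C
    with (- csum (fun n => d (k + n)%nat))%C by ring.
  rewrite Cmod_opp. eapply Rle_trans.
  - apply csum_bound_dom with (v := fun n => ((1 / 2) ^ k * e / 4) * (1 / 2) ^ n); [|now apply ex_series_mul].
    intros n. eapply Rle_trans; [apply H|]. rewrite !pow_add. right. field.
  - rewrite (Series_scal_l _ (fun n => (1 / 2) ^ n)), GS. right. field.
Qed.

Lemma half_pow_le1 (i : nat) : (1 / 2) ^ i <= 1.
Proof. induction i as [|i IH]; simpl; [lra|]. assert (0 < (1 / 2) ^ i) by (apply pow_lt; lra). lra. Qed.

Lemma half_pow_small (x y : R) : (forall i : nat, x <= (1 / 2) ^ i * y) -> x <= 0.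
Proof.
  intros H. apply Rnot_lt_le. intros Hx.
  assert (Hy : 0 < y) by (specialize (H O); simpl in H; lra).
  destruct (pow_lt_1_zero (1 / 2) ltac:(rewrite Rabs_pos_eq; lra) (x / y)) as [N HN].
  { now apply Rdiv_lt_0_compat. }
  specialize (HN N (Nat.le_refl _)). specialize (H N).
  rewrite Rabs_pos_eq in HN by (apply pow_le; lra).
  apply Rmult_lt_compat_r with (r := y) in HN; [|lra].
  replace (x / y * y) with x in HN by (field; lra). lra.
Qed.

(** * Exchanging zeros along a sparse sequence *)

Section Removal.
Context {t : nat -> C} {A : C -> C} {mu : nat -> R}.
Context {Hdata : admissible_data t mu} {HA : generating_function t A}.

Notation inHr := (@inHr t A mu).
Notation res := (residue t A).
Notation W := (weight t).

Lemma sqrt_mu_pos (m : nat) : 0 < sqrt (mu m).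
Proof. apply sqrt_lt_R0, mu_pos. Qed.

Lemma res_bound (F : C -> C) : inHr F ->
  exists c, 0 <= c /\ forall m, Cmod (res F m) <= c * sqrt (mu m).
Proof.
  intros HF. assert (S := proj1 HF). unfold l2mu in S.
  set (B := Series (fun n => Cmod (res F n) ^ 2 / mu n)).
  assert (P : forall n, 0 <= Cmod (res F n) ^ 2 / mu n).
  { intros n. apply Rdiv_le_0_compat; [apply pow2_ge_0|apply mu_pos]. }
  assert (B0 : 0 <= B) by (apply Series_pos; auto).
  exists (B + 1). split; [lra|]. intros m. assert (T := Series_term _ m P S). fold B in T. cbv beta in T.
  assert (PM := mu_pos m). assert (Q := sqrt_mu_pos m). assert (E := pow2_sqrt (mu m) ltac:(lra)).
  apply Rsqr_incr_0_var; [|apply Rmult_le_pos; lra].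
  rewrite !Rsqr_pow2, Rpow_mult_distr, E.
  apply Rmult_le_compat_r with (r := mu m) in T; [|lra].
  unfold Rdiv in T. rewrite Rmult_assoc, Rinv_l, Rmult_1_r in T by lra. nra.
Qed.

Context {L b : nat} {f : C -> C} {z0 : C} {J : nat -> Prop} {s s' p : nat -> C} {C0 : R}.
Context (HL : ex_series (fun n => / W n ^ L)).
Context (Hf : inHr f) (Hz0 : f z0 <> 0%C).
Context (HJ : forall n, exists j, (n <= j)%nat /\ J j).
Context (Hs : forall j, J j -> f (s j) = 0%C /\ (s' j = p j \/ (f (s' j) = 0%C /\ s' j <> s j))).
Context (Hd : forall j, J j -> Cmod (s j - t j)%C <= 4 /\ Cmod (s' j - t j)%C <= 4 /\ Cmod (p j - t j)%C <= 4).

Definition qrel (F G : C -> C) (j : nat) : Prop :=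
  forall z, (G z * Qf (s j) (s' j) z = F z * Nf (p j) z)%C.

(** Beyond [|t j| / 2] a point [t m] may be close to a zero of the denominator, and sizes alone do
    not control the multiplier; this bound is required instead. The factor [W m ^ a] records the
    gain from [a] divisions. *)
Definition farb (a : nat) (c : R) (G : C -> C) (j : nat) : Prop :=
  forall m, Cmod (t j) / 2 <= Cmod (t m) -> Cmod (res G m) * W m ^ a <= c * (W m ^ b * sqrt (mu m)).

Context (Hb : forall j G, J j -> inHr G -> qrel f G j -> farb 0 C0 G j).

(* [F] is [f] after finitely many exchanges and [a] divisions by zeros; by [U] and [V],
   the zeros of [F] far away are zeros of [f]. *)
Definition removable (a : nat) (F : C -> C) : Prop :=
  inHr F /\ F z0 <> 0%C /\
  (exists c, 0 <= c /\ forall m, Cmod (res F m) * W m ^ a <= c * (W m ^ b * sqrt (mu m))) /\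
  (exists c j0, 0 <= c /\ forall j, (j0 <= j)%nat -> J j ->
     F (s j) = 0%C /\ (s' j = p j \/ (F (s' j) = 0%C /\ s' j <> s j)) /\
     forall G, inHr G -> qrel F G j -> farb a c G j) /\
  (exists U V rho, (forall z, ccont U z) /\ (forall z, ccont V z) /\
     (forall z, (f z * V z = F z * U z)%C) /\ forall z, rho <= Cmod z -> V z <> 0%C).

Lemma weight_pos (m : nat) : 0 < W m ^ b * sqrt (mu m).
Proof.
  assert (P := W_pow_pos t m b). assert (Q := sqrt_mu_pos m). nra.
Qed.

Lemma near_t (u : C) (j : nat) : Cmod (u - t j)%C <= 4 ->
  Cmod (t j) - 4 <= Cmod u <= Cmod (t j) + 4.
Proof.
  intros H. assert (T1 := Cmod_rev_triangle (t j) u). rewrite Cmod_sub_sym in T1.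
  assert (T2 := Cmod_rev_triangle u (t j)). lra.
Qed.

Lemma removable_init : removable 0 f.
Proof.
  split; [exact Hf|]. split; [exact Hz0|]. split; [|split].
  - destruct (res_bound f Hf) as [c [H0 Hc]]. exists c. split; [exact H0|]. intros m.
    rewrite pow_O, Rmult_1_r. eapply Rle_trans; [apply Hc|]. apply Rmult_le_compat_l; [exact H0|].
    assert (PW := W_pow_pos t m b). assert (Q := sqrt_mu_pos m). nra.
  - exists (Rmax 0 C0), O. split; [apply Rmax_l|]. intros j _ Hj. destruct (Hs j Hj) as [H1 H2].
    split; [exact H1|split; [exact H2|]]. intros G HG HQ m Hm.
    eapply Rle_trans; [apply (Hb j G Hj HG HQ m Hm)|].
    apply Rmult_le_compat_r; [left; apply weight_pos|apply Rmax_r].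
  - exists (fun _ => RtoC 1), (fun _ => RtoC 1), 0.
    split; [intros; apply ccont_const|split; [intros; apply ccont_const|split; [reflexivity|]]].
    intros z _. apply Cmod_gt_0; rewrite Cmod_1; lra.
Qed.

Lemma far_shift (w : C) (m : nat) : 2 * Cmod w + 1 <= Cmod (t m) -> W m <= 2 * Cmod (t m - w)%C.
Proof.
  intros H. unfold weight. assert (T := Cmod_rev_triangle (t m) w). lra.
Qed.

Lemma far_shift_bound (F G : C -> C) (w : C) (a m : nat) (c : R) :
  (forall z, F z = ((z - w) * G z)%C) -> 2 * Cmod w + 1 <= Cmod (t m) ->
  Cmod (res F m) * W m ^ a <= c * (W m ^ b * sqrt (mu m)) ->
  Cmod (res G m) * W m ^ S a <= 2 * c * (W m ^ b * sqrt (mu m)).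
Proof.
  intros E Hm H. rewrite (res_divide F G w E), Cmod_mult in H.
  assert (T := far_shift w m Hm). assert (P := W_pow_pos t m a). assert (Q := Cmod_ge_0 (res G m)).
  simpl. apply Rle_trans with (Cmod (res G m) * (2 * Cmod (t m - w)%C * W m ^ a)); [|nra].
  apply Rmult_le_compat_l; auto. apply Rmult_le_compat_r; lra.
Qed.

(** Division by [z - w] at a remaining zero [w] gains a factor of order [W] in distant residues. It
    commutes with later exchanges, so their bounds improve in the same way. *)
Lemma removable_divide (a : nat) (F : C -> C) : removable a F -> exists G, removable (S a) G.
Proof.
  intros [HF [HF0 [[c1 [C1 B1]] [[c2 [j0 [C2 B2]]] [U [V [rho [HU [HV [EUV NV]]]]]]]]]].
  destruct (HJ j0) as [j1 [Hj1 Jj1]]. destruct (B2 j1 Hj1 Jj1) as [Z1 _].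
  set (w := s j1) in *. destruct (fin_ni F w HF Z1) as [G [HG E]].
  exists G. split; [exact HG|]. split; [|split; [|split]].
  - intros Z. apply HF0. rewrite E, Z. ring.
  - destruct (t_far (2 * Cmod w + 1)) as [N HN].
    apply eventual_bound with N (2 * c1); [apply weight_pos|].
    intros m Hm. apply (far_shift_bound F G w); auto.
  - destruct (t_far (4 * Cmod w + 10)) as [N HN].
    exists (2 * c2), (max j0 N). split; [lra|]. intros j Hj Jj.
    assert (Fj := HN j ltac:(lia)). destruct (B2 j ltac:(lia) Jj) as [Z2 [Z3 FB]].
    destruct (Hd j Jj) as [D1 [D2 D3]]. apply near_t in D1. apply near_t in D2. apply near_t in D3.
    assert (PW := Cmod_ge_0 w).
    assert (Zd : forall u, Cmod (t j) - 4 <= Cmod u -> F u = 0%C -> G u = 0%C).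
    { intros u Hu Z. rewrite E in Z. apply Cmult_integral in Z. destruct Z as [Z|Z]; auto.
      apply Cminus_eq0 in Z. subst u. lra. }
    split; [apply Zd; [lra|auto]|]. split.
    { destruct Z3 as [Z3|[Z3 Z4]]; [now left|right]. split; auto. apply Zd; [lra|auto]. }
    intros K HK HQ m Hm.
    assert (NZ : forall u, Cmod (t j) - 4 <= Cmod u -> u <> 0%C).
    { intros u Hu. apply Cmod_gt_0. lra. }
    assert (N1 : s j <> 0%C) by (apply NZ; lra).
    assert (N2 : s' j <> 0%C) by (apply NZ; lra).
    assert (N3 : p j <> 0%C) by (apply NZ; lra).
    destruct (quotient_exists F (s j) (s' j) (p j) HF N1 N2 N3 Z2 Z3) as [G1 [HG1 E1]].
    assert (E2 : forall z, G1 z = ((z - w) * K z)%C).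
    { apply (Qf_cancel (s j) (s' j) _ _ N1 N2).
      - intros z. apply inHr_cont, HG1.
      - intros z. apply ccont_mult; [|apply inHr_cont, HK].
        apply ccont_minus; [apply ccont_id|apply ccont_const].
      - intros z. rewrite E1, E, <- !Cmult_assoc. f_equal. symmetry. apply HQ. }
    apply (far_shift_bound G1 K w); [exact E2|lra|]. exact (FB G1 HG1 E1 m Hm).
  - exists (fun z => (z - w) * U z)%C, V, rho. split; [|split; [exact HV|split; [|exact NV]]].
    + intros z. apply ccont_mult; [|apply HU]. apply ccont_minus; [apply ccont_id|apply ccont_const].
    + intros z. rewrite EUV, E. ring.
Qed.

Lemma removable_divide_many (a : nat) : exists F, removable a F.
Proof.
  induction a as [|a [F IH]]; [exists f; apply removable_init|]. exact (removable_divide a F IH).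
Qed.

(** Up to the continuous factors [U] and [V], [G] is [f] with the zero [u] divided out; if [G] still
    vanishes at [u], the slope of [f] there is [0]. *)
Lemma hidden_zero (G U V : C -> C) (u w : C) : u <> 0%C ->
  (forall z, ccont U z) -> (forall z, ccont V z) -> (forall z, ccont G z) ->
  (forall z, (f z * V z = G z * ((1 - z / u) * U z))%C) -> V w <> 0%C -> G w = 0%C ->
  f w = 0%C /\ (w = u -> cderiv f w 0%C).
Proof.
  intros Hu HU HV HG E HVw Gw.
  assert (fw : f w = 0%C).
  { specialize (E w). rewrite Gw in E. replace (0 * ((1 - w / u) * U w))%C with (RtoC 0) in E by ring.
    apply Cmult_integral in E. now destruct E. }
  split; auto. intros ->.
  destruct (inHr_hol f u Hf) as [l Hl].
  destruct (proj1 (cderiv_carath f u l) Hl) as [phi [P1 [P2 P3]]].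
  replace (RtoC 0) with l; [exact Hl|].
  assert (E3 : (phi u * V u = - / u * (G u * U u))%C).
  { apply (ccont_eq_at (fun z => phi z * V z)%C (fun z => - / u * (G z * U z))%C u 1 Rlt_0_1).
    - apply ccont_mult; auto.
    - apply ccont_mult; [apply ccont_const|]. apply ccont_mult; auto.
    - intros z Hz _. assert (N := Cminus_neq0 _ _ Hz).
      transitivity ((z - u) * phi z * V z / (z - u))%C; [field; auto|].
      rewrite <- P3, fw. replace (f z - 0)%C with (f z) by ring. rewrite E. field. auto. }
  rewrite Gw, P2 in E3. replace (- / u * (0 * U u))%C with (RtoC 0) in E3 by ring.
  apply Cmult_integral in E3. now destruct E3.
Qed.

Lemma far_neq (j : nat) (r : R) : J j -> 0 <= r -> r + 5 <= Cmod (t j) ->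
  forall u, u = s j \/ u = s' j \/ u = p j -> r < Cmod u /\ u <> 0%C.
Proof.
  intros Hj Hr H u Hu. destruct (Hd j Hj) as [D1 [D2 D3]].
  apply near_t in D1. apply near_t in D2. apply near_t in D3.
  assert (r < Cmod u) by (destruct Hu as [-> | [-> | ->]]; lra).
  split; auto. apply Cmod_gt_0. lra.
Qed.

(** Far beyond [t j] the multiplier has modulus at most [1] by [NQ_far], so an exchange does not
    spoil the constants that govern later ones. *)
Lemma res_shrink (F G : C -> C) (j m : nat) : J j -> 16 <= Cmod (t j) -> qrel F G j ->
  4 * (Cmod (t j) + 4) <= Cmod (t m) -> Cmod (res G m) <= Cmod (res F m).
Proof.
  intros Hj Hlarge HQ Hm. destruct (Hd j Hj) as [D1 [D2 D3]].
  apply near_t in D1. apply near_t in D2. apply near_t in D3.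
  assert (NZ := far_neq j 0 Hj ltac:(lra) ltac:(lra)).
  destruct (NQ_far (s j) (s' j) (p j) (t m) (Cmod (t j) + 4)) as [Q1 Q2]; try lra;
    try (apply NZ; tauto).
  assert (E := quotient_res (t := t) (A := A) F G _ _ _ HQ m). apply (f_equal Cmod) in E. rewrite !Cmod_mult in E.
  apply Cmod_gt_0 in Q1. assert (P := Cmod_ge_0 (res F m)).
  apply Rmult_le_reg_r with (Cmod (Qf (s j) (s' j) (t m))); [auto|]. rewrite E.
  now apply Rmult_le_compat_l.
Qed.

(** [NQ_near] with [r = |t j| - 4], as the three points lie within [4] of [t j]; [36] becomes [48]
    because [|t j| - 4 >= (3 / 4) |t j|]. *)
Lemma near_close (j : nat) (z : C) (x y : C) : J j -> 16 <= Cmod (t j) -> Cmod z <= Cmod (t j) / 2 ->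
  (y * Qf (s j) (s' j) z = x * Nf (p j) z)%C ->
  Cmod (y - x)%C <= 48 * (Cmod z / Cmod (t j)) * Cmod x.
Proof.
  intros Hj Hlarge Hz E. destruct (Hd j Hj) as [D1 [D2 D3]].
  apply near_t in D1. apply near_t in D2. apply near_t in D3.
  destruct (NQ_near (s j) (s' j) (p j) z (Cmod (t j) - 4)) as [Q1 Q2]; try lra.
  assert (PQ : 0 < Cmod (Qf (s j) (s' j) z)) by lra.
  apply Rmult_le_reg_r with (Cmod (Qf (s j) (s' j) z)); [auto|]. rewrite <- Cmod_mult.
  replace ((y - x) * Qf (s j) (s' j) z)%C with (x * (Nf (p j) z - Qf (s j) (s' j) z))%C
    by (replace ((y - x) * Qf (s j) (s' j) z)%C
          with (y * Qf (s j) (s' j) z - x * Qf (s j) (s' j) z)%C by ring; rewrite E; ring).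
  rewrite Cmod_mult. assert (PX := Cmod_ge_0 x). assert (PZ := Cmod_ge_0 z).
  assert (T : 36 * (Cmod z / (Cmod (t j) - 4)) <= 48 * (Cmod z / Cmod (t j))).
  { replace (36 * (Cmod z / (Cmod (t j) - 4))) with (Cmod z * (36 * / (Cmod (t j) - 4)))
      by (unfold Rdiv; ring).
    replace (48 * (Cmod z / Cmod (t j))) with (Cmod z * (48 * / Cmod (t j))) by (unfold Rdiv; ring).
    apply Rmult_le_compat_l; auto.
    apply Rmult_le_reg_r with (Cmod (t j) * (Cmod (t j) - 4)); [nra|].
    replace (36 * / (Cmod (t j) - 4) * (Cmod (t j) * (Cmod (t j) - 4))) with (36 * Cmod (t j))
      by (field; lra).
    replace (48 * / Cmod (t j) * (Cmod (t j) * (Cmod (t j) - 4))) with (48 * (Cmod (t j) - 4))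
      by (field; lra). lra. }
  apply Rle_trans with (Cmod x * (36 * (Cmod z / (Cmod (t j) - 4)) * Cmod (Qf (s j) (s' j) z))).
  { now apply Rmult_le_compat_l. }
  replace (48 * (Cmod z / Cmod (t j)) * Cmod x * Cmod (Qf (s j) (s' j) z))
    with (Cmod x * (48 * (Cmod z / Cmod (t j)) * Cmod (Qf (s j) (s' j) z))) by ring.
  apply Rmult_le_compat_l; auto. apply Rmult_le_compat_r; lra.
Qed.

(** Exchanges at different indices commute: an exchange of [G] at a distant [i] is the one of [F] at
    [i] followed by the one at [j], which only shrinks the residues in question. *)
Lemma removable_quotient (a j : nat) (F G : C -> C) : removable a F -> J j -> 16 <= Cmod (t j) ->
  Cmod z0 + 5 <= Cmod (t j) -> inHr G -> qrel F G j -> removable a G.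
Proof.
  intros [HF [HF0 [[c1 [C1 B1]] [[c2 [j0 [C2 B2]]] [U [V [rho [HU [HV [EUV NV]]]]]]]]]] Jj Hl Hz HG HQ.
  assert (NZ := far_neq j (Cmod z0) Jj (Cmod_ge_0 _) Hz).
  assert (Ns := proj2 (NZ (s j) ltac:(tauto))). assert (Ns' := proj2 (NZ (s' j) ltac:(tauto))).
  assert (Np := NZ (p j) ltac:(tauto)).
  split; [exact HG|]. split; [|split; [|split]].
  - intros Z. specialize (HQ z0). rewrite Z in HQ.
    replace (0 * Qf (s j) (s' j) z0)%C with (RtoC 0) in HQ by ring.
    symmetry in HQ. apply Cmult_integral in HQ. destruct HQ as [Q|Q]; [auto|].
    revert Q. apply Nf_neq; [apply Np|]. intros E. rewrite <- E in Np. lra.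
  - destruct (t_far (4 * (Cmod (t j) + 4))) as [N HN].
    apply eventual_bound with N c1; [apply weight_pos|].
    intros m Hm. eapply Rle_trans; [|apply B1]. apply Rmult_le_compat_r.
    + assert (P := W_pow_pos t m a). lra.
    + apply (res_shrink F G j m Jj Hl HQ). auto.
  - destruct (t_far (8 * (Cmod (t j) + 4))) as [N HN].
    exists c2, (max j0 N). split; [exact C2|]. intros i Hi Ji.
    assert (Fi := HN i ltac:(lia)). destruct (B2 i ltac:(lia) Ji) as [Z2 [Z3 FB]].
    assert (NZi := far_neq i (Cmod (t j) + 4) Ji ltac:(lra) ltac:(lra)).
    destruct (Hd j Jj) as [D1 [D2 D3]]. apply near_t in D1. apply near_t in D2.
    assert (Zd : forall u, Cmod (t j) + 4 < Cmod u -> F u = 0%C -> G u = 0%C).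
    { intros u Hu Z. specialize (HQ u). rewrite Z in HQ.
      replace (0 * Nf (p j) u)%C with (RtoC 0) in HQ by ring. apply Cmult_integral in HQ.
      destruct HQ as [Q|Q]; auto. exfalso. revert Q. apply Qf_neq; auto; intros ->; lra. }
    split; [apply Zd; [apply NZi; tauto|auto]|]. split.
    { destruct Z3 as [Z3|[Z3 Z4]]; [now left|right]. split; auto. apply Zd; [apply NZi; tauto|auto]. }
    intros K HK HKQ m Hm.
    assert (N1 := proj2 (NZi (s i) ltac:(tauto))). assert (N2 := proj2 (NZi (s' i) ltac:(tauto))).
    assert (N3 := proj2 (NZi (p i) ltac:(tauto))).
    destruct (quotient_exists F (s i) (s' i) (p i) HF N1 N2 N3 Z2 Z3) as [G1 [HG1 E1]].
    assert (E2 : qrel G1 K j).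
    { refine (Qf_cancel (s i) (s' i) (fun z => K z * Qf (s j) (s' j) z)%C
        (fun z => G1 z * Nf (p j) z)%C N1 N2 _ _ _).
      - intros z. apply ccont_mult; [now apply inHr_cont|]. apply hol_cont, Qf_hol.
      - intros z. apply ccont_mult; [now apply inHr_cont|]. apply hol_cont, Nf_hol.
      - intros z.
        transitivity (K z * Qf (s i) (s' i) z * Qf (s j) (s' j) z)%C; [ring|]. rewrite (HKQ z).
        transitivity (G z * Qf (s j) (s' j) z * Nf (p i) z)%C; [ring|]. rewrite (HQ z).
        transitivity (F z * Nf (p i) z * Nf (p j) z)%C; [ring|]. rewrite <- (E1 z). ring. }
    eapply Rle_trans; [|exact (FB G1 HG1 E1 m Hm)]. apply Rmult_le_compat_r.
    + assert (P := W_pow_pos t m a). lra.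
    + apply (res_shrink G1 K j m Jj Hl E2). lra.
  - exists (fun z => Qf (s j) (s' j) z * U z)%C, (fun z => V z * Nf (p j) z)%C, (Rmax rho (Cmod (p j) + 1)).
    split; [|split; [|split]].
    + intros z. apply ccont_mult; [|apply HU]. apply hol_cont, Qf_hol.
    + intros z. apply ccont_mult; [apply HV|]. apply hol_cont, Nf_hol.
    + intros z. transitivity (F z * Nf (p j) z * U z)%C.
      * transitivity (f z * V z * Nf (p j) z)%C; [ring|]. rewrite EUV. ring.
      * rewrite <- (HQ z). ring.
    + intros z Hz'. assert (T1 := Rmax_l rho (Cmod (p j) + 1)). assert (T2 := Rmax_r rho (Cmod (p j) + 1)).
      apply Cmult_neq_0; [apply NV; lra|]. apply Nf_neq; [apply Np|]. intros ->. lra.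
Qed.

(* The division by [b + L + 1] zeros makes the residues so small that the exchange of zeros at a distant
   [t j] changes the element little. *)
Lemma removable_multiply (F : C -> C) (eta R0 : R) (n0 : nat) : removable (S (b + L)) F -> 0 < eta ->
  exists j G, (n0 <= j)%nat /\ J j /\ R0 <= Cmod (t j) /\ removable (S (b + L)) G /\
    (forall m, Cmod (res G m - res F m)%C * W m ^ L <= eta * sqrt (mu m)) /\
    (forall w, Cmod w <= R0 -> Cmod (F w) * (1 - eta) <= Cmod (G w)) /\
    (forall w, Cmod (w - t j)%C <= 1 -> w <> p j -> G w = 0%C ->
       f w = 0%C /\ (w = s j -> cderiv f w 0%C)).
Proof.
  intros I Heta. assert (I1 := I). destruct I1 as [HF [HF0 [[c1 [C1 B1]] [[c2 [j0 [C2 B2]]]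
    [U [V [rho [HU [HV [EUV NV]]]]]]]]]].
  (* Beyond [B] the disk of radius [R0] and the point [z0] lie well inside, points near [t j] are
     outside the radius [rho], and [eta * T] dominates all constants. *)
  set (B := 2 * Rabs R0 + Rabs rho + Cmod z0 + 20 + (48 * c1 + 2 * c2 + 48 * Rabs R0) / eta).
  assert (PR := Rabs_pos R0). assert (Pr := Rabs_pos rho). assert (Pz := Cmod_ge_0 z0).
  assert (Pq : 0 <= (48 * c1 + 2 * c2 + 48 * Rabs R0) / eta) by (apply Rdiv_le_0_compat; lra).
  destruct (t_far B) as [N HN]. destruct (HJ (max n0 (max j0 N))) as [j [Hj Jj]].
  assert (Fj := HN j ltac:(lia)). set (T := Cmod (t j)) in *.
  assert (HT : 20 <= T) by (unfold B in Fj; lra).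
  assert (HTe : 48 * c1 + 2 * c2 + 48 * Rabs R0 <= eta * T).
  { replace (48 * c1 + 2 * c2 + 48 * Rabs R0) with (eta * ((48 * c1 + 2 * c2 + 48 * Rabs R0) / eta))
      by (field; lra). apply Rmult_le_compat_l; [lra|]. unfold B in Fj. lra. }
  destruct (B2 j ltac:(lia) Jj) as [Z2 [Z3 FB]].
  assert (HTz : Cmod z0 + 5 <= T) by (unfold B in Fj; lra).
  assert (NZ := far_neq j 0 Jj ltac:(lra) ltac:(fold T; lra)).
  assert (Ns := proj2 (NZ (s j) ltac:(tauto))). assert (Ns' := proj2 (NZ (s' j) ltac:(tauto))).
  assert (Np := proj2 (NZ (p j) ltac:(tauto))).
  destruct (quotient_exists F (s j) (s' j) (p j) HF Ns Ns' Np Z2 Z3) as [G [HG HQ]].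
  exists j, G. split; [lia|]. split; [exact Jj|]. split.
  { fold T. assert (R1 := Rle_abs R0). unfold B in Fj. lra. }
  split; [apply (removable_quotient _ j F G I Jj); [fold T; lra|exact HTz|exact HG|exact HQ]|].
  split; [|split].
  - intros m. assert (PW := W_pow_pos t m L). assert (PWb := W_pow_pos t m b).
    assert (W1 := W_ge1 (t := t) m). assert (Q := sqrt_mu_pos m).
    set (y := sqrt (mu m)) in *.
    assert (Div : forall c x, x * W m ^ Datatypes.S (b + L) <= c * (W m ^ b * y) ->
      x * W m ^ L * W m <= c * y).
    { intros c x H. simpl in H. rewrite pow_add in H.
      apply Rmult_le_reg_r with (W m ^ b); [lra|].
      replace (x * W m ^ L * W m * W m ^ b) with (x * (W m * (W m ^ b * W m ^ L))) by ring. lra. }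
    assert (H1 := Div c1 _ (B1 m)).
    assert (PF := Cmod_ge_0 (res F m)).
    (* Up to [T / 2] the multiplier is close to [1]; beyond, both residues are small by themselves,
       as the spare factor [W m >= T / 2] outweighs the constants. *)
    destruct (Rle_dec (Cmod (t m)) (T / 2)) as [Hm|Hm].
    + assert (E := quotient_res (t := t) (A := A) F G _ _ _ HQ m).
      assert (K := near_close j (t m) (res F m) (res G m) Jj ltac:(fold T; lra) Hm E). fold T in K.
      apply Rle_trans with (48 * (Cmod (t m) / T) * Cmod (res F m) * W m ^ L).
      { apply Rmult_le_compat_r; lra. }
      replace (48 * (Cmod (t m) / T) * Cmod (res F m) * W m ^ L)
        with ((Cmod (res F m) * W m ^ L * Cmod (t m)) * (48 * / T)) by (field; lra).
      apply Rmult_le_reg_r with T; [lra|]. rewrite Rmult_assoc, (Rmult_assoc 48), Rinv_l by lra.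
      assert (H2 : Cmod (res F m) * W m ^ L * Cmod (t m) <= c1 * y).
      { eapply Rle_trans; [|exact H1]. apply Rmult_le_compat_l; [nra|]. unfold weight. lra. }
      assert (48 * c1 <= eta * T) by lra. nra.
    + apply Rnot_le_lt in Hm. assert (H2 := Div c2 _ (FB G HG HQ m (Rlt_le _ _ Hm))).
      assert (K := Cmod_sub_le (res G m) (res F m)).
      assert (HW : T / 2 <= W m) by (unfold weight; lra).
      set (x := Cmod (res G m - res F m)%C) in *.
      assert (K2 : x * W m ^ L * W m <= (c1 + c2) * y).
      { apply Rle_trans with ((Cmod (res G m) + Cmod (res F m)) * W m ^ L * W m); [|lra].
        apply Rmult_le_compat_r; [lra|]. apply Rmult_le_compat_r; lra. }
      assert (PX : 0 <= x) by apply Cmod_ge_0.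
      assert (K3 : x * W m ^ L * (T / 2) <= x * W m ^ L * W m) by (apply Rmult_le_compat_l; nra).
      assert (K4 : 2 * (c1 + c2) * y <= eta * T * y) by (apply Rmult_le_compat_r; lra).
      nra.
  - intros w Hw. assert (R1 := Rle_abs R0).
    assert (Hw2 : Cmod w <= T / 2) by (unfold B in Fj; lra).
    assert (K := near_close j w (F w) (G w) Jj ltac:(fold T; lra) Hw2 (HQ w)). fold T in K.
    assert (K2 := Cmod_rev_triangle (F w) (F w - G w)%C). rewrite (Cmod_sub_sym (F w) (G w)) in K2.
    replace (F w - (F w - G w))%C with (G w) in K2 by ring.
    assert (K3 : 48 * (Cmod w / T) <= eta).
    { apply Rmult_le_reg_r with T; [lra|].
      replace (48 * (Cmod w / T) * T) with (48 * Cmod w) by (field; lra). lra. }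
    assert (PF := Cmod_ge_0 (F w)). nra.
  - intros w Hw Hwp Gw.
    assert (Hwr : rho <= Cmod w).
    { assert (R1 := Rle_abs rho). assert (K := Cmod_rev_triangle (t j) w).
      rewrite Cmod_sub_sym in K. fold T in K. unfold B in Fj. lra. }
    apply (hidden_zero G (fun z => (1 - z / s' j) * U z)%C (fun z => V z * Nf (p j) z)%C (s j)); auto.
    + intros z. apply ccont_mult; [|apply HU]. apply hol_cont, (Nf_hol _ z).
    + intros z. apply ccont_mult; [apply HV|]. apply hol_cont, Nf_hol.
    + intros z. now apply inHr_cont.
    + intros z. transitivity (F z * Nf (p j) z * U z)%C.
      * transitivity (f z * V z * Nf (p j) z)%C; [ring|]. rewrite EUV. ring.
      * rewrite <- (HQ z). unfold Qf. ring.
    + apply Cmult_neq_0; [now apply NV|]. apply Nf_neq; auto.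
Qed.

(** The [k]-th exchange changes residues by at most [2^(-k-2)] in the weighted supremum and keeps
    moduli on a growing disk up to the factor [1 - 2^(-k-2)]. The product of these factors exceeds
    [1 / 2], so on the disk reached at some stage the limit vanishes only where the element of that
    stage does. *)
Lemma removal_limit : exists G, inHr G /\ G z0 <> 0%C /\ forall N, exists j, (N <= j)%nat /\ J j /\
  forall w, Cmod (w - t j)%C <= 1 -> w <> p j -> G w = 0%C ->
    f w = 0%C /\ (w = s j -> cderiv f w 0%C).
Proof.
  destruct (removable_divide_many (S (b + L))) as [F0 I0].
  (* The disk on which the next exchange must be harmless: it contains the unit disk about the last
     treated [t j] and the point [z0]. *)
  set (RR := fun (k : nat) (x : nat * (C -> C)) => Cmod (t (fst x)) + 2 + Cmod z0 + INR k).
  destruct (dependent_choice_nat (fun _ x => removable (S (b + L)) (snd x))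
    (fun k x y => (k <= fst y)%nat /\ J (fst y) /\ RR k x <= Cmod (t (fst y)) /\
      (forall m, Cmod (res (snd y) m - res (snd x) m)%C * W m ^ L <= (1 / 2) ^ (k + 2) * sqrt (mu m)) /\
      (forall w, Cmod w <= RR k x -> Cmod (snd x w) * (1 - (1 / 2) ^ (k + 2)) <= Cmod (snd y w)) /\
      (forall w, Cmod (w - t (fst y))%C <= 1 -> w <> p (fst y) -> snd y w = 0%C ->
         f w = 0%C /\ (w = s (fst y) -> cderiv f w 0%C)))
    (O, F0) I0) as [phi [phi0 Hphi]].
  { intros k x Hx.
    destruct (removable_multiply (snd x) ((1 / 2) ^ (k + 2)) (RR k x) k Hx) as [j [G [H1 [H2 [H3 [H4 H5]]]]]].
    { apply pow_lt. lra. }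
    exists (j, G). simpl. tauto. }
  set (F := fun k => snd (phi k)). set (jj := fun k => fst (phi k)). set (Rk := fun k => RR k (phi k)).
  assert (HF : forall k, inHr (F k)) by (intros k; apply (proj1 (Hphi k))).
  assert (Hclose : forall k m, Cmod (res (F (S k)) m - res (F k) m)%C * W m ^ L
      <= (1 / 2) ^ (k + 2) * sqrt (mu m)) by (intros k; apply (proj2 (Hphi k))).
  assert (Hlow : forall k w, Cmod w <= Rk k -> Cmod (F k w) * (1 - (1 / 2) ^ (k + 2)) <= Cmod (F (S k) w))
    by (intros k; apply (proj2 (Hphi k))).
  assert (HR : forall k, Rk k <= Rk (S k)).
  { intros k. destruct (proj2 (Hphi k)) as [_ [_ [H _]]]. unfold Rk at 2. unfold RR.
    assert (T := pos_INR (S k)). assert (T2 := Cmod_ge_0 z0). unfold Rk. lra. }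
  assert (HR2 : forall l i, Rk l <= Rk (l + i)%nat).
  { intros l. induction i as [|i IH]; [rewrite Nat.add_0_r; lra|]. rewrite Nat.add_succ_r.
    eapply Rle_trans; [apply IH|apply HR]. }
  (* An inductive form of the lower bound for the product: [1 / 2 + (1 / 2)^(i + 1)] starts at [1]
     and decreases to [1 / 2]. *)
  assert (Hlow2 : forall l w, Cmod w <= Rk l -> forall i,
    Cmod (F l w) * (1 / 2 + (1 / 2) ^ (i + 1)) <= Cmod (F (l + i)%nat w)).
  { intros l w Hw. induction i as [|i IH].
    - rewrite Nat.add_0_r. simpl. assert (T := Cmod_ge_0 (F l w)). lra.
    - rewrite (Nat.add_succ_r l i). eapply Rle_trans; [|apply Hlow; eapply Rle_trans; [exact Hw|apply HR2]].
      set (y := (1 / 2) ^ (i + 1)) in *.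
      assert (Y : 0 < y <= 1 / 2).
      { unfold y. rewrite pow_add, pow_1. assert (P : 0 < (1 / 2) ^ i) by (apply pow_lt; lra).
        assert (Q : (1 / 2) ^ i <= 1) by apply half_pow_le1. lra. }
      assert (Z : 0 <= (1 / 2) ^ (l + i + 2) <= y / 2).
      { split; [apply pow_le; lra|]. unfold y. replace (l + i + 2)%nat with (l + (i + 1) + 1)%nat by lia.
        rewrite (pow_add _ (l + (i + 1)) 1), (pow_add _ l (i + 1)).
        assert (P : 0 < (1 / 2) ^ (i + 1)) by (apply pow_lt; lra).
        assert (Q : (1 / 2) ^ l <= 1) by apply half_pow_le1. rewrite pow_1. nra. }
      replace ((1 / 2) ^ (S i + 1)) with (y / 2) by (unfold y; simpl; field).
      assert (T := Cmod_ge_0 (F l w)).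
      apply Rle_trans with (Cmod (F l w) * (1 / 2 + y) * (1 - (1 / 2) ^ (l + i + 2))).
      + rewrite Rmult_assoc. apply Rmult_le_compat_l; [auto|]. nra.
      + apply Rmult_le_compat_r; [lra|auto]. }
  assert (HD : forall m, exists l, forall k, Cmod (res (F k) m - l)%C <= (1 / 2) ^ k * (sqrt (mu m) / W m ^ L)).
  { intros m. apply geometric_limit. intros k. assert (P := W_pow_pos t m L).
    apply Rmult_le_reg_r with (W m ^ L); [lra|]. eapply Rle_trans; [apply Hclose|].
    right. field. lra. }
  set (d := fun m => proj1_sig (constructive_indefinite_description _ (HD m))).
  assert (Hd' : forall m k, Cmod (res (F k) m - d m)%C <= (1 / 2) ^ k * (sqrt (mu m) / W m ^ L))
    by (intros m; exact (proj2_sig (constructive_indefinite_description _ (HD m)))).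
  (* The total correction is a residue sequence of the space, since [|e m|^2 / mu m] is at most
     [W m ^ (- 2 L)]. *)
  clearbody d. set (e := fun m => (d m - res (F O) m)%C).
  assert (He : l2mu mu e).
  { apply ex_series_dom with (fun m => / W m ^ L); [|exact HL]. intros m.
    assert (PM := mu_pos m). assert (P := W_pow_pos t m L). assert (Q := sqrt_mu_pos m).
    assert (E := pow2_sqrt (mu m) ltac:(lra)).
    split; [apply Rdiv_le_0_compat; [apply pow2_ge_0|auto]|].
    specialize (Hd' m O). rewrite pow_O, Rmult_1_l, Cmod_sub_sym in Hd'. fold (e m) in Hd'.
    apply Rmult_le_reg_r with (mu m); [auto|]. unfold Rdiv at 1. rewrite Rmult_assoc, Rinv_l, Rmult_1_r by lra.
    apply Rle_trans with ((sqrt (mu m) / W m ^ L) ^ 2).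
    - apply pow_incr. split; [apply Cmod_ge_0|auto].
    - unfold Rdiv. rewrite Rpow_mult_distr, E.
      assert (I1 : / W m ^ L <= 1) by (rewrite <- Rinv_1; apply Rinv_le_contravar; lra).
      assert (I2 : 0 < / W m ^ L) by (apply Rinv_0_lt_compat; lra).
      set (x := / W m ^ L) in *. assert (I3 : 0 <= mu m * (x * (1 - x))) by (apply Rmult_le_pos; nra). nra. }
  set (G := fun z => (F O z + synth t A e z)%C).
  assert (HG : inHr G) by (apply inHr_plus; [auto|now apply synth_inHr]).
  assert (RG : forall m, res G m = d m).
  { intros m. unfold G. rewrite (res_plus (F O) (synth t A e)), res_synth. unfold e. ring. }
  assert (Hev : forall z, exists c, forall k, Cmod (F k z - G z)%C <= (1 / 2) ^ k * c).
  { intros z. destruct (eval_small L z HL) as [c [_ Hc]]. exists c. intros k.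
    apply (Hc (fun z => F k z - G z)%C); [now apply inHr_minus|apply pow_le; lra|].
    intros m. rewrite res_minus, RG. assert (P := W_pow_pos t m L).
    apply Rle_trans with ((1 / 2) ^ k * (sqrt (mu m) / W m ^ L) * W m ^ L).
    - apply Rmult_le_compat_r; [lra|apply Hd'].
    - right. field. lra. }
  assert (Hfin : forall l w, Cmod w <= Rk l -> Cmod (F l w) / 2 <= Cmod (G w)).
  { intros l w Hw. destruct (Hev w) as [c Hc].
    assert (C0' : 0 <= c).
    { specialize (Hc O). rewrite pow_O, Rmult_1_l in Hc.
      assert (T := Cmod_ge_0 (F O w - G w)%C). lra. }
    assert (T : Cmod (F l w) / 2 - Cmod (G w) <= 0); [|lra].
    apply half_pow_small with c. intros i. specialize (Hc (l + i)%nat).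
    assert (T1 := Hlow2 l w Hw i). assert (T2 := Cmod_rev_triangle (F (l + i)%nat w) (G w)).
    assert (T3 := Cmod_ge_0 (F l w)).
    assert (T4 : 0 < (1 / 2) ^ (i + 1)) by (apply pow_lt; lra).
    assert (T5 : (1 / 2) ^ (l + i) <= (1 / 2) ^ i).
    { rewrite pow_add. assert (P : 0 < (1 / 2) ^ i) by (apply pow_lt; lra).
      assert (Q : (1 / 2) ^ l <= 1) by apply half_pow_le1. nra. }
    assert (T6 : (1 / 2) ^ (l + i) * c <= (1 / 2) ^ i * c) by (apply Rmult_le_compat_r; auto).
    nra. }
  exists G. split; [exact HG|]. split.
  - intros Z. assert (T := Hfin O z0). rewrite Z, Cmod_0 in T.
    assert (Cmod z0 <= Rk O).
    { unfold Rk, RR. simpl. assert (T2 := Cmod_ge_0 (t (fst (phi O)))). lra. }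
    specialize (T H). destruct (proj1 (Hphi O)) as [_ [N0 _]]. apply Cmod_gt_0 in N0.
    unfold F in T. lra.
  - intros N. exists (jj (S N)). destruct (proj2 (Hphi N)) as [K1 [K2 [_ [_ [_ K3]]]]].
    split; [exact K1|]. split; [exact K2|]. intros w Hw Hp Gw. apply K3; auto.
    assert (T := Hfin (S N) w). rewrite Gw, Cmod_0 in T.
    assert (H : Cmod w <= Rk (S N)).
    { unfold Rk, RR. assert (T2 := Cmod_rev_triangle w (t (jj (S N)))). fold (jj (S N)).
      assert (T3 := Cmod_ge_0 z0). assert (T4 := pos_INR (S N)). lra. }
    specialize (T H). apply Cmod_small_eq0. intros eps Heps. unfold F in T. lra.
Qed.

End Removal.

(** * Density from localization *)

Section LocalizationConverse.
Context {t : nat -> C} {A : C -> C} {mu : nat -> R}.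
Context {Hdata : admissible_data t mu} {HA : generating_function t A}.

Notation inHr := (@inHr t A mu).
Notation res := (residue t A).
Notation W := (weight t).

Lemma mom_nu_of_polys (x : nat -> C) (k : nat) (F : C -> C) :
  (forall p, mom t A (peval p) F = 0%C) -> mom t A (nu x k) F = 0%C.
Proof.
  intros H. destruct (nu_peval x k) as [q Hq]. rewrite <- (H q).
  apply csum_ext. intros n. now rewrite Hq.
Qed.

(** Such an element would bring some [A / nu_{k+1}] into the same subspace, whose [k]-th Newton
    moment is [1]. *)
Lemma Smom_all_no_fin_supp (d : nat) : all_moments t mu ->
  ~ fin_supp (t := t) (A := A) (Smom (t := t) (A := A) (mu := mu) t (fun _ => True)) d.
Proof.
  intros HM HF.
  assert (HS : nearly_invariant t A mu (Smom (t := t) (A := A) (mu := mu) t (fun _ => True))).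
  { apply Smom_ni; auto. intros k _. now apply all_moments_nu. }
  destruct (min_support d HF) as [k [s [E [Hs [SE [HE _]]]]]].
  destruct (newton_dual (t := t) (A := A) (mu := mu) s k Hs) as [V [HV [EV [_ MV]]]].
  assert (EVE : forall z, V z = E z).
  { apply (nu_cancel (fun i => t (s i)) (S k)).
    - intros z. now apply inHr_cont.
    - intros z. apply inHr_cont, SE.
    - intros z. now rewrite <- EV, <- HE. }
  specialize (MV k). rewrite Nat.eqb_refl in MV. rewrite (mom_ext _ V E EVE) in MV.
  rewrite mom_nu_of_polys in MV; [now apply C1_nz|].
  apply (all_moments_newton t); [auto|apply SE|]. intros j. apply SE. exact I.
Qed.

Context {r : nat -> R} {L : nat} (HL : ex_series (fun n => / W n ^ L)).
Context (Hr0 : forall n, 0 < r n) (Hr : is_lim_seq r 0).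
Context (Hdisj : forall n m z, n <> m -> in_disk (t n) (r n) z -> in_disk (t m) (r m) z -> False).
Context (Hloc : forall F, inH t A mu F -> (exists z, F z <> 0%C) ->
  exists N, forall n, (N <= n)%nat ->
    exists w, in_disk (t n) (r n) w /\ simple_zero F w /\
      forall z, in_disk (t n) (r n) z -> F z = 0%C -> z = w).

Lemma radius_le1 : exists N, forall n, (N <= n)%nat -> r n <= 1.
Proof.
  apply is_lim_seq_spec in Hr. destruct (Hr (mkposreal 1 Rlt_0_1)) as [N HN]. exists N.
  intros n Hn. specialize (HN n Hn). simpl in HN. rewrite Rminus_0_r in HN.
  assert (T := Rle_abs (r n)). lra.
Qed.

(* Exchanging the zeros [s j], [s' j] of [f] for the zero [p j] along a sparse sequence of [j] would
   produce an element without zeros in infinitely many of the disks. *)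
Lemma no_removal (b : nat) (f : C -> C) (J : nat -> Prop) (s s' p : nat -> C) (c : R) :
  inHr f -> (exists z, f z <> 0%C) ->
  (forall n, exists j, (n <= j)%nat /\ J j) ->
  (forall j, J j -> in_disk (t j) (r j) (s j) /\ ~ in_disk (t j) (r j) (p j)) ->
  (forall j, J j -> f (s j) = 0%C /\ (s' j = p j \/ (f (s' j) = 0%C /\ s' j <> s j))) ->
  (forall j, J j -> Cmod (s j - t j)%C <= 4 /\ Cmod (s' j - t j)%C <= 4 /\ Cmod (p j - t j)%C <= 4) ->
  (forall j G, J j -> inHr G -> (forall z, G z * Qf (s j) (s' j) z = f z * Nf (p j) z)%C ->
     forall m, Cmod (t j) / 2 <= Cmod (t m) -> Cmod (res G m) <= c * (W m ^ b * sqrt (mu m))) ->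
  False.
Proof.
  intros Hf [z0 Hz0] HJ Hsp Hs Hd Hb.
  assert (Hb' : forall j G, J j -> inHr G -> qrel (s := s) (s' := s') (p := p) f G j ->
    farb (t := t) (A := A) (mu := mu) (b := b) 0 c G j).
  { intros j G Jj HG HQ m Hm. rewrite pow_O, Rmult_1_r. apply (Hb j G Jj HG HQ m Hm). }
  destruct (removal_limit HL Hf Hz0 HJ Hs Hd Hb') as [G [HG [G0 HGj]]].
  destruct radius_le1 as [N1 R1].
  destruct (Hloc f) as [N2 L2]; [now apply inH_iff|now exists z0|].
  destruct (Hloc G) as [N3 L3]; [now apply inH_iff|now exists z0|].
  destruct (HGj (max N1 (max N2 N3))) as [j [Hj [Jj Hw]]].
  destruct (L3 j ltac:(lia)) as [w [W1 [[W2 _] _]]].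
  destruct (L2 j ltac:(lia)) as [u [U1 [[_ [l [Hl Nl]]] U3]]].
  destruct (Hsp j Jj) as [S1 S2].
  assert (Ej : in_disk (t j) (r j) w -> Cmod (w - t j)%C <= 1).
  { unfold in_disk. specialize (R1 j ltac:(lia)). lra. }
  (* The zero [w] of [G] in the disk is a zero of [f], hence the only one there, [s j]. As [s j] had
     been divided out, the derivative of [f] at it is [0], against simplicity. *)
  destruct (Hw w (Ej W1)) as [fw dw]; [intros ->; tauto|exact W2|].
  assert (Es := U3 (s j) S1 (proj1 (Hs j Jj))). assert (Ew := U3 w W1 fw). subst u.
  specialize (dw Ew). apply is_derive_cderiv in Hl. rewrite <- Ew in Hl.
  apply Nl. exact (cderiv_unique _ _ _ _ Hl dw).
Qed.

(** For [s' = p] the auxiliary point cancels, and the exchange is division by [1 - z / s]. *)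
Lemma quotient_single (f G : C -> C) (s p : C) : inHr f -> inHr G -> s <> 0%C -> p <> 0%C ->
  (forall z, (G z * Qf s p z = f z * Nf p z)%C) -> forall z, ((s - z) * G z = s * f z)%C.
Proof.
  intros Hf HG Ns Np E z.
  apply (lin_cancel (fun z => (s - z) * G z)%C (fun z => s * f z)%C p).
  - intros y. apply ccont_mult; [|now apply inHr_cont]. apply ccont_minus; [apply ccont_const|apply ccont_id].
  - intros y. apply ccont_mult; [apply ccont_const|now apply inHr_cont].
  - intros y. transitivity (- p * s * (G y * Qf s p y))%C; [unfold Qf; field; auto|].
    rewrite E. unfold Nf. field. auto.
Qed.

(** [t j + 2] serves as [p j] when a zero is merely removed: it is outside a disk of radius at most
    [1] and within [4] of [t j]. *)
Lemma C2_far (j : nat) : Cmod (t j + 2 - t j)%C = 2.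
Proof.
  replace (t j + 2 - t j)%C with (RtoC 2) by ring. rewrite Cmod_R, Rabs_pos_eq; lra.
Qed.

(** [G] is [t_j A / ((t_j - z) (z - t_k))], with residues at [t_k] and [t_j] only; the latter is
    [- t_j / (t_j - t_k)]. *)
Lemma qn_residue_removed (k j : nat) (G : C -> C) : j <> k -> inHr G ->
  2 * Cmod (t k) < Cmod (t j) -> (forall z, ((t j - z) * G z = t j * qn t A k z)%C) ->
  forall m, m <> k -> Cmod (res G m) <= if Nat.eqb m j then 2 else 0.
Proof.
  intros Hjk HG Hfar E m Hm.
  assert (Pk := Cmod_ge_0 (t k)).
  destruct (Nat.eqb_spec m j) as [->|Hmj].
  - assert (E2 : forall z, ((z - t k) * G z = - t j * qn t A j z)%C).
    { apply (lin_cancel (fun z => (z - t k) * G z)%C (fun z => - t j * qn t A j z)%C (t j)).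
      - intros y. apply ccont_mult; [|now apply inHr_cont]. apply ccont_minus; [apply ccont_id|apply ccont_const].
      - intros y. apply ccont_mult; [apply ccont_const|]. apply hol_cont, qn_hol.
      - intros y. transitivity (- (y - t k) * ((t j - y) * G y))%C; [ring|]. rewrite E.
        transitivity (- t j * ((y - t k) * qn t A k y))%C; [ring|]. rewrite <- (A_qn (A := A) k y).
        rewrite (A_qn (A := A) j y). ring. }
    assert (Njk : (t j - t k)%C <> 0%C) by (apply Cminus_neq0; intros Q; apply t_inj in Q; auto).
    assert (ER : res G j = (- t j / (t j - t k))%C).
    { specialize (E2 (t j)). rewrite qn_at in E2. unfold residue.
      transitivity ((t j - t k) * G (t j) / (alpha t A j * (t j - t k)))%C.
      - field. split; auto. apply alpha_neq.
      - rewrite E2. field. split; auto. apply alpha_neq. }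
    rewrite ER, Cmod_div, Cmod_opp by auto.
    assert (T := Cmod_rev_triangle (t j) (t k)). apply Cmod_gt_0 in Njk.
    apply Rmult_le_reg_r with (Cmod (t j - t k)%C); [auto|].
    unfold Rdiv. rewrite Rmult_assoc, Rinv_l by lra. lra.
  - assert (Gm : G (t m) = 0%C).
    { specialize (E (t m)). assert (Z : qn t A k (t m) = 0%C).
      { assert (T := A_qn k (t m)). rewrite (proj2 (A_zero (t m)) (ex_intro _ m eq_refl)) in T.
        symmetry in T. apply Cmult_integral in T. destruct T as [T|T]; [|exact T].
        apply Cminus_eq0, t_inj in T. contradiction. }
      rewrite Z in E. replace (t j * 0)%C with (RtoC 0) in E by ring.
      apply Cmult_integral in E. destruct E as [E|E]; [|exact E].
      apply Cminus_eq0, t_inj in E. congruence. }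
    unfold residue. rewrite Gm. replace (0 / alpha t A m)%C with (RtoC 0).
    + rewrite Cmod_0. lra.
    + field. apply alpha_neq.
Qed.

(** Otherwise the zeros [t_j] of [A / (z - t_0)] with [mu_j W_j^K > 1] could be removed with
    controlled residues, against [no_removal]: the new residue at [t_j] is at most [2], and
    [W_j^K mu_j^(1/2)] is at least [1]. *)
Lemma weights_decay (K : nat) : exists N, forall j, (N <= j)%nat -> mu j * W j ^ K <= 1.
Proof.
  apply NNPP. intros HN.
  assert (HJ0 : forall n, exists j, (n <= j)%nat /\ 1 < mu j * W j ^ K).
  { intros n. apply NNPP. intros H. apply HN. exists n. intros j Hj. apply Rnot_lt_le.
    intros Q. apply H. now exists j. }
  destruct radius_le1 as [N1 R1]. destruct (t_far (2 * Cmod (t O) + 10)) as [N2 R2].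
  set (N := S (max N1 N2)). assert (P0 := Cmod_ge_0 (t O)).
  apply (no_removal K (qn t A O) (fun j => (N <= j)%nat /\ 1 < mu j * W j ^ K) t
    (fun j => t j + 2)%C (fun j => t j + 2)%C 2).
  - apply qn_inHr.
  - exists (t O). rewrite qn_at. apply alpha_neq.
  - intros n. destruct (HJ0 (max n N)) as [j [Hj1 Hj2]]. exists j.
    split; [lia|split; [lia|exact Hj2]].
  - intros j [Hj _]. specialize (R1 j ltac:(lia)). unfold in_disk. rewrite C2_far.
    split; [|lra]. replace (t j - t j)%C with (RtoC 0) by ring. rewrite Cmod_0. apply Hr0.
  - intros j [Hj _]. split; [|now left].
    assert (T := A_qn O (t j)). rewrite (proj2 (A_zero (t j)) (ex_intro _ j eq_refl)) in T.
    symmetry in T. apply Cmult_integral in T. destruct T as [T|T]; [|exact T].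
    apply Cminus_eq0, t_inj in T. lia.
  - intros j _. rewrite C2_far. replace (t j - t j)%C with (RtoC 0) by ring. rewrite Cmod_0. lra.
  - intros j G [Hj Hmu] HG HQ m Hm. specialize (R2 j ltac:(lia)).
    assert (Nt : t j <> 0%C) by (apply Cmod_gt_0; lra).
    assert (Np : (t j + 2)%C <> 0%C).
    { apply Cmod_gt_0. assert (T := Cmod_rev_triangle (t j) (- RtoC 2)%C).
      replace (t j - - RtoC 2)%C with (t j + 2)%C in T by ring.
      rewrite Cmod_opp, Cmod_R, Rabs_pos_eq in T; lra. }
    assert (E := quotient_single (qn t A O) G (t j) (t j + 2)%C (qn_inHr O) HG Nt Np HQ).
    assert (B := qn_residue_removed O j G ltac:(lia) HG ltac:(lra) E m).
    assert (Hm0 : m <> O) by (intros ->; lra). specialize (B Hm0).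
    assert (PW := W_pow_pos t m K). assert (PS := sqrt_mu_pos m).
    destruct (Nat.eqb_spec m j) as [->|Hmj].
    + apply Rle_trans with (2 * 1); [lra|]. apply Rmult_le_compat_l; [lra|].
      apply Rnot_lt_le. intros Q. apply (Rlt_not_le _ _ Hmu).
      assert (PM := mu_pos j). assert (E2 := pow2_sqrt (mu j) ltac:(lra)).
      rewrite <- E2. set (y := sqrt (mu j)) in *. set (x := W j ^ K) in *.
      assert (0 < x * y) by (apply Rmult_lt_0_compat; lra).
      assert (y <= 1) by nra. nra.
    + assert (0 < 2 * (W m ^ K * sqrt (mu m))) by nra. lra.
Qed.

Lemma localized_all_moments : all_moments t mu.
Proof.
  intros k. destruct (weights_decay (k + L)) as [N HN].
  apply ex_series_dom_ev with (fun n => / W n ^ L) N; [|exact HL].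
  intros n Hn. specialize (HN n Hn). rewrite pow_add in HN. assert (P := mu_pos n).
  assert (P1 := W_pow_pos t n k). assert (P2 := W_pow_pos t n L).
  split; [apply Rmult_le_pos; lra|].
  apply Rmult_le_reg_r with (W n ^ L); [lra|]. rewrite Rinv_l by lra. lra.
Qed.

Lemma quotient_double (f G : C -> C) (s s' p z : C) : s <> 0%C -> s' <> 0%C -> p <> 0%C ->
  (G z * Qf s s' z = f z * Nf p z)%C ->
  (G z * ((s - z) * (s' - z)) * p = f z * (p - z) * (s * s'))%C.
Proof.
  intros Ns Ns' Np E. transitivity (s * s' * p * (G z * Qf s s' z))%C; [unfold Qf; field; auto|].
  rewrite E. unfold Nf. field. auto.
Qed.

Lemma single_bound (F G : C -> C) (s : C) (d : R) (m : nat) :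
  (forall z, ((s - z) * G z = s * F z)%C) -> 0 < d -> d <= Cmod (s - t m)%C ->
  Cmod (res G m) * d <= Cmod s * Cmod (res F m).
Proof.
  intros E Hd Hm. assert (R : ((s - t m) * res G m = s * res F m)%C).
  { unfold residue. transitivity ((s - t m) * G (t m) / alpha t A m)%C; [unfold Cdiv; ring|].
    rewrite E. unfold Cdiv. ring. }
  apply (f_equal Cmod) in R. rewrite !Cmod_mult in R. rewrite <- R, Rmult_comm.
  apply Rmult_le_compat_r; [apply Cmod_ge_0|auto].
Qed.

(** At [t_m] the multiplier is [(p - t_m) s s' / ((s - t_m) (s' - t_m) p)]; the two halved distances
    and [|s'| <= 2 |p|] account for the factor [8]. *)
Lemma double_bound (F G : C -> C) (s s' p : C) (x : R) (m : nat) :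
  s <> 0%C -> s' <> 0%C -> p <> 0%C -> (forall z, (G z * Qf s s' z = F z * Nf p z)%C) ->
  p <> t m -> Cmod (p - t m)%C / 2 <= Cmod (s - t m)%C -> Cmod (p - t m)%C / 2 <= Cmod (s' - t m)%C ->
  Cmod s <= x -> Cmod s' <= 2 * Cmod p ->
  Cmod (res G m) * Cmod (p - t m)%C <= 8 * x * Cmod (res F m).
Proof.
  intros Ns Ns' Np E Hpm H1 H2 Hs Hs'.
  assert (R : (res G m * ((s - t m) * (s' - t m)) * p = res F m * (p - t m) * (s * s'))%C).
  { unfold residue.
    transitivity (G (t m) * ((s - t m) * (s' - t m)) * p / alpha t A m)%C; [unfold Cdiv; ring|].
    rewrite (quotient_double F G s s' p (t m) Ns Ns' Np (E (t m))). unfold Cdiv. ring. }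
  apply (f_equal Cmod) in R. rewrite !Cmod_mult in R.
  set (D := Cmod (p - t m)%C) in *. assert (PD : 0 < D) by now apply Cmod_sub_pos.
  assert (Pp : 0 < Cmod p) by now apply Cmod_gt_0.
  set (g := Cmod (res G m)) in *. assert (Pg : 0 <= g) by apply Cmod_ge_0.
  set (h := Cmod (res F m)) in *. assert (Ph : 0 <= h) by apply Cmod_ge_0.
  assert (T1 : g * (D / 2 * (D / 2)) * Cmod p <= h * D * (x * (2 * Cmod p))).
  { apply Rle_trans with (h * D * (Cmod s * Cmod s')).
    - rewrite <- R. apply Rmult_le_compat_r; [lra|]. apply Rmult_le_compat_l; [auto|].
      apply Rmult_le_compat; lra.
    - apply Rmult_le_compat_l; [nra|]. apply Rmult_le_compat; try apply Cmod_ge_0; auto. }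
  apply Rmult_le_reg_r with (D * Cmod p); [nra|].
  replace (g * D * (D * Cmod p)) with (4 * (g * (D / 2 * (D / 2)) * Cmod p)) by field.
  replace (8 * x * h * (D * Cmod p)) with (4 * (h * D * (x * (2 * Cmod p)))) by ring.
  lra.
Qed.

Lemma localized_dense : power_separated t -> polys_in_and_dense t mu.
Proof.
  intros Hsep. apply NNPP. intros Hnd.
  assert (HM := localized_all_moments).
  destruct (not_dense_annihilator (all_moments_polys HM) Hnd) as [F [HF [HF0 HFm]]].
  destruct (power_separated_nat t Hsep) as [c [q [Hc [Hc1 Hsp]]]].
  destruct (Hloc F) as [N0 HN0]; [now apply inH_iff|auto|].
  assert (Hch : forall j, exists u, (N0 <= j)%nat -> in_disk (t j) (r j) u /\ F u = 0%C).
  { intros j. destruct (Nat.le_gt_cases N0 j) as [Hj|Hj].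
    - destruct (HN0 j Hj) as [u [U1 [[U2 _] _]]]. now exists u.
    - exists (RtoC 0). lia. }
  set (s := fun j => proj1_sig (constructive_indefinite_description _ (Hch j))).
  assert (Hs : forall j, (N0 <= j)%nat -> in_disk (t j) (r j) (s j) /\ F (s j) = 0%C)
    by (intros j; exact (proj2_sig (constructive_indefinite_description _ (Hch j)))).
  clearbody s.
  destruct radius_le1 as [N1 R1]. destruct (t_far 10) as [N2 R2].
  set (N3 := max N0 (max N1 N2)).
  destruct (finite_bound (fun n => Cmod (t n)) N3) as [B HB].
  destruct (t_far (B + 3)) as [N4 R4].
  set (N := max N3 N4).
  (* Weights of points within distance [2] differ by a factor at most [2], so [4 * de j] stays below
     the separation at a [t n] near [s j]. The summand [L] of [M] makes the final displacements
     summable. *)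
  set (k2 := (/ 2) ^ (q + 2)). assert (Hk2 : 0 < k2) by (apply pow_lt; lra).
  set (M := (q + L)%nat). set (de := fun j => c * k2 / W j ^ M).
  assert (Hde : forall j, 0 < de j).
  { intros j. apply Rdiv_lt_0_compat; [nra|]. assert (T := W_pow_pos t j M). lra. }
  assert (Hde1 : forall j, de j <= c * k2).
  { intros j. assert (T := W_pow_pos t j M). unfold de.
    apply Rmult_le_reg_r with (W j ^ M); [lra|]. unfold Rdiv. rewrite Rmult_assoc, Rinv_l by lra. assert (0 < c * k2) by nra. nra. }
  assert (Hk21 : k2 <= / 4).
  { unfold k2. rewrite pow_add. assert (P : (/ 2) ^ q <= 1).
    { assert (T := half_pow_le1 q). unfold Rdiv in T. now rewrite Rmult_1_l in T. }
    simpl. lra. }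
  assert (Hsd : forall j, (N3 <= j)%nat -> Cmod (s j - t j)%C <= 1).
  { intros j Hj. destruct (Hs j ltac:(lia)) as [S1 _]. unfold in_disk in S1.
    specialize (R1 j ltac:(lia)). lra. }
  assert (Htd : forall j n, (N3 <= j)%nat -> n <> j -> s j <> t n).
  { intros j n Hj Hn E. destruct (Hs j ltac:(lia)) as [S1 _]. rewrite E in S1.
    apply (Hdisj n j (t n) Hn); auto. unfold in_disk.
    replace (t n - t n)%C with (RtoC 0) by ring. rewrite Cmod_0. apply Hr0. }
  assert (Hss : forall i j, (N3 <= i)%nat -> (N3 <= j)%nat -> i <> j -> s i <> s j).
  { intros i j Hi Hj Hij E. destruct (Hs i ltac:(lia)) as [S1 _]. destruct (Hs j ltac:(lia)) as [S2 _].
    rewrite <- E in S2. exact (Hdisj i j (s i) Hij S1 S2). }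
  assert (HW2 : forall j m, Cmod (t j) / 2 <= Cmod (t m) -> W j <= 2 * W m).
  { intros j m H. unfold weight. lra. }
  assert (Hsm : forall j, (N3 <= j)%nat -> Cmod (s j) <= W j /\ s j <> 0%C).
  { intros j Hj. specialize (Hsd j Hj). specialize (R2 j ltac:(lia)).
    assert (T1 := Cmod_rev_triangle (s j) (t j)). assert (T2 := Cmod_rev_triangle (t j) (s j)).
    rewrite Cmod_sub_sym in T2. split; [unfold weight; lra|]. apply Cmod_gt_0. lra. }
  destruct (res_bound F HF) as [cF [CF0 HcF]].
  (* If infinitely many zeros keep the distance [de j] from [T], removing [s j] multiplies residues
     by at most [W j / de j], a power of the weight, which [no_removal] forbids. *)
  assert (Case1 : exists K, forall j, (K <= j)%nat -> exists n, Cmod (s j - t n)%C < de j).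
  { apply NNPP. intros Hn.
    assert (HJ : forall n, exists j, (n <= j)%nat /\ (N3 <= j)%nat /\ forall m, de j <= Cmod (s j - t m)%C).
    { intros n. apply NNPP. intros H. apply Hn. exists (max n N3). intros j Hj. apply NNPP. intros Q.
      apply H. exists j. split; [lia|split; [lia|]]. intros m. apply Rnot_lt_le. intros Q2. apply Q.
      now exists m. }
    apply (no_removal (S M) F (fun j => (N3 <= j)%nat /\ forall m, de j <= Cmod (s j - t m)%C) s
      (fun j => t j + 2)%C (fun j => t j + 2)%C (2 ^ S M * cF / (c * k2))); auto.
    - intros j [Hj _]. split; [apply Hs; lia|]. unfold in_disk. rewrite C2_far.
      specialize (R1 j ltac:(lia)). lra.
    - intros j [Hj _]. split; [apply Hs; lia|now left].
    - intros j [Hj _]. rewrite C2_far. specialize (Hsd j Hj). lra.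
    - intros j G [Hj Hm] HG HQ m Htm. destruct (Hsm j Hj) as [S1 S2].
      assert (Np : (t j + 2)%C <> 0%C).
      { apply Cmod_gt_0. assert (T := Cmod_rev_triangle (t j) (- RtoC 2)%C).
        replace (t j - - RtoC 2)%C with (t j + 2)%C in T by ring.
        specialize (R2 j ltac:(lia)). rewrite Cmod_opp, Cmod_R, Rabs_pos_eq in T; lra. }
      assert (E := quotient_single F G (s j) (t j + 2)%C HF HG S2 Np HQ).
      assert (T := single_bound F G (s j) (de j) m E (Hde j) (Hm m)).
      specialize (HcF m). specialize (HW2 j m Htm). assert (PS := sqrt_mu_pos m).
      assert (PWj := W_ge1 (t := t) j). assert (PWm := W_ge1 (t := t) m).
      assert (PWM := W_pow_pos t j M).
      assert (T2 : Cmod (res G m) * (c * k2) <= W j ^ S M * (cF * sqrt (mu m))).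
      { replace (c * k2) with (de j * W j ^ M) by (unfold de; field; lra).
        rewrite <- Rmult_assoc. simpl.
        apply Rle_trans with (Cmod (s j) * Cmod (res F m) * W j ^ M).
        - apply Rmult_le_compat_r; lra.
        - replace (W j * W j ^ M * (cF * sqrt (mu m))) with (W j * (cF * sqrt (mu m)) * W j ^ M) by ring.
          apply Rmult_le_compat_r; [lra|]. apply Rmult_le_compat; try apply Cmod_ge_0; auto. }
      assert (T3 : W j ^ S M <= 2 ^ S M * W m ^ S M).
      { rewrite <- Rpow_mult_distr. apply pow_incr. lra. }
      apply Rmult_le_reg_r with (c * k2); [nra|]. eapply Rle_trans; [exact T2|].
      replace (2 ^ S M * cF / (c * k2) * (W m ^ S M * sqrt (mu m)) * (c * k2))
        with (2 ^ S M * W m ^ S M * (cF * sqrt (mu m))) by (field; lra).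
      apply Rmult_le_compat_r; [apply Rmult_le_pos; lra|auto]. }
  assert (HnW : forall j n, (N3 <= j)%nat -> Cmod (s j - t n)%C < de j -> Cmod (t n - t j)%C <= 2 /\
    forall m, m <> n -> 4 * de j <= Cmod (t n - t m)%C).
  { intros j n Hj Hn. assert (D2 : Cmod (t n - t j)%C <= 2).
    { replace (t n - t j)%C with ((s j - t j) - (s j - t n))%C by ring.
      eapply Rle_trans; [apply Cmod_sub_le|]. specialize (Hsd j Hj). specialize (Hde1 j). nra. }
    split; auto. intros m Hm. eapply Rle_trans; [|apply Hsp; auto].
    assert (WW : W n <= 2 * W j).
    { assert (T := Cmod_rev_triangle (t n) (t j)). specialize (R2 j ltac:(lia)). unfold weight. lra. }
    assert (P1 := W_pow_pos t n q). assert (P2 := W_pow_pos t j q). assert (P3 := W_pow_pos t j L).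
    assert (Wn := W_ge1 (t := t) n). assert (Wj := W_ge1 (t := t) j).
    assert (PP : W n ^ q <= 2 ^ q * W j ^ q) by (rewrite <- Rpow_mult_distr; apply pow_incr; lra).
    assert (P2q : 0 < 2 ^ q) by (apply pow_lt; lra).
    unfold de, M, k2. rewrite !pow_add, pow_inv.
    apply Rmult_le_reg_r with (W n ^ q); [lra|]. replace (c / W n ^ q * W n ^ q) with c by (field; lra).
    apply Rmult_le_reg_r with (2 ^ q * (W j ^ q * W j ^ L)); [repeat apply Rmult_lt_0_compat; lra|].
    replace (4 * (c * (/ 2 ^ q * (/ 2) ^ 2) / (W j ^ q * W j ^ L)) * W n ^ q * (2 ^ q * (W j ^ q * W j ^ L)))
      with (c * W n ^ q) by (field; lra).
    apply Rmult_le_compat_l; [lra|]. nra. }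
  (* If [s j] is close to some [t n] with [n <> j], then both [s j] and [s n] are near [t n]; they
     are exchanged for the single zero [t n], which kills the residue with the small
     denominators. *)
  assert (Case2 : exists K, forall j n, (K <= j)%nat -> Cmod (s j - t n)%C < de j -> n = j).
  { apply NNPP. intros Hn.
    set (J := fun j => (N <= j)%nat /\ exists n, n <> j /\ Cmod (s j - t n)%C < de j).
    assert (HJ : forall n, exists j, (n <= j)%nat /\ J j).
    { intros n. apply NNPP. intros H. apply Hn. exists (max n N). intros j m Hj Hm. apply NNPP. intros Q.
      apply H. exists j. split; [lia|split; [lia|]]. now exists m. }
    assert (Hcn : forall j, exists n, J j -> n <> j /\ Cmod (s j - t n)%C < de j).
    { intros j. destruct (classic (J j)) as [[H1 [n Hn']]|H]; [now exists n|now exists O]. }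
    set (nn := fun j => proj1_sig (constructive_indefinite_description _ (Hcn j))).
    assert (Hnn : forall j, J j -> nn j <> j /\ Cmod (s j - t (nn j))%C < de j)
      by (intros j; exact (proj2_sig (constructive_indefinite_description _ (Hcn j)))).
    clearbody nn.
    assert (Hbig : forall j, J j -> (N3 <= nn j)%nat).
    { intros j Jj. destruct (Nat.le_gt_cases N3 (nn j)) as [Q|Q]; [auto|exfalso].
      specialize (HB _ Q). cbv beta in HB. destruct Jj as [Hj Hj2].
      destruct (HnW j (nn j) ltac:(lia)) as [T _]; [now apply Hnn|].
      assert (T2 := Cmod_rev_triangle (t j) (t (nn j))). rewrite Cmod_sub_sym in T2.
      specialize (R4 j ltac:(lia)). lra. }
    apply (no_removal (S q) F J s (fun j => s (nn j)) (fun j => t (nn j)) (16 * cF / c)); auto.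
    - intros j Jj. assert (HJj := proj1 Jj). split; [apply Hs; lia|]. intros Q. destruct (Hnn j Jj) as [Q1 _].
      apply (Hdisj _ j (t (nn j)) Q1); auto. unfold in_disk.
      replace (t (nn j) - t (nn j))%C with (RtoC 0) by ring. rewrite Cmod_0. apply Hr0.
    - intros j Jj. assert (HJj := proj1 Jj). assert (B1 := Hbig j Jj). split; [apply Hs; lia|]. right.
      split; [apply Hs; lia|]. apply Hss; [lia|lia|]. apply Hnn, Jj.
    - intros j Jj. assert (HJj := proj1 Jj). assert (B1 := Hbig j Jj).
      destruct (HnW j (nn j) ltac:(lia)) as [T _]; [now apply Hnn|].
      assert (T1 := Hsd j ltac:(lia)). assert (T2 := Hsd (nn j) ltac:(lia)).
      split; [lra|split; [|lra]].
      replace (s (nn j) - t j)%C with ((s (nn j) - t (nn j)) + (t (nn j) - t j))%C by ring.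
      eapply Rle_trans; [apply Cmod_triangle|]. lra.
    - intros j G Jj HG HQ m Htm. assert (HJj := proj1 Jj). assert (B1 := Hbig j Jj).
      destruct (Hnn j Jj) as [Q1 Q2]. set (n := nn j) in *.
      destruct (Hsm j ltac:(lia)) as [S1 S2]. destruct (Hsm n ltac:(lia)) as [S3 S4].
      assert (R2n := R2 n ltac:(lia)). assert (Ntn : t n <> 0%C) by (apply Cmod_gt_0; lra).
      assert (PS := sqrt_mu_pos m). assert (PWq := W_pow_pos t m (S q)).
      assert (C0' : 0 <= 16 * cF / c * (W m ^ S q * sqrt (mu m))).
      { apply Rmult_le_pos; [apply Rdiv_le_0_compat; lra|]. apply Rmult_le_pos; lra. }
      assert (Hsjn : s j <> t n) by (apply Htd; [lia|auto]).
      destruct (Nat.eq_dec m n) as [->|Hmn].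
      (* [G] vanishes at [t n]: this is the new zero or, when [s n = t n], a zero of [F] that has
         been kept. *)
      + replace (res G n) with (RtoC 0); [now rewrite Cmod_0|]. symmetry. unfold residue.
        replace (G (t n)) with (RtoC 0); [unfold Cdiv; ring|]. symmetry.
        destruct (classic (s n = t n)) as [E|E].
        * rewrite E in HQ. assert (E1 := quotient_single F G (s j) (t n) HF HG S2 Ntn HQ (t n)).
          rewrite <- E in E1 at 3. rewrite (proj2 (Hs n ltac:(lia))) in E1.
          replace (s j * 0)%C with (RtoC 0) in E1 by ring. apply Cmult_integral in E1.
          destruct E1 as [E1|E1]; [|exact E1]. apply Cminus_eq0 in E1. contradiction.
        * specialize (HQ (t n)). replace (Nf (t n) (t n)) with (RtoC 0) in HQ by (unfold Nf; field; auto).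
          replace (F (t n) * 0)%C with (RtoC 0) in HQ by ring. apply Cmult_integral in HQ.
          destruct HQ as [HQ|HQ]; [exact HQ|]. exfalso. revert HQ. apply Qf_neq; auto.
      + destruct (HnW j n ltac:(lia) Q2) as [_ T]. assert (T1 := T m Hmn).
        assert (Pde := Hde j).
        assert (U1 : Cmod (t n - t m)%C / 2 <= Cmod (s j - t m)%C).
        { assert (Z := Cmod_rev_triangle (t n - t m)%C (t n - s j)%C).
          replace (t n - t m - (t n - s j))%C with (s j - t m)%C in Z by ring.
          rewrite (Cmod_sub_sym (t n) (s j)) in Z. lra. }
        (* [s j] lies in the disk of [t j], hence not in that of [t n], so [r n <= |s j - t n|];
           this bounds the distance of [s n] from [t n] as well. *)
        assert (Hrn : Cmod (s n - t n)%C < de j).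
        { destruct (Hs n ltac:(lia)) as [Z1 _]. unfold in_disk in Z1.
          apply Rlt_le_trans with (r n); [auto|]. apply Rle_trans with (Cmod (s j - t n)%C); [|lra].
          apply Rnot_lt_le. intros Z. destruct (Hs j ltac:(lia)) as [Z3 _].
          exact (Hdisj n j (s j) Q1 Z Z3). }
        assert (U2 : Cmod (t n - t m)%C / 2 <= Cmod (s n - t m)%C).
        { assert (Z := Cmod_rev_triangle (t n - t m)%C (t n - s n)%C).
          replace (t n - t m - (t n - s n))%C with (s n - t m)%C in Z by ring.
          rewrite (Cmod_sub_sym (t n) (s n)) in Z. lra. }
        assert (Ntm : t n <> t m) by (intros Z; apply t_inj in Z; auto).
        assert (U3 : Cmod (s n) <= 2 * Cmod (t n)) by (unfold weight in S3; lra).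
        assert (V := double_bound F G (s j) (s n) (t n) (W j) m S2 S4 Ntn HQ Ntm U1 U2 S1 U3).
        specialize (HcF m). specialize (HW2 j m Htm). specialize (Hsp m n Hmn).
        rewrite Cmod_sub_sym in Hsp. assert (PWmq := W_pow_pos t m q). assert (PWm := W_ge1 (t := t) m).
        assert (Pg := Cmod_ge_0 (res G m)). assert (Pf := Cmod_ge_0 (res F m)).
        assert (V1 : Cmod (res G m) * (c / W m ^ q) <= 16 * W m * (cF * sqrt (mu m))).
        { apply Rle_trans with (Cmod (res G m) * Cmod (t n - t m)%C); [now apply Rmult_le_compat_l|].
          eapply Rle_trans; [exact V|]. apply Rmult_le_compat; try lra.
          assert (Wj := W_ge1 (t := t) j). lra. }
        apply Rmult_le_reg_r with (c / W m ^ q); [apply Rdiv_lt_0_compat; lra|].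
        eapply Rle_trans; [exact V1|]. right. simpl. field. lra. }
  destruct Case1 as [K1 Case1]. destruct Case2 as [K2 Case2].
  (* By the two cases [|s j - t j| < de j] for all large [j], so the zeros can be moved to the [t j]
     within the subspace of elements with all moments [0]. *)
  assert (HS : nearly_invariant t A mu (Smom (t := t) (A := A) (mu := mu) t (fun _ => True))).
  { apply Smom_ni; auto. intros k _. now apply all_moments_nu. }
  destruct (move_zeros (S := Smom (t := t) (A := A) (mu := mu) t (fun _ => True)) F s
    (fun n => / W n ^ L) (max N3 (max K1 K2))) as [d Hd].
  - split; [exact HF|]. intros k _. now apply mom_nu_of_polys.
  - exact HF0.
  - intros i Hi. apply Hs. lia.
  - intros i j Hi Hj. apply Hss; lia.
  - intros n. assert (P := W_pow_pos t n L). left. apply Rinv_0_lt_compat. lra.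
  - exact HL.
  - intros i n Hi Hn. split; [intros E; apply (Htd i n ltac:(lia) Hn); auto|].
    destruct (Case1 i ltac:(lia)) as [m Hm]. assert (E := Case2 i m ltac:(lia) Hm). subst m.
    destruct (HnW i i ltac:(lia) Hm) as [_ T]. assert (T1 := Hsp i n (not_eq_sym Hn)).
    specialize (T n Hn). assert (Pde := Hde i).
    assert (Z := Cmod_rev_triangle (t n - t i)%C (s i - t i)%C).
    replace (t n - t i - (s i - t i))%C with (t n - s i)%C in Z by ring.
    rewrite (Cmod_sub_sym (t n) (t i)) in Z.
    assert (Z2 : c / W i ^ q * (3 / 4) <= Cmod (t n - s i)%C) by lra.
    assert (P1 := W_pow_pos t i q). assert (P2 := W_pow_pos t i L).
    apply Rle_trans with (de i); [lra|].
    apply Rle_trans with (/ W i ^ L * (c / W i ^ q * (3 / 4))).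
    + unfold de, M. rewrite pow_add.
      replace (/ W i ^ L * (c / W i ^ q * (3 / 4))) with (c * (3 / 4) / (W i ^ q * W i ^ L)) by (field; lra).
      apply Rmult_le_compat_r; [left; apply Rinv_0_lt_compat; nra|]. nra.
    + apply Rmult_le_compat_l; [|auto]. left. apply Rinv_0_lt_compat. lra.
  - exact (Smom_all_no_fin_supp d HM Hd).
Qed.

End LocalizationConverse.

Lemma strong_localization_dense {t : nat -> C} {A : C -> C} {mu : nat -> R}
  {Hdata : admissible_data t mu} {HA : generating_function t A} :
  power_separated t -> strong_localization t A mu -> polys_in_and_dense t mu.
Proof.
  intros Hsep [r [Hr0 [Hr [Hdisj Hloc]]]]. destruct (sum_inv_W t Hsep) as [L HL].
  apply (localized_dense (A := A) HL Hr0 Hr Hdisj); auto.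
  intros F HF HF0. exact (proj2 (Hloc F HF HF0)).
Qed.

(** * Codimensions and moments *)

Section Codimensions.
Context {t : nat -> C} {A : C -> C} {mu : nat -> R}.
Context {Hdata : admissible_data t mu} {HA : generating_function t A}.

Notation inHr := (@inHr t A mu).
Notation res := (residue t A).
Notation W := (weight t).
Notation Sm := (Smom (t := t) (A := A) (mu := mu) t).

Lemma mom_psum (g : C -> C) (a : nat -> C) (V : nat -> C -> C) (m : nat) : gL2 t mu g ->
  (forall i, (i < m)%nat -> inHr (V i)) ->
  inHr (fun z => psum (fun i => a i * V i z)%C m) /\
  mom t A g (fun z => psum (fun i => a i * V i z)%C m) = psum (fun i => a i * mom t A g (V i))%C m.
Proof.
  intros Hg. induction m as [|m IH]; intros HV; simpl.
  - split; [apply inHr_zero|]. unfold mom. rewrite (csum_fin _ O); [reflexivity|].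
    intros n _. rewrite (res_zero (A := A) n). ring.
  - destruct IH as [I1 I2]; [auto|]. assert (HVm := HV m ltac:(lia)).
    assert (H2 : inHr (fun z => a m * V m z)%C) by now apply inHr_scal.
    split; [now apply (inHr_plus (fun z => psum (fun i => a i * V i z)%C m))|].
    rewrite (mom_plus g (fun z => psum (fun i => a i * V i z)%C m) (fun z => a m * V m z)%C) by auto.
    rewrite I2, mom_scal by auto. reflexivity.
Qed.

Lemma newton_biorthogonal : exists V : nat -> C -> C, (forall l, inHr (V l)) /\
  forall l j, mom t A (nu t j) (V l) = if Nat.eqb j l then 1%C else 0%C.
Proof.
  assert (H : forall l, exists V, inHr V /\ forall j, mom t A (nu t j) V = if Nat.eqb j l then 1%C else 0%C).
  { intros l. destruct (newton_dual (t := t) (A := A) (mu := mu) (fun i => i) l) as [V [HV [_ [_ HM]]]].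
    - intros i j _ _ E. exact E.
    - exists V. split; auto. }
  exists (fun l => proj1_sig (constructive_indefinite_description _ (H l))).
  split; intros l; apply (proj2_sig (constructive_indefinite_description _ (H l))).
Qed.

Lemma psum_delta (a : nat -> C) (m j : nat) :
  psum (fun i => a i * (if Nat.eqb j i then 1%C else 0%C))%C m = if Nat.ltb j m then a j else 0%C.
Proof.
  induction m as [|m IH]; simpl psum; [reflexivity|]. rewrite IH.
  destruct (Nat.eqb_spec j m) as [->|Hj].
  - rewrite Nat.ltb_irrefl. replace (Nat.ltb m (S m)) with true by (symmetry; apply Nat.ltb_lt; lia). ring.
  - destruct (Nat.ltb_spec j m); destruct (Nat.ltb_spec j (S m)); try lia; ring.
Qed.

(** The dual elements [V_l] with [l < m] span a complement: subtracting the moments of [F] times the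
    [V_l] kills the orders below [m]. *)
Lemma Smom_codim (m : nat) : all_moments t mu -> codim t A mu (Sm (fun k => (k < m)%nat)) m.
Proof.
  intros HM. destruct newton_biorthogonal as [V [HV HVM]].
  assert (Hg : forall k, gL2 t mu (nu t k)) by (intros k; now apply all_moments_nu).
  assert (MP : forall a j, mom t A (nu t j) (fun z => psum (fun i => a i * V i z)%C m)
    = if Nat.ltb j m then a j else 0%C).
  { intros a j. rewrite (proj2 (mom_psum (nu t j) a V m (Hg j) (fun i _ => HV i))).
    rewrite <- psum_delta. apply psum_ext. intros i _. now rewrite HVM. }
  exists V. split; [|split].
  - intros i _. now apply inH_iff.
  - intros F HF. apply inH_iff in HF. exists (fun l => mom t A (nu t l) F).
    rewrite (fun_ext_C (fun z => F z - lincomb m (fun l => mom t A (nu t l) F) V z)%C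
      (fun z => F z - psum (fun i => mom t A (nu t i) F * V i z) m)%C)
      by (intros z; now rewrite lincomb_psum).
    destruct (mom_psum (nu t 0) (fun l => mom t A (nu t l) F) V m (Hg _) (fun i _ => HV i)) as [HP _].
    split; [now apply (inHr_minus F)|]. intros k Hk.
    rewrite (mom_minus (nu t k) F (fun z => psum (fun i => mom t A (nu t i) F * V i z)%C m)) by auto.
    rewrite MP. replace (Nat.ltb k m) with true by (symmetry; now apply Nat.ltb_lt). ring.
  - intros a Ha i Hi. destruct Ha as [_ Ha]. specialize (Ha i Hi).
    rewrite (mom_ext _ _ _ (lincomb_psum m a V)), MP in Ha.
    now replace (Nat.ltb i m) with true in Ha by (symmetry; now apply Nat.ltb_lt).
Qed.

(** The dual elements are independent modulo this subspace, in any number: the coefficients of a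
    combination are its moments. *)
Lemma Smom_all_no_codim (m : nat) : all_moments t mu -> ~ codim t A mu (Sm (fun _ => True)) m.
Proof.
  intros HM Hc. destruct newton_biorthogonal as [V [HV HVM]].
  assert (Hg : forall k, gL2 t mu (nu t k)) by (intros k; now apply all_moments_nu).
  assert (HS : nearly_invariant t A mu (Sm (fun _ => True))) by now apply Smom_ni.
  assert (HC := ni_closed _ HS).
  destruct (codim_spans m Hc) as [v Hv].
  destruct (dependent_mod m (S m) v V Hv) as [a [[i [Hi Ni]] [_ Ha]]]; [lia| |].
  { intros i _. now apply inH_iff. }
  apply Ni. specialize (Ha i I).
  rewrite (proj2 (mom_psum (nu t i) a V (S m) (Hg i) (fun i _ => HV i))) in Ha.
  rewrite (psum_ext _ (fun l => a l * (if Nat.eqb i l then 1%C else 0%C))%C) in Ha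
    by (intros l _; now rewrite HVM).
  rewrite psum_delta in Ha.
  now replace (Nat.ltb i (S m)) with true in Ha by (symmetry; now apply Nat.ltb_lt).
Qed.

(** Localization with exponent [q + L] gives zeros whose relative displacements from the [t_j] are
    at most [W_j^(-L)], hence summable. Then [move_zeros] and [min_support] put some [A / nu_{k+1}]
    into [S], and [newton_spans] applies. *)
Lemma dense_finite_codim (S : (C -> C) -> Prop) : power_separated t -> polys_in_and_dense t mu ->
  nearly_invariant t A mu S -> (exists F, S F /\ exists z, F z <> 0%C) -> exists m, codim t A mu S m.
Proof.
  intros Hsep HD HS [F [SF HF0]]. assert (HC := ni_closed _ HS).
  assert (HM := polys_all_moments (proj1 HD)).
  destruct (power_separated_nat t Hsep) as [c [q [Hc [Hc1 Hsp]]]].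
  destruct (sum_inv_W t Hsep) as [L HL].
  destruct (dense_localizes c q (q + L) F Hc ltac:(lia) Hsp HD (sub_inHr F SF) HF0) as [_ [N HN]].
  assert (Hch : forall j, exists u, (N <= j)%nat -> in_disk (t j) (c / 4 / W j ^ (q + L)) u /\ F u = 0%C).
  { intros j. destruct (Nat.le_gt_cases N j) as [Hj|Hj].
    - destruct (HN j Hj) as [u [U1 [[U2 _] _]]]. now exists u.
    - exists (RtoC 0). lia. }
  set (s := fun j => proj1_sig (constructive_indefinite_description _ (Hch j))).
  assert (Hs : forall j, (N <= j)%nat -> in_disk (t j) (c / 4 / W j ^ (q + L)) (s j) /\ F (s j) = 0%C)
    by (intros j; exact (proj2_sig (constructive_indefinite_description _ (Hch j)))).
  clearbody s. unfold in_disk in Hs.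
  assert (Hd : forall j, 0 < c / 4 / W j ^ (q + L) <= c / W j ^ q / 4).
  { intros j. assert (P1 := W_pow_pos t j q). assert (P2 := W_pow_pos t j L). rewrite pow_add.
    split; [apply Rdiv_lt_0_compat; nra|].
    replace (c / 4 / (W j ^ q * W j ^ L)) with (c / W j ^ q / 4 * / W j ^ L) by (field; lra).
    assert (I1 : / W j ^ L <= 1) by (rewrite <- Rinv_1; apply Rinv_le_contravar; lra).
    assert (0 < c / W j ^ q) by (apply Rdiv_lt_0_compat; lra). nra. }
  assert (Hfar : forall i n, (N <= i)%nat -> n <> i -> c / W i ^ q * (3 / 4) <= Cmod (t n - s i)%C).
  { intros i n Hi Hn. assert (T := Hsp i n (not_eq_sym Hn)).
    assert (Z := Cmod_rev_triangle (t n - t i)%C (s i - t i)%C).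
    replace (t n - t i - (s i - t i))%C with (t n - s i)%C in Z by ring.
    rewrite (Cmod_sub_sym (t n) (t i)) in Z. specialize (Hd i). destruct (Hs i Hi) as [S1 _]. lra. }
  destruct (move_zeros (S := S) F s (fun n => / W n ^ L) N SF HF0) as [d Hfs].
  - intros i Hi. now apply Hs.
  - intros i j Hi Hj Hij E. assert (T1 := Hfar i j Hi (not_eq_sym Hij)).
    assert (T2 := Hfar j i Hj Hij). destruct (Hs i Hi) as [S1 _]. destruct (Hs j Hj) as [S2 _].
    rewrite E in S1, T1. rewrite Cmod_sub_sym in S1, S2.
    assert (Di := Hd i). assert (Dj := Hd j).
    assert (0 < c / W i ^ q) by lra. lra.
  - intros n. assert (P := W_pow_pos t n L). left. apply Rinv_0_lt_compat. lra.
  - exact HL.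
  - intros i n Hi Hn. assert (T := Hfar i n Hi Hn). specialize (Hd i). destruct (Hs i Hi) as [S1 _].
    assert (P1 := W_pow_pos t i q). assert (P2 := W_pow_pos t i L).
    split; [intros Q; rewrite Q in T; replace (s i - s i)%C with (RtoC 0) in T by ring; rewrite Cmod_0 in T; lra|].
    apply Rle_trans with (c / 4 / W i ^ (q + L)); [lra|].
    apply Rle_trans with (/ W i ^ L * (c / W i ^ q * (3 / 4))).
    + rewrite pow_add.
      replace (/ W i ^ L * (c / W i ^ q * (3 / 4))) with (c * (3 / 4) / (W i ^ q * W i ^ L)) by (field; lra).
      replace (c / 4 / (W i ^ q * W i ^ L)) with (c * / 4 / (W i ^ q * W i ^ L)) by (field; lra).
      apply Rmult_le_compat_r; [left; apply Rinv_0_lt_compat; nra|]. nra.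
    + apply Rmult_le_compat_l; [|auto]. left. apply Rinv_0_lt_compat. lra.
  - destruct (min_support d Hfs) as [k [x [E [Hx [SE [HE _]]]]]].
    destruct (newton_family (t := t) (A := A) (mu := mu) Hx) as [V HV].
    apply (spans_codim (S := S) k V).
    + intros i Hi. apply inH_iff. now apply HV.
    + intros G HG. apply inH_iff in HG. exists (fun l => mom t A (nu (fun i => t (x i)) l) G).
      apply (newton_spans (S := S) SE HE HV); auto. intros l _. now apply all_moments_nu.
Qed.

(** * Summability forced by finite codimension *)

Lemma nu_growth (x : nat -> C) (l : nat) : exists c, 0 < c /\ forall n, Cmod (nu x l (t n)) <= c * W n ^ l.
Proof.
  induction l as [|l [c [Hc IH]]]; simpl.
  - exists 1. split; [lra|]. intros n. rewrite Cmod_1. lra.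
  - assert (P := Cmod_ge_0 (x l)). exists (c * (1 + Cmod (x l))). split; [nra|]. intros n.
    rewrite Cmod_mult. assert (T := Cmod_sub_le (t n) (x l)). assert (Pn := Cmod_ge_0 (t n)).
    replace (c * (1 + Cmod (x l)) * (W n * W n ^ l)) with ((c * W n ^ l) * ((1 + Cmod (x l)) * W n)) by ring.
    apply Rmult_le_compat; try apply Cmod_ge_0; auto. unfold weight. nra.
Qed.

Lemma nu_growth_below (x : nat -> C) (l : nat) : exists N, forall n, (N <= n)%nat ->
  W n ^ l <= 2 ^ l * Cmod (nu x l (t n)).
Proof.
  induction l as [|l [N1 IH]]; simpl.
  - exists O. intros n _. rewrite Cmod_1. lra.
  - destruct (t_far (2 * Cmod (x l) + 1)) as [N2 HN2]. exists (max N1 N2). intros n Hn.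
    specialize (IH n ltac:(lia)). specialize (HN2 n ltac:(lia)). rewrite Cmod_mult.
    assert (T := Cmod_rev_triangle (t n) (x l)). assert (P := W_pow_pos t n l).
    replace (2 * 2 ^ l * (Cmod (nu x l (t n)) * Cmod (t n - x l)%C))
      with ((2 * Cmod (t n - x l)%C) * (2 ^ l * Cmod (nu x l (t n)))) by ring.
    assert (W1 := W_ge1 (t := t) n). apply Rmult_le_compat; [lra|lra| |auto]. unfold weight in *. lra.
Qed.

Lemma gL2_weight (x : nat -> C) (l : nat) : gL2 t mu (nu x l) -> ex_series (fun n => mu n * W n ^ (2 * l)).
Proof.
  intros H. destruct (nu_growth_below x l) as [N HN].
  apply ex_series_dom_ev with (fun n => 4 ^ l * (mu n * Cmod (nu x l (t n)) ^ 2)) N;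
    [|now apply ex_series_mul].
  intros n Hn. specialize (HN n Hn). assert (P := W_pow_pos t n l). assert (PM := mu_pos n).
  assert (P2 := W_pow_pos t n (2 * l)). split; [apply Rmult_le_pos; lra|].
  replace (4 ^ l) with ((2 ^ l) ^ 2) by (rewrite <- pow_mult, Nat.mul_comm, pow_mult; f_equal; lra).
  replace (W n ^ (2 * l)) with ((W n ^ l) ^ 2) by (rewrite <- pow_mult; f_equal; lia).
  replace ((2 ^ l) ^ 2 * (mu n * Cmod (nu x l (t n)) ^ 2)) with (mu n * (2 ^ l * Cmod (nu x l (t n))) ^ 2) by ring.
  apply Rmult_le_compat_l; [lra|]. apply pow_incr. lra.
Qed.

Lemma weight_gL2 (x : nat -> C) (l j : nat) : (l <= j)%nat ->
  ex_series (fun n => mu n * W n ^ (2 * j)) -> gL2 t mu (nu x l).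
Proof.
  intros Hl H. destruct (nu_growth x l) as [c [Hc HN]].
  apply ex_series_dom with (fun n => c ^ 2 * (mu n * W n ^ (2 * j))); [|now apply ex_series_mul].
  intros n. specialize (HN n). assert (PM := mu_pos n). assert (W1 := W_ge1 (t := t) n).
  assert (P := Cmod_ge_0 (nu x l (t n))).
  split; [apply Rmult_le_pos; [lra|apply pow2_ge_0]|].
  replace (W n ^ (2 * j)) with ((W n ^ j) ^ 2) by (rewrite <- pow_mult; f_equal; lia).
  replace (c ^ 2 * (mu n * (W n ^ j) ^ 2)) with (mu n * (c * W n ^ j) ^ 2) by ring.
  apply Rmult_le_compat_l; [lra|]. apply pow_incr. split; auto.
  eapply Rle_trans; [exact HN|]. apply Rmult_le_compat_l; [lra|]. now apply Rle_pow.
Qed.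

(** Among the [m + 1] elements [A / (z - t_i)], [i <= m], there is a nontrivial relation modulo
    [S]. *)
Lemma codim_fin_supp (S : (C -> C) -> Prop) (m : nat) : nearly_invariant t A mu S ->
  codim t A mu S m -> exists d, fin_supp (t := t) (A := A) S d.
Proof.
  intros HS Hc. assert (HC := ni_closed _ HS). destruct (codim_spans m Hc) as [v Hv].
  destruct (dependent_mod m (Datatypes.S m) v (fun i => qn t A i) Hv) as [a [[i [Hi Ni]] Ha]]; [lia| |].
  { intros j _. apply inH_iff, qn_inHr. }
  destruct (lin_peval (t := t) (A := A) (Datatypes.S m) a) as [p Hp].
  exists (Datatypes.S m), (fun i => i), (lin (t := t) (A := A) (Datatypes.S m) a), p. split; [|split; [|split]].
  - intros x y _ _ E. exact E.
  - exact Ha.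
  - apply NNPP. intros Q. apply Ni.
    assert (Z : forall z, lin (t := t) (A := A) (Datatypes.S m) a z = 0%C).
    { intros z. apply NNPP. intros Q2. apply Q. now exists z. }
    assert (R := res_lin (t := t) (A := A) (Datatypes.S m) a i).
    rewrite (res_ext (A := A) _ (fun _ => RtoC 0) i Z), (res_zero (A := A)) in R.
    replace (Nat.ltb i (Datatypes.S m)) with true in R by (symmetry; now apply Nat.ltb_lt).
    now symmetry.
  - exact Hp.
Qed.

(** For the minimal [k], [nu_{k-1}] is square summable, since otherwise [newton_unsummable] puts
    [V_{k-1}], an element on [k] nodes only, into [S]. Then so are the lower [nu_l], the [V_l]
    generate the quotient, and the codimension [m + 1] is at most [k]. *)
Lemma codim_weight (S : (C -> C) -> Prop) (m : nat) : nearly_invariant t A mu S ->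
  codim t A mu S (Datatypes.S m) -> exists j, (m <= j)%nat /\ ex_series (fun n => mu n * W n ^ (2 * j)).
Proof.
  intros HS Hc. assert (HC := ni_closed _ HS). destruct (codim_fin_supp S _ HS Hc) as [d Hd].
  destruct (min_support d Hd) as [k [x [E [Hx [SE [HE Hmin]]]]]].
  destruct (newton_family (t := t) (A := A) (mu := mu) Hx) as [V HV].
  assert (Hle : (forall l, (l < k)%nat -> gL2 t mu (nu (fun i => t (x i)) l)) -> (Datatypes.S m <= k)%nat).
  { intros Hg. apply (codim_le_spans (S := S) (Datatypes.S m) k V Hc).
    intros G HG. apply inH_iff in HG. exists (fun l => mom t A (nu (fun i => t (x i)) l) G).
    now apply (newton_spans (S := S) SE HE HV). }
  (* For [k = 0] there is no condition on the [nu_l], and the codimension would be [0]. *)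
  destruct k as [|j]; [assert (T := Hle ltac:(intros; lia)); lia|].
  assert (Hg : gL2 t mu (nu (fun i => t (x i)) j)).
  { apply NNPP. intros Q. apply (Hmin (Datatypes.S j) (Nat.le_refl _)).
    assert (SV := newton_unsummable (S := S) SE HE HV j eq_refl Q).
    exists x, (V j), [RtoC 1]. split; [|split; [exact SV|split]].
    - intros a b Ha Hb. apply Hx; lia.
    - assert (Z := proj2 (HV j ltac:(lia))).
      destruct (classic (exists z, V j z <> 0%C)) as [Q2|Q2]; [exact Q2|exfalso].
      assert (A0 : forall z, A z = 0%C).
      { intros z. rewrite Z. replace (V j z) with (RtoC 0); [ring|].
        symmetry. apply NNPP. intros Q3. apply Q2. now exists z. }
      destruct (proj1 (A_zero (t O + 1)%C) (A0 _)) as [i _].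
      assert (HN := alpha_neq (t := t) (A := A) O). rewrite <- (qn_at O) in HN. apply HN.
      apply (lin_cancel (qn t A O) (fun _ => RtoC 0) (t O)).
      + intros z. apply hol_cont, qn_hol.
      + intros z. apply ccont_const.
      + intros z. rewrite <- (A_qn (A := A) O z), A0. ring.
    - intros z. rewrite <- (proj2 (HV j ltac:(lia))). simpl. ring. }
  assert (Hw := gL2_weight _ _ Hg). exists j. split; [|exact Hw].
  assert (T := Hle ltac:(intros l Hl; apply (weight_gL2 _ l j); [lia|exact Hw])). lia.
Qed.

Lemma codims_all_moments : (forall m, exists S, nearly_invariant t A mu S /\ codim t A mu S m) ->
  all_moments t mu.
Proof.
  intros H k. destruct (H (Datatypes.S k)) as [S [HS Hc]].
  destruct (codim_weight S k HS Hc) as [j [Hj Hw]].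
  apply ex_series_dom with (fun n => mu n * W n ^ (2 * j)); [|exact Hw].
  intros n. assert (P := W_pow_pos t n k). assert (PM := mu_pos n). split; [apply Rmult_le_pos; lra|].
  apply Rmult_le_compat_l; [lra|]. apply Rle_pow; [apply W_ge1|lia].
Qed.

(** Without density the elements with all moments [0] would form a nonzero nearly invariant
    subspace, and its codimension is infinite. *)
Lemma codims_dense : (forall m, exists S, nearly_invariant t A mu S /\ codim t A mu S m) ->
  (forall S, nearly_invariant t A mu S -> (exists F, S F /\ exists z, F z <> 0%C) ->
     exists m, codim t A mu S m) ->
  polys_in_and_dense t mu.
Proof.
  intros H1 H2. apply NNPP. intros Hnd. assert (HM := codims_all_moments H1).
  destruct (not_dense_annihilator (all_moments_polys HM) Hnd) as [F [HF [HF0 HFm]]].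
  destruct (H2 (Sm (fun _ => True))) as [m Hm].
  - apply Smom_ni; auto. intros k _. now apply all_moments_nu.
  - exists F. split; [|exact HF0]. split; [exact HF|]. intros k _. now apply mom_nu_of_polys.
  - exact (Smom_all_no_codim m HM Hm).
Qed.

End Codimensions.

Theorem theorem8p1 (t : nat -> C) (A : C -> C) (mu : nat -> R)
  (Hdata : admissible_data t mu)
  (HA : generating_function t A)
  (Hsep : power_separated t) :
  ( ( (forall m : nat, exists S, nearly_invariant t A mu S /\ codim t A mu S m) /\
      (forall S, nearly_invariant t A mu S -> (exists F, S F /\ exists z, F z <> 0%C) ->
         exists m, codim t A mu S m) )
    <-> polys_in_and_dense t mu ) /\
  ( polys_in_and_dense t mu <-> strong_localization t A mu ).
Proof.
  split; split.
  - intros [H1 H2]. exact (codims_dense H1 H2).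
  - intros HD. assert (HM := polys_all_moments (proj1 HD)). split.
    + intros m. exists (Smom (t := t) (A := A) (mu := mu) t (fun k => (k < m)%nat)). split.
      * apply Smom_ni; [intros; lia|]. intros k _. now apply all_moments_nu.
      * now apply Smom_codim.
    + intros S HS HS0. now apply dense_finite_codim.
  - intros HD. now apply dense_strong_localization.
  - now apply strong_localization_dense.
Qed.
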